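(* Let $k\ge 3$ be an integer and let $d'>0$ be a fixed real number with $d'/k\le 2^{k-1}\ln 2-2$. For $l\ge 2$ set $$\lambda_l=\frac{[d'(k-1)]^l}{2l},\qquad \delta_l=\frac{(-1)^l}{(2^{k-1}-1)^l}.$$ Let $(X_l)_{l\ge 2}$ be a family of independent Poisson random variables with $\mathbb{E}[X_l]=\lambda_l$, all defined on the same probability space. Then the random variable $$W=\sum_{l\ge 2}\bigl(X_l\ln(1+\delta_l)-\lambda_l\delta_l\bigr)$$ satisfies $\mathbb{E}|W|<\infty$, and, with $m=\lceil d'n/k\rceil$, the sequence $\ln Z(H_k(n,m))-\ln\mathbb{E}[Z(H_k(n,m))]$ converges in distribution to $W$ as $n\to\infty$.
   Context: $[n]=\{1,\dots,n\}$. $H_k(n,m)$ is the random $k$-uniform hypergraph on vertex set $[n]$ with exactly $m$ hyperedges, the edge set being chosen uniformly at random among all $m$-element sets of $k$-element subsets of $[n]$. A 2-colouring of a hypergraph $H$ on $[n]$ is a map $\sigma:[n]\to\{0,1\}$ such that no edge $e$ of $H$ is monochromatic (i.e. $|\sigma(e)|\neq 1$ for every edge $e$). $Z(H)$ is the number of 2-colourings of $H$. Convention: $\ln 0=-\infty$. *)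

(* Defs.v *)
From HB Require Import structures.
From mathcomp Require Import all_boot all_order all_algebra.
From mathcomp Require Import all_classical all_reals all_analysis.

Set Implicit Arguments.
Unset Strict Implicit.
Unset Printing Implicit Defensive.

Import Order.TTheory GRing.Theory Num.Theory.
Import numFieldNormedType.Exports.

Local Open Scope classical_set_scope.
Local Open Scope ring_scope.

Definition hypergraphs (k n m : nat) : {set {set {set 'I_n}}} :=
  [set H : {set {set 'I_n}} | (#|H| == m) && [forall e in H, #|e| == k]]%SET.

Definition colouring (n : nat) (H : {set {set 'I_n}}) (s : {ffun 'I_n -> bool}) :=
  [forall e in H, #|(s @: e)%SET| != 1%N].

Definition Z (n : nat) (H : {set {set 'I_n}}) : nat :=
  #|[set s : {ffun 'I_n -> bool} | colouring H s]%SET|.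

(* Uniform probability and expectation on a finite set A; both are 0 when A is
   empty, which for A = hypergraphs k n m happens exactly when m > 'C(n, k). *)
Definition unif_prob (R : realType) (T : finType) (A : {set T}) (E : T -> bool) : R :=
  #|[set x in A | E x]%SET|%:R / #|A|%:R.

Definition unif_mean (R : realType) (T : finType) (A : {set T}) (f : T -> R) : R :=
  (\sum_(x in A) f x) / #|A|%:R.

Definition EZ (R : realType) (k n m : nat) : R :=
  unif_mean (hypergraphs k n m) (fun H => (Z H)%:R).

(* ln Z(H) - ln E[Z(H_k(n,m))], in the extended reals because lne 0 = -oo *)
Definition lnZ_dev (R : realType) (k n m : nat) (H : {set {set 'I_n}}) : \bar R :=
  (lne (Z H)%:R%:E - lne (EZ R k n m)%:E)%E.

Definition lnZ_dev_cdf (R : realType) (k n m : nat) (x : R) : R :=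
  unif_prob R (hypergraphs k n m) (fun H => (lnZ_dev R k m H <= x%:E)%E).

(* Convergence in distribution of a sequence of [-oo, +oo]-valued random
   variables, given by their distribution functions F n, to the real random
   variable W. As W is real, the limits of F n at the continuity points of the
   distribution function of W also force the mass at -oo and +oo to vanish in the limit. *)
Definition cvg_in_distribution (R : realType) (F : nat -> R -> R)
    (disp : measure_display) (T : measurableType disp) (P : probability T R)
    (W : T -> R) : Prop :=
  let G := fun x : R => P [set w | W w <= x] in
  forall x : R, {for x, continuous G} -> (F n x)%:E @[n --> \oo] --> G x.

Definition independent_RVs (R : realType)
    (disp disp' : measure_display) (T : measurableType disp)
    (T' : measurableType disp') (P : probability T R)
    (I : choiceType) (D : set I) (X : I -> {RV P >-> T'}) : Prop :=
  forall (s : seq I) (A : I -> set T'), uniq s ->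
    (forall i, i \in s -> D i /\ measurable (A i)) ->
    P (\bigcap_(i in [set` s]) X i @^-1` A i)
      = (\prod_(i <- s) P (X i @^-1` A i))%E.

Definition poisson_RV (R : realType) (disp : measure_display)
    (T : measurableType disp) (P : probability T R)
    (rate : R) (X : {RV P >-> nat}) : Prop :=
  forall j : nat, P (X @^-1` [set j]) = (poisson_pmf rate j)%:E.

Definition lambda (R : realType) (k : nat) (d : R) (l : nat) : R :=
  (d * (k%:R - 1)) ^+ l / (2 * l%:R).

Definition delta (R : realType) (k l : nat) : R :=
  (-1) ^+ l / (2 ^+ (k - 1) - 1) ^+ l.

Definition W_partial (R : realType) (k : nat) (d : R) (T : Type)
    (X : nat -> T -> nat) (N : nat) (w : T) : R :=
  \sum_(2 <= l < N)
    ((X l w)%:R * ln (1 + delta R k l) - lambda k d l * delta R k l).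

(* The sum over l >= 2 is the limit of its partial sums (it need not converge
   absolutely); off the convergence set limn takes a junk value. *)
Definition W (R : realType) (k : nat) (d : R) (T : Type)
    (X : nat -> T -> nat) (w : T) : R :=
  limn (fun N => W_partial k d X N w).

(* Main.v *)
(* Small subgraph conditioning. Exchanging the edges of a cycle for random edges gives an approximate
   recurrence for the joint law of the numbers X_l of cycles of length l, so that they are
   asymptotically independent Poisson variables: with means lambda_l in the null model, and with means
   lambda_l (1 + delta_l) in the planted model of edges bichromatic under a fixed balanced colouring.
   Hence, for a box of cycle counts, E[Z; X = a] / E[Z] tends to P(X = a) g(a), where g(a) = prod_l (1
   + delta_l) ^ a_l exp (- lambda_l delta_l). The second moment of the number of nearly balanced
   colourings is at most (1 + o(1)) exp (sum_l lambda_l delta_l ^ 2) times the square of its mean: this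
   is a Laplace sum over the overlap of two colourings, where the bound on d' / k enters through an
   inequality between the entropy of the overlap and the probability that an edge is monochromatic
   under both colourings. That constant is also the second moment of g under the limit law, so Z / E[Z]
   is L2-close to g(X) up to an event of small probability; taking logarithms gives W, whose series
   converges absolutely almost surely because E|X_l - lambda_l| |delta_l| decays geometrically. *)

Require Import Defs.
From HB Require Import structures.
From mathcomp Require Import all_boot all_order all_algebra.
From mathcomp Require Import reals.
From mathcomp Require Import ring lra zify.

Set Implicit Arguments.
Unset Strict Implicit.
Unset Printing Implicit Defensive.

Import Order.TTheory GRing.Theory Num.Theory.

Local Open Scope ring_scope.

(** * Switchings in a uniform random m-subset *)

Section UniformSubsets.
Variable T : finType.
Implicit Types (F G H S C U : {set T}) (m : nat).

(** Class sizes of the relevant colourings fluctuate on the scale sqrt n, and pairs of colourings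
    with different class sizes are awkward to compare. Pairs are therefore treated only within one
    class size, where the second-order effects of imbalance cancel, and Minkowski's inequality
    ([minkowski_sqr]) carries the bound, with the same constant, to the sum over all nearly balanced
    sizes. The other colourings enter only through the first moment. The constant exp (sum_l
    lambda_l delta_l ^ 2) arises as exp (- x / 2) / sqrt (1 - x), where x = d (k - 1) / (2 ^ (k - 1)
    - 1) ^ 2: the square root is the widening of a Gaussian overlap law, and exp (- x / 2), the
    missing term l = 1 of the series, comes from the k vertices of an edge being distinct. A finite
    box of cycle lengths and counts is fixed first, large enough to capture almost all of that
    constant; only then does n grow. On the box an L1 bound between Z / E Z and g results, and
    Markov's inequality compares distribution functions, so the event Z = 0 needs no estimate of its
    own. *)

Definition msub F m : {set {set T}} := [set H : {set T} | (H \subset F) && (#|H| == m)].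

Lemma card_msub F m : #|msub F m| = 'C(#|F|, m).
Proof. exact: cards_draws. Qed.

Lemma msub_supE F m S : S \subset F -> (#|S| <= m)%N ->
  [set H in msub F m | S \subset H] =
  [set H' :|: S | H' in msub (F :\: S) (m - #|S|)].
Proof.
move=> SF Sm; apply/setP => H; rewrite !inE; apply/idP/imsetP.
- case/andP=> /andP[HF /eqP Hm] SH; exists (H :\: S).
    by rewrite inE setSD //= cardsDS // Hm.
  by apply/setP => x; rewrite !inE; case: (boolP (x \in S)) => [/(subsetP SH)->|_]; rewrite ?orbT ?orbF.
- case=> H'; rewrite inE subsetD => /andP[/andP[H'F dH'] /eqP cH'] ->.
  rewrite subUset H'F SF subsetUr andbT /=.
  by rewrite cardsU (eqP (_ : H' :&: S == set0)) ?setI_eq0 // cards0 subn0 cH' subnK.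
Qed.

Lemma card_msub_sup F m S : S \subset F -> (#|S| <= m)%N ->
  #|[set H in msub F m | S \subset H]| = 'C(#|F| - #|S|, m - #|S|).
Proof.
move=> SF Sm; rewrite msub_supE // card_in_imset ?card_msub ?cardsDS //.
move=> H1 H2; rewrite !inE !subsetD => /andP[/andP[_ d1] _] /andP[/andP[_ d2] _] E.
have K (H : {set T}) : [disjoint H & S] -> (H :|: S) :\: S = H.
  by move=> d; rewrite setDUl setDv setU0; apply/setDidPl.
by rewrite -(K H1 d1) E (K H2 d2).
Qed.

Lemma card_msub_sup0 F m S : ~~ (S \subset F) || (m < #|S|)%N ->
  #|[set H in msub F m | S \subset H]| = 0%N.
Proof.
move=> h; apply/eqP; rewrite cards_eq0; apply/eqP/setP => H; rewrite !inE.
apply/negP => /andP[/andP[HF /eqP Hm] SH]; case/orP: h.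
  by rewrite (subset_trans SH HF).
by rewrite ltnNge -Hm subset_leq_card.
Qed.

End UniformSubsets.

Lemma bin_ffact_shift f m s : (s <= m)%N -> (m <= f)%N ->
  ('C(f, m) * m ^_ s = 'C(f - s, m - s) * f ^_ s)%N.
Proof.
move=> sm mf; have sf := leq_trans sm mf.
apply/eqP; rewrite -(@eqn_pmul2r ((m - s)`! * (f - m)`!)) ?muln_gt0 ?fact_gt0 //.
apply/eqP; transitivity f`!.
  by rewrite mulnA -(mulnA 'C(f, m)) ffact_fact // -mulnA bin_fact.
have e : (f - m = f - s - (m - s))%N by lia.
by rewrite mulnAC e bin_fact ?leq_sub2r // mulnC ffact_fact.
Qed.

Lemma ffact_ratio_le f m s : (m <= f)%N -> (m ^_ s * f ^ s <= f ^_ s * m ^ s)%N.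
Proof.
move=> mf; elim: s => [|s IH]; first by rewrite !ffactn0 !expn0.
rewrite !ffactnSr !expnS.
have h : ((m - s) * f <= (f - s) * m)%N by rewrite !mulnBl (mulnC f m) leq_sub2l // leq_mul2l mf orbT.
have := leq_mul IH h; lia.
Qed.

Section SupProb.
Variables (R : realType) (T : finType).
Implicit Types (F S : {set T}) (m : nat).

Definition psup F m S : R := unif_prob R (msub F m) (fun H => S \subset H).

Lemma psup_ge0 F m S : 0 <= psup F m S.
Proof. by rewrite /psup /unif_prob divr_ge0. Qed.

Lemma psupE F m S : (m <= #|F|)%N -> S \subset F ->
  psup F m S = (m ^_ #|S|)%:R / (#|F| ^_ #|S|)%:R.
Proof.
move=> mF SF; rewrite /psup /unif_prob card_msub.
have F0 : (0 < #|F| ^_ #|S|)%N by rewrite ffact_gt0 subset_leq_card.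
have B0 : (0 < 'C(#|F|, m))%N by rewrite bin_gt0.
have [Sm|mS] := leqP #|S| m; last first.
  by rewrite card_msub_sup0 ?mS ?orbT // ffact_small // !mul0r.
rewrite card_msub_sup //; apply/eqP; rewrite eqr_div ?pnatr_eq0 -?lt0n //.
by rewrite -!natrM eqr_nat -bin_ffact_shift // mulnC.
Qed.

(** Sampling without replacement: each factor (m - j) / (f - j) is at most m / f. *)
Lemma psup_le F m S : (m <= #|F|)%N -> psup F m S <= (m%:R / #|F|%:R) ^+ #|S|.
Proof.
move=> mF; have [SF|nSF] := boolP (S \subset F); last first.
  by rewrite /psup /unif_prob card_msub_sup0 ?nSF // mul0r exprn_ge0 ?divr_ge0.
have [F0|F0] := posnP #|F|.
  have S0 : S = set0 by apply/eqP; rewrite -cards_eq0 -leqn0 -F0 subset_leq_card.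
  by rewrite psupE // S0 cards0 !ffactn0 expr0 divr1.
rewrite psupE // expr_div_n ler_pdivrMr ?ltr0n ?ffact_gt0 ?subset_leq_card //.
rewrite mulrAC ler_pdivlMr ?exprn_gt0 ?ltr0n // -!natrX -!natrM ler_nat.
by rewrite [leqRHS]mulnC ffact_ratio_le.
Qed.

End SupProb.

Section CycleSwitch.
Variables (T : finType) (F : {set T}) (m : nat) (L : nat) (len : 'I_L -> nat).
Variable Cs : 'I_L -> {set {set T}}.
Hypothesis CsF : forall i U, U \in Cs i -> U \subset F.
Hypothesis CsC : forall i U, U \in Cs i -> #|U| = len i.
Hypothesis len_gt0 : forall i, (0 < len i)%N.
Hypothesis len_inj : injective len.

Definition subcounts (H : {set T}) : {ffun 'I_L -> nat} :=
  [ffun i => #|[set U in Cs i | U \subset H]|].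

Definition incr (a : {ffun 'I_L -> nat}) (i : 'I_L) : {ffun 'I_L -> nat} :=
  [ffun j => (a j + (j == i))%N].

(** For fixed [S] disjoint from [C], the maps taking G to (G minus S) with C added, and H to (H
    minus C) with S added, are inverse to each other. With [S] as the outer index both sums have the
    same terms. *)
Lemma switch_one (C : {set T}) l (f : {set T} -> {set T} -> nat) :
  C \subset F -> #|C| = l ->
  (\sum_(G in msub F m | [disjoint C & G]) \sum_(S in msub G l) f ((G :\: S) :|: C) S =
   \sum_(H in msub F m | C \subset H) \sum_(S in msub (F :\: H) l) f H S)%N.
Proof.
move=> CF Cl.
rewrite (exchange_big_dep (fun S => S \in msub (F :\: C) l)) /=; last first.
  move=> G S; rewrite !inE => /andP[/andP[GF _] d] /andP[SG ->]; rewrite andbT subsetD.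
  by rewrite (subset_trans SG GF) disjoint_sym (disjointWr SG).
rewrite [RHS](exchange_big_dep (fun S => S \in msub (F :\: C) l)) /=; last first.
  move=> H S; rewrite !inE => /andP[_ CH] /andP[SG ->]; rewrite andbT.
  by rewrite (subset_trans SG) // setDS.
apply: eq_bigr => S; rewrite inE subsetD => /andP[/andP[SF dSC] /eqP Sl].
rewrite (reindex_onto (fun H : {set T} => (H :\: C) :|: S) (fun G : {set T} => (G :\: S) :|: C)) /=; last first.
  move=> G; rewrite !inE => /andP[/andP[_ d] /andP[SG _]].
  apply/setP => x; rewrite !inE.
  have := subsetP SG x; have := disjointFr d (x := x); have := disjointFr dSC (x := x).
  by case: (x \in S); case: (x \in C); case: (x \in G) => //= h1 h2 h3;
    (try by rewrite h1) ; (try by rewrite h2); (try by rewrite h3).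
apply: eq_big => [H|H]; last first.
  move=> /andP[_ /eqP E]; by rewrite E.
rewrite !inE subUset; apply/idP/idP.
- move=> /andP[/andP[/andP[/andP[/andP[HF SF'] /eqP Hm] d] _] /eqP E].
  have CH : C \subset H by rewrite -E subsetUr.
  have dSH : [disjoint S & H].
    apply/pred0P => x /=; apply/negP => /andP[xS xH].
    by move: xH; rewrite -E !inE xS /= (disjointFr dSC xS).
  have HF' : H \subset F.
    apply/subsetP => x xH; have [xC|xC] := boolP (x \in C); first exact: (subsetP CF).
    by apply: (subsetP HF); rewrite !inE xH xC.
  rewrite HF' CH subsetD SF dSH Sl eqxx !andbT /= -Hm cardsU cardsDS // Cl.
  rewrite (_ : (H :\: C) :&: S = set0) ?cards0 ?subn0 ?Sl ?subnK //.
  - by rewrite -Cl subset_leq_card.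
  - by apply/setP => x; rewrite !inE; case: (boolP (x \in S)) => [/(disjointFr dSH)->|]; rewrite ?andbF.
- move=> /andP[/andP[/andP[HF /eqP Hm] CH] /andP[]]; rewrite subsetD => /andP[_ dSH] _.
  rewrite (subset_trans (subsetDl _ _) HF) SF subsetUr Sl eqxx !andbT /=.
  have z : (H :\: C) :&: S = set0.
    by apply/setP => x; rewrite !inE; case: (boolP (x \in S)) => [/(disjointFr dSH)->|]; rewrite ?andbF.
  apply/andP; split; first (apply/andP; split).
  + rewrite cardsU z cards0 subn0 cardsDS // Cl Sl subnK ?Hm //.
    by rewrite -Cl -Hm subset_leq_card.
  + apply/pred0P => x /=; apply/negP => /andP[xC]; rewrite !inE xC /= => xS.
    by move: (disjointFr dSC xS); rewrite xC.
  + apply/eqP/setP => x; rewrite !inE.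
    have := subsetP CH x; have := disjointFr dSH (x := x); have := disjointFr dSC (x := x).
    by case: (x \in S); case: (x \in C); case: (x \in H) => //= h1 h2 h3;
      (try by rewrite h1) ; (try by rewrite h2); (try by rewrite h3).
Qed.

Lemma sum_subcounts i (P : pred {set T}) :
  (\sum_(C in Cs i) #|[set H in msub F m | P H & C \subset H]| =
   \sum_(H in msub F m | P H) subcounts H i)%N.
Proof.
under eq_bigr do rewrite -sum1_card.
rewrite (exchange_big_dep (fun H => (H \in msub F m) && P H)) /=; last first.
  by move=> C H _; rewrite inE => /andP[-> /andP[-> _]].
apply: eq_bigr => H /andP[Hm PH]; rewrite ffunE -sum1_card.
by apply: eq_bigl => C; rewrite [in LHS]inE Hm PH /= [in RHS]inE.
Qed.

Lemma card_msub_hit (G U : {set T}) l : (0 < l)%N -> U \subset G ->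
  (#|[set S in msub G l | ~~ [disjoint S & U]]| <= #|U| * 'C(#|G|.-1, l.-1))%N.
Proof.
move=> l0 UG.
apply: (@leq_trans (\sum_(x in U) #|[set S in msub G l | [set x] \subset S]|)).
  rewrite -sum1_card.
  under [leqRHS]eq_bigr do rewrite -sum1_card.
  rewrite (exchange_big_dep (fun S => S \in msub G l)) /=; last first.
    by move=> x S _; rewrite inE => /andP[].
  rewrite (eq_bigl (fun S => (S \in msub G l) && ~~ [disjoint S & U])); last by move=> S; rewrite inE.
  rewrite big_mkcondr; apply: leq_sum => S Sm.
  case: ifP => // /pred0Pn[x /andP[/= xS xU]].
  by rewrite (bigD1 x) ?inE /= ?xU ?sub1set ?xS ?andbT; move: Sm; rewrite ?inE ?xU ?sub1set ?xS ?andbT //.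
rewrite -sum_nat_const; apply: leq_sum => x xU.
rewrite card_msub_sup ?cards1 ?subn1 //; first by rewrite sub1set (subsetP UG).
Qed.

(** The lengths being distinct, [C] lies in the family [i] only. A counted set of [G] survives
    unless [S] hits it, and a new one other than [C] would have to meet [C]; the two last premises
    exclude both events. *)
Lemma subcounts_switch i (G C S H : {set T}) : C \in Cs i -> [disjoint C & G] ->
  H = (G :\: S) :|: C ->
  (forall j U, U \in Cs j -> U \subset G -> [disjoint S & U]) ->
  (forall j U, U \in Cs j -> U \subset H -> U != C -> [disjoint U & C]) ->
  subcounts H = incr (subcounts G) i.
Proof.
move=> Ci dCG -> h1 h2; apply/ffunP => j; rewrite !ffunE.
have C0 : exists x, x \in C by apply/card_gt0P; rewrite (CsC Ci).
have nCG : ~~ (C \subset G).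
  case: C0 => x xC; apply/negP => /subsetP/(_ x xC) xG.
  by rewrite (disjointFr dCG xC) in xG.
have -> : [set U in Cs j | U \subset (G :\: S) :|: C] =
   (if j == i then [set C] else set0) :|: [set U in Cs j | U \subset G].
  apply/setP => U; rewrite !inE.
  have -> : (U \in (if j == i then [set C] else set0)) = (U \in Cs j) && (U == C).
    case: (j =P i) => [->|ji]; rewrite inE; last first.
      apply/esym/negP => /andP[Uj /eqP E]; apply: ji; apply: len_inj.
      by rewrite -(CsC Uj) E (CsC Ci).
    by case: eqP => [->|]; rewrite ?Ci ?andbF.
  rewrite -andb_orr; case: (boolP (U \in Cs j)) => //= Uj.
  apply/idP/idP.
  - move=> UH; case: (boolP (U == C)) => //= UC.
    have d := h2 _ _ Uj UH UC.
    apply/subsetP => x xU; have := subsetP UH x xU; rewrite !inE (disjointFr d xU) orbF.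
    by case/andP.
  - case/orP => [/eqP->|UG]; first exact: subsetUr.
    have d := h1 _ _ Uj UG; apply/subsetP => x xU; rewrite !inE (subsetP UG x xU).
    by rewrite (disjointFl d xU).
rewrite cardsU (_ : _ :&: _ = set0) ?cards0 ?subn0.
  by rewrite addnC; case: eqP => _; rewrite ?cards1 ?cards0.
case: (j =P i) => [->|_]; last by rewrite set0I.
apply/setP => U; rewrite !inE; apply/negP => /andP[/eqP-> /andP[_]].
exact: negP.
Qed.

Definition cnt a := #|[set H in msub F m | subcounts H == a]|.

Definition overlap i : nat :=
  (\sum_(C in Cs i) \sum_(j < L) \sum_(U in Cs j | (U != C) && ~~ [disjoint U & C])
    #|[set H in msub F m | C :|: U \subset H]|)%N.

Definition hits i : nat :=
  (#|Cs i| * \sum_(j < L) \sum_(U in Cs j)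
     #|[set G in msub F m | U \subset G]| * (len j * 'C(m.-1, (len i).-1)))%N.

Definition touches i : nat := ('C(m, len i) * (#|Cs i| * (len i * 'C(#|F|.-1, m.-1))))%N.

Let bad i (G C S : {set T}) := subcounts ((G :\: S) :|: C) != incr (subcounts G) i.

(** A triple is bad only if [S] hits a counted set of G ([b1]) or the new H contains a counted set
    that meets C ([b2]). The first sum is a union bound over elements; the second is carried by
    [switch_one] to the side of H, where it no longer depends on [S]. *)
Lemma switch_bad i :
  (\sum_(C in Cs i) \sum_(G in msub F m | [disjoint C & G])
     \sum_(S in msub G (len i)) bad i G C S
   <= hits i + 'C(#|F| - m, len i) * overlap i)%N.
Proof.
pose b1 (G S : {set T}) : nat :=
  (\sum_(j < L) \sum_(U in Cs j | U \subset G) ~~ [disjoint S & U])%N.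
pose b2 (H C : {set T}) : nat :=
  (\sum_(j < L) \sum_(U in Cs j | (U \subset H) && (U != C)) ~~ [disjoint U & C])%N.
have key (C G S : {set T}) : C \in Cs i -> [disjoint C & G] ->
    (bad i G C S <= b1 G S + b2 ((G :\: S) :|: C) C)%N.
  move=> Ci d; case: (posnP (b1 G S)) => [z1|]; last by case: bad => //; lia.
  case: (posnP (b2 ((G :\: S) :|: C) C)) => [z2|]; last by case: bad => //; lia.
  rewrite /bad (subcounts_switch (i := i) (G := G) (S := S) (C := C)) ?eqxx //.
  - move=> j U Uj UG; move/eqP: z1; rewrite sum_nat_eq0 => /forallP/(_ j) /=.
    rewrite sum_nat_eq0 => /forall_inP/(_ U); rewrite Uj UG => /(_ isT).
    by case: ([disjoint S & U]).
  - move=> j U Uj UH UC; move/eqP: z2; rewrite sum_nat_eq0 => /forallP/(_ j) /=.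
    rewrite sum_nat_eq0 => /forall_inP/(_ U); rewrite Uj UH UC => /(_ isT).
    by case: ([disjoint U & C]).
apply: (@leq_trans (\sum_(C in Cs i) \sum_(G in msub F m | [disjoint C & G])
     \sum_(S in msub G (len i)) (b1 G S + b2 ((G :\: S) :|: C) C))).
  by apply: leq_sum => C Ci; apply: leq_sum => G /andP[Gm d]; apply: leq_sum => S Sm; apply: key.
under eq_bigr do under eq_bigr do rewrite big_split /=.
under eq_bigr do rewrite big_split /=.
rewrite big_split /=; apply: leq_add.
- rewrite /hits -sum_nat_const; apply: leq_sum => C Ci.
  apply: (@leq_trans (\sum_(G in msub F m) \sum_(S in msub G (len i)) b1 G S)).
    by rewrite big_mkcondr /=; apply: leq_sum => G _; case: ifP.
  rewrite /b1.
  under eq_bigr do rewrite exchange_big /=.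
  rewrite exchange_big /=; apply: leq_sum => j _.
  under eq_bigr do rewrite exchange_big /=.
  rewrite (exchange_big_dep (fun U => U \in Cs j)) /=; last by move=> G U _ /andP[].
  apply: leq_sum => U Uj; rewrite -sum_nat_const.
  rewrite [leqLHS](eq_bigl (fun G => G \in [set G in msub F m | U \subset G])); last first.
    by move=> G; rewrite inE Uj.
  apply: leq_sum => G; rewrite !inE => /andP[/andP[GF /eqP Gm] UG].
  rewrite -Gm -(CsC Uj); apply: leq_trans (card_msub_hit _ UG) => //.
  rewrite -[leqRHS]sum1_card [leqLHS]big_mkcond [leqRHS]big_mkcond /=.
  by apply: leq_sum => S _; rewrite !inE; case: (_ && _) => //=; case: disjoint.
- rewrite /overlap big_distrr /=; apply: leq_sum => C Ci.
  rewrite (switch_one (fun H S => b2 H C)) ?(CsF Ci) ?(CsC Ci) //.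
  apply: (@leq_trans (\sum_(H in msub F m | C \subset H) 'C(#|F| - m, len i) * b2 H C)).
    apply: leq_sum => H /andP[]; rewrite inE => /andP[HF /eqP Hm] CH.
    by rewrite sum_nat_const card_msub cardsDS // Hm.
  rewrite -big_distrr /= leq_mul2l; apply/orP; right.
  rewrite /b2 exchange_big /=; apply: leq_sum => j _.
  rewrite (exchange_big_dep (fun U => (U \in Cs j) && (U != C))) /=; last first.
    by move=> H U _ /andP[-> /andP[_ ->]].
  rewrite big_mkcondr [leqRHS]big_mkcondr /=; apply: leq_sum => U Uj.
  case: (U != C) => //=; case: (boolP [disjoint U & C]) => d /=.
    by rewrite big1.
  rewrite -[leqRHS]sum1_card [leqLHS]big_mkcond [leqRHS]big_mkcond /=.
  apply: leq_sum => H _; rewrite !inE subUset Uj andbT /=.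
  by case: (H \subset F); case: (#|H| == m); case: (C \subset H); case: (U \subset H).
Qed.

(* Exchange a set C of [Cs i] absent from G for an S \subset G of the same size: generically only
   the i-th count moves, by one. [E] counts the triples (G, C, S) for which another set of the
   families is destroyed by S ([hits]) or created by C ([overlap]), or for which C meets G
   ([touches]). *)
Lemma switch_ineq i (a : {ffun 'I_L -> nat}) : (m <= #|F|)%N ->
  let A := ('C(#|F| - m, len i) * ((a i).+1 * cnt (incr a i)))%N in
  let B := ('C(m, len i) * (#|Cs i| * cnt a))%N in
  let E := (hits i + 'C(#|F| - m, len i) * overlap i + touches i)%N in
  (A <= B + E)%N /\ (B <= A + E)%N.
Proof.
move=> mF A B E.
set Q := (\sum_(C in Cs i) \sum_(G in msub F m | [disjoint C & G])
     \sum_(S in msub G (len i)) bad i G C S)%N.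
have Qle := switch_bad i; rewrite -/Q in Qle.
(* The triples are read from H here: each H with counts [incr a i] contains [a i + 1] sets of
   [Cs i]. [B1] below counts the same triples from the side of G, and [bad] bounds the
   difference. *)
have AE : A = (\sum_(C in Cs i) \sum_(G in msub F m | [disjoint C & G])
     \sum_(S in msub G (len i)) (subcounts ((G :\: S) :|: C) == incr a i))%N.
  transitivity (\sum_(C in Cs i) \sum_(H in msub F m | C \subset H)
     \sum_(S in msub (F :\: H) (len i)) (subcounts H == incr a i))%N; last first.
    apply: eq_bigr => C Ci.
    by rewrite -(switch_one (fun H S => (subcounts H == incr a i) : nat)) ?(CsF Ci) ?(CsC Ci).
  transitivity ('C(#|F| - m, len i) *
     \sum_(C in Cs i) #|[set H in msub F m | subcounts H == incr a i & C \subset H]|)%N.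
    rewrite sum_subcounts /A /cnt; congr (_ * _)%N.
    rewrite mulnC -sum_nat_const.
    apply: eq_big => [H|H]; rewrite inE // => /andP[_ /eqP->].
    by rewrite ffunE eqxx addn1.
  rewrite big_distrr /=; apply: eq_bigr => C Ci.
  rewrite -[#|finset _|]sum1_card big_distrr /=.
  rewrite (eq_bigl (fun H => ((H \in msub F m) && (C \subset H)) && (subcounts H == incr a i))); last first.
    by move=> H; rewrite inE andbA andbAC.
  rewrite big_mkcondr /=; apply: eq_bigr => H /andP[]; rewrite inE => /andP[HF /eqP Hm] CH.
  rewrite sum_nat_const card_msub cardsDS // Hm muln1.
  by case: eqP => _; rewrite ?muln1 ?muln0.
set B1 := (\sum_(C in Cs i) \sum_(G in msub F m | [disjoint C & G])
     \sum_(S in msub G (len i)) (subcounts G == a))%N.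
have inj : forall x, (incr x i == incr a i) = (x == a).
  move=> x; apply/eqP/eqP => [/ffunP h|->//]; apply/ffunP => j.
  by have := h j; rewrite !ffunE => /addIn.
have aux (X Y : {ffun 'I_L -> nat}) :
    ((X == incr a i) <= (Y == a) + (X != incr Y i))%N /\
    ((Y == a) <= (X == incr a i) + (X != incr Y i))%N.
  by case: (X =P incr Y i) => [->|_]; rewrite ?inj; split; rewrite ?addn0 ?addn1; case: eqP.
have AB1 : (A <= B1 + Q)%N /\ (B1 <= A + Q)%N.
  rewrite AE /B1 /Q; split; rewrite -big_split /=; apply: leq_sum => C Ci;
   rewrite -big_split /=; apply: leq_sum => G _; rewrite -big_split /=; apply: leq_sum => S _;
   by case: (aux (subcounts ((G :\: S) :|: C)) (subcounts G)).
have B1B : (B1 <= B)%N /\ (B <= B1 + touches i)%N.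
  have B1E : B1 = ('C(m, len i) * \sum_(C in Cs i) #|[set G in msub F m | [disjoint C & G] & subcounts G == a]|)%N.
    rewrite big_distrr /=; apply: eq_bigr => C Ci.
    rewrite -[#|finset _|]sum1_card big_distrr /= [RHS](eq_bigl (fun G => ((G \in msub F m) && [disjoint C & G]) && (subcounts G == a))); last first.
      by move=> G; rewrite inE andbA.
    rewrite [RHS]big_mkcondr /=; apply: eq_bigr => G /andP[]; rewrite inE => /andP[GF /eqP Gm] d.
    by rewrite sum_nat_const card_msub Gm muln1; case: eqP => _; rewrite ?muln1 ?muln0.
  rewrite B1E /B /touches -mulnDr !leq_mul2l -!sum_nat_const -big_split /=.
  split; apply/orP; right.
    apply: leq_sum => C Ci; apply: subset_leq_card; apply/subsetP => G; rewrite !inE.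
    by case/andP=> -> /andP[_ ->].
  apply: leq_sum => C Ci.
  apply: (@leq_trans (#|[set G in msub F m | [disjoint C & G] & subcounts G == a]| +
     #|[set G in msub F m | ~~ [disjoint C & G]]|)).
    apply: leq_trans (leq_card_setU _ _); apply: subset_leq_card.
    apply/subsetP => G; rewrite !inE => /andP[-> ->] /=.
    by case: disjoint.
  rewrite leq_add2l -(CsC Ci).
  have [->|m0] := posnP m.
    rewrite (_ : [set _ in _ | _] = set0) ?cards0 //.
    apply/setP => G; rewrite !inE cards_eq0; apply/negP => /andP[/andP[_ /eqP->]].
    by rewrite disjoint_sym disjoints_subset sub0set.
  apply: leq_trans (card_msub_hit m0 (CsF Ci)); apply: subset_leq_card.
  by apply/subsetP => G; rewrite !inE disjoint_sym.
case: AB1 => h1 h2; case: B1B => h3 h4; rewrite /E; split; lia.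
Qed.

End CycleSwitch.

(** * Cycles in uniform hypergraphs *)

Lemma cards_triple (T : finType) (a b c : T) :
  a != b -> c != a -> c != b -> #|[set a; b; c]| = 3%N.
Proof. by move=> ab ca cb; rewrite setUC cardsU1 !inE cards2 negb_or ab ca cb. Qed.

Section Core.
Variables (V I : finType) (A : {set I}) (e : I -> {set V}) (k : nat).
Hypothesis ek : forall i, i \in A -> #|e i| = k.

Definition ideg v := #|[set i in A | v \in e i]|.
Definition special i := [set v in e i | (1 < ideg v)%N].
Definition icover := \bigcup_(i in A) e i.

Lemma ideg_gt0 i v : i \in A -> v \in e i -> (0 < ideg v)%N.
Proof. by move=> iA vi; apply/card_gt0P; exists i; rewrite inE iA. Qed.

Lemma ideg_gt1 i j v : i \in A -> j \in A -> i != j -> v \in e i -> v \in e j -> (1 < ideg v)%N.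
Proof.
move=> iA jA ij vi vj; apply: (@leq_trans #|[set i; j]|); first by rewrite cards2 ij.
apply: subset_leq_card; apply/subsetP => x; rewrite !inE.
by case/orP => /eqP ->; rewrite ?iA ?jA.
Qed.

Hypothesis core : forall i, i \in A -> (1 < #|special i|)%N.

(* Each incidence (v, i) gets weight 2 if v has degree 1 and weight 1 otherwise:
   every vertex collects at least 2, every edge gives away 2k - #|special i|. *)
Lemma core_identity :
  (2 * #|icover| + \sum_(v in icover) (ideg v * (1 + (ideg v == 1%N)) - 2)
   + 2 * #|A| + \sum_(i in A) (#|special i| - 2) = 2 * k * #|A|)%N.
Proof.
have h1 : (2 * #|icover| + \sum_(v in icover) (ideg v * (1 + (ideg v == 1%N)) - 2) =
   \sum_(v in icover) ideg v * (1 + (ideg v == 1%N)))%N.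
  rewrite mulnC -sum_nat_const -big_split /=; apply: eq_bigr => v /bigcupP[i iA vi].
  by have := ideg_gt0 iA vi; case: (ideg v) => [|[|d]] _ //=; lia.
have h2 : (2 * #|A| + \sum_(i in A) (#|special i| - 2) = \sum_(i in A) #|special i|)%N.
  rewrite mulnC -sum_nat_const -big_split /=; apply: eq_bigr => i iA.
  have := core iA; lia.
rewrite -addnA h1 h2.
have -> : (\sum_(v in icover) ideg v * (1 + (ideg v == 1%N)) =
   \sum_(i in A) \sum_(v in e i) (1 + (ideg v == 1%N)))%N.
  under eq_bigr do rewrite -sum_nat_const.
  rewrite (exchange_big_dep (fun i => i \in A)) /=; last by move=> v i _; rewrite inE => /andP[].
  apply: eq_bigr => i iA; apply: eq_bigl => v; rewrite inE iA /=.
  rewrite andb_idl // => vi; apply/bigcupP; by exists i.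
rewrite -big_split /= mulnC -sum_nat_const; apply: eq_bigr => i iA.
rewrite big_split /= sum1_card (ek iA) -addnA.
have -> : (\sum_(v in e i) (ideg v == 1%N) + #|special i| = \sum_(v in e i) 1)%N.
  rewrite -[#|special i|]sum1_card [X in (_ + X)%N](eq_bigl (fun v => (v \in e i) && (1 < ideg v)%N)); last first.
    by move=> v; rewrite inE.
  rewrite big_mkcondr -big_split /=; apply: eq_bigr => v vi.
  by have := ideg_gt0 iA vi; case: (ideg v) => [|[|d]].
by rewrite sum1_card (ek iA) mul2n addnn.
Qed.

Lemma core_cover_le : (#|icover| <= (k - 1) * #|A|)%N.
Proof.
have h := core_identity; rewrite mulnBl mul1n.
have : (2 * k * #|A| = 2 * (k * #|A|))%N by rewrite mulnA.
move: (k * #|A|)%N => x h2; rewrite h2 in h; lia.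
Qed.

Hypothesis tight : #|icover| = ((k - 1) * #|A|)%N.

(** Equality in [core_cover_le] leaves no room for the two nonnegative slack sums of
    [core_identity]. Their vanishing means degrees at most 2 and exactly two special vertices in
    each edge. *)
Let tight_sums : (\sum_(v in icover) (ideg v * (1 + (ideg v == 1%N)) - 2) = 0)%N /\
  (\sum_(i in A) (#|special i| - 2) = 0)%N.
Proof.
have h := core_identity; rewrite tight mulnBl mul1n in h.
have [A0|A0] := posnP #|A|.
  move: h; rewrite A0 !muln0; lia.
have e1 : (2 * k * #|A| = 2 * (k * #|A|))%N by rewrite mulnA.
have kA : (#|A| <= k * #|A|)%N.
  have [k0|k0] := posnP k; last by rewrite leq_pmull.
  case/card_gt0P: A0 => i iA; have := core iA.
  have : (#|special i| <= #|e i|)%N.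
    by apply: subset_leq_card; apply/subsetP => v; rewrite inE => /andP[].
  rewrite (ek iA) k0; lia.
move: e1 kA h; move: (k * #|A|)%N => x -> h2 h; lia.
Qed.

Lemma tight_special i : i \in A -> #|special i| = 2%N.
Proof.
move=> iA; case: tight_sums => _ /eqP; rewrite sum_nat_eq0 => /forall_inP/(_ i iA).
have := core iA; rewrite subn_eq0; lia.
Qed.

Lemma tight_ideg i v : i \in A -> v \in e i -> (ideg v <= 2)%N.
Proof.
move=> iA vi; case: tight_sums => /eqP; rewrite sum_nat_eq0 => /forall_inP/(_ v) h _.
have vc : v \in icover by apply/bigcupP; exists i.
move: (h vc); case: (ideg v) => [|[|[|d]]] //=; lia.
Qed.

End Core.

(** A set of at most [s] points is the set of values of a map from ['I_s] to [option V], [None]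
    serving as padding. *)
Lemma few_small_sets (V : finType) s :
  (#|[set W : {set V} | (#|W| <= s)%N]| <= #|V|.+1 ^ s)%N.
Proof.
rewrite -card_option -[X in (_ <= _ ^ X)%N]card_ord -card_ffun.
apply: leq_trans (leq_imset_card (fun f : {ffun 'I_s -> option V} => [set x | Some x \in codom f]) _).
apply: subset_leq_card; apply/subsetP => W; rewrite inE => Ws.
apply/imsetP; exists [ffun i : 'I_s => nth None (map some (enum W)) i] => //.
apply/setP => x; rewrite inE; apply/idP/codomP => [xW|[i]].
  have h : (index x (enum W) < #|W|)%N by rewrite cardE index_mem mem_enum.
  exists (Ordinal (leq_trans h Ws)); rewrite ffunE /= (nth_map x) -?cardE //.
  by rewrite nth_index // mem_enum.
rewrite ffunE; case: (ltnP i (size (enum W))) => h; last first.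
  by rewrite nth_default ?size_map.
by rewrite (nth_map x) // => -[->]; rewrite -mem_enum mem_nth.
Qed.

(** Union bound over the vertex set [W] on which a configuration lives. It is applied to
    configurations covering at least one vertex fewer than generic ones, so that they lose a factor
    of order n. *)
Lemma few_small_covers (V X : finType) s c (B : {set X}) (phi : {set V} -> {set X}) :
  (forall W : {set V}, (#|W| <= s)%N -> (#|phi W| <= c)%N) ->
  (forall x, x \in B -> exists2 W : {set V}, (#|W| <= s)%N & x \in phi W) ->
  (#|B| <= #|V|.+1 ^ s * c)%N.
Proof.
move=> hc hB; apply: (@leq_trans #|\bigcup_(W in [set W : {set V} | (#|W| <= s)%N]) phi W|).
  apply: subset_leq_card; apply/subsetP => x /hB[W Ws xW]; apply/bigcupP; exists W => //.
  by rewrite inE.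
apply: (@leq_trans (\sum_(W in [set W : {set V} | (#|W| <= s)%N]) c)); last first.
  by rewrite sum_nat_const leq_mul2r few_small_sets orbT.
apply: (@leq_trans (\sum_(W in [set W : {set V} | (#|W| <= s)%N]) #|phi W|)).
  elim/big_ind2 : _ => [|x1 x2 y1 y2 h1 h2|W _] //; first by rewrite cards0.
  by apply: leq_trans (leq_card_setU _ _) _; exact: leq_add.
by apply: leq_sum => W Ws; apply: hc; rewrite inE in Ws.
Qed.

Section Cycles.
Variables (V : finType) (k l' : nat).
Hypothesis k3 : (2 < k)%N.
Local Notation J := 'I_l'.+2.
Local Notation param := ({ffun J -> V} * {ffun J -> {set V}})%type.
Implicit Types (F : {set {set V}}) (p : param).

Definition cyc F p := injectiveb p.1 &&
  [forall i : J, [&& p.2 i \in F, p.1 i \in p.2 i & p.1 (i + 1) \in p.2 i]].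

(* A cycle, parametrised by its joints p.1 and its edges p.2, is generic when its edges cover as many
   vertices as possible, i.e. meet only at the joints. It then has 2 l parametrisations. *)
Definition gen F p := cyc F p && (#|\bigcup_i p.2 i| == (k - 1) * l'.+2)%N.

Definition edges p : {set {set V}} := [set p.2 i | i : J].

Definition kunif F := [forall f in F, #|f| == k].

Lemma cyclic_ind (P : J -> Prop) : P 0 -> (forall i, P i -> P (i + 1)) -> forall i, P i.
Proof.
move=> P0 PS i; rewrite -(natr_Zp i); elim: (i : nat) => [|j IH]; first by rewrite mulr0n.
by rewrite mulrSr; apply: PS.
Qed.

Lemma succ_neq (i : J) : i + 1 != i.
Proof. by rewrite -subr_eq0 addrAC subrr add0r. Qed.

Lemma pred_neq (i : J) : i - 1 != i.
Proof. by rewrite -subr_eq0 addrAC subrr add0r oppr_eq0. Qed.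

Section CycFacts.
Variables (F : {set {set V}}) (p : param).
Hypothesis kF : kunif F.
Hypothesis cp : cyc F p.

Lemma cyc_inj : injective p.1.
Proof. by case/andP: cp => /injectiveP. Qed.

Lemma cycP i : [/\ p.2 i \in F, p.1 i \in p.2 i & p.1 (i + 1) \in p.2 i].
Proof. by case/andP: cp => _ /forallP/(_ i)/and3P. Qed.

Lemma cyc_prev i : p.1 i \in p.2 (i - 1).
Proof. by case: (cycP (i - 1)) => _ _; rewrite subrK. Qed.

Lemma cyc_card i : #|p.2 i| = k.
Proof. by case: (cycP i) => h _ _; apply/eqP; exact: (forall_inP kF). Qed.

Let A : {set J} := [set: J].

Lemma cyc_ideg i : (1 < ideg A p.2 (p.1 i))%N.
Proof.
apply: (@ideg_gt1 _ _ _ _ i (i - 1)); rewrite ?inE //.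
- by rewrite eq_sym pred_neq.
- by case: (cycP i).
- exact: cyc_prev.
Qed.

Lemma cyc_pair i : [set p.1 i; p.1 (i + 1)] \subset special A p.2 i.
Proof.
apply/subsetP => x; rewrite !inE => /orP[]/eqP->; rewrite cyc_ideg andbT; by case: (cycP i).
Qed.

Lemma cyc_pair2 i : #|[set p.1 i; p.1 (i + 1)]| = 2%N.
Proof. by rewrite cards2 (inj_eq cyc_inj) eq_sym succ_neq. Qed.

Lemma cyc_core i : (1 < #|special A p.2 i|)%N.
Proof. by rewrite -(cyc_pair2 i); exact: subset_leq_card (cyc_pair i). Qed.

Lemma icoverT : icover A p.2 = \bigcup_i p.2 i.
Proof. by apply: eq_bigl => i; rewrite inE. Qed.

Lemma cyc_cover_le : (#|\bigcup_i p.2 i| <= (k - 1) * l'.+2)%N.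
Proof.
rewrite -icoverT -[l'.+2 in leqRHS]card_ord -cardsT; apply: core_cover_le => i _.
  exact: cyc_card.
exact: cyc_core.
Qed.

Hypothesis gp : gen F p.

Let tightT : #|icover A p.2| = ((k - 1) * #|A|)%N.
Proof. by rewrite icoverT cardsT card_ord; case/andP: gp => _ /eqP. Qed.

Let special2 i : #|special A p.2 i| = 2%N.
Proof. by apply: (@tight_special _ _ A p.2 k) => // j _; [exact: cyc_card|exact: cyc_core]. Qed.

Let ideg2 i v : v \in p.2 i -> (ideg A p.2 v <= 2)%N.
Proof.
by move=> vi; apply: (@tight_ideg _ _ A p.2 k _ _ _ i) => // j _; [exact: cyc_card|exact: cyc_core].
Qed.

Lemma gen_specialE i : special A p.2 i = [set p.1 i; p.1 (i + 1)].
Proof.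
apply/esym/eqP; rewrite eqEcard cyc_pair special2 cyc_pair2 //.
Qed.

(** If two positions carried the same edge, all its k > 2 vertices would have degree at least 2,
    against the two special vertices allowed. *)
Lemma gen_inj : injective p.2.
Proof.
move=> i j eij; apply/eqP; apply: contraT => ij.
have h : p.2 i \subset special A p.2 i.
  apply/subsetP => v vi; rewrite inE vi /=; apply: (@ideg_gt1 _ _ _ _ i j); rewrite ?inE //.
  by rewrite -eij.
have := subset_leq_card h; rewrite special2 cyc_card; by rewrite leqNgt k3.
Qed.

Lemma gen_meet i j v : i != j -> v \in p.2 i -> v \in p.2 j -> v = p.1 i \/ v = p.1 (i + 1).
Proof.
move=> ij vi vj.
have : v \in special A p.2 i by rewrite inE vi; apply: (@ideg_gt1 _ _ _ _ i j); rewrite ?inE.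
by rewrite gen_specialE !inE => /orP[]/eqP; [left|right].
Qed.

Lemma gen_at i j : p.1 i \in p.2 j -> j = i \/ j = i - 1.
Proof.
move=> h; case: (j =P i) => [|/eqP ji]; first by left.
case: (j =P i - 1) => [|/eqP ji1]; first by right.
have : (#|[set i; (i - 1)%R; j]| <= 2)%N.
  apply: leq_trans (ideg2 h); apply: subset_leq_card; apply/subsetP => x; rewrite !inE.
  by case/orP => [/orP[]|] /eqP->; [case: (cycP i)|exact: cyc_prev|].
by rewrite cards_triple // eq_sym pred_neq.
Qed.

Lemma card_edges : #|edges p| = l'.+2.
Proof. by rewrite card_imset ?card_ord //; exact: gen_inj. Qed.

Lemma edges_sub : edges p \subset F.
Proof. by apply/subsetP => _ /imsetP[i _ ->]; case: (cycP i). Qed.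

End CycFacts.

Lemma cover_edges p : cover (edges p) = \bigcup_i p.2 i.
Proof.
apply/setP => x; apply/bigcupP/bigcupP => [[_ /imsetP[i _ ->] h]|[i _ h]].
  by exists i.
by exists (p.2 i) => //; apply: imset_f.
Qed.

(** The dihedral group acting on parametrisations by a rotation or a reflection. In a reflection the
    joints are shifted by one against the edges, because edge [c - i] runs from joint [c - i] to
    joint [c - i + 1]. *)
Definition dih (b : bool) (c : J) p : param :=
  if b then ([ffun i => p.1 (c + 1 - i)], [ffun i => p.2 (c - i)])
  else ([ffun i => p.1 (c + i)], [ffun i => p.2 (c + i)]).

Lemma dih_reindex (b : bool) (c : J) : bijective (fun i : J => if b then c - i else c + i).
Proof.
case: b; [exists (fun i => c - i)|exists (fun i => i - c)] => i.
- by rewrite opprB addrC subrK.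
- by rewrite opprB addrC subrK.
- by rewrite addrC addKr.
- by rewrite addrC subrK.
Qed.

Lemma dih2E b c p i : (dih b c p).2 i = p.2 (if b then c - i else c + i).
Proof. by case: b; rewrite ffunE. Qed.

Lemma dih_edges b c p : edges (dih b c p) = edges p.
Proof.
have [g gK Kg] := dih_reindex b c.
apply/setP => f; apply/imsetP/imsetP => -[i _ ->].
  by rewrite dih2E; eexists.
by exists (g i) => //; rewrite dih2E Kg.
Qed.

Lemma dih_gen F b c p : gen F p -> gen F (dih b c p).
Proof.
move=> /andP[cp /eqP tp]; apply/andP; split; last first.
  by rewrite -cover_edges dih_edges cover_edges tp.
apply/andP; split.
  apply/injectiveP => i j; case: b; rewrite !ffunE => /(cyc_inj cp).
    by move/addrI/oppr_inj.
  by move/addrI.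
apply/forallP => i; case: b; rewrite !ffunE.
  case: (cycP cp (c - i)) => -> h1 h2; rewrite addrAC h2 /=.
  by rewrite opprD addrA -addrA (addrC (- i)) addrA addrK h1.
by case: (cycP cp (c + i)) => -> -> ; rewrite addrA.
Qed.

(** Edges of a generic cycle meet only at joints, so once the edge in position 0 and its first joint
    are known, each next joint and edge is forced all the way round. The two possible first joints
    give the rotation and the reflection. *)
Lemma gen_dih F p p' : kunif F -> gen F p -> gen F p' -> edges p' = edges p ->
  exists bc : bool * J, p' = dih bc.1 bc.2 p.
Proof.
move=> kF gp gp' E.
have cp : cyc F p by case/andP: gp.
have cp' : cyc F p' by case/andP: gp'.
have idx i : exists j, p'.2 i = p.2 j.
  have : p'.2 i \in edges p by rewrite -E; apply/imsetP; exists i.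
  by case/imsetP => j _ ->; exists j.
have pos i j : p'.2 i = p.2 j ->
   (p'.1 i = p.1 j \/ p'.1 i = p.1 (j + 1)) /\ (p'.1 (i + 1) = p.1 j \/ p'.1 (i + 1) = p.1 (j + 1)).
  move=> eij; split.
  - have [j' ej'] := idx (i - 1).
    have jj' : j != j'.
      apply/eqP => jj'; have := pred_neq i; rewrite -(inj_eq (gen_inj kF cp' gp')) ej' eij jj'.
      by rewrite eqxx.
    apply: (gen_meet kF cp gp jj'); rewrite -?eij -?ej'; first by case: (cycP cp' i).
    exact: (cyc_prev cp').
  - have [j' ej'] := idx (i + 1).
    have jj' : j != j'.
      apply/eqP => jj'; have := succ_neq i; rewrite -(inj_eq (gen_inj kF cp' gp')) ej' eij jj'.
      by rewrite eqxx.
    apply: (gen_meet kF cp gp jj'); rewrite -?eij -?ej'; first by case: (cycP cp' i).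
    by case: (cycP cp' (i + 1)).
have next i j v : p'.2 i = p.2 j -> p'.1 (i + 1) = p.1 v ->
    (p'.2 (i + 1) = p.2 v) \/ (p'.2 (i + 1) = p.2 (v - 1)).
  move=> eij ev; have [j' ej'] := idx (i + 1).
  have : p.1 v \in p.2 j' by rewrite -ej' -ev; case: (cycP cp' (i + 1)).
  by case/(gen_at kF cp gp) => <-; rewrite ej'; [left|right].
have nz i j : p'.2 i = p.2 j -> p'.2 (i + 1) = p.2 j -> False.
  move=> h1 h2; have := succ_neq i; rewrite -(inj_eq (gen_inj kF cp' gp')) h1 h2.
  by rewrite eqxx.
have vnz i w : p'.1 i = w -> p'.1 (i + 1) = w -> False.
  move=> h1 h2; have := succ_neq i; rewrite -(inj_eq (cyc_inj cp')) h1 h2.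
  by rewrite eqxx.
have [c ec] := idx 0.
have [[h0|h0] _] := pos _ _ ec.
- exists (false, c); rewrite /dih /=.
  suff h i : p'.1 i = p.1 (c + i) /\ p'.2 i = p.2 (c + i).
    rewrite [LHS]surjective_pairing; congr pair; apply/ffunP => i; rewrite ffunE; by case: (h i).
  move: i; apply: cyclic_ind; first by rewrite addr0.
  move=> i [hv he].
  have hv1 : p'.1 (i + 1) = p.1 (c + (i + 1)).
    by case: (pos _ _ he) => _ [h|h]; [case: (vnz _ _ hv h)|rewrite h addrA].
  split => //; case: (next _ _ _ he hv1) => // h.
  by case: (nz _ _ he); rewrite h addrA addrK.
- exists (true, c); rewrite /dih /=.
  suff h i : p'.1 i = p.1 (c + 1 - i) /\ p'.2 i = p.2 (c - i).
    rewrite [LHS]surjective_pairing; congr pair; apply/ffunP => i; rewrite ffunE; by case: (h i).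
  move: i; apply: cyclic_ind; first by rewrite !subr0.
  move=> i [hv he].
  have hv1 : p'.1 (i + 1) = p.1 (c - i).
    case: (pos _ _ he) => _ [h|h] //; case: (vnz _ _ hv); by rewrite h addrAC.
  have e1 : c + 1 - (i + 1) = c - i by rewrite opprD addrACA subrr addr0.
  have e2 : c - i - 1 = c - (i + 1) by rewrite opprD addrA.
  rewrite e1; split => //; case: (next _ _ _ he hv1) => h; last by rewrite h e2.
  by case: (nz _ _ he).
Qed.

Lemma dih_inj F p : kunif F -> gen F p -> injective (fun bc : bool * J => dih bc.1 bc.2 p).
Proof.
move=> kF gp; have cp : cyc F p by case/andP: gp.
move=> [b c] [b' c'] /= E.
have cc : c = c'.
  have : (dih b c p).2 0 = (dih b' c' p).2 0 by rewrite E.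
  by rewrite !dih2E !subr0 !addr0 !if_same => /(gen_inj kF cp gp).
have : (dih b c p).1 0 = (dih b' c' p).1 0 by rewrite E.
rewrite cc; case: b {E} => [|]; case: b' => //; rewrite !ffunE ?subr0 ?addr0 => /(cyc_inj cp) /eqP.
  by rewrite (negPf (succ_neq _)).
by rewrite eq_sym (negPf (succ_neq _)).
Qed.

Definition cycles F : {set {set {set V}}} := [set edges p | p in [set p | gen F p]].

Lemma card_gen F : kunif F -> #|[set p | gen F p]| = (2 * l'.+2 * #|cycles F|)%N.
Proof.
move=> kF; rewrite -sum1_card (partition_big_imset edges) /= mulnC -sum_nat_const.
apply: eq_bigr => U /imsetP[p0]; rewrite inE => gp0 ->.
rewrite sum1_card -[RHS](_ : #|[set dih bc.1 bc.2 p0 | bc : bool * J]| = _); last first.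
  by rewrite card_imset ?card_prod ?card_bool ?card_ord //; exact: (dih_inj kF gp0).
apply: eq_card => p; rewrite unfold_in inE; apply/andP/imsetP.
  by case=> /= gp /eqP /(gen_dih kF gp0 gp)[bc ->]; exists bc.
by case=> bc _ ->; rewrite dih_gen // dih_edges eqxx.
Qed.

(** A non-generic cycle covers at most [(k - 1) * l'.+2 - 1] vertices, which makes the number of
    these cycles smaller than the generic order by a factor n. *)
Lemma card_cyc_nongen F : kunif F ->
  (#|[set p | cyc F p & ~~ gen F p]| <=
    #|V|.+1 ^ ((k - 1) * l'.+2 - 1) *
     (((k - 1) * l'.+2 - 1) * 2 ^ ((k - 1) * l'.+2 - 1)) ^ l'.+2)%N.
Proof.
move=> kF; set s := ((k - 1) * l'.+2 - 1)%N.
pose phi (W : {set V}) : {set param} :=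
  [set p | (p.1 \in ffun_on [in W]) && (p.2 \in ffun_on [in powerset W])].
apply: (few_small_covers (phi := phi)) => [W Ws|p].
  rewrite /phi (_ : [set _ | _] = setX [set v : {ffun J -> V} | v \in ffun_on [in W]]
     [set e : {ffun J -> {set V}} | e \in ffun_on [in powerset W]]); last first.
    by apply/setP => p; rewrite !inE.
  rewrite cardsX !cardsE !card_ffun_on card_powerset card_ord expnMn.
  by rewrite leq_mul // leq_exp2r // leq_exp2l.
rewrite inE /gen => /andP[cp]; rewrite cp /= => nt.
have le : (#|\bigcup_i p.2 i| <= s)%N.
  have := cyc_cover_le kF cp; rewrite leq_eqVlt (negPf nt) /= /s; lia.
exists (\bigcup_i p.2 i) => //; rewrite inE; apply/andP; split; apply/ffun_onP => i /=.
  by apply/bigcupP; exists i => //; case: (cycP cp i).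
by rewrite inE; exact: (bigcup_sup i).
Qed.

End Cycles.

(** * Pairs of overlapping cycles *)

Section Overlap.
Variables (V : finType) (k : nat) (F : {set {set V}}).
Hypothesis k3 : (2 < k)%N.
Hypothesis kF : kunif k F.

Local Notation Special G := (special G id).

Lemma gen_core l (p : {ffun 'I_l.+2 -> V} * {ffun 'I_l.+2 -> {set V}}) (G : {set {set V}}) f :
  gen k F p -> edges p \subset G -> f \in edges p -> (1 < #|Special G f|)%N.
Proof.
move=> gp sG /imsetP[i _ ->]; have cp : cyc F p by case/andP: gp.
have inG j : p.2 j \in G by apply: (subsetP sG); apply/imsetP; exists j.
rewrite -(cyc_pair2 cp i); apply: subset_leq_card; apply/subsetP => x; rewrite !inE.
have ne a b : a != b -> p.2 a != p.2 b by rewrite (inj_eq (gen_inj k3 kF cp gp)).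
case/orP => /eqP->.
  apply/andP; split; first by case: (cycP cp i).
  apply: (@ideg_gt1 _ _ _ _ (p.2 i) (p.2 (i - 1))) => //; first by rewrite ne // eq_sym pred_neq.
    by case: (cycP cp i).
  exact: (cyc_prev cp).
apply/andP; split; first by case: (cycP cp i).
apply: (@ideg_gt1 _ _ _ _ (p.2 i) (p.2 (i + 1))) => //; first by rewrite ne // eq_sym succ_neq.
  by case: (cycP cp i).
by case: (cycP cp (i + 1)).
Qed.

Lemma special_mono (G G' : {set {set V}}) f : G \subset G' -> Special G f \subset Special G' f.
Proof.
move=> s; apply/subsetP => v; rewrite !inE => /andP[-> h] /=; apply: leq_trans h _.
apply: subset_leq_card; apply/subsetP => g; rewrite !inE => /andP[gG ->].
by rewrite (subsetP s).
Qed.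

(** Walk along the cycle from an edge already in [U]. Tightness leaves that edge just two special
    vertices in the union, and it has as many in [U] alone, so the next joint also has degree 2 in
    [U]. The other edge of [U] at this joint must be the next edge of the cycle, as degrees in the
    union do not exceed 2. *)
Lemma tight_absorb l (p : {ffun 'I_l.+2 -> V} * {ffun 'I_l.+2 -> {set V}}) (U : {set {set V}}) :
  gen k F p -> U \subset F -> (forall f, f \in U -> (1 < #|Special U f|)%N) ->
  #|cover (edges p :|: U)| = ((k - 1) * #|edges p :|: U|)%N ->
  edges p :&: U != set0 -> edges p \subset U.
Proof.
move=> gp UF coreU tG; have cp : cyc F p by case/andP: gp.
set G := edges p :|: U in tG *.
have GF f : f \in G -> #|f| = k.
  move=> fG; apply/eqP; apply: (forall_inP kF); move: fG; rewrite inE => /orP[]; last exact: (subsetP UF).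
  exact: (subsetP (edges_sub cp)).
have coreG f : f \in G -> (1 < #|Special G f|)%N.
  rewrite inE => /orP[fp|fU].
    by apply: (gen_core gp) => //; exact: subsetUl.
  by apply: leq_trans (coreU f fU) _; apply: subset_leq_card; apply: special_mono; exact: subsetUr.
have pG j : p.2 j \in G by rewrite inE; apply/orP; left; apply/imsetP; exists j.
have step i : p.2 i \in U -> p.2 (i + 1) \in U.
  move=> iU.
  have sE : Special U (p.2 i) = Special G (p.2 i).
    apply/eqP; rewrite eqEcard special_mono ?subsetUr //=.
    by rewrite (tight_special (k := k) (e := id) GF coreG tG (pG i)) coreU.
  have ne : p.2 (i + 1) != p.2 i by rewrite (inj_eq (gen_inj k3 kF cp gp)) succ_neq.
  have vi : p.1 (i + 1) \in p.2 i by case: (cycP cp i).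
  have vi1 : p.1 (i + 1) \in p.2 (i + 1) by case: (cycP cp (i + 1)).
  have : p.1 (i + 1) \in Special U (p.2 i).
    by rewrite sE inE vi /=; apply: (@ideg_gt1 _ _ _ _ (p.2 i) (p.2 (i + 1))); rewrite // eq_sym.
  rewrite inE vi /= => d2.
  have [f /andP[fU fi] fv] : exists2 f, (f \in U) && (f != p.2 i) & p.1 (i + 1) \in f.
    move: d2; rewrite /ideg (cardsD1 (p.2 i)) inE iU vi /= add1n ltnS => /card_gt0P[f].
    by rewrite !inE => /andP[fi /andP[fU fv]]; exists f => //; rewrite fU.
  case: (f =P p.2 (i + 1)) => [<-//|/eqP fi1].
  have : (#|[set p.2 i; p.2 (i + 1)%R; f]| <= 2)%N.
    apply: leq_trans (tight_ideg (k := k) (e := id) GF coreG tG (pG i) vi).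
    apply: subset_leq_card; apply/subsetP => x; rewrite inE.
    have fG : f \in G by rewrite inE fU orbT.
    by case/setUP => [/set2P[]|/set1P] ->; rewrite ?pG ?fG ?vi ?vi1 ?fv.
  by rewrite cards_triple // eq_sym.
case/set0Pn => f; rewrite inE => /andP[/imsetP[i0 _ ->] i0U].
have all i : p.2 (i0 + i) \in U.
  move: i; apply: cyclic_ind; first by rewrite addr0.
  by move=> i h; rewrite addrA; exact: step.
apply/subsetP => _ /imsetP[i _ ->]; by have := all (i - i0); rewrite addrC subrK.
Qed.

(** If the bound on the cover were attained, [tight_absorb] would apply in both directions and the
    two cycles would be equal. The vertex saved makes overlapping pairs rarer by a factor n. *)
Lemma overlap_cover l1 l2 C U : C \in cycles k l1 F -> U \in cycles k l2 F ->
  C != U -> ~~ [disjoint C & U] ->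
  (#|cover (C :|: U)| <= (k - 1) * #|C :|: U| - 1)%N.
Proof.
case/imsetP => p; rewrite inE => gp ->; case/imsetP => q; rewrite inE => gq ->.
have cp : cyc F p by case/andP: gp.
have cq : cyc F q by case/andP: gq.
rewrite -setI_eq0; move: (edges_sub cp) (edges_sub cq).
have := gen_core gp; have := gen_core gq.
move=> coq cop CF UF ne ov.
have cC f : f \in edges p -> (1 < #|Special (edges p) f|)%N by exact: cop.
have cU f : f \in edges q -> (1 < #|Special (edges q) f|)%N by exact: coq.
have le : (#|cover (edges p :|: edges q)| <= (k - 1) * #|edges p :|: edges q|)%N.
  apply: (core_cover_le (e := id)) => f; rewrite inE => /orP[] h.
  - by apply/eqP; apply: (forall_inP kF); exact: (subsetP CF).
  - by apply/eqP; apply: (forall_inP kF); exact: (subsetP UF).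
  - by apply: leq_trans (cC f h) _; apply: subset_leq_card; apply: special_mono; exact: subsetUl.
  - by apply: leq_trans (cU f h) _; apply: subset_leq_card; apply: special_mono; exact: subsetUr.
suff h : #|cover (edges p :|: edges q)| != ((k - 1) * #|edges p :|: edges q|)%N.
  by move: le h; move: #|cover _| (_ * _)%N => x y; clear; lia.
apply/eqP => t; case/eqP: ne; apply/eqP; rewrite eqEsubset; apply/andP; split.
  exact: (tight_absorb gp UF cU t ov).
by apply: (tight_absorb gq CF cC); rewrite 1?setUC // setIC.
Qed.

Lemma card_overlap_pairs l1 l2 t :
  (#|[set CU in setX (cycles k l1 F) (cycles k l2 F) |
      [&& CU.1 != CU.2, ~~ [disjoint CU.1 & CU.2] & #|CU.1 :|: CU.2| == t]]| <=
   #|V|.+1 ^ ((k - 1) * t - 1) * (2 ^ (2 ^ ((k - 1) * t - 1))) ^ 2)%N.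
Proof.
set s := ((k - 1) * t - 1)%N.
pose phi (W : {set V}) := setX (powerset (powerset W)) (powerset (powerset W)).
apply: (few_small_covers (phi := phi)) => [W Ws|[C U]].
  by rewrite cardsX !card_powerset -mulnn leq_mul // leq_exp2l // leq_exp2l.
rewrite !inE /= => /andP[/andP[Cl Ul] /and3P[ne ov /eqP ct]].
exists (cover (C :|: U)); first by rewrite /s -ct; exact: overlap_cover Cl Ul ne ov.
by rewrite !inE; apply/andP; split; apply/subsetP => f fC; rewrite inE;
  apply: bigcup_sup; rewrite inE fC ?orbT.
Qed.

End Overlap.

(** * Colour patterns around a cycle *)

Section CyclicSum.
Variables (R : comRingType) (l' : nat).
Local Notation J := 'I_l'.+2.

Definition chi (b : bool) : R := (-1) ^+ b.

Lemma cyclic_const (S : {set J}) : (forall i, (i \in S) = (i - 1 \in S)) -> S = set0 \/ S = setT.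
Proof.
move=> h; case: (boolP (0 \in S)) => h0; [right|left]; apply/setP => i; rewrite inE; move: i;
 apply: cyclic_ind => //.
- by move=> i; rewrite (h (i + 1)) addrK.
- by apply/negbTE.
- by move=> i; rewrite (h (i + 1)) addrK.
Qed.

(** This is the trace of a power of the transfer matrix with entries A + B on the diagonal and A - B
    off it, whose eigenvalues are 2 A and 2 B. The proof expands the product instead: sums over
    colours kill every mixed choice of factors. *)
Lemma cyclic_sum (A B : R) :
  \sum_(c : {ffun J -> bool}) \prod_i (A + B * (chi (c i) * chi (c (i + 1)))) =
  2 ^+ l'.+2 * (A ^+ l'.+2 + B ^+ l'.+2).
Proof.
under eq_bigr do rewrite bigA_distr.
rewrite exchange_big /=.
(* [S] is the set of positions where the factor A is chosen. Regrouped by joints, the signs at joint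
   i come from positions i and i - 1; their sum over the colour of the joint is 2 if both or neither
   lie in [S] and 0 otherwise. Only [set0] and [setT] are invariant under the shift. *)
pose w (S : {set J}) : R := (\prod_i (if i \in S then A else B)) *
   \prod_i (if (i \in S) == (i - 1 \in S) then 2 else 0).
rewrite (eq_bigr w) => [|S _]; last first.
  have e1 (c : {ffun J -> bool}) :
     \prod_i (if i \in S then A else B * (chi (c i) * chi (c (i + 1)))) =
     (\prod_i (if i \in S then A else B)) *
     \prod_i ((if i \in S then 1 else chi (c i)) * (if i - 1 \in S then 1 else chi (c i))).
    rewrite big_split /= [X in _ * (_ * X)](reindex (fun i : J => i + 1)); last first.
      by exists (fun i => i - 1) => i _; rewrite ?addrK ?subrK.
    rewrite -!big_split /=; apply: eq_bigr => i _; rewrite addrK.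
    by case: ifP => _; rewrite ?mulr1.
  under eq_bigr do rewrite e1.
  rewrite -mulr_sumr /w; congr (_ * _).
  rewrite -(bigA_distr_bigA (fun i b => (if i \in S then 1 else chi b) * (if i - 1 \in S then 1 else chi b))).
  apply: eq_bigr => i _; rewrite big_bool /chi.
  by case: (i \in S); case: (i - 1 \in S) => /=; ring.
rewrite (bigD1 set0) //= (bigD1 setT) /=; last first.
  by apply/negP => /eqP/setP/(_ 0); rewrite !inE.
rewrite big1 ?addr0 => [|S /andP[S0 ST]]; last first.
  have [i hi] : exists i, (i \in S) != (i - 1 \in S).
    apply/existsP; apply: contraT; rewrite negb_exists => /forallP h.
    have h' i : (i \in S) = (i - 1 \in S) by have := h i; rewrite negbK => /eqP.
    by case: (cyclic_const h') => E; rewrite E eqxx in S0 ST.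
  by rewrite /w [X in _ * X](bigD1 i) //= (negPf hi) mul0r mulr0.
rewrite /w.
have p2 : \prod_(i : J) (2 : R) = 2 ^+ l'.+2 by rewrite prodr_const card_ord.
rewrite [X in X * _ + _](eq_bigr (fun=> B)); last by move=> i _; rewrite inE.
rewrite [X in _ * X + _](eq_bigr (fun=> 2)); last by move=> i _; rewrite !inE eqxx.
rewrite [X in _ + X * _](eq_bigr (fun=> A)); last by move=> i _; rewrite inE.
rewrite [X in _ + _ * X](eq_bigr (fun=> 2)); last by move=> i _; rewrite !inE eqxx.
by rewrite p2 !prodr_const card_ord; ring.
Qed.

End CyclicSum.

Section CountCycles.
Variables (n k l' : nat) (F : {set {set 'I_n}}) (sigma : {ffun 'I_n -> bool}).
Variable g : bool -> bool -> nat.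
Hypothesis F_pair : forall x y, x != y ->
  #|[set f in F | (x \in f) && (y \in f)]| = g (sigma x) (sigma y).
Local Notation J := 'I_l'.+2.

Definition nclass (b : bool) := #|[set x | sigma x == b]|.

Definition ncol (c : {ffun J -> bool}) :=
  #|[set v : {ffun J -> 'I_n} | injectiveb v & [forall i, sigma (v i) == c i]]|.

Lemma card_cyc : #|[set p | @cyc _ l' F p]| =
  (\sum_(c : {ffun J -> bool}) ncol c * \prod_i g (c i) (c (i + 1)%R))%N.
Proof.
pose E (v : {ffun J -> 'I_n}) (i : J) := [set f in F | (v i \in f) && (v (i + 1) \in f)].
transitivity (\sum_(v : {ffun J -> 'I_n} | injectiveb v) \prod_i #|E v i|)%N.
  rewrite -sum1_card (eq_bigl (fun p : {ffun J -> 'I_n} * {ffun J -> {set 'I_n}} =>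
     injectiveb p.1 && (p.2 \in family (E p.1)))); last first.
    move=> p; rewrite inE /cyc; congr andb; apply/forallP/familyP => h i.
      by rewrite inE; apply: h.
    by have := h i; rewrite inE.
  rewrite -(pair_big_dep (fun v : {ffun J -> 'I_n} => injectiveb v) (fun v e => e \in family (E v)) (fun _ _ => 1%N)) /=.
  by apply: eq_bigr => v _; rewrite sum1_card card_family foldrE big_map big_enum.
rewrite (partition_big (fun v : {ffun J -> 'I_n} => [ffun i => sigma (v i)] : {ffun J -> bool}) predT) //=.
apply: eq_bigr => c _; rewrite /ncol -sum_nat_const; apply: eq_big => [v|v].
  rewrite inE; congr andb; apply/eqP/forallP => [<- i|h]; first by rewrite ffunE.
  by apply/ffunP => i; rewrite ffunE; apply/eqP.
move=> /andP[/injectiveP vi /eqP <-]; apply: eq_bigr => i _; rewrite !ffunE F_pair //.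
by rewrite (inj_eq vi) eq_sym succ_neq.
Qed.

Lemma ncol_le (c : {ffun J -> bool}) : (ncol c <= \prod_i nclass (c i))%N.
Proof.
rewrite /nclass -[leqRHS](_ : #|family (fun i => [set x | sigma x == c i])| = _); last first.
  by rewrite card_family foldrE big_map big_enum.
apply: subset_leq_card; apply/subsetP => v; rewrite inE => /andP[_ /forallP h].
by apply/familyP => i; rewrite inE.
Qed.

Lemma ncol_ge (c : {ffun J -> bool}) : (\prod_i nclass (c i) <= ncol c + (n ^ l'.+2 - n ^_ l'.+2))%N.
Proof.
rewrite /nclass -[leqLHS](_ : #|family (fun i => [set x | sigma x == c i])| = _); last first.
  by rewrite card_family foldrE big_map big_enum.
have -> : (n ^ l'.+2 - n ^_ l'.+2 = #|[set v : {ffun J -> 'I_n} | ~~ injectiveb v]|)%N.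
  have e : #|[set v : {ffun J -> 'I_n} | injectiveb v]| = n ^_ l'.+2.
    by rewrite -[n in RHS]card_ord -[l'.+2 in RHS]card_ord -card_inj_ffuns; apply: eq_card => v; rewrite !inE.
  have := cardsC [set v : {ffun J -> 'I_n} | injectiveb v].
  rewrite card_ffun !card_ord e => <-; rewrite addKn.
  by apply: eq_card => v; rewrite !inE.
apply: leq_trans (leq_card_setU _ _); apply: subset_leq_card; apply/subsetP => v /familyP h.
rewrite !inE; case: injectiveb => //=; rewrite orbF; apply/forallP => i.
by have := h i; rewrite inE.
Qed.

End CountCycles.

(** * Colour classes and overlaps *)

Section ColourFamilies.
Variables (n k : nat).

Definition ksets : {set {set 'I_n}} := [set f : {set 'I_n} | #|f| == k].

Definition bichromatic (s : {ffun 'I_n -> bool}) : {set {set 'I_n}} :=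
  [set f in ksets | #|s @: f| != 1%N].

Definition colour_class (s : {ffun 'I_n -> bool}) b : {set 'I_n} := [set x | s x == b].

Hypothesis k3 : (2 < k)%N.

Lemma card_ksets : #|ksets| = 'C(n, k).
Proof.
rewrite -[in RHS](card_ord n) -cardsT -cards_draws; apply: eq_card => f.
by rewrite !inE subsetT.
Qed.

Lemma card_ksets_sup (B S : {set 'I_n}) : S \subset B -> (#|S| <= k)%N ->
  #|[set f in ksets | (f \subset B) && (S \subset f)]| = 'C(#|B| - #|S|, k - #|S|).
Proof.
move=> SB Sk; rewrite -card_msub_sup //; apply: eq_card => f; rewrite !inE.
by rewrite andbA [(#|f| == k) && _]andbC.
Qed.

Lemma mono_class (s : {ffun 'I_n -> bool}) (f : {set 'I_n}) : f != set0 ->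
  (#|s @: f| == 1%N) = (f \subset colour_class s true) || (f \subset colour_class s false).
Proof.
move=> f0; apply/cards1P/orP => [[b E]|h].
  have sub : f \subset colour_class s b.
    apply/subsetP => x xf; rewrite inE; apply/eqP; apply/set1P; rewrite -E; exact: imset_f.
  by case: b sub {E}; [left|right].
have [b hb] : exists b, f \subset colour_class s b by case: h => h; eexists; exact: h.
case/set0Pn: f0 => x xf; exists b; apply/setP => y; rewrite inE; apply/imsetP/eqP.
  by case=> z zf ->; have := subsetP hb z zf; rewrite inE => /eqP.
by move=> ->; exists x => //; have := subsetP hb x xf; rewrite inE => /eqP.
Qed.

Lemma kset_neq0 (f : {set 'I_n}) : f \in ksets -> f != set0.
Proof. rewrite inE -card_gt0 => /eqP->; lia. Qed.

Lemma class_disj s (f : {set 'I_n}) : f != set0 ->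
  f \subset colour_class s true -> f \subset colour_class s false -> False.
Proof.
case/set0Pn => x xf /subsetP/(_ x xf); rewrite inE => /eqP h /subsetP/(_ x xf).
by rewrite inE h.
Qed.

Lemma card_bichromatic s :
  (#|bichromatic s| + ('C(#|colour_class s true|, k) + 'C(#|colour_class s false|, k)) = 'C(n, k))%N.
Proof.
rewrite -card_ksets -(cardsID (bichromatic s) ksets) /bichromatic setIdE setIA setIid.
congr (_ + _)%N; rewrite -!(card_msub) -cardsUI.
rewrite [X in (_ + X)%N](_ : _ = 0%N) ?addn0; last first.
  apply/eqP; rewrite cards_eq0; apply/eqP/setP => f; rewrite !inE; apply/negP.
  move=> /andP[/andP[h1 fk] /andP[h2 _]]; apply: (class_disj _ h1 h2).
  by apply: kset_neq0; rewrite inE.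
apply: eq_card => f; rewrite !inE; case: (boolP (#|f| == k)) => fk; rewrite ?andbF //= !andbT.
by rewrite negbK mono_class // kset_neq0 // inE.
Qed.

Lemma bichromatic_pair s x y : x != y ->
  #|[set f in bichromatic s | (x \in f) && (y \in f)]| =
  ('C(n - 2, k - 2) - (if s x == s y then 'C(#|colour_class s (s x)| - 2, k - 2) else 0))%N.
Proof.
move=> xy; set S := [set x; y].
have S2 : #|S| = 2%N by rewrite cards2 xy.
have Sk : (#|S| <= k)%N by rewrite S2; lia.
have SE (f : {set 'I_n}) : (x \in f) && (y \in f) = (S \subset f).
  by rewrite subUset !sub1set.
have -> : 'C(n - 2, k - 2) = #|[set f in ksets | S \subset f]|.
  rewrite -{1}(card_ord n) -cardsT -S2 -card_ksets_sup ?subsetT //.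
  by apply: eq_card => f; rewrite !inE subsetT.
rewrite -(cardsID (bichromatic s) [set f in ksets | S \subset f]).
have -> : [set f in ksets | S \subset f] :&: bichromatic s =
   [set f in bichromatic s | (x \in f) && (y \in f)].
  by apply/setP => f; rewrite !inE SE; case: (#|f| == k); case: (S \subset f); rewrite ?andbF ?andbT.
suff -> : (if s x == s y then 'C(#|colour_class s (s x)| - 2, k - 2) else 0)%N =
   #|[set f in ksets | S \subset f] :\: bichromatic s| by rewrite addnK.
have mono (f : {set 'I_n}) : f \in ksets -> S \subset f -> (f \notin bichromatic s) =
   (s x == s y) && (f \subset colour_class s (s x)).
  move=> fk Sf; rewrite inE fk /= negbK mono_class ?kset_neq0 //.
  have xf : x \in f by rewrite (subsetP Sf) // !inE eqxx.
  have yf : y \in f by rewrite (subsetP Sf) // !inE eqxx orbT.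
  have key b : f \subset colour_class s b -> s x = b /\ s y = b.
    by move=> /subsetP h; have := h x xf; have := h y yf; rewrite !inE => /eqP-> /eqP->.
  apply/orP/andP => [[] h|[/eqP e h]].
  - by have [-> ->] := key _ h.
  - by have [-> ->] := key _ h.
  - by case: (s x) h; [left|right].
case: eqP => e; last first.
  apply/esym/eqP; rewrite cards_eq0; apply/eqP/setP => f; rewrite in_set0.
  apply/negP; rewrite inE => /andP[h]; rewrite inE => /andP[fk Sf]; move: h.
  by rewrite (mono f fk Sf); case: eqP.
rewrite -S2 -card_ksets_sup //; last first.
  by rewrite subUset !sub1set !inE eqxx -e eqxx.
apply: eq_card => f; rewrite [in RHS]inE [X in _ && X]inE [in LHS]inE.
case: (boolP (f \in ksets)) => fk; rewrite ?andbF //=.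
case: (boolP (S \subset f)) => Sf; rewrite ?andbF ?andbT //=.
by rewrite mono // e eqxx.
Qed.

Lemma ksets_pair x y : x != y -> #|[set f in ksets | (x \in f) && (y \in f)]| = 'C(n - 2, k - 2).
Proof.
move=> xy; have S2 : #|[set x; y]| = 2%N by rewrite cards2 xy.
rewrite -[in RHS](card_ord n) -cardsT -S2 -card_ksets_sup ?subsetT ?S2 //; last by lia.
by apply: eq_card => f; rewrite !inE subsetT subUset !sub1set.
Qed.

Lemma kunif_ksets : kunif k ksets.
Proof. by apply/forall_inP => f; rewrite inE. Qed.

Lemma kunif_bichromatic s : kunif k (bichromatic s).
Proof. by apply/forall_inP => f; rewrite !inE => /andP[]. Qed.

Lemma card_colour_classes s : (#|colour_class s true| + #|colour_class s false| = n)%N.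
Proof.
rewrite -[RHS](card_ord n) -(cardsC (colour_class s true)); congr (_ + _)%N.
by apply: eq_card => x; rewrite !inE; case: (s x).
Qed.

End ColourFamilies.

(** * Two colourings at once *)

Section OverlapCounts.
Variables (n k : nat).
Hypothesis k3 : (2 < k)%N.
Implicit Types (s t : {ffun 'I_n -> bool}) (S T : {set 'I_n}).

Lemma hypergraphsE m : hypergraphs k n m = msub (ksets n k) m.
Proof.
apply/setP => H; rewrite !inE andbC; congr (_ && _).
apply/forall_inP/subsetP => h f fH; first by rewrite inE h.
by have := h f fH; rewrite inE.
Qed.

Lemma colouring_sub m (H : {set {set 'I_n}}) s : H \in msub (ksets n k) m ->
  colouring H s = (H \subset bichromatic k s).
Proof.
rewrite inE => /andP[/subsetP HF _]; apply/forall_inP/subsetP => h f fH.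
  by rewrite inE HF ?h.
by have := h f fH; rewrite inE => /andP[].
Qed.

Lemma card_colourings m s :
  #|[set H in msub (ksets n k) m | H \subset bichromatic k s]| = 'C(#|bichromatic k s|, m).
Proof.
rewrite -card_msub; apply: eq_card => H; rewrite !inE -andbA andbC -andbA.
case: (boolP (H \subset bichromatic k s)) => //=; last by rewrite andbF.
move=> h; rewrite (subset_trans h) ?andbT //.
by apply/subsetP => f; rewrite inE => /andP[].
Qed.

Lemma card_colourings2 m s t :
  #|[set H in msub (ksets n k) m | (H \subset bichromatic k s) && (H \subset bichromatic k t)]| =
  'C(#|bichromatic k s :&: bichromatic k t|, m).
Proof.
rewrite -card_msub; apply: eq_card => H; rewrite !inE subsetI.
case: (boolP (H \subset bichromatic k s)) => hs; rewrite /= ?andbF //.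
have -> : H \subset ksets n k.
  by apply: (subset_trans hs); apply/subsetP => f; rewrite inE => /andP[].
by rewrite andTb andbC.
Qed.

Lemma sum_ksets_sub S : (\sum_(f in ksets n k) (f \subset S) = 'C(#|S|, k))%N.
Proof.
rewrite -card_msub -[RHS]sum1_card [RHS]big_mkcond [LHS]big_mkcond; apply: eq_bigr => f _.
by rewrite !inE; case: (#|f| == k); rewrite ?andbF // andbT; case: (f \subset S).
Qed.

Lemma mono_sum s f : f \in ksets n k ->
  (#|s @: f| == 1%N) = ((f \subset colour_class s true) + (f \subset colour_class s false))%N :> nat.
Proof.
move=> fk; have f0 := kset_neq0 k3 fk; rewrite mono_class //.
have := @class_disj n s f f0.
by case: (f \subset _); case: (f \subset _) => // /(_ isT isT).
Qed.

(** Inclusion-exclusion on monochromatic edges: an edge monochromatic under both colourings lies in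
    one of the four cells of the common refinement of the two partitions. *)
Lemma card_bichromatic2 s t :
  let S := colour_class s true in let T := colour_class t true in
  (#|bichromatic k s :&: bichromatic k t| +
    ('C(#|S|, k) + 'C(#|colour_class s false|, k) + ('C(#|T|, k) + 'C(#|colour_class t false|, k))) =
   'C(n, k) + ('C(#|S :&: T|, k) + 'C(#|S :\: T|, k) + ('C(#|T :\: S|, k) + 'C(#|~: (S :|: T)|, k))))%N.
Proof.
move=> S T; set S' := colour_class s false; set T' := colour_class t false.
have SE : S' = ~: S by apply/setP => x; rewrite !inE; case: (s x).
have TE : T' = ~: T by apply/setP => x; rewrite !inE; case: (t x).
rewrite setCU -SE -TE (setDE S) (setDE T) -SE -TE (setIC T).
rewrite -!sum_ksets_sub -card_ksets -!sum1_card.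
have -> : (\sum_(f in bichromatic k s :&: bichromatic k t) 1 =
  \sum_(f in ksets n k) ((#|s @: f| != 1%N) && (#|t @: f| != 1%N)))%N.
  rewrite big_mkcond [RHS]big_mkcond; apply: eq_bigr => f _; rewrite !inE.
  by case: (#|f| == k) => //=; case: (_ && _).
rewrite -!big_split /=; apply: eq_bigr => f fk.
have hs := mono_sum s fk; have ht := mono_sum t fk; rewrite -/S -/S' -/T -/T' in hs ht.
rewrite !subsetI; move: hs ht.
case: (f \subset S); case: (f \subset S'); case: (f \subset T); case: (f \subset T');
 by case: (#|_| == _); case: (#|_| == _).
Qed.

(** [T] is determined by what it loses, S minus T, and what it gains, T minus S. Equality of sizes
    forces both to have [i] elements, and they can be chosen independently. *)
Lemma card_overlap S i :
  #|[set T : {set 'I_n} | (#|T| == #|S|) && (#|S :\: T| == i)]| = ('C(#|S|, i) * 'C(n - #|S|, i))%N.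
Proof.
have -> : (n - #|S|)%N = #|~: S| by rewrite -{1}(card_ord n) -(cardsC S) addKn.
rewrite -!card_msub -cardsX.
have inj : {in setX (msub S i) (msub (~: S) i) &, injective (fun U => (S :\: U.1) :|: U.2)}.
  move=> [A B] [A' B']; rewrite !inE /= => /andP[/andP[AS _] /andP[BS _]] /andP[/andP[AS' _] /andP[BS' _]] E.
  have key (U V : {set 'I_n}) : U \subset S -> V \subset ~: S ->
     U = S :\: ((S :\: U) :|: V) /\ V = ((S :\: U) :|: V) :\: S.
    move=> /subsetP US /subsetP VS; split; apply/setP => x; have := US x; have := VS x; rewrite !inE.
      by case: (x \in U); case: (x \in V); case: (x \in S) => // h1 h2; first [by move: (h1 isT) | by move: (h2 isT)].
    by case: (x \in U); case: (x \in V); case: (x \in S) => // h1 h2; first [by move: (h1 isT) | by move: (h2 isT)].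
  have [e1 e2] := key _ _ AS BS; have [e3 e4] := key _ _ AS' BS'.
    by congr pair; [rewrite e1 e3 E|rewrite e2 e4 E].
rewrite -(card_in_imset inj); apply: eq_card => T; rewrite !inE; apply/andP/imsetP.
  move=> [/eqP TS /eqP ST]; exists (S :\: T, T :\: S).
    rewrite !inE /= subsetDl ST eqxx /=; apply/andP; split.
      by apply/subsetP => x; rewrite !inE => /andP[].
    by rewrite -(eqn_add2l #|S :&: T|) -{1}ST cardsID setIC cardsID TS.
  by apply/setP => x; rewrite !inE; case: (x \in S); case: (x \in T).
move=> [[A B]]; rewrite !inE /= => /andP[/andP[AS /eqP Ai] /andP[BS /eqP Bi]] ->.
have d : [disjoint S :\: A & B].
  rewrite -setI_eq0 -subset0; apply/subsetP => x; rewrite !inE => /andP[/andP[_ xS] xB].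
  by have := subsetP BS x xB; rewrite inE xS.
split.
  move: d; rewrite -leq_card_setU => /eqP->; rewrite cardsDS // Ai Bi subnK //.
  by rewrite -Ai subset_leq_card.
rewrite -Ai; apply/eqP; congr (#|pred_of_set _|); apply/setP => x.
have := subsetP AS x; have := subsetP BS x; rewrite !inE.
by case: (x \in A); case: (x \in B); case: (x \in S) => // h1 h2; first [by move: (h1 isT) | by move: (h2 isT)].
Qed.

Lemma card_bichromatic_overlap s t :
  let a := #|colour_class s true| in let b := #|colour_class s false| in
  let j := #|colour_class s true :\: colour_class t true| in
  #|colour_class t true| = a ->
  (#|bichromatic k s :&: bichromatic k t| + 2 * ('C(a, k) + 'C(b, k)) =
   'C(n, k) + ('C(a - j, k) + 2 * 'C(j, k) + 'C(b - j, k)))%N.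
Proof.
move=> a b j ta; have := card_bichromatic2 s t; rewrite /=.
have abn := card_colour_classes s; rewrite -/a -/b in abn.
have tb : #|colour_class t false| = b by have := card_colour_classes t; rewrite ta; lia.
set S := colour_class s true; set T := colour_class t true.
have sa : #|S| = a by []. have sb : #|colour_class s false| = b by [].
have {}ta : #|T| = a by [].
rewrite sa sb ta tb; clearbody a b.
have i1 : (#|S :&: T| + j)%N = a by rewrite cardsID.
have i2 : #|T :\: S| = j by apply/eqP; rewrite -(eqn_add2l #|T :&: S|) cardsID setIC i1 ta.
have i3 : (#|~: (S :|: T)| + j)%N = b.
  have := cardsUI S T; have := cardsC (S :|: T); rewrite card_ord sa ta => h1 h2.
  by move: i1 h1 h2 abn; lia.
by rewrite i2 -/j -[#|S :&: T|](addnK j) i1 -[#|~: (S :|: T)|](addnK j) i3; lia.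
Qed.

Lemma overlap_exists s i : (i <= #|colour_class s true|)%N -> (i <= #|colour_class s false|)%N ->
  exists2 t, #|colour_class t true| = #|colour_class s true| &
    #|colour_class s true :\: colour_class t true| = i.
Proof.
set S := colour_class s true => ia ib.
have : (0 < 'C(#|S|, i) * 'C(n - #|S|, i))%N.
  have h : (#|S| + #|colour_class s false|)%N = n by exact: card_colour_classes.
  have iN : (i <= n - #|S|)%N by apply: (leq_trans ib); move: h; clear; lia.
  by rewrite muln_gt0 !bin_gt0 ia iN.
rewrite -card_overlap card_gt0 => /set0Pn[T]; rewrite inE => /andP[/eqP TS /eqP Ti].
exists [ffun x => x \in T].
  by rewrite -TS; apply: eq_card => x; rewrite inE ffunE; case: (x \in T).
rewrite -Ti; apply: eq_card => x; rewrite !inE ffunE.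
by case: (x \in T).
Qed.

Definition class_col (a : nat) : {set {ffun 'I_n -> bool}} :=
  [set s | #|colour_class s true| == a].

Lemma col_bij : bijective (fun s => colour_class s true).
Proof.
exists (fun S => [ffun x => x \in S]).
  by move=> s; apply/ffunP => x; rewrite ffunE inE; case: (s x).
by move=> S; apply/setP => x; rewrite inE ffunE; case: (x \in S).
Qed.

Lemma card_class_col a : #|class_col a| = 'C(n, a).
Proof.
rewrite -[in RHS](card_ord n) -cardsT -card_msub -(on_card_preimset (onW_bij _ col_bij)).
by apply: eq_card => s; rewrite !inE subsetT.
Qed.

Lemma sum_class_col (R : realType) (f : nat -> R) s :
  \sum_(t in class_col #|colour_class s true|) f #|colour_class s true :\: colour_class t true| =
  \sum_(i < n.+1) ('C(#|colour_class s true|, i) * 'C(n - #|colour_class s true|, i))%:R * f i.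
Proof.
set S := colour_class s true.
have [g gK Kg] := col_bij.
rewrite (reindex g) /=; last by apply: onW_bij; exists (fun s => colour_class s true).
transitivity (\sum_(T : {set 'I_n} | #|T| == #|S|) f #|S :\: T|).
  by apply: eq_big => [T|T _]; rewrite ?inE Kg.
rewrite (partition_big (fun T => (inord #|S :\: T| : 'I_n.+1)) predT) //=.
apply: eq_bigr => i _; rewrite -card_overlap -sum1_card natr_sum mulr_suml.
have h T : (#|S :\: T| < n.+1)%N by rewrite ltnS -[leqRHS](card_ord n) max_card.
apply: eq_big => [T|T].
  by rewrite inE; congr (_ && _); rewrite -val_eqE /= inordK.
by case/andP => _ /eqP <-; rewrite mul1r inordK.
Qed.

End OverlapCounts.

(** * Imbalance of the colour classes *)

Section Imbalance.
Variables (R : realType) (n : nat).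
Implicit Types (s t : {ffun 'I_n -> bool}) (M : R).

Definition imbalance s : R := #|colour_class s true|%:R - #|colour_class s false|%:R.

Definition balanced M : {set {ffun 'I_n -> bool}} := [set s | imbalance s ^+ 2 <= M * n%:R].

Lemma sum_pascal j (g : nat -> R) :
  \sum_(i < j.+2) 'C(j.+1, i)%:R * g i = \sum_(i < j.+1) 'C(j, i)%:R * (g i + g i.+1).
Proof.
rewrite big_ord_recl bin0 mul1r /=.
under [RHS]eq_bigr do rewrite mulrDr; rewrite big_split /=.
rewrite (eq_bigr (fun i : 'I_j.+1 => 'C(j, i.+1)%:R * g i.+1 + 'C(j, i)%:R * g i.+1)); last first.
  by move=> i _; rewrite /bump /= add1n binS natrD mulrDl.
rewrite big_split /= addrA; congr (_ + _).
rewrite [RHS]big_ord_recl bin0 mul1r; congr (_ + _).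
rewrite big_ord_recr /= bin_small // mul0r addr0.
by apply: eq_bigr => i _; rewrite /bump /= add1n.
Qed.

(** The free shift [c] closes the induction: Pascal's rule turns [c] into [c - 1] and [c + 1], whose
    squares average to c ^ 2 + 1. *)
Lemma sum_bin_sqr j (c : R) :
  \sum_(i < j.+1) 'C(j, i)%:R * (2 * i%:R - j%:R + c) ^+ 2 = (j%:R + c ^+ 2) * 2 ^+ j.
Proof.
elim: j c => [|j IH] c; first by rewrite big_ord1 /= bin0 mulr0n expr0; ring.
rewrite (sum_pascal j (fun i => (2 * i%:R - j.+1%:R + c) ^+ 2)).
rewrite (eq_bigr (fun i : 'I_j.+1 => 'C(j, i)%:R * (2 * i%:R - j%:R + (c - 1)) ^+ 2 +
   'C(j, i)%:R * (2 * i%:R - j%:R + (c + 1)) ^+ 2)); last first.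
  by move=> i _; rewrite -[j.+1%:R]natr1 -[i.+1%:R]natr1; ring.
by rewrite big_split /= !IH -[j.+1%:R]natr1 [2 ^+ j.+1]exprS; ring.
Qed.

Lemma imbalanceE s : imbalance s = 2 * #|colour_class s true|%:R - n%:R.
Proof.
have : n%:R = #|colour_class s true|%:R + #|colour_class s false|%:R :> R.
  by rewrite -natrD card_colour_classes.
by rewrite /imbalance => ->; ring.
Qed.

Lemma sum_by_class (f : nat -> R) :
  \sum_(s : {ffun 'I_n -> bool}) f #|colour_class s true| = \sum_(a < n.+1) 'C(n, a)%:R * f a.
Proof.
have h s : (#|colour_class s true| < n.+1)%N by rewrite ltnS -[leqRHS](card_ord n) max_card.
rewrite (partition_big (fun s => (inord #|colour_class s true| : 'I_n.+1)) predT) //=.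
apply: eq_bigr => a _; rewrite -card_class_col -sum1_card natr_sum mulr_suml.
apply: eq_big => [s|s]; first by rewrite inE -val_eqE /= inordK.
by move=> /eqP <-; rewrite mul1r inordK.
Qed.

Lemma sum_imbalance_sqr : \sum_s imbalance s ^+ 2 = n%:R * 2 ^+ n.
Proof.
under eq_bigr do rewrite imbalanceE.
rewrite (sum_by_class (fun a => (2 * a%:R - n%:R) ^+ 2)).
have := sum_bin_sqr n 0; rewrite expr0n addr0 => <-.
by apply: eq_bigr => a _; rewrite addr0.
Qed.

Lemma card_unbalanced M : 0 < M -> (0 < n)%N -> #|~: balanced M|%:R <= 2 ^+ n / M.
Proof.
move=> M0 n0; have nR : 0 < n%:R :> R by rewrite ltr0n.
rewrite ler_pdivlMr // -(ler_pM2r nR) -mulrA [_ * n%:R in leRHS]mulrC -sum_imbalance_sqr.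
rewrite mulr_natl -sumr_const [leRHS](bigID (mem (~: balanced M))) /= -[leLHS]addr0.
apply: lerD; last by apply: sumr_ge0 => s _; exact: sqr_ge0.
by apply: ler_sum => s; rewrite !inE -ltNge => /ltW.
Qed.

(** By Chebyshev, [balanced 4] contains at least 3/4 of all colourings, so each [p s] can be charged
    to [C] times an average over them. Chebyshev at level [M] bounds the number of charges; the
    factor 4/3 is rounded up to 2. *)
Lemma unbalanced_sum_le (p : {ffun 'I_n -> bool} -> R) (C M : R) : 0 < M -> (0 < n)%N ->
  0 <= C -> (forall s, 0 <= p s) -> (forall s t, t \in balanced 4 -> p s <= C * p t) ->
  \sum_(s in ~: balanced M) p s <= 2 * C / M * \sum_s p s.
Proof.
move=> M0 n0 C0 p0 H; have P0 : 0 < 2 ^+ n :> R by rewrite exprn_gt0.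
have cM := card_unbalanced M0 n0.
have c4 : 3 / 4 * 2 ^+ n <= #|balanced 4|%:R :> R.
  have h1 := card_unbalanced (_ : 0 < 4) n0.
  have : #|balanced 4|%:R + #|~: balanced 4|%:R = 2 ^+ n :> R.
    by rewrite -natrD cardsC card_ffun card_bool card_ord natrX.
  have := h1 ltac:(by []); lra.
set S := \sum_(s in _) _; set T := \sum_s _.
have S0 : 0 <= S by apply: sumr_ge0.
have T0 : 0 <= T by apply: sumr_ge0.
have key : #|balanced 4|%:R * S <= C * #|~: balanced M|%:R * T.
  rewrite mulr_natl -sumr_const.
  apply: (@le_trans _ _ (\sum_(t in balanced 4) (C * #|~: balanced M|%:R * p t))); last first.
    rewrite -mulr_sumr ler_wpM2l ?mulr_ge0 // /T [leRHS](bigID (mem (balanced 4))) /= lerDl.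
    exact: sumr_ge0.
  apply: ler_sum => t ht; rewrite -mulrA mulrCA mulr_natl -sumr_const.
  by apply: ler_sum => s _; exact: H.
have h1 : 3 / 4 * 2 ^+ n * S <= C * (2 ^+ n / M) * T.
  apply: le_trans (le_trans _ key) _; first by rewrite ler_wpM2r.
  by rewrite ler_wpM2r // ler_wpM2l.
have h2 : 0 <= C / M * T by rewrite mulr_ge0 // divr_ge0 // ltW.
have -> : 2 * C / M * T = 2 * (C / M * T) by ring.
have h3 : 3 / 4 * S <= C / M * T.
  rewrite -(ler_pM2l P0); apply: le_trans (le_trans _ h1) _; last by rewrite le_eqVlt; apply/orP; left; apply/eqP; ring.
  by rewrite le_eqVlt; apply/orP; left; apply/eqP; ring.
clear -h2 h3 S0; lra.
Qed.

End Imbalance.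

(** Minkowski's inequality in l2, without square roots. It is needed with [i] a class size and [m i]
    a first moment: since first moments add up over class sizes, a second-moment bound inside each
    class passes to the whole with the same constant [c]. *)
Lemma minkowski_sqr (R : realType) (I : Type) (r : seq I) (J : finType) (Q : pred J)
    (f : I -> J -> R) (m : I -> R) (c : R) : 0 <= c ->
  (forall i j, Q j -> 0 <= f i j) -> (forall i, 0 <= m i) ->
  (forall i, \sum_(j | Q j) f i j ^+ 2 <= c * m i ^+ 2) ->
  \sum_(j | Q j) (\sum_(i <- r) f i j) ^+ 2 <= c * (\sum_(i <- r) m i) ^+ 2.
Proof.
move=> c0 f0 m0 H.
have cross i i' : \sum_(j | Q j) f i j * f i' j <= c * (m i * m i').
  have [m1|m1] := eqVneq (m i) 0.
    have z : \sum_(j | Q j) f i j ^+ 2 = 0.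
      apply/eqP; rewrite eq_le (le_trans (H i)) ?m1 ?expr0n ?mulr0 //=.
      by apply: sumr_ge0 => j _; exact: sqr_ge0.
    rewrite m1 mul0r mulr0 big1 // => j Qj.
    have/eqP := z; rewrite psumr_eq0; last by move=> *; exact: sqr_ge0.
    move/allP/(_ j (mem_index_enum j)); rewrite Qj /= sqrf_eq0 => /eqP->; exact: mul0r.
  have [m2|m2] := eqVneq (m i') 0.
    have z : \sum_(j | Q j) f i' j ^+ 2 = 0.
      apply/eqP; rewrite eq_le (le_trans (H i')) ?m2 ?expr0n ?mulr0 //=.
      by apply: sumr_ge0 => j _; exact: sqr_ge0.
    rewrite m2 mulr0 mulr0 big1 // => j Qj.
    have/eqP := z; rewrite psumr_eq0; last by move=> *; exact: sqr_ge0.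
    move/allP/(_ j (mem_index_enum j)); rewrite Qj /= sqrf_eq0 => /eqP->; exact: mulr0.
  have p1 : 0 < m i by rewrite lt0r m1 m0.
  have p2 : 0 < m i' by rewrite lt0r m2 m0.
  (* The weight that makes the two terms of the arithmetic-geometric inequality contribute equally,
     which gives Cauchy-Schwarz for the cross term. The degenerate cases [m i = 0] and [m i' = 0]
     are settled above. *)
  pose t := m i' / m i; have t0 : 0 < t by rewrite divr_gt0.
  apply: (@le_trans _ _ (\sum_(j | Q j) (t / 2 * f i j ^+ 2 + t^-1 / 2 * f i' j ^+ 2))).
    apply: ler_sum => j _; rewrite -subr_ge0.
    have -> : t / 2 * f i j ^+ 2 + t^-1 / 2 * f i' j ^+ 2 - f i j * f i' j = t^-1 / 2 * (t * f i j - f i' j) ^+ 2.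
      by field; rewrite gt_eqF.
    by rewrite mulr_ge0 ?sqr_ge0 // divr_ge0 // invr_ge0 ltW.
  rewrite big_split /= -!mulr_sumr.
  have h1 := ler_wpM2l (_ : 0 <= t / 2) (H i); have h2 := ler_wpM2l (_ : 0 <= t^-1 / 2) (H i').
  apply: le_trans (lerD (h1 _) (h2 _)) _; rewrite ?divr_ge0 ?invr_ge0 ?(ltW t0) //.
  by rewrite le_eqVlt; apply/orP; left; apply/eqP; rewrite /t; field; rewrite !gt_eqF.
under eq_bigr do rewrite expr2 mulr_suml; rewrite exchange_big /=.
rewrite expr2 mulr_suml mulr_sumr; apply: ler_sum => i _.
under eq_bigr do rewrite mulr_sumr; rewrite exchange_big /=.
by rewrite mulr_sumr mulr_sumr; apply: ler_sum => i' _; exact: cross.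
Qed.

Section CyclesRestrict.
Variables (V : finType) (k l' : nat).
Implicit Types (F H : {set {set V}}).

Lemma edges_subset F p : (edges p \subset F) = [forall i : 'I_l'.+2, p.2 i \in F].
Proof.
apply/subsetP/forallP => [h i|h f /imsetP[i _ ->]]; last exact: h.
by apply: h; apply/imsetP; exists i.
Qed.

Lemma genE F p : @gen V k l' F p = gen k (edges p) p && (edges p \subset F).
Proof.
rewrite /gen /cyc edges_subset; case: (injectiveb _) => //=; case: (#|_| == _); rewrite ?andbF //= !andbT.
apply/forallP/andP => [h|[/forallP h1 /forallP h2] i].
  split; apply/forallP => i; have /and3P[h1 h2 h3] := h i; rewrite ?h1 // h2 h3 ?andbT.
  by apply/imsetP; exists i.
by have /and3P[_ -> ->] := h1 i; rewrite h2.
Qed.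

(** Genericity of a cycle involves its own edges only, so the cycle counts of [H] are the same in
    every host family containing it. This makes counts in the null and in the planted model
    comparable. *)
Lemma cycles_restrict F H : H \subset F -> [set U in cycles k l' F | U \subset H] = cycles k l' H.
Proof.
move=> HF; apply/setP => U; rewrite inE; apply/andP/imsetP => [[/imsetP[p + ->] UH]|[p + ->]].
  by rewrite inE genE => /andP[gp _]; exists p => //; rewrite inE genE gp.
rewrite inE genE => /andP[gp pH]; split => //; apply/imsetP; exists p => //.
by rewrite inE genE gp (subset_trans pH).
Qed.

End CyclesRestrict.

Lemma subcounts_cycles (V : finType) (k L : nat) (F H : {set {set V}}) : H \subset F ->
  subcounts (fun j : 'I_L => cycles k j F) H = subcounts (fun j : 'I_L => cycles k j H) H.
Proof. by move=> HF; apply/ffunP => j; rewrite !ffunE !cycles_restrict. Qed.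

From mathcomp Require Import all_classical all_reals all_analysis.
From mathcomp Require Import measurable_realfun.

Import numFieldNormedType.Exports.

Local Open Scope classical_set_scope.
Local Open Scope ring_scope.

(** * From approximate recurrences to Poisson limits *)

Section LimitTools.
Variable R : realType.
Implicit Types u v : nat -> R.

Lemma cvgn_sum (I : Type) (r : seq I) (P : pred I) (f : I -> nat -> R) (l : I -> R) :
  (forall i, P i -> f i n @[n --> \oo] --> l i) ->
  (\sum_(i <- r | P i) f i n) @[n --> \oo] --> \sum_(i <- r | P i) l i.
Proof.
move=> h; elim: r => [|i r IH].
  rewrite big_nil; under eq_fun do rewrite big_nil; exact: cvg_cst.
rewrite big_cons; under eq_fun do rewrite big_cons.
by case: ifP => // Pi; apply: cvgD => //; apply: h.
Qed.

Lemma cvgn_prod (I : Type) (r : seq I) (P : pred I) (f : I -> nat -> R) (l : I -> R) :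
  (forall i, P i -> f i n @[n --> \oo] --> l i) ->
  (\prod_(i <- r | P i) f i n) @[n --> \oo] --> \prod_(i <- r | P i) l i.
Proof.
move=> h; elim: r => [|i r IH].
  rewrite big_nil; under eq_fun do rewrite big_nil; exact: cvg_cst.
rewrite big_cons; under eq_fun do rewrite big_cons.
by case: ifP => // Pi; apply: cvgM => //; apply: h.
Qed.

Lemma cvgn_le0 u v : (\forall n \near \oo, `|u n| <= v n) ->
  v n @[n --> \oo] --> 0 -> u n @[n --> \oo] --> 0.
Proof.
move=> h hv; apply/norm_cvg0P; apply: (squeeze_cvgr (f := fun=> 0) (h := v)) => //.
  by near=> n; rewrite normr_ge0 /=; near: n.
exact: cvg_cst.
Unshelve. all: by end_near. Qed.

Lemma cvgn_ext u v (l : R) : u =1 v ->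
  u n @[n --> \oo] --> l -> v n @[n --> \oo] --> l.
Proof. by move=> /funext->. Qed.

Lemma cvgn_near u v (l : R) : (\forall n \near \oo, u n = v n) ->
  u n @[n --> \oo] --> l -> v n @[n --> \oo] --> l.
Proof. by move=> h; apply: cvg_trans; apply: near_eq_cvg. Qed.

Lemma cvgn_sub0 u v (l : R) : (u n - v n) @[n --> \oo] --> 0 ->
  v n @[n --> \oo] --> l -> u n @[n --> \oo] --> l.
Proof.
move=> h1 h2; rewrite -[l]add0r.
apply: (@cvgn_ext (fun n => (u n - v n) + v n)); last exact: cvgD.
by move=> n; rewrite subrK.
Qed.

Lemma cvgn_inv_nat : (n%:R^-1 : R) @[n --> \oo] --> 0.
Proof.
apply/cvgrPdist_le => e e0; near=> n.
rewrite sub0r normrN ger0_norm ?invr_ge0 // -[leRHS]invrK lef_pV2 ?posrE ?invr_gt0 //.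
  by near: n; apply: nbhs_infty_ger.
by near: n; apply: nbhs_infty_gtr.
Unshelve. all: by end_near. Qed.

Lemma cvgn_exp u (c : R) l : u n @[n --> \oo] --> c -> (u n ^+ l) @[n --> \oo] --> c ^+ l.
Proof.
move=> h; rewrite -(card_ord l) -prodr_const; under eq_fun do rewrite -prodr_const.
by apply: cvgn_prod.
Qed.

Lemma ffact_ratio_cvg l (c : R) (x y : nat -> nat) : (\forall n \near \oo, (l <= x n)%N) ->
  ((x n)%:R / (y n)%:R : R) @[n --> \oo] --> c -> ((y n)%:R^-1 : R) @[n --> \oo] --> 0 ->
  (((x n) ^_ l)%:R / (y n)%:R ^+ l : R) @[n --> \oo] --> c ^+ l.
Proof.
move=> hx hxy hy.
apply: (@cvgn_near (fun n => \prod_(i < l) ((x n)%:R / (y n)%:R - i%:R / (y n)%:R))).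
  near=> n; rewrite ffact_prod natr_prod -[X in _ / _ ^+ X](card_ord l) -prodr_const -prodf_div.
  apply: eq_bigr => i _; rewrite natrB ?mulrBl //.
  by apply: leq_trans (ltnW (ltn_ord i)) _; near: n.
rewrite [X in _ --> X](_ : _ = \prod_(i < l) c); last by rewrite prodr_const card_ord.
apply: cvgn_prod => i _.
rewrite -[X in _ --> X]subr0; apply: cvgB => //.
by rewrite -[X in _ --> X](mulr0 i%:R); apply: cvgMr.
Unshelve. all: by end_near. Qed.

End LimitTools.

Section PoissonLimit.
Variables (R : realType) (L : nat) (mu : 'I_L -> R).
Hypothesis mu_ge0 : forall i, 0 <= mu i.

Definition poisw (a : {ffun 'I_L -> nat}) : R :=
  \prod_i (mu i ^+ a i / (a i)`!%:R).

Definition box K (c : {ffun 'I_L -> 'I_K}) : {ffun 'I_L -> nat} := [ffun i => val (c i)].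

Lemma sum_box_prod (f : 'I_L -> nat -> R) K :
  \sum_(c : {ffun 'I_L -> 'I_K}) \prod_i f i (box c i) = \prod_i \sum_(0 <= j < K) f i j.
Proof.
under [RHS]eq_bigr do rewrite big_mkord.
rewrite bigA_distr_bigA /=; apply: eq_bigr => c _; apply: eq_bigr => i _.
by rewrite ffunE.
Qed.

Lemma exp_series_cvg (x : R) :
  (\sum_(0 <= j < K) (x ^+ j / j`!%:R)) @[K --> \oo] --> expR x.
Proof. exact: is_cvg_series_exp_coeff. Qed.

Lemma sum_poisw_cvg :
  (\sum_(c : {ffun 'I_L -> 'I_K}) poisw (box c)) @[K --> \oo] --> expR (\sum_i mu i).
Proof.
under eq_fun do rewrite /poisw (sum_box_prod (fun i j => mu i ^+ j / j`!%:R)).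
rewrite expR_sum; apply: cvgn_prod => i _; exact: exp_series_cvg.
Qed.

Lemma incr_ind (Q : {ffun 'I_L -> nat} -> Prop) : Q [ffun=> 0%N] ->
  (forall a i, Q a -> Q (incr a i)) -> forall a, Q a.
Proof.
move=> Q0 QS a; move E: (\sum_i a i)%N => s; elim: s a E => [|s IH] a E.
  suff -> : a = [ffun=> 0%N] by [].
  apply/ffunP => i; rewrite ffunE; apply/eqP.
  by move/eqP: E; rewrite sum_nat_eq0 => /forallP/(_ i).
have [i ai] : exists i, (0 < a i)%N.
  apply/existsP; apply: contraPT E; rewrite negb_exists => /forallP h.
  rewrite big1 // => i _; have := h i; by rewrite lt0n negbK => /eqP.
have -> : a = incr [ffun j => (a j - (j == i))%N] i.
  apply/ffunP => j; rewrite !ffunE subnK //; case: eqP => // ->; exact: ai.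
apply: QS; apply: IH.
apply/eqP; rewrite -(eqn_add2r 1); apply/eqP; rewrite [RHS]addn1 -E; have -> : 1%N = (\sum_j (j == i))%N.
  by rewrite (bigD1 i) //= eqxx big1 ?addn0 // => j /negPf->.
rewrite -big_split /=; apply: eq_bigr => j _; rewrite ffunE subnK //.
by case: eqP => // ->; exact: ai.
Qed.

Lemma poisw_incr (a : {ffun 'I_L -> nat}) i : (a i).+1%:R * poisw (incr a i) = mu i * poisw a.
Proof.
rewrite /poisw (bigD1 i) //= [in RHS](bigD1 i) //= ffunE eqxx addn1.
rewrite (eq_bigr (fun j => mu j ^+ a j / (a j)`!%:R)); last first.
  by move=> j ji; rewrite ffunE (negPf ji) addn0.
rewrite factS natrM exprS.
have h1 : ((a i).+1%:R : R) != 0 by rewrite pnatr_eq0.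
have h2 : ((a i)`!%:R : R) != 0 by rewrite pnatr_eq0 -lt0n fact_gt0.
move: h1 h2; set x := (a i).+1%:R; set y := (a i)`!%:R => h1 h2.
by clearbody x y; field; rewrite ?h1 ?h2.
Qed.

Variable p : nat -> {ffun 'I_L -> nat} -> R.
Hypothesis p_ge0 : forall n a, 0 <= p n a.
Hypothesis p_le1 : forall n K, \sum_(c : {ffun 'I_L -> 'I_K}) p n (box c) <= 1.
Hypothesis p_tight : exists B, forall K, (0 < K)%N ->
  \forall n \near \oo, 1 - B / K%:R <= \sum_(c : {ffun 'I_L -> 'I_K}) p n (box c).
Hypothesis p_rec : forall (a : {ffun 'I_L -> nat}) i,
  ((a i).+1%:R * p n (incr a i) - mu i * p n a) @[n --> \oo] --> 0.

Let p0 n := p n [ffun=> 0%N].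

Let p_asymp a : (p n a - poisw a * p0 n) @[n --> \oo] --> 0.
Proof.
move: a; apply: incr_ind => [|a i IH].
  apply: (@cvgn_ext _ (fun=> 0)); last exact: cvg_cst.
  move=> n; rewrite /poisw big1 ?mul1r ?subrr // => i _.
  by rewrite ffunE expr0 fact0 divr1.
have h1 : ((a i).+1%:R : R) != 0 by rewrite pnatr_eq0.
apply: (@cvgn_ext _ (fun n => (a i).+1%:R^-1 *
   (((a i).+1%:R * p n (incr a i) - mu i * p n a) + mu i * (p n a - poisw a * p0 n)))); last first.
  rewrite -[0](mulr0 (a i).+1%:R^-1); apply: cvgMr.
  rewrite -[0]addr0; apply: cvgD; first exact: p_rec.
  by rewrite -[0](mulr0 (mu i)); apply: cvgMr.
move=> n; apply: (mulfI h1); rewrite mulrA divff // mul1r [RHS]mulrBr [in RHS]mulrA poisw_incr.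
ring.
Qed.

(** The recurrence expresses every [p n a] as [poisw a * p0 n] up to o(1). Summed over a large box,
    where tightness leaves almost all the mass, this identifies the limit of [p0 n] as exp (- sum
    mu). *)
Lemma poisson_limit a :
  p n a @[n --> \oo] --> poisw a * expR (- \sum_i mu i).
Proof.
apply: (cvgn_sub0 (p_asymp a)).
rewrite -/(poisw a); apply: cvgMr.
set E := expR (\sum_i mu i).
have E0 : 0 < E by exact: expR_gt0.
have p01 n : 0 <= p0 n <= 1.
  rewrite p_ge0 /=; apply: le_trans (p_le1 n 1).
  rewrite (bigD1 [ffun=> ord0]) //= [X in p n X](_ : _ = [ffun=> 0%N]); last first.
    by apply/ffunP => i; rewrite !ffunE.
  by rewrite lerDl sumr_ge0.
suff h : (p0 n * E) @[n --> \oo] --> (1 : R).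
  rewrite expRN -/E -[E^-1]mul1r.
  apply: (@cvgn_ext _ (fun n => (p0 n * E) / E)); last by apply: cvgMl.
  by move=> n; rewrite mulfK // gt_eqF.
apply/cvgrPdist_le => e e0.
have [B hB] := p_tight.
have e4 : 0 < e / 4 by rewrite divr_gt0.
have [K [K0 KB KE]] : exists K, [/\ (0 < K)%N, B / K%:R <= e / 4 &
   `|E - \sum_(c : {ffun 'I_L -> 'I_K}) poisw (box c)| <= e / 4].
  have h1 := (cvgrPdist_le _ _).1 sum_poisw_cvg _ e4.
  have h2 : (B / n%:R) @[n --> \oo] --> (0 : R).
    by rewrite -[0](mulr0 B); apply: cvgMr; exact: cvgn_inv_nat.
  have h3 := cvgr_le _ h2 _ e4.
  near \oo => K; exists K; split.
  - by near: K; exists 1%N.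
  - by near: K; exact: h3.
  - by near: K; exact: h1.
set BK := \sum_(c : {ffun 'I_L -> 'I_K}) poisw (box c) in KE.
have h5 : (\sum_(c : {ffun 'I_L -> 'I_K}) p n (box c) - BK * p0 n) @[n --> \oo] --> 0.
  apply: (@cvgn_ext _ (fun n => \sum_(c : {ffun 'I_L -> 'I_K}) (p n (box c) - poisw (box c) * p0 n))); last first.
    rewrite [X in _ --> X](_ : _ = \sum_(c : {ffun 'I_L -> 'I_K}) 0); last by rewrite big1.
    by apply: cvgn_sum => c _; exact: p_asymp.
  by move=> n; rewrite sumrB mulr_suml.
near=> n.
have a1 : `|\sum_(c : {ffun 'I_L -> 'I_K}) p n (box c) - BK * p0 n| <= e / 4.
  by rewrite -normrN -sub0r; near: n; exact: ((cvgrPdist_le _ _).1 h5).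
have a2 : 1 - B / K%:R <= \sum_(c : {ffun 'I_L -> 'I_K}) p n (box c) by near: n; exact: hB.
have a3 := p_le1 n K.
move: a2 a1 a3; set s := \sum_c _ => a2 a1 a3.
have a4 : `|p0 n * (E - BK)| <= e / 4.
  rewrite normrM; apply: le_trans KE; rewrite ger0_norm; last by case/andP: (p01 n).
  by rewrite ler_piMl //; case/andP: (p01 n).
move: a1 a4 KB a2 a3; rewrite !ler_norml => /andP[b1 b2] /andP[b3 b4] c1 c2 c3.
rewrite mulrBr in b3 b4.
apply/andP; split; clear -b1 b2 c1 c2 c3 b3 b4; lra.
Unshelve. all: by end_near. Qed.

End PoissonLimit.

(** * The switching inequality in terms of probabilities *)

Section SwitchReal.
Variables (R : realType) (T : finType) (F : {set T}) (m : nat) (L : nat) (len : 'I_L -> nat).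
Variable Cs : 'I_L -> {set {set T}}.
Hypothesis CsF : forall i U, U \in Cs i -> U \subset F.
Hypothesis CsC : forall i U, U \in Cs i -> #|U| = len i.
Hypothesis len_gt0 : forall i, (0 < len i)%N.
Hypothesis len_inj : injective len.
Hypothesis mF : (m <= #|F|)%N.

Definition pcnt (a : {ffun 'I_L -> nat}) : R :=
  unif_prob R (msub F m) (fun H => subcounts Cs H == a).

(** The ratio between the numbers of choices of [S] in the two directions of the switching. By
    [psup_le_rho] it also bounds the probability that a given set of [len i] elements is contained
    in the random one. *)
Definition rho i : R := 'C(m, len i)%:R / 'C(#|F| - m, len i)%:R.

Definition overlap_mean i : R :=
  \sum_(C in Cs i) \sum_(j < L) \sum_(U in Cs j | (U != C) && ~~ [disjoint U & C])
    psup R F m (C :|: U).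

Let B0 : ('C(#|F|, m)%:R : R) != 0.
Proof. by rewrite pnatr_eq0 -lt0n bin_gt0. Qed.

Lemma pcntE a : pcnt a = (cnt F m Cs a)%:R / 'C(#|F|, m)%:R.
Proof. by rewrite /pcnt /unif_prob card_msub. Qed.

Lemma overlap_meanE i : overlap_mean i = (overlap F m Cs i)%:R / 'C(#|F|, m)%:R.
Proof.
rewrite /overlap_mean /overlap natr_sum mulr_suml; apply: eq_bigr => C _.
rewrite natr_sum mulr_suml; apply: eq_bigr => j _.
rewrite natr_sum mulr_suml; apply: eq_bigr => U _.
by rewrite /psup /unif_prob card_msub.
Qed.

Lemma psup_le_rho j U : (len j <= #|F| - m)%N -> U \in Cs j -> psup R F m U <= rho j.
Proof.
move=> lj Uj; rewrite psupE ?(CsF Uj) // (CsC Uj) /rho.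
have -> : 'C(m, len j)%:R / 'C(#|F| - m, len j)%:R =
  (m ^_ len j)%:R / ((#|F| - m) ^_ len j)%:R :> R.
  by rewrite -!bin_ffact !natrM -mulf_div divff ?mulr1 // pnatr_eq0 -lt0n fact_gt0.
apply: ler_wpM2l => //; rewrite lef_pV2 ?posrE ?ltr0n ?ffact_gt0 //; last first.
  by apply: leq_trans lj _; rewrite leq_subr.
rewrite ler_nat !ffact_prod; apply: leq_prod => x _; lia.
Qed.

Lemma sum_psup_le j : (len j <= #|F| - m)%N ->
  \sum_(U in Cs j) psup R F m U <= rho j * #|Cs j|%:R.
Proof.
move=> lj; rewrite mulrC mulr_natl -sumr_const; apply: ler_sum => U Uj; exact: psup_le_rho.
Qed.

(** [switch_ineq] divided by the number of pairs of an m-subset and a set of [len i] elements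
    outside it. The three error terms are, in order, the chance that the removed set hits a counted
    one, that the inserted set was not disjoint, and that it overlaps another counted set. *)
Lemma switch_real i (a : {ffun 'I_L -> nat}) : (0 < m)%N -> (forall j, len j <= #|F| - m)%N ->
  `|(a i).+1%:R * pcnt (incr a i) - rho i * #|Cs i|%:R * pcnt a| <=
  rho i * #|Cs i|%:R *
    ((\sum_j rho j * #|Cs j|%:R * (len j)%:R) * (len i)%:R / m%:R + (len i)%:R * m%:R / #|F|%:R)
  + overlap_mean i.
Proof.
move=> m0 lF.
have := switch_ineq CsF CsC len_gt0 len_inj i a mF.
set A := (_ * (_ * cnt _ _ _ (incr a i)))%N; set B := (_ * (_ * cnt _ _ _ a))%N.
set h := hits _ _ _ _ _; set o := overlap _ _ _ _; set t := touches _ _ _ _ _.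
set W : R := 'C(#|F| - m, len i)%:R; set V : R := 'C(#|F|, m)%:R.
have W0 : W != 0 by rewrite pnatr_eq0 -lt0n bin_gt0.
have m0R : (m%:R : R) != 0 by rewrite pnatr_eq0 -lt0n.
have f0R : (#|F|%:R : R) != 0 by rewrite pnatr_eq0 -lt0n (leq_trans m0 mF).
have V0 : V != 0 by exact: B0.
have WV : 0 < W * V by rewrite mulr_gt0 // lt0r ?W0 ?B0 /=.
have hE : h%:R / (W * V) <= rho i * #|Cs i|%:R *
    ((\sum_j rho j * #|Cs j|%:R * (len j)%:R) * (len i)%:R / m%:R).
  rewrite /h /hits /rho -/W.
  have -> : ('C(m, len i)%:R : R) = m%:R * 'C(m.-1, (len i).-1)%:R / (len i)%:R.
    have := mul_bin_diag m (len i).-1; rewrite prednK // => e.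
    by rewrite -natrM e natrM mulrAC divff ?mul1r // pnatr_eq0 -lt0n.
  set b : R := 'C(m.-1, _)%:R.
  have li : ((len i)%:R : R) != 0 by rewrite pnatr_eq0 -lt0n.
  have -> : m%:R * b / (len i)%:R / W * #|Cs i|%:R *
    ((\sum_j rho j * #|Cs j|%:R * (len j)%:R) * (len i)%:R / m%:R) =
    #|Cs i|%:R * (b / W * \sum_j rho j * #|Cs j|%:R * (len j)%:R).
    by clearbody b W; field; rewrite W0 li m0R.
  rewrite natrM -mulrA; apply: ler_wpM2l => //.
  rewrite natr_sum mulr_suml mulr_sumr; apply: ler_sum => j _.
  have -> : b / W * (rho j * #|Cs j|%:R * (len j)%:R) = (rho j * #|Cs j|%:R) * (b * (len j)%:R / W).
    ring.
  apply: le_trans (ler_wpM2r _ (sum_psup_le (lF j))); last by rewrite divr_ge0 // mulr_ge0.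
  rewrite mulr_suml natr_sum mulr_suml; apply: ler_sum => U Uj.
  rewrite /psup /unif_prob card_msub -/V !natrM -/b.
  by rewrite le_eqVlt; apply/orP; left; apply/eqP; clearbody b W V; field; rewrite ?W0 ?V0.
have oE : (W * o%:R) / (W * V) = overlap_mean i.
  by rewrite overlap_meanE -mulf_div divff ?mul1r.
have tE : t%:R / (W * V) = rho i * #|Cs i|%:R * ((len i)%:R * m%:R / #|F|%:R).
  rewrite /t /touches /rho -/W !natrM.
  have -> : ('C(#|F|.-1, m.-1)%:R : R) = m%:R * V / #|F|%:R.
    have := mul_bin_diag #|F| m.-1; rewrite prednK // => e.
    by rewrite /V -natrM -e natrM mulrAC divff ?mul1r.
  by clearbody W V; field; rewrite ?W0 ?f0R ?V0.
have AE : A%:R / (W * V) = (a i).+1%:R * pcnt (incr a i).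
  by rewrite /A pcntE !natrM -/W -/V; clearbody W V; field; rewrite ?W0 ?V0.
have BE : B%:R / (W * V) = rho i * #|Cs i|%:R * pcnt a.
  by rewrite /B pcntE /rho !natrM -/W -/V; clearbody W V; field; rewrite ?W0 ?V0.
rewrite -AE -BE => -[AB BA].
set E : R := _ + overlap_mean i.
have EE : ((h + 'C(#|F| - m, len i) * o + t)%:R : R) / (W * V) <= E.
  rewrite /E !natrD natrM !mulrDl oE tE mulrDr -/W.
  by rewrite (addrAC (h%:R / _)) lerD2r lerD2r.
have F1 : A%:R / (W * V) - B%:R / (W * V) <= E.
  apply: le_trans EE; rewrite -mulrBl ler_pM2r ?invr_gt0 // lerBlDl -natrD ler_nat.
  exact: AB.
have F2 : B%:R / (W * V) - A%:R / (W * V) <= E.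
  apply: le_trans EE; rewrite -mulrBl ler_pM2r ?invr_gt0 // lerBlDl -natrD ler_nat.
  exact: BA.
by rewrite ler_norml F1 andbT lerNl opprB.
Qed.

Lemma card_box_sum K :
  (\sum_(c : {ffun 'I_L -> 'I_K}) cnt F m Cs (box c) <= #|msub F m|)%N.
Proof.
rewrite /cnt -[leqRHS]sum1_card; under [leqLHS]eq_bigr do rewrite -sum1_card.
rewrite (exchange_big_dep (fun H => H \in msub F m)) /=; last first.
  by move=> c H _; rewrite finset.inE => /andP[].
apply: leq_sum => H Hm.
case: (pickP (fun c : {ffun 'I_L -> 'I_K} => subcounts Cs H == box c)) => [c hc|h0].
  rewrite (bigD1 c) /=; last by rewrite finset.inE Hm.
  rewrite big1 // => c'; rewrite finset.inE Hm /= => /andP[/eqP h1 /negP []].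
  apply/eqP/ffunP => i; apply: val_inj.
  by move/eqP: hc; rewrite h1 => /ffunP/(_ i); rewrite !ffunE.
by rewrite big1 // => c; rewrite finset.inE Hm h0.
Qed.

Lemma pcnt_box_le1 K : \sum_(c : {ffun 'I_L -> 'I_K}) pcnt (box c) <= 1.
Proof.
under eq_bigr do rewrite pcntE.
rewrite -mulr_suml -natr_sum ler_pdivrMr ?lt0r ?B0 //= mul1r ler_nat.
by apply: leq_trans (card_box_sum K) _; rewrite card_msub.
Qed.

Lemma card_box_tight K : (0 < K)%N ->
  (K * #|msub F m| <= K * (\sum_(c : {ffun 'I_L -> 'I_K}) cnt F m Cs (box c)) +
    \sum_(H in msub F m) \sum_j subcounts Cs H j)%N.
Proof.
move=> K0; rewrite -[#|msub F m|]sum1_card /cnt.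
under [X in (K * X + _)%N]eq_bigr do rewrite -sum1_card.
rewrite (exchange_big_dep (fun H => H \in msub F m)) /=; last first.
  by move=> c H _; rewrite finset.inE => /andP[].
rewrite !big_distrr -big_split /=; apply: leq_sum => H Hm; rewrite muln1.
case: (boolP [forall j, (subcounts Cs H j < K)%N]) => [/forallP h|].
  pose c : {ffun 'I_L -> 'I_K} := [ffun j => Ordinal (h j)].
  rewrite (bigD1 c) /=; first by lia.
  by rewrite finset.inE Hm /=; apply/eqP/ffunP => j; rewrite [RHS]ffunE [X in _ = val X]ffunE.
rewrite negb_forall => /existsP[j]; rewrite -leqNgt => h.
apply: leq_trans h _; rewrite (bigD1 j) //=; lia.
Qed.

(** Markov's inequality for the total count: outside the box some count is at least [K]. *)
Lemma pcnt_box_tight K : (0 < K)%N -> (forall j, len j <= #|F| - m)%N ->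
  1 - (\sum_j rho j * #|Cs j|%:R) / K%:R <= \sum_(c : {ffun 'I_L -> 'I_K}) pcnt (box c).
Proof.
move=> K0 lF; under [leRHS]eq_bigr do rewrite pcntE.
rewrite -mulr_suml -natr_sum; set s := (\sum_c _)%N.
have := card_box_tight K0; rewrite -/s exchange_big card_msub.
set V := 'C(_, _); set e := (\sum_j _)%N => h.
have V0 : 0 < V%:R :> R by rewrite lt0r B0 /=.
have K0R : 0 < K%:R :> R by rewrite ltr0n.
have eE : e%:R / V%:R <= \sum_j rho j * #|Cs j|%:R.
  rewrite natr_sum mulr_suml; apply: ler_sum => j _.
  apply: le_trans (sum_psup_le (lF j)).
  have := @sum_subcounts _ F m L Cs j predT.
  rewrite [X in _ = X](eq_bigl (fun H => H \in msub F m)); last by move=> H; rewrite andbT.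
  move=> <-; rewrite natr_sum mulr_suml; apply: ler_sum => U _.
  by rewrite /psup /unif_prob card_msub.
rewrite lerBlDl -(ler_pM2r V0) mul1r mulrDl divfK ?gt_eqF //.
rewrite -(ler_pM2l K0R).
have h' : K%:R * V%:R <= K%:R * s%:R + e%:R :> R by rewrite -!natrM -natrD ler_nat.
have eE' : e%:R <= (\sum_j rho j * #|Cs j|%:R) * V%:R by rewrite -ler_pdivrMr.
rewrite mulrDr [K%:R * (_ / _ * _)](_ : _ = (\sum_j rho j * #|Cs j|%:R) * V%:R).
  lra.
by field; rewrite gt_eqF.
Qed.

End SwitchReal.

Lemma pcnt_big (R : realType) (T : finType) (F : {set T}) m L (Cs : 'I_L -> {set {set T}}) a :
  (#|F| < m)%N -> pcnt R F m Cs a = 0.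
Proof. by move=> h; rewrite /pcnt /unif_prob card_msub bin_small // invr0 mulr0. Qed.

Section CyclePoisson.
Variables (R : realType) (L : nat) (len : 'I_L -> nat).
Variables (T : nat -> finType) (F : forall n, {set T n}) (m : nat -> nat).
Variable Cs : forall n, 'I_L -> {set {set T n}}.
Variable mu : 'I_L -> R.
Hypothesis mu_ge0 : forall i, 0 <= mu i.
Hypothesis CsF : forall n i U, U \in Cs n i -> U \subset F n.
Hypothesis CsC : forall n i U, U \in Cs n i -> #|U| = len i.
Hypothesis len_gt0 : forall i, (0 < len i)%N.
Hypothesis len_inj : injective len.
Hypothesis m_infty : forall M, \forall n \near \oo, (M <= m n)%N.
Hypothesis mF : \forall n \near \oo, (m n <= #|F n|)%N.
Hypothesis mF0 : ((m n)%:R / #|F n|%:R : R) @[n --> \oo] --> 0.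
Hypothesis Cs_mu : forall i,
  (#|Cs n i|%:R * ((m n)%:R / #|F n|%:R) ^+ len i) @[n --> \oo] --> mu i.
Hypothesis Cs_overlap : forall i,
  overlap_mean R (F n) (m n) (Cs n) i @[n --> \oo] --> 0.

Let m_inv : ((m n)%:R^-1 : R) @[n --> \oo] --> 0.
Proof.
apply/cvgrPdist_le => e e0; near=> n.
rewrite sub0r normrN ger0_norm ?invr_ge0 // -[leRHS]invrK lef_pV2 ?posrE ?invr_gt0 //.
  apply: le_trans (_ : (Num.trunc e^-1).+1%:R <= _).
    by apply/ltW; rewrite archimedean.Num.Theory.truncnS_gt.
  rewrite ler_nat; near: n; exact: m_infty.
rewrite ltr0n; near: n; exact: m_infty.
Unshelve. all: by end_near. Qed.

Let m_pos : \forall n \near \oo, (0 < m n)%N.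
Proof. exact: m_infty. Qed.

Let len_le M : \forall n \near \oo, (M <= #|F n| - m n)%N.
Proof.
have h : \forall n \near \oo, `|0 - (m n)%:R / #|F n|%:R| <= 2^-1 :> R.
  by move/cvgrPdist_le: mF0; apply; rewrite invr_gt0.
near=> n.
have m0 : (0 < m n)%N by near: n.
have mFn : (m n <= #|F n|)%N by near: n.
have f0 : 0 < (#|F n|%:R : R) by rewrite ltr0n (leq_trans m0 mFn).
have : `|0 - (m n)%:R / #|F n|%:R| <= 2^-1 :> R by near: n.
rewrite sub0r normrN ger0_norm ?divr_ge0 // ler_pdivrMr // mulrC ler_pdivlMr // -natrM ler_nat => h1.
have : (M <= m n)%N by near: n; exact: m_infty.
lia.
Unshelve. all: by end_near. Qed.

Let f_inv : (#|F n|%:R^-1 : R) @[n --> \oo] --> 0.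
Proof.
apply: (@cvgn_near _ (fun n => (m n)%:R / #|F n|%:R * (m n)%:R^-1)).
  near=> n; rewrite mulrAC divff ?mul1r // pnatr_eq0 -lt0n; near: n; exact: m_pos.
by rewrite -[0](mulr0 0); apply: cvgM.
Unshelve. all: by end_near. Qed.

Let rho_mu i : (rho R (F n) (m n) len i * #|Cs n i|%:R) @[n --> \oo] --> mu i.
Proof.
pose l := len i.
have h1 : (((m n) ^_ l)%:R / (m n)%:R ^+ l : R) @[n --> \oo] --> (1 : R).
  rewrite -[X in _ --> X](expr1n _ l); apply: ffact_ratio_cvg => //.
  apply: (@cvgn_near _ (fun=> 1)); last exact: cvg_cst.
  near=> n; rewrite divff // pnatr_eq0 -lt0n; near: n; exact: m_pos.
have h2 : (((#|F n| - m n) ^_ l)%:R / #|F n|%:R ^+ l : R) @[n --> \oo] --> (1 : R).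
  rewrite -[X in _ --> X](expr1n _ l); apply: ffact_ratio_cvg => //.
  apply: (@cvgn_near _ (fun n => 1 - (m n)%:R / #|F n|%:R)).
    near=> n; have mFn : (m n <= #|F n|)%N by near: n.
    rewrite natrB // mulrBl divff // pnatr_eq0 -lt0n.
    by rewrite (leq_trans _ mFn) //; near: n; exact: m_pos.
  by rewrite -[X in _ --> X]subr0; apply: cvgB => //; exact: cvg_cst.
have h3 : (#|Cs n i|%:R * ((m n)%:R / #|F n|%:R) ^+ l * (((m n) ^_ l)%:R / (m n)%:R ^+ l)
    * (((#|F n| - m n) ^_ l)%:R / #|F n|%:R ^+ l)^-1) @[n --> \oo] --> mu i * 1 * 1^-1.
  by apply: cvgM; [apply: cvgM => //; exact: Cs_mu|apply: cvgV].
rewrite invr1 !mulr1 in h3.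
apply: cvgn_near h3; near=> n; rewrite /rho /= -/l.
have m0 : (0 < m n)%N by near: n.
have mFn : (m n <= #|F n|)%N by near: n.
have f0 : ((#|F n|%:R : R) != 0) by rewrite pnatr_eq0 -lt0n (leq_trans m0 mFn).
have m0' : ((m n)%:R : R) != 0 by rewrite pnatr_eq0 -lt0n.
have g0 : (((#|F n| - m n) ^_ l)%:R : R) != 0.
  by rewrite pnatr_eq0 -lt0n ffact_gt0; near: n; exact: len_le.
have -> : 'C(m n, l)%:R / 'C(#|F n| - m n, l)%:R =
  ((m n) ^_ l)%:R / ((#|F n| - m n) ^_ l)%:R :> R.
  by rewrite -!bin_ffact !natrM -mulf_div divff ?mulr1 // pnatr_eq0 -lt0n fact_gt0.
have := expf_neq0 l f0; have := expf_neq0 l m0'; rewrite expr_div_n.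
move: (_ ^+ l) (_ ^+ l) g0 => x y; move: (_%:R) => z z0 x0 y0.
by field; rewrite x0 y0 z0.
Unshelve. all: by end_near. Qed.

Theorem cycle_poisson (a : {ffun 'I_L -> nat}) :
  pcnt R (F n) (m n) (Cs n) a @[n --> \oo] --> poisw mu a * expR (- \sum_i mu i).
Proof.
apply: (poisson_limit (p := fun n b => pcnt R (F n) (m n) (Cs n) b)) => //.
- by move=> n b; rewrite /pcnt /unif_prob divr_ge0.
- move=> n K; case: (leqP (m n) #|F n|) => mFn; first exact: pcnt_box_le1.
  by rewrite big1 // => c _; exact: pcnt_big.
- have hs : (\sum_j rho R (F n) (m n) len j * #|Cs n j|%:R) @[n --> \oo] --> \sum_j mu j.
    by apply: cvgn_sum => j _; exact: rho_mu.
  exists (\sum_j mu j + 1) => K K0; near=> n.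
  have lF : forall j, (len j <= #|F n| - m n)%N.
    near: n; apply: filter_forall => j; exact: len_le.
  have mFn : (m n <= #|F n|)%N by near: n.
  apply: le_trans (pcnt_box_tight R (@CsF n) (@CsC n) mFn K0 lF).
  rewrite lerD2l lerN2 ler_wpM2r ?invr_ge0 //.
  by near: n; apply: (cvgr_le _ hs); rewrite ltrDl.
- move=> b i.
  pose g n := (b i).+1%:R * pcnt R (F n) (m n) (Cs n) (incr b i)
     - rho R (F n) (m n) len i * #|Cs n i|%:R * pcnt R (F n) (m n) (Cs n) b.
  have pb n : `|pcnt R (F n) (m n) (Cs n) b| <= 1.
    case: (leqP (m n) #|F n|) => mFn; last by rewrite pcnt_big // normr0.
    rewrite ger0_norm /pcnt /unif_prob ?divr_ge0 // ler_pdivrMr; last first.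
      by rewrite ltr0n card_msub bin_gt0.
    rewrite mul1r ler_nat; apply: subset_leq_card.
    by apply/fintype.subsetP => H; rewrite finset.inE => /andP[].
  apply: (@cvgn_ext _ (fun n => g n + (rho R (F n) (m n) len i * #|Cs n i|%:R - mu i) *
      pcnt R (F n) (m n) (Cs n) b)); first by move=> n; rewrite /g; ring.
  rewrite -[X in _ --> X]addr0; apply: cvgD; last first.
    apply: (@cvgn_le0 _ _ (fun n => `|rho R (F n) (m n) len i * #|Cs n i|%:R - mu i|)).
      by near=> n; rewrite normrM ler_piMr.
    by apply/norm_cvg0P; rewrite -(subrr (mu i)); apply: cvgB; [exact: rho_mu|exact: cvg_cst].
  apply: (@cvgn_le0 _ _ (fun n => rho R (F n) (m n) len i * #|Cs n i|%:R *
    ((\sum_j rho R (F n) (m n) len j * #|Cs n j|%:R * (len j)%:R) * (len i)%:R / (m n)%:R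
      + (len i)%:R * (m n)%:R / #|F n|%:R)
    + overlap_mean R (F n) (m n) (Cs n) i)).
    near=> n; apply: switch_real => //.
    + exact: CsF.
    + exact: CsC.
    + by near: n.
    + by near: n; exact: m_pos.
    + near: n; apply: filter_forall => j; exact: len_le.
  rewrite -[X in _ --> X]addr0; apply: cvgD => //.
  rewrite -[X in _ --> X](mulr0 (mu i)); apply: cvgM; first exact: rho_mu.
  rewrite -[X in _ --> X]addr0; apply: cvgD.
    rewrite -[X in _ --> X](mulr0 ((\sum_j mu j * (len j)%:R) * (len i)%:R)); apply: cvgM => //.
    apply: cvgMl; apply: cvgn_sum => j _; apply: cvgMl; exact: rho_mu.
  apply: (@cvgn_ext _ (fun n => (len i)%:R * ((m n)%:R / #|F n|%:R))).
    by move=> n; rewrite mulrA.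
  by rewrite -[X in _ --> X](mulr0 (len i)%:R); apply: cvgMr.
Unshelve. all: by end_near. Qed.

End CyclePoisson.

(** * Short cycle counts, null and planted *)

Section CycleCount.
Variables (R : realType) (k l' : nat).
Hypothesis k3 : (2 < k)%N.
Variables (F : forall n, {set {set 'I_n}}) (sigma : forall n, {ffun 'I_n -> bool}).
Variable g : nat -> bool -> bool -> nat.
Hypothesis kF : forall n, kunif k (F n).
Hypothesis F_pair : forall n (x y : 'I_n), x != y ->
  #|[set f in F n | (x \in f) && (y \in f)]%SET| = g n (sigma n x) (sigma n y).
Hypothesis half : forall b, ((nclass (sigma n) b)%:R / n%:R : R) @[n --> \oo] --> (2^-1 : R).
Variables A B : R.
Hypothesis g_lim : forall b b',
  ((g n b b')%:R / n%:R ^+ (k - 2) : R) @[n --> \oo] --> A + B * (chi R b * chi R b').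

Local Notation l := l'.+2.

Let ncol_lim (c : {ffun 'I_l -> bool}) :
  ((ncol (sigma n) c)%:R / n%:R ^+ l : R) @[n --> \oo] --> (2^-1 : R) ^+ l.
Proof.
have h1 : (\prod_(i < l) ((nclass (sigma n) (c i))%:R / n%:R : R)) @[n --> \oo] --> (2^-1 : R) ^+ l.
  rewrite [X in _ --> X](_ : _ = \prod_(i < l) 2^-1); last by rewrite prodr_const card_ord.
  by apply: cvgn_prod => i _.
have h2 : ((n ^_ l)%:R / n%:R ^+ l : R) @[n --> \oo] --> (1 : R).
  rewrite -[X in _ --> X](expr1n _ l); apply: ffact_ratio_cvg.
  - by near=> n; near: n; exists l.
  - apply: (@cvgn_near _ (fun=> 1)); last exact: cvg_cst.
    near=> n; rewrite divff // pnatr_eq0 -lt0n; near: n; by exists 1%N.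
  - exact: cvgn_inv_nat.
apply: (squeeze_cvgr (f := fun n => \prod_(i < l) ((nclass (sigma n) (c i))%:R / n%:R : R)
    - (1 - (n ^_ l)%:R / n%:R ^+ l)) _ _ h1); last first.
  rewrite -[X in _ --> X]subr0; apply: cvgB => //.
  rewrite -[X in _ --> X](subrr 1); apply: cvgB => //; exact: cvg_cst.
near=> n.
have n0 : 0 < n%:R ^+ l :> R by rewrite exprn_gt0 // ltr0n; near: n; exists 1%N.
have -> : \prod_(i < l) ((nclass (sigma n) (c i))%:R / n%:R : R) =
   (\prod_i nclass (sigma n) (c i))%:R / n%:R ^+ l.
  by rewrite prodf_div prodr_const card_ord natr_prod.
rewrite ler_pM2r ?invr_gt0 // ler_nat ncol_le andbT.
rewrite lerBlDr -[X in _ + (X - _)](divff (lt0r_neq0 n0)) -mulrBl -mulrDl ler_pM2r ?invr_gt0 //.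
have le : (n ^_ l <= n ^ l)%N.
  rewrite ffact_prod -[X in (_ <= n ^ X)%N](card_ord l) -prod_nat_const.
  by apply: leq_prod => i _; exact: leq_subr.
rewrite -natrX -natrB // -natrD ler_nat; exact: ncol_ge.
Unshelve. all: by end_near. Qed.

Let n_inv_exp s : (((n.+1)%:R ^+ s / n%:R ^+ s.+1 : R)) @[n --> \oo] --> 0.
Proof.
apply: (@cvgn_near _ (fun n => (1 + n%:R^-1) ^+ s * n%:R^-1)); last first.
  rewrite -[X in _ --> X](mulr0 ((1 + 0) ^+ s)); apply: cvgM; last exact: cvgn_inv_nat.
  apply: cvgn_exp; apply: cvgD; [exact: cvg_cst|exact: cvgn_inv_nat].
near=> n.
have n0 : n%:R != 0 :> R by rewrite pnatr_eq0 -lt0n; near: n; exists 1%N.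
rewrite exprS invfM mulrA [RHS]mulrAC -expr_div_n; congr (_ ^+ _ * _).
by rewrite -addn1 natrD mulrDl divff // mul1r.
Unshelve. all: by end_near. Qed.

(** Each colour pattern is carried by about (n / 2) ^ l sequences of joints, so [cyclic_sum] yields
    A ^ l + B ^ l closed walks; cycles that are not generic vanish in the limit, and each generic
    one is counted 2 l times. *)
Lemma card_cycles_lim :
  (#|cycles k l' (F n)|%:R / n%:R ^+ ((k - 1) * l) : R) @[n --> \oo] -->
  (A ^+ l + B ^+ l) / (2 * l%:R).
Proof.
have e1 : ((k - 1) * l = l + (k - 2) * l)%N by rewrite -mulSn; congr (_ * _)%N; lia.
have h1 : (#|[set p | @cyc _ l' (F n) p]%SET|%:R / n%:R ^+ ((k - 1) * l) : R) @[n --> \oo] -->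
    A ^+ l + B ^+ l.
  apply: (@cvgn_ext _ (fun n => \sum_(c : {ffun 'I_l -> bool}) (ncol (sigma n) c)%:R / n%:R ^+ l *
     \prod_i ((g n (c i) (c (i + 1)%R))%:R / n%:R ^+ (k - 2)))).
    move=> n; rewrite (card_cyc l' (F_pair (n := n))) natr_sum mulr_suml; apply: eq_bigr => c _.
    rewrite natrM natr_prod prodf_div prodr_const card_ord e1 exprD exprM.
    by rewrite mulf_div.
  rewrite [X in _ --> X](_ : _ = \sum_(c : {ffun 'I_l -> bool}) (2^-1) ^+ l *
      \prod_i (A + B * (chi R (c i) * chi R (c (i + 1)%R)))); last first.
    rewrite -mulr_sumr cyclic_sum mulrA -exprMn mulVf ?expr1n ?mul1r //.
  apply: cvgn_sum => c _; apply: cvgM; first exact: ncol_lim.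
  by apply: cvgn_prod => i _; exact: g_lim.
have h2 : (#|[set p | @cyc _ l' (F n) p & ~~ gen k (F n) p]%SET|%:R / n%:R ^+ ((k - 1) * l) : R)
     @[n --> \oo] --> 0.
  set s := ((k - 1) * l - 1)%N.
  have -> : ((k - 1) * l = s.+1)%N by have : (0 < (k - 1) * l)%N; [rewrite muln_gt0 andbT; lia|rewrite /s; lia].
  apply: (@cvgn_le0 _ _ (fun n => (n.+1%:R ^+ s / n%:R ^+ s.+1) * ((s * 2 ^ s) ^ l)%:R)).
    near=> n; rewrite ger0_norm ?divr_ge0 ?exprn_ge0 // mulrAC ler_wpM2r ?invr_ge0 ?exprn_ge0 //.
    rewrite -natrX -natrM ler_nat; have := card_cyc_nongen l' k3 (kF n); rewrite card_ord.
    by rewrite -/s.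
  by rewrite -[X in _ --> X](mul0r ((s * 2 ^ s) ^ l)%:R); apply: cvgMl; exact: n_inv_exp.
apply: (@cvgn_ext _ (fun n => (#|[set p | @cyc _ l' (F n) p]%SET|%:R / n%:R ^+ ((k - 1) * l)
   - #|[set p | @cyc _ l' (F n) p & ~~ gen k (F n) p]%SET|%:R / n%:R ^+ ((k - 1) * l)) / (2 * l%:R))).
  move=> n; rewrite -mulrBl.
  have -> : #|[set p | @cyc _ l' (F n) p]%SET|%:R - #|[set p | @cyc _ l' (F n) p & ~~ gen k (F n) p]%SET|%:R
     = (2 * l * #|cycles k l' (F n)|)%:R :> R.
    rewrite -(card_gen l' k3 (kF n)); apply/eqP; rewrite subr_eq -natrD eqr_nat; apply/eqP.
    rewrite -(cardsID [set p | gen k (F n) p]%SET [set p | @cyc _ l' (F n) p]%SET).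
    congr (_ + _)%N; apply: eq_card => p; rewrite !finset.inE.
      by rewrite andb_idl // => /andP[].
    by rewrite andbC.
  rewrite !natrM; have l0 : (2 * l%:R : R) != 0 by rewrite mulf_neq0 ?pnatr_eq0.
  by move: (2 * l%:R) l0 => y l0; rewrite mulrC !mulrA mulVf // mul1r.
apply: cvgMl; rewrite -[X in _ --> X]subr0; exact: cvgB.
Unshelve. all: by end_near. Qed.

End CycleCount.

Section OverlapLimit.
Variables (R : realType) (k L : nat).
Hypothesis k3 : (2 < k)%N.
Variables (F : forall n, {set {set 'I_n}}) (m : nat -> nat).
Hypothesis kF : forall n, kunif k (F n).
Hypothesis mF : \forall n \near \oo, (m n <= #|F n|)%N.
Variable K : R.
Hypothesis density : ((m n)%:R / #|F n|%:R * n%:R ^+ (k - 1) : R) @[n --> \oo] --> K.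

Let n_inv_exp s : (((n.+1)%:R ^+ s / n%:R ^+ s.+1 : R)) @[n --> \oo] --> 0.
Proof.
apply: (@cvgn_near _ (fun n => (1 + n%:R^-1) ^+ s * n%:R^-1)); last first.
  rewrite -[X in _ --> X](mulr0 ((1 + 0) ^+ s)); apply: cvgM; last exact: cvgn_inv_nat.
  apply: cvgn_exp; apply: cvgD; [exact: cvg_cst|exact: cvgn_inv_nat].
near=> n.
have n0 : n%:R != 0 :> R by rewrite pnatr_eq0 -lt0n; near: n; exists 1%N.
rewrite exprS invfM mulrA [RHS]mulrAC -expr_div_n; congr (_ ^+ _ * _).
by rewrite -addn1 natrD mulrDl divff // mul1r.
Unshelve. all: by end_near. Qed.

Let pair_sum_le n (l1 l2 : nat) : (m n <= #|F n|)%N ->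
  \sum_(C in cycles k l1 (F n)) \sum_(U in cycles k l2 (F n) | (U != C) && ~~ [disjoint U & C]%B)
    psup R (F n) (m n) (C :|: U)%SET <=
  \sum_(t < l1.+2 + l2.+2)
    (n.+1%:R ^+ ((k - 1) * t.+1 - 1) * ((2 ^ (2 ^ ((k - 1) * t.+1 - 1))) ^ 2)%:R) *
    ((m n)%:R / #|F n|%:R) ^+ t.+1.
Proof.
move=> mFn; set Cy1 := cycles k l1 (F n); set Cy2 := cycles k l2 (F n).
have size1 (l : nat) C : C \in cycles k l (F n) -> #|C| = l.+2.
  by case/imsetP => p; rewrite finset.inE => gp ->; case/andP: (gp) => cp _; exact: (card_edges k3 (kF n) cp gp).
rewrite pair_big_dep /=.
pose S t := [set CU in finset.setX Cy1 Cy2 |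
      [&& CU.1 != CU.2, ~~ [disjoint CU.1 & CU.2] & #|CU.1 :|: CU.2| == t]]%SET.
apply: (@le_trans _ _ (\sum_(t < l1.+2 + l2.+2) \sum_(CU in S t.+1) ((m n)%:R / #|F n|%:R) ^+ t.+1)).
  under [leRHS]eq_bigr do rewrite big_mkcond.
  rewrite exchange_big /= big_mkcond /=; apply: ler_sum => -[C U] _ /=.
  have ge0 (t : 'I_(l1.+2 + l2.+2)) : 0 <= (if (C, U) \in S t.+1 then ((m n)%:R / #|F n|%:R) ^+ t.+1 else 0) :> R.
    by case: ifP => // _; rewrite exprn_ge0 ?divr_ge0.
  case: ifP => [/andP[C1 /andP[U2 /andP[UC dis]]]|_]; last by rewrite sumr_ge0.
  have c1 := size1 _ _ C1; have c2 := size1 _ _ U2.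
  have cpos : (0 < #|C :|: U|)%N by apply: (@leq_trans #|C|); [rewrite c1|apply: subset_leq_card; exact: finset.subsetUl].
  have cle : (#|C :|: U|.-1 < l1.+2 + l2.+2)%N.
    by rewrite prednK // -c1 -c2; exact: leq_card_setU.
  rewrite (bigD1 (Ordinal cle)) //= ifT; last first.
    by rewrite prednK // !finset.inE /= C1 U2 eq_sym UC disjoint_sym dis eqxx.
  rewrite prednK // -[leLHS]addr0 lerD ?psup_le // sumr_ge0 // => t _.
apply: ler_sum => t _; rewrite sumr_const -[X in X <= _]mulr_natl ler_wpM2r ?exprn_ge0 ?divr_ge0 //.
rewrite -natrX -natrM ler_nat; have := card_overlap_pairs k3 (kF n) l1 l2 t.+1.
by rewrite card_ord.
Qed.

(** Pairs are sorted by the number t of edges in their union: at most of order n ^ ((k - 1) t - 1)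
    pairs, each present with probability of order n ^ (- (k - 1) t), so every term is O(1 / n). *)
Lemma overlap_lim (i : 'I_L) :
  overlap_mean R (F n) (m n) (fun j : 'I_L => cycles k j (F n)) i @[n --> \oo] --> 0.
Proof.
apply: (@cvgn_le0 _ _ (fun n => \sum_(j < L) \sum_(t < i.+2 + j.+2)
    (n.+1%:R ^+ ((k - 1) * t.+1 - 1) * ((2 ^ (2 ^ ((k - 1) * t.+1 - 1))) ^ 2)%:R) *
    ((m n)%:R / #|F n|%:R) ^+ t.+1)).
  near=> n; have mFn : (m n <= #|F n|)%N by near: n.
  rewrite ger0_norm; last first.
    by rewrite /overlap_mean !sumr_ge0 // => C _; rewrite sumr_ge0 // => j _; rewrite sumr_ge0 // => U _; exact: psup_ge0.
  rewrite /overlap_mean exchange_big /=; apply: ler_sum => j _; exact: pair_sum_le.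
rewrite [X in _ --> X](_ : _ = \sum_(j < L) \sum_(t < i.+2 + j.+2) 0); last by rewrite big1 // => j _; rewrite big1.
apply: cvgn_sum => j _; apply: cvgn_sum => t _.
set s := ((k - 1) * t.+1 - 1)%N; set c := ((2 ^ 2 ^ s) ^ 2)%N.
have es : ((k - 1) * t.+1 = s.+1)%N by have : (0 < (k - 1) * t.+1)%N; [rewrite muln_gt0 andbT; lia|rewrite /s; lia].
apply: (@cvgn_near _ (fun n => (n.+1%:R ^+ s / n%:R ^+ s.+1) * (c%:R *
   ((m n)%:R / #|F n|%:R * n%:R ^+ (k - 1)) ^+ t.+1))).
  near=> n.
  have n0 : n%:R ^+ s.+1 != 0 :> R by rewrite expf_neq0 // pnatr_eq0 -lt0n; near: n; exists 1%N.
  rewrite [in LHS]exprMn -exprM es; move: n0 (_ ^+ s) (_ ^+ t.+1) (c%:R).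
  move: (_ ^+ s.+1) => x x0 y z w; field; exact: x0.
rewrite -[X in _ --> X](mul0r (c%:R * K ^+ t.+1)); apply: cvgM; first exact: n_inv_exp.
by apply: cvgMr; apply: cvgn_exp.
Unshelve. all: by end_near. Qed.

End OverlapLimit.

Lemma density_alg (R : fieldType) (m n f c : R) : n != 0 -> m / n / (f / (c * n)) = m / f * c.
Proof. by move=> n0; rewrite invf_div; move: (f^-1) => y; field. Qed.

Section FamilyPoisson.
Variables (R : realType) (k L : nat).
Hypothesis k3 : (2 < k)%N.
Variables (F : forall n, {set {set 'I_n}}) (sigma : forall n, {ffun 'I_n -> bool}) (m : nat -> nat).
Variable g : nat -> bool -> bool -> nat.
Hypothesis kF : forall n, kunif k (F n).
Hypothesis F_pair : forall n (x y : 'I_n), x != y ->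
  #|[set f in F n | (x \in f) && (y \in f)]%SET| = g n (sigma n x) (sigma n y).
Hypothesis half : forall b, ((nclass (sigma n) b)%:R / n%:R : R) @[n --> \oo] --> (2^-1 : R).
Variables A B r phi : R.
Hypothesis g_lim : forall b b',
  ((g n b b')%:R / n%:R ^+ (k - 2) : R) @[n --> \oo] --> A + B * (chi R b * chi R b').
Hypothesis m_lim : ((m n)%:R / n%:R : R) @[n --> \oo] --> r.
Hypothesis r0 : 0 < r.
Hypothesis phi0 : 0 < phi.
Hypothesis F_lim : (#|F n|%:R / n%:R ^+ k : R) @[n --> \oo] --> phi.

Let K := r / phi.

Let n_pos : \forall n \near \oo, 0 < n%:R :> R.
Proof. by near=> n; rewrite ltr0n; near: n; exists 1%N. Unshelve. all: by end_near. Qed.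

Let density : ((m n)%:R / #|F n|%:R * n%:R ^+ (k - 1) : R) @[n --> \oo] --> K.
Proof.
apply: (@cvgn_near _ (fun n => (m n)%:R / n%:R * (#|F n|%:R / n%:R ^+ k)^-1)); last first.
  by apply: cvgM => //; apply: cvgV => //; rewrite gt_eqF.
near=> n; have n0 : n%:R != 0 :> R by rewrite gt_eqF //; near: n.
have -> : n%:R ^+ k = n%:R ^+ (k - 1) * n%:R :> R by rewrite -exprSr; congr (_ ^+ _); lia.
exact: density_alg.
Unshelve. all: by end_near. Qed.

Let ratio0 : ((m n)%:R / #|F n|%:R : R) @[n --> \oo] --> 0.
Proof.
apply: (@cvgn_near _ (fun n => (m n)%:R / #|F n|%:R * n%:R ^+ (k - 1) * (n%:R^-1) ^+ (k - 1))); last first.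
  rewrite -[X in _ --> X](mulr0 K); apply: cvgM; first exact: density.
  have -> : (0 : R) = 0 ^+ (k - 1) by rewrite expr0n; have -> : (k - 1 == 0)%N = false by lia.
  by apply: cvgn_exp; exact: cvgn_inv_nat.
near=> n; have n0 : n%:R != 0 :> R by rewrite gt_eqF //; near: n.
by rewrite exprVn mulfK // expf_neq0.
Unshelve. all: by end_near. Qed.

Let F_pos : \forall n \near \oo, 0 < #|F n|%:R :> R.
Proof.
near=> n; have n0 : 0 < n%:R :> R by near: n.
have h : 0 < #|F n|%:R / n%:R ^+ k :> R by near: n; exact: (cvgr_gt _ F_lim).
by move: h; rewrite pmulr_lgt0 // invr_gt0 exprn_gt0.
Unshelve. all: by end_near. Qed.

Let mF : \forall n \near \oo, (m n <= #|F n|)%N.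
Proof.
near=> n; have F0 : 0 < #|F n|%:R :> R by near: n.
have h : (m n)%:R / #|F n|%:R <= 1 :> R by near: n; exact: (cvgr_le _ ratio0).
by move: h; rewrite ler_pdivrMr // mul1r ler_nat.
Unshelve. all: by end_near. Qed.

Let m_infty M : \forall n \near \oo, (M <= m n)%N.
Proof.
near=> n; have n0 : 0 < n%:R :> R by near: n.
have h : r / 2 <= (m n)%:R / n%:R :> R.
  by near: n; apply: (cvgr_ge _ m_lim); rewrite gtr_pMr // invf_lt1 ?ltr1n.
have h2 : M%:R / (r / 2) <= n%:R :> R by near: n; exact: nbhs_infty_ger.
rewrite ler_pdivlMr // in h; rewrite ler_pdivrMr ?divr_gt0 // in h2.
by rewrite -(ler_nat R) (le_trans h2) // mulrC.
Unshelve. all: by end_near. Qed.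

Definition cyc_mean (i : 'I_L) : R := ((K * A) ^+ i.+2 + (K * B) ^+ i.+2) / (2 * i.+2%:R).

Lemma cycles_poisson (a : {ffun 'I_L -> nat}) : (forall i, 0 <= cyc_mean i) ->
  pcnt R (F n) (m n) (fun j : 'I_L => cycles k j (F n)) a @[n --> \oo] -->
  poisw cyc_mean a * expR (- \sum_i cyc_mean i).
Proof.
move=> mean0.
apply: (cycle_poisson (len := fun i : 'I_L => i.+2)) => //.
- move=> n i U /imsetP[p]; rewrite finset.inE => gp ->; apply: edges_sub; by case/andP: gp.
- move=> n i U /imsetP[p]; rewrite finset.inE => gp ->; case/andP: (gp) => cp _; exact: (card_edges k3 (kF n) cp gp).
- by move=> i j [] /val_inj.
- move=> i; rewrite /cyc_mean.
  have h := card_cycles_lim (l' := i) k3 kF F_pair half g_lim.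
  apply: (@cvgn_near _ (fun n => #|cycles k i (F n)|%:R / n%:R ^+ ((k - 1) * i.+2) *
     ((m n)%:R / #|F n|%:R * n%:R ^+ (k - 1)) ^+ i.+2)).
    near=> n; have n0 : n%:R != 0 :> R by rewrite gt_eqF //; near: n.
    rewrite [in LHS]exprMn -exprM; move: (expf_neq0 ((k - 1) * i.+2) n0).
    move: (_ ^+ ((k - 1) * i.+2)) => x x0; rewrite mulrA mulrAC; congr (_ * _).
    by rewrite divfK.
  rewrite [X in _ --> X](_ : _ = (A ^+ i.+2 + B ^+ i.+2) / (2 * i.+2%:R) * K ^+ i.+2); last first.
    by rewrite !exprMn; ring.
  by apply: cvgM => //; apply: cvgn_exp; exact: density.
- by move=> i; apply: overlap_lim density _.
Unshelve. all: by end_near. Qed.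

End FamilyPoisson.

Section Planted.
Variables (R : realType) (k : nat) (d : R).
Hypothesis k3 : (2 < k)%N.
Hypothesis d0 : 0 < d.

Definition medges n := `|Num.ceil (d * n%:R / k%:R)|%N.

Let k0 : 0 < k%:R :> R. Proof. by rewrite ltr0n; lia. Qed.

Let fE : (k`!%:R : R) = k%:R * ((k%:R - 1) * (k - 2)`!%:R).
Proof.
rewrite -[X in _ - X]/(1%:R) -natrB; last by lia.
rewrite -!natrM; congr (_%:R); case: k k3 => [|[|k']] // _.
by rewrite !factS subn1 subn2.
Qed.

Lemma medges_bounds n : d / k%:R * n%:R <= (medges n)%:R < d / k%:R * n%:R + 1.
Proof.
have h : 0 <= d * n%:R / k%:R by rewrite divr_ge0 ?mulr_ge0 // ltW.
rewrite mulrAC /medges natr_absz ger0_norm; last first.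
  by rewrite archimedean.Num.Theory.ceil_ge0 (lt_le_trans _ h).
rewrite archimedean.Num.Theory.ceil_ge /=.
have := archimedean.Num.Theory.ceilB1_lt (d * n%:R / k%:R).
by rewrite rmorphB /= ltrBlDr.
Qed.

Lemma medges_lim : ((medges n)%:R / n%:R : R) @[n --> \oo] --> d / k%:R.
Proof.
apply: (squeeze_cvgr (f := fun=> d / k%:R) (h := fun n => d / k%:R + n%:R^-1)).
- near=> n; have n0 : 0 < n%:R :> R by rewrite ltr0n; near: n; exists 1%N.
  case/andP: (medges_bounds n) => h1 h2.
  rewrite ler_pdivlMr // h1 /= ler_pdivrMr // mulrDl mulVf ?gt_eqF //; exact: ltW.
- exact: cvg_cst.
- rewrite -[X in _ --> X]addr0; apply: cvgD; [exact: cvg_cst|exact: cvgn_inv_nat].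
Unshelve. all: by end_near. Qed.

Lemma nat_ratio_ge (c : R) (x : nat -> nat) l : 0 < c ->
  ((x n)%:R / n%:R : R) @[n --> \oo] --> c -> \forall n \near \oo, (l <= x n)%N.
Proof.
move=> c0 hx; near=> n.
have n0 : 0 < n%:R :> R by rewrite ltr0n; near: n; exists 1%N.
have h : c / 2 <= (x n)%:R / n%:R :> R.
  by near: n; apply: (cvgr_ge _ hx); rewrite gtr_pMr // invf_lt1 ?ltr1n.
have h2 : l%:R / (c / 2) <= n%:R :> R by near: n; exact: nbhs_infty_ger.
rewrite ler_pdivlMr // in h; rewrite ler_pdivrMr ?divr_gt0 // in h2.
by rewrite -(ler_nat R) (le_trans h2) // mulrC.
Unshelve. all: by end_near. Qed.

Lemma bin_lim (c : R) (x : nat -> nat) l : 0 < c ->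
  ((x n)%:R / n%:R : R) @[n --> \oo] --> c ->
  ('C(x n, l)%:R / n%:R ^+ l : R) @[n --> \oo] --> c ^+ l / l`!%:R.
Proof.
move=> c0 hx.
have h : (((x n) ^_ l)%:R / n%:R ^+ l : R) @[n --> \oo] --> c ^+ l.
  by apply: (@ffact_ratio_cvg R l c x id) => //; [exact: (nat_ratio_ge l c0 hx)|exact: cvgn_inv_nat].
apply: (@cvgn_ext _ (fun n => ((x n) ^_ l)%:R / n%:R ^+ l / l`!%:R)); last by apply: cvgMl.
move=> n; rewrite -bin_ffact natrM mulrAC mulfK // pnatr_eq0 -lt0n fact_gt0 //.
Qed.

Lemma ratio_sub2 (c : R) (x : nat -> nat) : 0 < c ->
  ((x n)%:R / n%:R : R) @[n --> \oo] --> c -> ((x n - 2)%N%:R / n%:R : R) @[n --> \oo] --> c.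
Proof.
move=> c0 hx; apply: (@cvgn_near _ (fun n => (x n)%:R / n%:R - 2 * n%:R^-1)); last first.
  rewrite -[X in _ --> X]subr0; apply: cvgB => //.
  by rewrite -[X in _ --> X](mulr0 2); apply: cvgMr; exact: cvgn_inv_nat.
near=> n; rewrite natrB ?mulrBl //; near: n; exact: (nat_ratio_ge _ c0 hx).
Unshelve. all: by end_near. Qed.

Lemma ratio_self : (n%:R / n%:R : R) @[n --> \oo] --> (1 : R).
Proof.
apply: (@cvgn_near _ (fun=> 1)); last exact: cvg_cst.
near=> n; rewrite divff // pnatr_eq0 -lt0n; near: n; by exists 1%N.
Unshelve. all: by end_near. Qed.

Variable L : nat.
Variable sigma : forall n, {ffun 'I_n -> bool}.
Hypothesis half : ((nclass (sigma n) true)%:R / n%:R : R) @[n --> \oo] --> (2^-1 : R).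

Let halfb b : ((nclass (sigma n) b)%:R / n%:R : R) @[n --> \oo] --> (2^-1 : R).
Proof.
case: b => //.
apply: (@cvgn_ext _ (fun n => n%:R / n%:R - (nclass (sigma n) true)%:R / n%:R)).
  by move=> n; rewrite -mulrBl -{1}(card_colour_classes (sigma n)) natrD addrAC subrr add0r.
rewrite [X in _ --> X](_ : _ = 1 - 2^-1); last by field.
apply: cvgB => //; exact: ratio_self.
Qed.

Let q : R := 2^-1 ^+ (k - 1).

Let q_lt1 : q < 1.
Proof. by rewrite /q exprn_ilt1 ?invr_ge0 ?invf_lt1 ?ltr1n //; lia. Qed.

Let q_gt0 : 0 < q. Proof. by rewrite exprn_gt0 // invr_gt0. Qed.

(** Here is the origin of delta. With q = 2 ^ (1 - k), an edge through two given vertices is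
    bichromatic with limiting probability 1 if their colours differ and 1 - 2 q if they agree, so A
    is proportional to 1 - q and B to - q. The ratio B / A is - 1 / (2 ^ (k - 1) - 1), and delta_l
    is its l-th power. *)
Lemma poisson_mean_planted (i : nat) :
  ((d / k%:R / ((1 - q) / k`!%:R) * ((1 - q) / (k - 2)`!%:R)) ^+ i.+2 +
   (d / k%:R / ((1 - q) / k`!%:R) * (- q / (k - 2)`!%:R)) ^+ i.+2) / (2 * i.+2%:R)
  = lambda k d i.+2 * (1 + delta R k i.+2).
Proof.
have q1 : 1 - q != 0 by rewrite subr_eq0 gt_eqF.
have f0 : ((k - 2)`!%:R : R) != 0 by rewrite pnatr_eq0 -lt0n fact_gt0.

have k1 : (k%:R - 1 : R) != 0.
  by rewrite subr_eq0 (eqr_nat _ k 1); apply/eqP; lia.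
have kn0 : (k%:R : R) != 0 by rewrite gt_eqF.
have e1 : d / k%:R / ((1 - q) / k`!%:R) * ((1 - q) / (k - 2)`!%:R) = d * (k%:R - 1).
  rewrite fE; move: (k%:R : R) ((k - 2)`!%:R) q kn0 k1 f0 q1 => x y z x0 x1 y0 z1.
  by field; rewrite ?x0 ?x1 ?y0 ?z1.
have Q1 : (2 ^+ (k - 1) - 1 : R) != 0.
  by rewrite subr_eq0 gt_eqF // exprn_egt1 ?ltr1n //; lia.
have e2 : d / k%:R / ((1 - q) / k`!%:R) * (- q / (k - 2)`!%:R) = d * (k%:R - 1) * (-1 / (2 ^+ (k - 1) - 1)).
  have qE : q = (2 ^+ (k - 1))^-1 by rewrite /q exprVn.
  have Q0 : (2 ^+ (k - 1) : R) != 0 by rewrite expf_neq0.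
  rewrite fE; move: q1; rewrite qE.
  move: (k%:R : R) ((k - 2)`!%:R) (2 ^+ (k - 1)) kn0 k1 f0 Q0 Q1 => x y z x0 x1 y0 z0 z1 w1.
  by field; rewrite ?x0 ?x1 ?y0 ?z0 ?z1.
rewrite e1 e2 /lambda /delta; move: (d * (k%:R - 1)) (2 ^+ (k - 1) - 1) => X Y.
by rewrite exprMn expr_div_n; ring.
Qed.

Lemma lambda_ge0 l : 0 <= lambda k d l.
Proof.
rewrite /lambda divr_ge0 ?mulr_ge0 // exprn_ge0 // mulr_ge0 ?(ltW d0) //.
by rewrite subr_ge0 ler1n; lia.
Qed.

Lemma norm_delta_le1 l : `|delta R k l| <= 1.
Proof.
have Q1 : 1 <= 2 ^+ (k - 1) - 1 :> R.
  rewrite lerBrDr; apply: (@le_trans _ _ (2 ^+ 1)); first by rewrite expr1.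
  by rewrite ler_eXn2l ?ltr1n //; lia.
rewrite /delta normrM normrX normrN1 expr1n mul1r normfV normrX ger0_norm; last exact: le_trans Q1.
by rewrite invf_le1 ?exprn_ege1 // exprn_gt0 // (lt_le_trans _ Q1).
Qed.

Lemma delta_ge l : 0 <= 1 + delta R k l.
Proof. by have := norm_delta_le1 l; rewrite ler_norml => /andP[h _]; rewrite addrC -lerBlDr sub0r. Qed.

Lemma planted_poisson (a : {ffun 'I_L -> nat}) :
  pcnt R (bichromatic k (sigma n)) (medges n)
    (fun j : 'I_L => cycles k j (bichromatic k (sigma n))) a @[n --> \oo] -->
  poisw (fun i => lambda k d i.+2 * (1 + delta R k i.+2)) a *
  expR (- \sum_(i < L) lambda k d i.+2 * (1 + delta R k i.+2)).
Proof.
pose A := (1 - q) / (k - 2)`!%:R; pose B := - q / (k - 2)`!%:R.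
pose phi := (1 - q) / k`!%:R.
pose g n b b' := ('C(n - 2, k - 2) -
   (if b == b' then 'C(nclass (sigma n) b - 2, k - 2) else 0))%N.
have meanE : cyc_mean A B (d / k%:R) phi =
    (fun i : 'I_L => lambda k d i.+2 * (1 + delta R k i.+2)).
  by apply/funext => i; rewrite /cyc_mean; exact: poisson_mean_planted.
have q2 : 2 * q = 2^-1 ^+ (k - 2).
  rewrite /q (_ : (k - 1 = (k - 2).+1)%N); last by lia.
  by rewrite exprS mulrA mulfV ?mul1r.
have -> : \sum_(i < L) lambda k d i.+2 * (1 + delta R k i.+2) =
    \sum_(i < L) cyc_mean A B (d / k%:R) phi i by rewrite meanE.
rewrite -meanE; apply: (@cycles_poisson R k L k3 (fun n => bichromatic k (sigma n)) sigma medges g _ _ _ A B (d / k%:R) phi).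
- by move=> n; exact: kunif_bichromatic.
- move=> n x y xy; exact: bichromatic_pair.
- exact: halfb.
- move=> b b'.
  have hn : ('C(n - 2, k - 2)%:R / n%:R ^+ (k - 2) : R) @[n --> \oo] --> (1 / (k - 2)`!%:R : R).
    rewrite -[X in X / _](expr1n _ (k - 2)); apply: bin_lim => //.
    by apply: ratio_sub2 => //; exact: ratio_self.
  have hb : ('C(nclass (sigma n) b - 2, k - 2)%:R / n%:R ^+ (k - 2) : R) @[n --> \oo] -->
     (2^-1 ^+ (k - 2) / (k - 2)`!%:R : R).
    by apply: bin_lim => //; apply: ratio_sub2 => //; exact: halfb.
  have ncl n : (nclass (sigma n) b <= n)%N.
    by rewrite -[X in (_ <= X)%N](card_ord n); exact: max_card.
  apply: (@cvgn_ext _ (fun n => 'C(n - 2, k - 2)%:R / n%:R ^+ (k - 2) -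
     (b == b')%:R * ('C(nclass (sigma n) b - 2, k - 2)%:R / n%:R ^+ (k - 2)))).
    move=> n; rewrite /g; case: (b == b'); rewrite ?mul1r ?mul0r ?subr0 ?subn0 //.
    by rewrite natrB ?mulrBl // leq_bin2l // leq_sub2r.
  rewrite [X in _ --> X](_ : _ = 1 / (k - 2)`!%:R - (b == b')%:R * (2^-1 ^+ (k - 2) / (k - 2)`!%:R)).
    by apply: cvgB => //; apply: cvgMr.
  rewrite -q2 /A /B /chi; case: b {hb ncl}; case: b' => /=; rewrite ?expr0 ?expr1; ring.
- exact: medges_lim.
- by rewrite divr_gt0.
- by rewrite /phi divr_gt0 ?ltr0n ?fact_gt0 // subr_gt0.
- have h1 : ('C(n, k)%:R / n%:R ^+ k : R) @[n --> \oo] --> (1 / k`!%:R : R).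
    by rewrite -[X in X / _](expr1n _ k); apply: bin_lim => //; exact: ratio_self.
  have h2 b : ('C(nclass (sigma n) b, k)%:R / n%:R ^+ k : R) @[n --> \oo] --> (2^-1 ^+ k / k`!%:R : R).
    by apply: bin_lim => //; exact: halfb.
  apply: (@cvgn_ext _ (fun n => 'C(n, k)%:R / n%:R ^+ k - ('C(nclass (sigma n) true, k)%:R / n%:R ^+ k +
     'C(nclass (sigma n) false, k)%:R / n%:R ^+ k))).
    move=> n; rewrite -mulrDl -mulrBl -(card_bichromatic k3 (sigma n)) !natrD; congr (_ / _).
    by rewrite addrK.
  rewrite [X in _ --> X](_ : _ = 1 / k`!%:R - (2^-1 ^+ k / k`!%:R + 2^-1 ^+ k / k`!%:R)).
    by apply: cvgB => //; apply: cvgD.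
  rewrite /phi /q (_ : 2^-1 ^+ (k - 1) = 2 * 2^-1 ^+ k); first by ring.
  by rewrite -[in RHS](subnK (ltnW (ltnW k3))) exprD expr1 mulrC -mulrA mulVf ?mulr1.
- by move=> i; rewrite meanE mulr_ge0 ?lambda_ge0 ?delta_ge.
Qed.

Lemma null_poisson (a : {ffun 'I_L -> nat}) :
  pcnt R (ksets n k) (medges n) (fun j : 'I_L => cycles k j (ksets n k)) a @[n --> \oo] -->
  poisw (fun i => lambda k d i.+2) a * expR (- \sum_(i < L) lambda k d i.+2).
Proof.
pose A : R := 1 / (k - 2)`!%:R; pose phi : R := 1 / k`!%:R.
pose g n (b b' : bool) := 'C(n - 2, k - 2).
have f0 : ((k - 2)`!%:R : R) != 0 by rewrite pnatr_eq0 -lt0n fact_gt0.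
have meanE : cyc_mean A 0 (d / k%:R) phi = (fun i : 'I_L => lambda k d i.+2).
  apply/funext => i; rewrite /cyc_mean /phi /A /lambda mulr0 [0 ^+ _]expr0n addr0; congr (_ ^+ _ / _).
  have -> : (k`!%:R : R) = k%:R * ((k%:R - 1) * (k - 2)`!%:R).
    exact: fE.
  have kn0 : (k%:R : R) != 0 by rewrite gt_eqF.
  have k1 : (k%:R - 1 : R) != 0.
    by rewrite subr_eq0 (eqr_nat _ k 1); apply/eqP; lia.
  move: (k%:R : R) ((k - 2)`!%:R) kn0 k1 f0 => x y x0 x1 y0.
  by field; rewrite ?x0 ?x1 ?y0.
have -> : \sum_(i < L) lambda k d i.+2 = \sum_(i < L) cyc_mean A 0 (d / k%:R) phi i by rewrite meanE.
rewrite -meanE; apply: (@cycles_poisson R k L k3 (fun n => ksets n k) sigma medges g _ _ _ A 0 (d / k%:R) phi).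
- by move=> n; exact: kunif_ksets.
- move=> n x y xy; exact: ksets_pair.
- exact: halfb.
- move=> b b'; rewrite mul0r addr0 /A -[X in X / _](expr1n _ (k - 2)); apply: bin_lim => //.
  by apply: ratio_sub2 => //; exact: ratio_self.
- exact: medges_lim.
- by rewrite divr_gt0.
- by rewrite /phi divr_gt0 ?ltr0n ?fact_gt0.
- under eq_fun do rewrite card_ksets.
  by rewrite /phi -[X in X / _](expr1n _ k); apply: bin_lim => //; exact: ratio_self.
- by move=> i; rewrite meanE lambda_ge0.
Qed.

End Planted.

(** * An entropy inequality *)

Section Calculus.
Variable R : realType.
Implicit Types (f df : R -> R) (x w : R).

Lemma deriv_nondecr f df w : 0 <= w ->
  (forall x, 0 <= x <= w -> is_derive x (1 : R) f (df x)) ->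
  (forall x, 0 <= x <= w -> 0 <= df x) -> f 0 <= f w.
Proof.
move=> w0 hf hdf.
have [c cw E] := @MVT_segment R f df 0 w w0
  (fun x xw => hf x ltac:(by move: xw; rewrite in_itv /= => /andP[/ltW-> /ltW->]))
  ltac:(by apply: derivable_within_continuous => x; rewrite in_itv /= => xw; case: (hf x xw)).
rewrite -subr_ge0 E subr0 mulr_ge0 // hdf //.
Qed.

Lemma is_derive_1D x : is_derive x (1 : R) (fun y : R => 1 + y) 1.
Proof.
have := is_deriveD (is_derive_cst (1 : R) x 1) (is_derive_id x (1 : R)).
by rewrite add0r.
Qed.

Lemma is_derive_1B x : is_derive x (1 : R) (fun y : R => 1 - y) (-1).
Proof.
have := is_deriveB (is_derive_cst (1 : R) x 1) (is_derive_id x (1 : R)).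
by rewrite add0r.
Qed.

Lemma is_derive_ln1D x : -1 < x -> is_derive x (1 : R) (fun y => ln (1 + y)) (1 + x)^-1.
Proof.
move=> x1; have h1 := is_derive_1D x.
have h2 := @is_derive1_ln R (1 + x) ltac:(lra).
have := @is_derive1_comp R (@ln R) (fun y => 1 + y) x _ _ h2 h1.
by rewrite mulr1.
Qed.

Lemma is_derive_ln1B x : x < 1 -> is_derive x (1 : R) (fun y => ln (1 - y)) (- (1 - x)^-1).
Proof.
move=> x1; have h1 := is_derive_1B x.
have h2 := @is_derive1_ln R (1 - x) ltac:(lra).
have := @is_derive1_comp R (@ln R) (fun y => 1 - y) x _ _ h2 h1.
by rewrite mulrN1.
Qed.

(* ln 2 minus the entropy of a bit of bias w *)
Definition Ient w : R := ((1 + w) * ln (1 + w) + (1 - w) * ln (1 - w)) / 2.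

(** Taylor polynomial of [Ient] at 0. Its first derivative is a Taylor polynomial of atanh and its
    second a geometric sum, so integrating twice shows that it lies below [Ient]. *)
Definition Ipart J w : R := \sum_(1 <= j < J.+1) w ^+ (2 * j) / (2 * j * (2 * j - 1))%:R.

Definition dIpart J w : R := \sum_(1 <= j < J.+1) w ^+ (2 * j - 1) / (2 * j - 1)%:R.

Definition ddIpart J w : R := \sum_(1 <= j < J.+1) w ^+ (2 * j - 2).

Lemma is_derive_pow x n : is_derive x (1 : R) (fun y : R => y ^+ n.+1) (n.+1%:R * x ^+ n).
Proof.
have := @is_deriveX R R id n.+1 x 1 1 (is_derive_id x 1).
rewrite (_ : id ^+ n.+1 = fun y : R => y ^+ n.+1); last first.
  by apply/funext => y; elim: n.+1 => [|i IH]; rewrite ?expr0 // !exprS -IH.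
by rewrite /GRing.scale /= mulr1.
Qed.

Lemma is_derive_bigsum (r : seq nat) (F dF : nat -> R -> R) x :
  (forall i, is_derive x (1 : R) (F i) (dF i x)) ->
  is_derive x (1 : R) (fun y => \sum_(i <- r) F i y) (\sum_(i <- r) dF i x).
Proof.
move=> h; elim: r => [|i r IH].
  rewrite big_nil (_ : (fun y => _) = fun=> 0); first exact: is_derive_cst.
  by apply/funext => y; rewrite big_nil.
rewrite big_cons (_ : (fun y => _) = F i + (fun y => \sum_(j <- r) F j y)); last first.
  by apply/funext => y; rewrite big_cons.
exact: is_deriveD.
Qed.

Lemma is_derive_scale x f (df c : R) :
  is_derive x (1 : R) f df -> is_derive x (1 : R) (fun y => f y * c) (df * c).
Proof.
move=> h; have := @is_deriveZ R R R f c x 1 df h.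
rewrite (_ : c \*: f = fun y => f y * c); last by apply/funext => y; rewrite /= mulrC.
by rewrite [c *: df]mulrC.
Qed.

Lemma is_derive_dIpart J x : is_derive x (1 : R) (dIpart J) (ddIpart J x).
Proof.
rewrite /dIpart /ddIpart !big_nat; rewrite -!big_nat.
rewrite (eq_big_nat _ _ (F2 := fun j => ((2 * j - 1)%N%:R * x ^+ (2 * j - 1).-1) / (2 * j - 1)%:R)); last first.
  move=> j /andP[j1 _]; rewrite mulrAC mulfV ?mul1r; last by rewrite pnatr_eq0; apply/eqP; lia.
  by congr (_ ^+ _); lia.
apply: (is_derive_bigsum _ (F := fun j y => y ^+ (2 * j - 1) / (2 * j - 1)%:R)
   (dF := fun j y => (2 * j - 1)%N%:R * y ^+ (2 * j - 1).-1 / (2 * j - 1)%:R)) => j.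
apply: is_derive_scale; case: (2 * j - 1)%N => [|n]; last exact: is_derive_pow.
rewrite mul0r (_ : (fun y => _) = fun=> 1); first exact: is_derive_cst.
by apply/funext => y; rewrite expr0.
Qed.

Lemma is_derive_Ipart J x : is_derive x (1 : R) (Ipart J) (dIpart J x).
Proof.
rewrite /Ipart /dIpart.
rewrite (eq_big_nat _ _ (F2 := fun j => ((2 * j)%N%:R * x ^+ (2 * j).-1) / (2 * j * (2 * j - 1))%:R)); last first.
  move=> j /andP[j1 _]; rewrite (natrM _ (2 * j) (2 * j - 1)) invfM mulrA [(2 * j)%:R * _]mulrC mulfK ?subn1 //.
  by rewrite pnatr_eq0; apply/eqP; lia.
apply: (is_derive_bigsum _ (F := fun j y => y ^+ (2 * j) / (2 * j * (2 * j - 1))%:R)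
   (dF := fun j y => (2 * j)%N%:R * y ^+ (2 * j).-1 / (2 * j * (2 * j - 1))%:R)) => j.
apply: is_derive_scale; case: (2 * j)%N => [|n]; last exact: is_derive_pow.
rewrite mul0r (_ : (fun y => _) = fun=> 1); first exact: is_derive_cst.
by apply/funext => y; rewrite expr0.
Qed.

Definition atanhR w : R := (ln (1 + w) - ln (1 - w)) / 2.

Lemma is_derive_atanh x : -1 < x < 1 -> is_derive x (1 : R) atanhR ((1 - x ^+ 2)^-1).
Proof.
move=> /andP[x1 x2].
have h := is_derive_scale 2^-1 (is_deriveB (is_derive_ln1D x1) (is_derive_ln1B x2)).
apply: (is_derive_eq h); rewrite opprK.
have h1 : 1 + x != 0 by lra. have h2 : 1 - x != 0 by lra.
have h3 : 1 - x ^+ 2 != 0 by rewrite (_ : 1 - x ^+ 2 = (1 - x) * (1 + x)) ?mulf_neq0 //; ring.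
by field; rewrite ?h1 ?h2 ?h3.
Qed.

Lemma is_derive_Ient x : -1 < x < 1 -> is_derive x (1 : R) Ient (atanhR x).
Proof.
move=> /andP[x1 x2].
have i1 := is_derive_1D x; have i2 := is_derive_1B x.
have h := is_derive_scale 2^-1 (is_deriveD (is_deriveM i1 (is_derive_ln1D x1)) (is_deriveM i2 (is_derive_ln1B x2))).
apply: (is_derive_eq h); rewrite /atanhR; congr (_ / 2).
rewrite /GRing.scale /=.
have h1 : 1 + x != 0 by lra. have h2 : 1 - x != 0 by lra.
by field; rewrite ?h1 ?h2.
Qed.

Lemma ddIpart_le J x : 0 <= x -> x < 1 -> ddIpart J x <= (1 - x ^+ 2)^-1.
Proof.
move=> x0 x1.
have h2 : 0 < 1 - x ^+ 2 by rewrite subr_gt0 expr_lt1.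
suff -> : ddIpart J x = (1 - (x ^+ 2) ^+ J) / (1 - x ^+ 2).
  by rewrite -[leRHS]mul1r ler_pM2r ?invr_gt0 // gerBl exprn_ge0 // exprn_ge0.
rewrite /ddIpart; elim: J => [|J IH]; first by rewrite big_geq // expr0 subrr mul0r.
rewrite big_nat_recr //= IH mulnSr addnK exprM [in RHS]exprS.
move: (x ^+ 2) h2 => y h2; by field; rewrite gt_eqF.
Qed.

Lemma dIpart_le J x : 0 <= x -> x < 1 -> dIpart J x <= atanhR x.
Proof.
move=> x0 x1; rewrite -subr_ge0.
have -> : 0 = atanhR 0 - dIpart J 0.
  rewrite /atanhR addr0 subr0 subrr mul0r /dIpart big_nat big1 ?subrr // => j /andP[j1 _].
  by rewrite (_ : (2 * j - 1 = (2 * j - 2).+1)%N) ?exprS ?mul0r //; lia.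
apply: (@deriv_nondecr (atanhR - dIpart J) (fun y => (1 - y ^+ 2)^-1 - ddIpart J y)) => // y /andP[y0 yx].
  apply: is_deriveB; last exact: is_derive_dIpart.
  by apply: is_derive_atanh; lra.
by rewrite subr_ge0 ddIpart_le //; lra.
Qed.

Lemma Ipart_le J x : 0 <= x -> x < 1 -> Ipart J x <= Ient x.
Proof.
move=> x0 x1; rewrite -subr_ge0.
have -> : 0 = Ient 0 - Ipart J 0.
  rewrite /Ient addr0 subr0 ln1 mulr0 addr0 mul0r /Ipart big_nat big1 ?subrr // => j /andP[j1 _].
  by rewrite (_ : (2 * j = (2 * j - 1).+1)%N) ?exprS ?mul0r //; lia.
apply: (@deriv_nondecr (Ient - Ipart J) (fun y => atanhR y - dIpart J y)) => // y /andP[y0 yx].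
  apply: is_deriveB; last exact: is_derive_Ipart.
  by apply: is_derive_Ient; lra.
by rewrite subr_ge0 dIpart_le //; lra.
Qed.

Lemma Ient1 : Ient 1 = ln 2.
Proof. by rewrite /Ient subrr mul0r addr0 mulrAC (_ : 1 + 1 = 2) // mulfV ?mul1r. Qed.

Lemma IentN w : Ient (- w) = Ient w.
Proof. by rewrite /Ient opprK addrC. Qed.

Lemma atanh_third : atanhR 3^-1 = ln 2 / 2.
Proof.
rewrite /atanhR -ln_div ?posrE; [|lra|lra].
by congr (ln _ / 2); field.
Qed.

Lemma ln2_ge : 69 / 100 <= ln 2 :> R.
Proof.
have := @dIpart_le 2 3^-1 ltac:(lra) ltac:(lra).
rewrite atanh_third /dIpart unlock /= !muln1 !addr0 => h.
have : 3^-1 ^+ 1 / 1 + 3^-1 ^+ 3 / 3 <= ln 2 / 2 :> R by [].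
lra.
Qed.

Lemma ln2_le : ln 2 <= 694 / 1000 :> R.
Proof.
suff : 0 <= 3^-1 + 3^-1 ^+ 3 / 3 + 3^-1 ^+ 5 * (9 / 40) - atanhR 3^-1 :> R.
  by rewrite atanh_third; lra.
(* The constant 9/40 bounds the remainder of the atanh series on [0, 1/3]: differentiating y ^ 5 *
   (9 / 40) gives 9/8 * y ^ 4, and 9/8 is the value of 1 / (1 - y ^ 2) at y = 1/3. *)
pose f := (fun y : R => dIpart 2 y + y ^+ 5 * (9 / 40)) - atanhR.
have fE y : f y = y + y ^+ 3 / 3 + y ^+ 5 * (9 / 40) - atanhR y.
  have d2 : dIpart 2 y = y + y ^+ 3 / 3 by rewrite /dIpart big_nat_recr //= big_nat1 divr1.
  by rewrite (_ : f y = dIpart 2 y + y ^+ 5 * (9 / 40) - atanhR y) // d2.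
rewrite -fE; have {1}-> : 0 = f 0.
  by rewrite fE /atanhR !expr0n /= !(addr0, subr0, mul0r, subrr).
apply: (@deriv_nondecr f (fun y => ddIpart 2 y + (5%:R * y ^+ 4) * (9 / 40) - (1 - y ^+ 2)^-1)); first by lra.
  move=> y hy; apply: is_deriveB; last by apply: is_derive_atanh; lra.
  by apply: is_deriveD; [exact: is_derive_dIpart | apply: is_derive_scale; exact: is_derive_pow].
move=> y /andP[y0 y1].
have y2 : y ^+ 2 <= 1 / 9 by have := lerXn2r 2 y0 (_ : (3^-1 : R) \in Num.nneg) y1; rewrite ?nnegrE; lra.
have -> : ddIpart 2 y = 1 + y ^+ 2.
  by rewrite /ddIpart unlock /= !muln1 addr0.
have h2 : 0 < 1 - y ^+ 2 by lra.
have -> : 1 + y ^+ 2 + 5%:R * y ^+ 4 * (9 / 40) - (1 - y ^+ 2)^-1 = y ^+ 4 * (9 / 8 - (1 - y ^+ 2)^-1).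
  by field; rewrite gt_eqF.
rewrite mulr_ge0 ?exprn_ge0 // subr_ge0 -[leRHS]invrK lef_pV2 ?posrE ?invr_gt0; lra.
Qed.

Lemma Ient_ge_poly w z : 0 <= w <= 1 -> z = w ^+ 2 ->
  z / 2 + z ^+ 2 / 12 + z ^+ 3 / 30 + z ^+ 4 / 56 + z ^+ 5 / 90 + z ^+ 6 / 132 + z ^+ 7 / 182
   + z ^+ 8 / 240 + z ^+ 9 / 306 + z ^+ 10 / 380 <= Ient w.
Proof.
move=> /andP[w0 w1] zE; have [wE|w1'] := eqVneq w 1.
  by rewrite zE wE Ient1 !expr1n; have := ln2_ge; lra.
have {}w1 : w < 1 by rewrite lt_neqAle w1'.
apply: le_trans (Ipart_le 10 w0 w1); rewrite /Ipart unlock /= zE !exprM.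
by rewrite !muln1 !addr0 -!addrA.
Qed.

Lemma Ient_ge_sq w : -1 <= w <= 1 -> w ^+ 2 / 2 <= Ient w.
Proof.
move=> /andP[w1 w2].
have key v : 0 <= v <= 1 -> v ^+ 2 / 2 <= Ient v.
  move=> hv; apply: le_trans (Ient_ge_poly hv erefl).
  have h n : 0 <= (v ^+ 2) ^+ n by rewrite !exprn_ge0 //; case/andP: hv.
  have := (h 2, h 3, h 4, h 5, h 6, h 7, h 8, h 9, h 10)%N.
  move=> [[[[[[[[]]]]]]]]; lra.
have [w0|w0] := leP 0 w; first by apply: key; rewrite w0.
by rewrite -IentN -sqrrN; apply: key; lra.
Qed.

(** With e = (1 - w) / 2 the claim reads H(e) <= s e + exp (- s) for the binary entropy H. Indeed -
    (1 - e) ln (1 - e) <= e, and e - e ln e - s e is maximal at e = exp (- s), with value exp (- s).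
    This controls [Ient] near w = 1, where Taylor polynomials are too weak. *)
Lemma Ient_ge_tangent w s : 0 <= w <= 1 ->
  ln 2 - s * ((1 - w) / 2) - expR (- s) <= Ient w.
Proof.
move=> /andP[w0 w1].
have l1 x : 0 < x -> ln x <= x - 1.
  by move=> x0; have := @le_ln1Dx R (x - 1) ltac:(lra); rewrite addrC subrK.
set e := (1 - w) / 2.
have E1 : 1 + w = 2 * (1 - e) by rewrite /e; field.
have E2 : 1 - w = 2 * e by rewrite /e; field.
have e1 : 0 < 1 - e by rewrite /e; lra.
have ha : ln 2 - e <= (1 + w) * ln (1 + w) / 2 + e * ln 2.
  rewrite E1 lnM ?posrE //.
  have := l1 (1 - e)^-1 ltac:(by rewrite invr_gt0); rewrite lnV ?posrE // => h.
  have : (1 - e) * (- ln (1 - e)) <= e.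
    apply: (le_trans (ler_wpM2l (ltW e1) h)).
    by rewrite mulrBr mulfV ?gt_eqF // mulr1; lra.
  rewrite (_ : 2 * (1 - e) * (ln 2 + ln (1 - e)) / 2 = (1 - e) * (ln 2 + ln (1 - e))); last by field.
  lra.
have hb : e * ln 2 - s * e - expR (- s) + e <= (1 - w) * ln (1 - w) / 2.
  rewrite E2; have [e0|e0] := leP e 0.
    have -> : e = 0 by rewrite /e in e0 *; lra.
    by rewrite !(mul0r, mulr0); have := expR_gt0 (- s); lra.
  rewrite lnM ?posrE // (_ : 2 * e * (ln 2 + ln e) / 2 = e * (ln 2 + ln e)); last by field.
  have := l1 (expR (- s) / e) ltac:(by rewrite divr_gt0 ?expR_gt0).
  rewrite lnM ?posrE ?expR_gt0 ?invr_gt0 // expRK lnV ?posrE // => h.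
  have := ler_wpM2l (ltW e0) h; rewrite [leRHS]mulrBr [e * (_ / e)]mulrC divfK ?gt_eqF // mulr1; lra.
have -> : Ient w = (1 + w) * ln (1 + w) / 2 + (1 - w) * ln (1 - w) / 2 by rewrite /Ient mulrDl.
lra.
Qed.

End Calculus.

Section EntropyInequality.
Variable R : realType.
Implicit Types (w z t e : R) (k K : nat).

Definition theta k : R := (2 ^+ (k - 1) - 1)^-1.
(* For balanced colourings of correlation w, q ^ 2 * Sev k w with q = 2 ^ (1 - k) is the limiting
   probability that a random edge is monochromatic under both. *)
Definition Sev k w : R := ((1 + w) ^+ k + (1 - w) ^+ k) / 2.
(** Odd companion of [Sev]. The pair obeys a linear recursion in [k], so bounds for both are proved
    by one induction. *)
Definition Dod k w : R := ((1 + w) ^+ k - (1 - w) ^+ k) / 2.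
(** Normalised to be 0 at w = 0 and 1 at w = 1, since [Sev k 1 = 2 ^ (k - 1)]; this makes different
    values of [k] comparable. *)
Definition hfun k w : R := theta k * (Sev k w - 1).

Lemma SevS k w : Sev k.+1 w = Sev k w + w * Dod k w.
Proof. by rewrite /Sev /Dod !exprS; field. Qed.

Lemma DodS k w : Dod k.+1 w = Dod k w + w * Sev k w.
Proof. by rewrite /Sev /Dod !exprS; field. Qed.

Lemma Sev_Dod0 w : (Sev 0 w = 1) * (Dod 0 w = 0).
Proof. by rewrite /Sev /Dod !expr0; split; field. Qed.

Lemma Sev_ge_sq k w : 0 <= w ->
  1 + k%:R * (k%:R - 1) / 2 * w ^+ 2 <= Sev k w /\ k%:R * w <= Dod k w.
Proof.
move=> w0; elim: k => [|k [IH1 IH2]]; first by rewrite !Sev_Dod0 !mul0r addr0.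
rewrite SevS DodS -natr1; have k0 : 0 <= k%:R :> R by [].
have k2 : 0 <= k%:R * (k%:R - 1) / 2 :> R.
  by case: k {IH1 IH2} k0 => [|k] k0; rewrite ?mul0r // -natr1 addrK divr_ge0 ?mulr_ge0.
have w2 : 0 <= w ^+ 2 by rewrite exprn_ge0.
have h := ler_wpM2l w0 IH2; split; first by nra.
have : 1 <= Sev k w by apply: le_trans IH1; rewrite lerDl mulr_ge0.
by move=> /(ler_wpM2l w0); nra.
Qed.

Lemma SevN k w : Sev k (- w) = Sev k w.
Proof. by rewrite /Sev opprK addrC. Qed.

Lemma theta_gt0 k : (2 <= k)%N -> 0 < theta k.
Proof.
move=> k2; rewrite invr_gt0 subr_gt0 exprn_egt1 ?ltr1n //.
by rewrite -lt0n subn_gt0.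
Qed.

Lemma hfun_ge0 k w : (2 <= k)%N -> 0 <= w -> 0 <= hfun k w.
Proof.
move=> k2 w0; rewrite mulr_ge0 ?(ltW (theta_gt0 k2)) // subr_ge0.
apply: le_trans (Sev_ge_sq k w0).1; rewrite lerDl mulr_ge0 ?exprn_ge0 //.
by rewrite divr_ge0 // mulr_ge0 // subr_ge0 ler1n; lia.
Qed.

Lemma tangent_pow n z t : 0 <= z -> 0 <= t ->
  t ^+ n.+1 + n.+1%:R * t ^+ n * (z - t) <= z ^+ n.+1.
Proof.
move=> z0 t0; elim: n => [|n IH]; first by rewrite !expr1 expr0; lra.
rewrite [leRHS]exprS; apply: le_trans (ler_wpM2l z0 IH).
rewrite -subr_ge0 -[n.+2%:R]natr1 !exprS; have tn : 0 <= t ^+ n by rewrite exprn_ge0.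
have n0 : 0 <= n.+1%:R :> R by [].
set a := t ^+ n in tn *; set b := n.+1%:R in n0 *.
rewrite (_ : _ - _ = a * b * (z - t) ^+ 2); last by ring.
by rewrite mulr_ge0 ?sqr_ge0 // mulr_ge0.
Qed.

(** In z = w ^ 2 both sides become polynomials: [Ient] is replaced by ten terms of its series and
    [ln 2] by 694/1000. For k = 3 and 4 linear arithmetic suffices; for 5 and 6 a factor z is
    removed and convexity of the powers is used. *)
Lemma entropy_small k w : (3 <= k <= 6)%N -> 0 <= w <= 1 ->
  (ln 2 - theta k) * hfun k w <= Ient w.
Proof.
move=> k36 hw; have zE := erefl (w ^+ 2); apply: le_trans (Ient_ge_poly hw erefl).
have z0 : 0 <= w ^+ 2 by rewrite exprn_ge0 //; case/andP: hw.
have z1 : w ^+ 2 <= 1 by rewrite exprn_ile1 //; case/andP: hw.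
have L1 := ln2_le R; have L0 := ln2_ge R.
have S3 : Sev 3 w = 1 + 3 * w ^+ 2 by rewrite /Sev; field.
have S4 : Sev 4 w = 1 + 6 * w ^+ 2 + (w ^+ 2) ^+ 2 by rewrite /Sev; field.
have S5 : Sev 5 w = 1 + 10 * w ^+ 2 + 5 * (w ^+ 2) ^+ 2 by rewrite /Sev; field.
have S6 : Sev 6 w = 1 + 15 * w ^+ 2 + 15 * (w ^+ 2) ^+ 2 + (w ^+ 2) ^+ 3 by rewrite /Sev; field.
have -> : theta k = (2 ^+ k.-1 - 1)^-1 by rewrite /theta subn1.
rewrite /hfun /theta subn1.
move: (w ^+ 2) z0 z1 S3 S4 S5 S6 => z z0 z1 S3 S4 S5 S6.
have P n : 0 <= z ^+ n by rewrite exprn_ge0.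
have T t n := @tangent_pow n z t z0.
have Q : forall p : R, 0 <= p -> z * p >= 0 by move=> p p0; rewrite mulr_ge0.
suff : exists2 c : R, ln 2 - (2 ^+ k.-1 - 1)^-1 <= c &
   c * ((2 ^+ k.-1 - 1)^-1 * (Sev k w - 1)) <=
   z / 2 + z ^+ 2 / 12 + z ^+ 3 / 30 + z ^+ 4 / 56 + z ^+ 5 / 90 + z ^+ 6 / 132 +
   z ^+ 7 / 182 + z ^+ 8 / 240 + z ^+ 9 / 306 + z ^+ 10 / 380.
  move=> [c c1 c2]; apply: le_trans c2; apply: ler_wpM2r c1.
  have := @hfun_ge0 k w ltac:(by case/andP: k36 => /ltnW) ltac:(by case/andP: hw).
  by rewrite /hfun /theta subn1.
have P2 := (P 2, P 3, P 4, P 5, P 6, P 7, P 8, P 9, P 10)%N.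
case: k k36 => [|[|[|[|[|[|[|k]]]]]]] // _ /=.
- have -> : (2 ^+ 2 - 1)^-1 = 1 / 3 :> R by field.
  exists (694 / 1000 - 1 / 3); first by clear -L1; lra.
  by rewrite S3; move: P2 => [[[[[[[[]]]]]]]]; lra.
- have -> : (2 ^+ 3 - 1)^-1 = 1 / 7 :> R by field.
  exists (694 / 1000 - 1 / 7); first by clear -L1; lra.
  by rewrite S4; move: P2 => [[[[[[[[]]]]]]]]; lra.
- have -> : (2 ^+ 4 - 1)^-1 = 1 / 15 :> R by field.
  exists (694 / 1000 - 1 / 15); first by clear -L1; lra.
  (* Powers of z are replaced by their tangents at 7/10, after which the inequality is linear in
     z. *)
  rewrite S5; have t0 : 0 <= 7 / 10 :> R by clear; lra.
  have g0 : 0 <= 1 / 2 - (694 / 1000 - 1 / 15) * 2 / 3 + (1 / 12 - (694 / 1000 - 1 / 15) / 3) * z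
      + z ^+ 2 / 30 + z ^+ 3 / 56 + z ^+ 4 / 90 + z ^+ 5 / 132.
    have := (T _ 1 t0, T _ 2 t0, T _ 3 t0, T _ 4 t0)%N.
    by move=> [[[]]]; clear -z0 z1; lra.
  have {g0} := Q _ g0; move: P2 => [[[[[[[[]]]]]]]]; clear -z0 z1; lra.
- have -> : (2 ^+ 5 - 1)^-1 = 1 / 31 :> R by field.
  exists (694 / 1000 - 1 / 31); first by clear -L1; lra.
  (* For k = 6 the tangents are taken close to z = 1, and all the terms of the series are kept. *)
  rewrite S6; have t0 : 0 <= 24 / 25 :> R by clear; lra.
  have g0 : 0 <= 1 / 2 - (694 / 1000 - 1 / 31) * 15 / 31 + (1 / 12 - (694 / 1000 - 1 / 31) * 15 / 31) * z
      + (1 / 30 - (694 / 1000 - 1 / 31) / 31) * z ^+ 2 + z ^+ 3 / 56 + z ^+ 4 / 90 + z ^+ 5 / 132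
      + z ^+ 6 / 182 + z ^+ 7 / 240 + z ^+ 8 / 306 + z ^+ 9 / 380.
    have := (T _ 1 t0, T _ 2 t0, T _ 3 t0, T _ 4 t0, T _ 5 t0, T _ 6 t0, T _ 7 t0, T _ 8 t0)%N.
    by move=> [[[[[[[]]]]]]]; clear -z0 z1; lra.
  have {g0} := Q _ g0; clear -z0 z1; lra.
Qed.

(** The bounds on [Sev] and [Dod] support each other: at each step the right-hand sides double while
    w <= 1/3 keeps the left-hand sides from growing faster. The value 7/10 is small enough that 7/10
    * ln 2 < 1/2, the coefficient of w ^ 2 in [Ient]. *)
Lemma hfun_le_sq k w : (7 <= k)%N -> 0 <= w <= 1 / 3 -> hfun k w <= 7 / 10 * w ^+ 2.
Proof.
move=> k7 /andP[w0 w1].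
have z0 : 0 <= w ^+ 2 by rewrite exprn_ge0.
have z1 : w ^+ 2 <= 1 / 9 by have := lerXn2r 2 w0 (_ : (1 / 3 : R) \in Num.nneg) w1; rewrite ?nnegrE; lra.
suff [h _] : Sev k w - 1 <= 7 / 10 * (2 ^+ (k - 1) - 1) * w ^+ 2 /\ Dod k w <= 7 / 10 * 2 ^+ (k - 1) * w.
  have t0 := @theta_gt0 k ltac:(lia).
  rewrite /hfun; apply: le_trans (ler_wpM2l (ltW t0) h) _.
  have q0 : 0 < 2 ^+ (k - 1) - 1 :> R by move: t0; rewrite invr_gt0.
  rewrite /theta; move: (2 ^+ (k - 1) - 1) (w ^+ 2) q0 => q z q0.
  by rewrite le_eqVlt; apply/orP; left; apply/eqP; field; rewrite gt_eqF.
elim: k k7 => // k IH; rewrite leq_eqVlt => /orP[/eqP <-|k7].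
  have -> : Sev 7 w = 1 + 21 * w ^+ 2 + 35 * (w ^+ 2) ^+ 2 + 7 * (w ^+ 2) ^+ 3 by rewrite /Sev; field.
  have -> : Dod 7 w = w * (7 + 35 * w ^+ 2 + 21 * (w ^+ 2) ^+ 2 + (w ^+ 2) ^+ 3) by rewrite /Dod; field.
  have -> : 2 ^+ (7 - 1) = 64 :> R by rewrite /=; ring.
  move: (w ^+ 2) z0 z1 => z z0 z1.
  have z2 : z ^+ 2 <= z / 9 by rewrite expr2; nra.
  have z3 : z ^+ 3 <= z / 81 by rewrite exprS; nra.
  split; first by lra.
  by rewrite [leRHS]mulrC ler_wpM2l //; lra.
have {IH} [h1 h2] := IH k7.
have -> : (k.+1 - 1 = (k - 1).+1)%N by lia.
rewrite exprS SevS DodS.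
have q1 : 32 <= 2 ^+ (k - 1) :> R.
  have -> : 32 = 2 ^+ 5 :> R by ring.
  by rewrite ler_eXn2l ?ltr1n //; lia.
move: (2 ^+ (k - 1)) q1 h1 h2 => q q1 h1 h2; split.
  by have := ler_wpM2l w0 h2; rewrite expr2; lra.
have qz : q * w ^+ 2 <= q * (1 / 9) by rewrite ler_wpM2l //; lra.
have h3 : Sev k w <= q / 2 by lra.
have wq : 0 <= w * q by rewrite mulr_ge0 //; lra.
by have := ler_wpM2l w0 h3; lra.
Qed.

Lemma two_pow_ge k : (6 <= k)%N -> ((k + 2) ^ 2 <= 2 ^ k)%N.
Proof.
elim: k => // k IH; rewrite leq_eqVlt => /orP[/eqP <- //|k6].
have := IH k6; rewrite [(2 ^ k.+1)%N]expnS -!mulnn; nia.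
Qed.

(** The amount by which [Sev] fails to double from K to K + 1, as needed in [hfun_step]. On the old
    range of e the induction multiplies it by 2 (1 - e) >= 4/3; the range added at the lower end is
    handled by Bernoulli's inequality. *)
Lemma gain_ge K e : (6 <= K)%N -> 3 / (2 * (K.+1%:R) ^+ 2) <= e <= 1 / 3 ->
  4 / 5 <= 2 ^+ (K - 1) * e * (1 - e) ^+ K.
Proof.
elim: K e => // K IH e; rewrite leq_eqVlt => /orP[/eqP <-|K6] /andP[e0 e1].
  have {}e0 : 3 / 98 <= e by lra.
  have -> : 2 ^+ (6 - 1) = 32 :> R by rewrite /=; ring.
  (* On an interval [a, b] the product is at least 32 a (1 - b) ^ 6, and eight intervals cover the
     range of e for K = 6. *)
  have key (a b : R) : 4 / 5 <= 32 * a * (1 - b) ^+ 6 -> 0 <= a -> b <= 1 -> a <= e <= b ->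
      4 / 5 <= 32 * e * (1 - e) ^+ 6.
    move=> h a0 b1 /andP[ae eb]; apply: le_trans h _; apply: ler_pM; rewrite ?mulr_ge0 ?exprn_ge0 //; try lra.
    by apply: lerXn2r; rewrite ?nnegrE; clear -b1 eb; lra.
  have [c0|c0] := leP e (31 / 1000); first by apply: (key (3 / 98) (31 / 1000)); [clear; lra..|rewrite e0 c0].
  have [c1|c1] := leP e (35 / 1000); first by apply: (key (31 / 1000) (35 / 1000)); [clear; lra..|rewrite (ltW c0) c1].
  have [c2|c2] := leP e (45 / 1000); first by apply: (key (35 / 1000) (45 / 1000)); [clear; lra..|rewrite (ltW c1) c2].
  have [c3|c3] := leP e (7 / 100); first by apply: (key (45 / 1000) (7 / 100)); [clear; lra..|rewrite (ltW c2) c3].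
  have [c4|c4] := leP e (15 / 100); first by apply: (key (7 / 100) (15 / 100)); [clear; lra..|rewrite (ltW c3) c4].
  have [c5|c5] := leP e (25 / 100); first by apply: (key (15 / 100) (25 / 100)); [clear; lra..|rewrite (ltW c4) c5].
  have [c6|c6] := leP e (31 / 100); first by apply: (key (25 / 100) (31 / 100)); [clear; lra..|rewrite (ltW c5) c6].
  by apply: (key (31 / 100) (1 / 3)); [clear; lra..|rewrite (ltW c6) e1].
have -> : (K.+1 - 1 = K)%N by lia.
have K1 : 0 < K.+1%:R ^+ 2 :> R by rewrite exprn_gt0.
have [h|h] := leP (3 / (2 * K.+1%:R ^+ 2)) e.
  have {IH} := IH e K6 ltac:(by rewrite h e1) => IH.
  have -> : 2 ^+ K = 2 * 2 ^+ (K - 1) :> R by rewrite -exprS; congr (_ ^+ _); lia.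
  rewrite [(1 - e) ^+ _]exprS; move: IH; set q := 2 ^+ (K - 1); set v := (1 - e) ^+ K => IH.
  rewrite (_ : 2 * q * e * ((1 - e) * v) = (2 * (1 - e)) * (q * e * v)); last by ring.
  nra.
have e0' : 0 < e by apply: lt_le_trans e0; rewrite divr_gt0 ?mulr_gt0 ?exprn_gt0.
(* Here e lies below the threshold for K, so K * e is small, Bernoulli loses little, and 2 ^ K * e
   >= 3/2 by [two_pow_ge]. *)
have Be : 1 - K.+1%:R * e <= (1 - e) ^+ K.+1.
  have := @tangent_pow K (1 - e) 1 ltac:(lra) ltac:(lra); rewrite !expr1n; lra.
have k7 : 7 <= K.+1%:R :> R by rewrite ler_nat.
have Ke : K.+1%:R * e <= 3 / 14.
  move: h; rewrite ltr_pdivlMr ?mulr_gt0 // => h.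
  move: (K.+1%:R) k7 h K1 => y y7 h _; nra.
have Q1 : 3 / 2 <= 2 ^+ K * e.
  apply: le_trans (ler_wpM2l _ e0); last by rewrite exprn_ge0.
  rewrite mulrA ler_pdivlMr ?mulr_gt0 ?exprn_gt0 //.
  have := two_pow_ge K6; rewrite -(ler_nat R) !natrX (_ : (K + 2 = K.+2)%N); last by lia.
  lra.
nra.
Qed.

Lemma ler_exprM_conv (al e : R) K : 0 <= e -> e <= al -> al + e = 1 ->
  al ^+ K.+1 + e ^+ K.+1 <= al * (al ^+ K + e ^+ K).
Proof.
move=> e0 ea s1; rewrite mulrDr !exprS lerD2l ler_wpM2r // exprn_ge0 //.
Qed.

Lemma Sev_eps k e : (0 < k)%N -> Sev k (1 - 2 * e) = 2 ^+ (k - 1) * ((1 - e) ^+ k + e ^+ k).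
Proof.
case: k => // k _; rewrite subn1 /= /Sev.
rewrite (_ : 1 + (1 - 2 * e) = 2 * (1 - e)); last by ring.
rewrite (_ : 1 - (1 - 2 * e) = 2 * e); last by ring.
by rewrite !exprMn !exprS; field.
Qed.

(** Away from both ends of the interval the left side of the entropy inequality decreases with k, so
    the inequality for K + 1 follows from that for K. *)
Lemma hfun_step K e : (6 <= K)%N -> 3 / (2 * (K.+1%:R) ^+ 2) <= e <= 1 / 3 ->
  (ln 2 - theta K.+1) * hfun K.+1 (1 - 2 * e) <= (ln 2 - theta K) * hfun K (1 - 2 * e).
Proof.
move=> K6 he; have T := gain_ge K6 he.
have E : (K.+1 - 1 = (K - 1).+1)%N by lia.
have K1 : (1 <= K)%N by lia.
have K2 : (5 <= K - 1)%N by lia.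
case/andP: he => e0 e1.
have e0' : 0 < e by apply: lt_le_trans e0; rewrite divr_gt0 ?mulr_gt0 ?exprn_gt0.
have q1 : 32 <= 2 ^+ (K - 1) :> R.
  have -> : 32 = 2 ^+ 5 :> R by ring.
  by rewrite ler_eXn2l ?ltr1n.
have L0 := ln2_ge R; have L1 := ln2_le R.
rewrite /hfun !Sev_eps //.
have := @ler_exprM_conv (1 - e) e K (ltW e0') ltac:(lra) ltac:(lra).
rewrite /theta E [2 ^+ _.+1]exprS.
have y1 : (1 - e) ^+ K + e ^+ K <= 1.
  have : (1 - e) ^+ K <= 1 - e by rewrite -[leRHS]expr1 ler_wiXn2l //; clear -e1 e0'; lra.
  have : e ^+ K <= e by rewrite -[leRHS]expr1 ler_wiXn2l //; clear -e1 e0'; lra.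
  clear; lra.
have eK : 0 <= e ^+ K by rewrite exprn_ge0 // ltW.
have aK : 0 <= (1 - e) ^+ K by rewrite exprn_ge0 //; clear -e1; lra.
move: (2 ^+ (K - 1)) T q1 => q T q1.
have q0 : 0 < q by clear -q1; lra.
have : 4 / 5 <= e * (q * ((1 - e) ^+ K + e ^+ K)).
  by rewrite mulrA [e * q]mulrC mulrDr; have := mulr_ge0 (mulr_ge0 (ltW q0) (ltW e0')) eK; clear -T; lra.
move: ((1 - e) ^+ K + e ^+ K) ((1 - e) ^+ K.+1 + e ^+ K.+1) y1 => y y' y1 eY yy.
move: (ln 2) L0 L1 => L L0 L1.
have Yq : q * y <= q by clear -q0 y1; nra.
(* 26/10 is 1 + 2 * (4/5): passing from y to y' <= (1 - e) y loses at least 2 e q y, and e q y >=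
   4/5 by [gain_ge]. *)
have : 2 * q * y' - 1 <= 2 * (q * y) - 26 / 10 by clear -q0 eY yy; nra.
have Y1 : 4 / 5 <= q * y by clear -e1 e0' eY; nra.
move: (q * y) Yq Y1 => Y Yq Y1 h.
have p1 : 0 < q - 1 by clear -q1; lra. have p2 : 0 < 2 * q - 1 by clear -p1; lra.
have c2 : 0 <= L - (2 * q - 1)^-1.
  by rewrite subr_ge0; apply: le_trans L0; rewrite -[leRHS]invrK lef_pV2 ?posrE ?invr_gt0; clear -q1; lra.
apply: (@le_trans _ _ ((L - (2 * q - 1)^-1) * ((2 * q - 1)^-1 * (2 * Y - 26 / 10)))).
  by rewrite ler_wpM2l // ler_wpM2l // invr_ge0 ltW.
set a := (q - 1)^-1; set b := (2 * q - 1)^-1.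
have a0 : 0 < a by rewrite invr_gt0.
have b0 : 0 < b by rewrite invr_gt0.
have a1 : a <= 1 / 31 by rewrite -[leRHS]invrK lef_pV2 ?posrE ?invr_gt0; clear -q1; lra.
have b1 : b <= 1 / 63 by rewrite -[leRHS]invrK lef_pV2 ?posrE ?invr_gt0; clear -q1; lra.
have pa : a * (q - 1) = 1 by rewrite mulVf ?gt_eqF.
have pb : b * (2 * q - 1) = 1 by rewrite mulVf ?gt_eqF.
(* This relation between the two values of theta makes the terms of leading order cancel; the rest
   is grouped into five products of visibly nonnegative factors. *)
have Hab : a = b * (2 + a) by rewrite /a /b; field; rewrite !gt_eqF.
clearbody a b.
pose u := q - Y; have u0 : 0 <= u by rewrite subr_ge0.
have -> : a * (Y - 1) = a * (q - 1) - a * u by rewrite /u; ring.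
have -> : b * (2 * Y - 26 / 10) = b * (2 * q - 1) - 16 / 10 * b - 2 * (u * b) by rewrite /u; field.
rewrite pa pb.
have Z : (a - b * (2 + a)) * (1 + L * u) = 0 by rewrite {1}Hab subrr mul0r.
have h1 : 0 <= b * (16 / 10 * L - 1 - a - 16 / 10 * b) by rewrite mulr_ge0 ?(ltW b0) //; clear -L0 a1 b1; lra.
have h2 : 0 <= u * (a * b * (1 - L)) by rewrite !mulr_ge0 ?(ltW a0) ?(ltW b0) //; clear -L1; lra.
have h3 : 0 <= u * (b * (a - 2 * b)) by rewrite !mulr_ge0 ?(ltW b0) //; clear -b1 pa pb; nra.
have h4 : 0 <= u * (a * (a - b * (2 + a))) by rewrite {2}Hab subrr !mulr0.
have h5 : 0 <= u * (a * b * a) by rewrite !mulr_ge0 ?(ltW b0) ?(ltW a0).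
clear -Z h1 h2 h3 h4 h5; lra.
Qed.

Lemma pow_1B_le k e : 0 <= e <= 1 -> (1 - e) ^+ k <= 1 - k%:R * e + k%:R * (k%:R - 1) / 2 * e ^+ 2.
Proof.
move=> /andP[e0 e1]; elim: k => [|k IH]; first by rewrite expr0; lra.
have k2 : 0 <= k%:R * (k%:R - 1) / 2 * e ^+ 3 :> R.
  case: k {IH} => [|k]; rewrite ?mul0r // -natr1 addrK mulr_ge0 ?exprn_ge0 // divr_ge0 ?mulr_ge0 //.
rewrite exprS; have := ler_wpM2l (_ : 0 <= 1 - e) IH; rewrite subr_ge0 => /(_ e1) h.
apply: le_trans h _; rewrite -[k.+1%:R]natr1; lra.
Qed.

Lemma theta_small k : (7 <= k)%N -> k%:R * theta k <= 1 / 9 /\ theta k <= 1 / 63.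
Proof.
move=> k7; have h : k%:R * 9 <= 2 ^+ (k - 1) - 1 :> R.
  suff : (k * 9 + 1 <= 2 ^ (k - 1))%N by rewrite -(ler_nat R) natrD natrM natrX; lra.
  elim: k k7 => // k IH; rewrite leq_eqVlt => /orP[/eqP <- //|k7].
  have := IH k7; have -> : (k.+1 - 1 = (k - 1).+1)%N by lia.
  by rewrite expnS; lia.
have k7' : 7 <= k%:R :> R by rewrite ler_nat.
rewrite /theta; split.
  by rewrite ler_pdivrMr; lra.
by rewrite -[leRHS]invrK lef_pV2 ?posrE ?invr_gt0; lra.
Qed.

(** Near w = 1 both sides equal ln 2 - theta to order 0 and the slopes decide: about (k - 3/4) ln 2
    for the loss of the left side against s <= (k - 1) ln 2 for the entropy. The surplus ln 2 / 4
    pays for the term k * theta <= 1/9. *)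
Lemma entropy_edge k e : (7 <= k)%N -> 0 <= e -> e <= 3 / (2 * k%:R ^+ 2) ->
  (ln 2 - theta k) * hfun k (1 - 2 * e) <= Ient (1 - 2 * e).
Proof.
move=> k7 e0 e1; have k2 : (2 <= k)%N by lia.
have k3 : (3 <= k)%N by lia.
have k0 : (0 < k)%N by lia.
have k7' : 7 <= k%:R :> R by rewrite ler_nat.
have ke : k%:R ^+ 2 * e <= 3 / 2.
  move: e1; rewrite ler_pdivlMr ?mulr_gt0 ?exprn_gt0; lra.
have e2 : e <= 1 / 32 by move: (k%:R) k7' ke => y y7 h; nra.
have t0 := theta_gt0 k2.
have [t1 t2] := theta_small k7.
have L0 := ln2_ge R.
(* The tangent parameter s = - ln theta is chosen so that exp (- s) is exactly the theta subtracted
   on the left. *)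
have Et : expR (- ln (theta k)^-1) = theta k by rewrite lnV ?posrE // opprK lnK ?posrE.
have := @Ient_ge_tangent R (1 - 2 * e) (ln (theta k)^-1) ltac:(lra).
rewrite Et (_ : (1 - (1 - 2 * e)) / 2 = e); last by field.
apply: le_trans.
have s1 : ln (theta k)^-1 <= (k%:R - 1) * ln 2.
  have -> : (k%:R - 1) * ln 2 = ln (2 ^+ (k - 1)) :> R.
    by rewrite lnXn // -[RHS]mulr_natl natrB.
  have q0 : 0 < 2 ^+ (k - 1) - 1 :> R by move: t0; rewrite invr_gt0.
  by rewrite /theta invrK ler_ln ?posrE ?exprn_gt0 //; clear; lra.
have hle : hfun k (1 - 2 * e) <= 1 - (k%:R - 3 / 4) * e.
  rewrite /hfun Sev_eps //.
  have := @pow_1B_le k e ltac:(lra).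
  have : e ^+ k <= e ^+ 3 by rewrite ler_wiXn2l //; clear -e2; lra.
  have : e ^+ 3 <= 1 / k%:R * (1 / 2) * e.
    rewrite -[3%N]/(2.+1) exprSr ler_wpM2r // mul1r mulrC ler_pdivlMr; last by clear -k7'; lra.
    move: (k%:R) k7' ke => y y7 h; nra.
  have tq : theta k * 2 ^+ (k - 1) = 1 + theta k.
    have q0 : 0 < 2 ^+ (k - 1) - 1 :> R by move: t0; rewrite invr_gt0.
    by rewrite /theta; field; rewrite gt_eqF.
  move=> h1 h2 h3; rewrite mulrBr mulr1 mulrA tq.
  have h4 : (1 - e) ^+ k + e ^+ k <= 1 - (k%:R - 3 / 4) * e.
    have h5 : k%:R * (k%:R - 1) / 2 * e ^+ 2 + 1 / k%:R * (1 / 2) * e <= 3 / 4 * e.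
      rewrite expr2 (mulrA _ e e) -mulrDl ler_wpM2r //.
      have h6 : (k%:R - 1) / k%:R * (k%:R ^+ 2 * e) <= (k%:R - 1) / k%:R * (3 / 2).
        by rewrite ler_wpM2l // divr_ge0; clear -k7'; lra.
      have -> : k%:R * (k%:R - 1) / 2 * e + 1 / k%:R * (1 / 2) =
         (k%:R - 1) / k%:R * (k%:R ^+ 2 * e) / 2 + 1 / k%:R * (1 / 2) :> R.
        by field; rewrite gt_eqF; clear -k7'; lra.
      have -> : 3 / 4 = (k%:R - 1) / k%:R * (3 / 2) / 2 + 1 / k%:R * (3 / 4) :> R.
        by field; rewrite gt_eqF; clear -k7'; lra.
      have : 0 <= 1 / k%:R :> R by rewrite divr_ge0; clear -k7'; lra.
      clear -h6; lra.
    clear -h1 h2 h3 h5; lra.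
  have t3 : 0 <= 1 + theta k by clear -t0; lra.
  have h7 := ler_wpM2l t3 h4.
  have h8 : 0 <= theta k * ((k%:R - 3 / 4) * e) by rewrite !mulr_ge0 // ?(ltW t0) //; clear -k7'; lra.
  clear -h7 h8; lra.
have h9 := ler_wpM2l (_ : 0 <= ln 2 - theta k) hle.
apply: (le_trans (h9 _)); first by clear -t2 L0; lra.
rewrite -subr_ge0; set s := ln (theta k)^-1 in s1 *.
have h10 : 0 <= e * ((ln 2 - theta k) * (k%:R - 3 / 4) - s).
  rewrite mulr_ge0 //; have : theta k * (k%:R - 3 / 4) <= 1 / 9 by clear -t0 t1; lra.
  lra.
clear -h10; lra.
Qed.

(** Induction on k with three regimes above k = 6: for w <= 1/3 a quadratic bound, for w within
    order 1 / k ^ 2 of 1 the tangent bound, and in between monotonicity in k together with the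
    induction hypothesis. *)
Lemma entropy_ge k w : (3 <= k)%N -> 0 <= w <= 1 -> (ln 2 - theta k) * hfun k w <= Ient w.
Proof.
elim: k => // k IH k3 hw; have [k6|k6] := leqP k.+1 6; first by apply: entropy_small => //; rewrite k3.
have n1 : (3 <= k)%N by lia.
have n2 : (7 <= k.+1)%N by lia.
have n3 : (2 <= k.+1)%N by lia.
have n4 : (6 <= k)%N by lia.
have {}IH := IH n1 hw; case/andP: hw => w0 w1.
have L1 := ln2_le R; have L0 := ln2_ge R.
have [t1 t2] := theta_small n2.
have t0 := theta_gt0 n3.
have [w3|w3] := leP w (1 / 3).
  have h := @hfun_le_sq k.+1 w n2 ltac:(by rewrite w0 w3).
  apply: le_trans (Ient_ge_sq _); last by clear -w0 w3; lra.
  apply: (le_trans (ler_wpM2l _ h)); first by clear -L0 t2; lra.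
  have := exprn_ge0 2 w0; move: (w ^+ 2) => z z0; nra.
pose e := (1 - w) / 2; have we : w = 1 - 2 * e by rewrite /e; field.
have [e1|e1] := leP e (3 / (2 * k.+1%:R ^+ 2)).
  by rewrite we; apply: entropy_edge => //; rewrite /e; lra.
apply: le_trans IH; rewrite we; apply: hfun_step => //; by rewrite (ltW e1) /= /e; lra.
Qed.

Lemma Ient_le w : 0 <= w -> w < 1 -> Ient w <= w ^+ 2 / (2 * (1 - w)).
Proof.
move=> w0 w1.
have l1 (x : R) : 0 < x -> ln x <= x - 1.
  by move=> x0; have := @le_ln1Dx R (x - 1) ltac:(lra); rewrite addrC subrK.
have h1 := l1 (1 + w) ltac:(lra).
have h2 := l1 (1 - w) ltac:(lra).
have h3 := l1 ((1 - w) * (1 + w)) ltac:(by rewrite mulr_gt0; lra).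
have h4 := l1 (1 - w)^-1 ltac:(by rewrite invr_gt0; lra).
rewrite lnM ?posrE in h3; [|lra|lra].
rewrite lnV ?posrE in h4; last by lra.
rewrite /Ient (_ : w ^+ 2 / _ = (w ^+ 2 / (1 - w)) / 2); last by field; rewrite gt_eqF // subr_gt0.
rewrite ler_pM2r ?invr_gt0 //.
have -> : w ^+ 2 / (1 - w) = - w ^+ 2 + w * (w + ((1 - w)^-1 - 1)).
  by field; rewrite gt_eqF // subr_gt0.
have : w * (ln (1 + w) - ln (1 - w)) <= w * (w + ((1 - w)^-1 - 1)).
  by rewrite ler_wpM2l //; lra.
lra.
Qed.

(** The second claim, convergence of the Gaussian sum later on, follows from the first: for small w
    the two sides compare as the quadratic terms d (k - 1) theta ^ 2 * w ^ 2 / 2 and (1 - kp) * w ^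
    2 / 2. *)
Lemma entropy_gap k d : (3 <= k)%N -> 0 < d -> d / k%:R <= 2 ^+ (k - 1) * ln 2 - 2 ->
  exists2 kp : R, 0 < kp < 1 &
   (forall w, -1 <= w <= 1 -> d / k%:R * theta k ^+ 2 * (Sev k w - 1) <= (1 - kp) * Ient w) /\
   d * (k%:R - 1) * theta k ^+ 2 < 1.
Proof.
move=> k3 d0 hd; have k2 : (2 <= k)%N by lia.
have L1 := ln2_le R; have L0 := ln2_ge R.
have t0 := theta_gt0 k2.
have k3' : 3 <= k%:R :> R by rewrite ler_nat.
have t1 : theta k <= 1 / 3.
  rewrite -[leRHS]invrK lef_pV2 ?posrE ?invr_gt0; last by lra.
    rewrite (_ : (1 / 3)^-1 = 2 ^+ 2 - 1 :> R); last by field.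
    by rewrite lerD2r ler_eXn2l ?ltr1n // -ltnS subn1 prednK // (leq_trans _ k3).
  by move: t0; rewrite invr_gt0.
(* Multiply the bound on d / k by theta: as theta * 2 ^ (k - 1) = 1 + theta, it becomes (d / k)
   theta <= ln 2 - theta - (1 - ln 2) theta. The last term is the slack over [entropy_ge] and serves
   as [kp]. *)
have kp0 : 0 < (1 - ln 2) * theta k by rewrite mulr_gt0 //; lra.
have kp1 : (1 - ln 2) * theta k < 1 by nra.
have tr : d / k%:R * theta k <= ln 2 - theta k - (1 - ln 2) * theta k.
  have := ler_wpM2r (ltW t0) hd => h; apply: (le_trans h).
  have tq : theta k * 2 ^+ (k - 1) = 1 + theta k.
    have q0 : 0 < 2 ^+ (k - 1) - 1 :> R by move: t0; rewrite invr_gt0.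
    by rewrite /theta; field; rewrite gt_eqF.
  rewrite mulrBl mulrAC [2 ^+ _ * _]mulrC tq; lra.
have main w : 0 <= w <= 1 -> d / k%:R * theta k ^+ 2 * (Sev k w - 1) <= (1 - (1 - ln 2) * theta k) * Ient w.
  move=> hw; have h0 := @hfun_ge0 k w k2 ltac:(by case/andP: hw).
  have := ler_wpM2l (_ : 0 <= 1 - (1 - ln 2) * theta k) (entropy_ge k3 hw).
  rewrite subr_ge0 => /(_ (ltW kp1)); apply: le_trans.
  have -> : d / k%:R * theta k ^+ 2 * (Sev k w - 1) = d / k%:R * theta k * hfun k w.
    by rewrite /hfun expr2 !mulrA.
  rewrite [leRHS]mulrA ler_wpM2r //.
  apply: (le_trans tr); nra.
exists ((1 - ln 2) * theta k); rewrite ?kp0 ?kp1 //; split.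
  move=> w hw; have [w0|w0] := leP 0 w; first by apply: main; rewrite w0; case/andP: hw.
  by rewrite -SevN -IentN; apply: main; lra.
set kp := (1 - ln 2) * theta k in main kp0 kp1 *.
clearbody kp; clear L0 L1 hd tr t1.
(* At w = kp / 2 the bound [Ient_le] exceeds w ^ 2 / 2 only by the factor 1 / (1 - kp / 2), which 1
   - kp outweighs. *)
have w0 : 0 < kp / 2 by lra.
have := main (kp / 2) ltac:(lra).
have h1 := (Sev_ge_sq k (ltW w0)).1.
have c0 : 0 <= d / k%:R * theta k ^+ 2 by rewrite mulr_ge0 ?exprn_ge0 ?(ltW t0) // divr_ge0 ?(ltW d0).
have h2 : d / k%:R * theta k ^+ 2 * (k%:R * (k%:R - 1) / 2 * (kp / 2) ^+ 2) <=
  d / k%:R * theta k ^+ 2 * (Sev k (kp / 2) - 1).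
  by rewrite ler_wpM2l //; lra.
move=> /(le_trans h2) {}h2.
have h3 := @Ient_le (kp / 2) ltac:(lra) ltac:(lra).
have h4 := ler_wpM2l (_ : 0 <= 1 - kp) h3.
have := le_trans h2 (h4 ltac:(lra)).
have -> : d / k%:R * theta k ^+ 2 * (k%:R * (k%:R - 1) / 2 * (kp / 2) ^+ 2) =
   (kp / 2) ^+ 2 / 2 * (d * (k%:R - 1) * theta k ^+ 2) by field; rewrite gt_eqF; lra.
have -> : (1 - kp) * ((kp / 2) ^+ 2 / (2 * (1 - kp / 2))) = (kp / 2) ^+ 2 / 2 * ((1 - kp) / (1 - kp / 2)).
  by field; rewrite !gt_eqF; lra.
rewrite ler_pM2l ?divr_gt0 ?exprn_gt0 // => /le_lt_trans; apply.
by rewrite ltr_pdivrMr; lra.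
Qed.

End EntropyInequality.

(** * Hypergeometric weights *)

Section RatioBounds.
Variable R : realType.
Implicit Types (x y s : R).

(** In this form the expansion of a ratio of consecutive weights has no quadratic term, and for
    those weights the denominator y + x does not depend on the position, so Gaussian exponents come
    out exactly with a cubic error. *)
Lemma atanh_ratio x y : 0 < x -> 0 < y -> ln (x / y) = - (2 * atanhR ((y - x) / (y + x))).
Proof.
move=> x0 y0; have s0 : 0 < y + x by rewrite addr_gt0.
rewrite /atanhR.
have -> : 1 + (y - x) / (y + x) = 2 * y / (y + x) by field; rewrite gt_eqF.
have -> : 1 - (y - x) / (y + x) = 2 * x / (y + x) by field; rewrite gt_eqF.
by rewrite !ln_div ?posrE ?mulr_gt0 // !lnM ?posrE //; field.
Qed.

Lemma atanh_le s : 0 <= s <= 1 / 2 -> atanhR s <= s + s ^+ 3 / 2.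
Proof.
move=> /andP[s0 s1]; rewrite -subr_ge0.
pose f := (fun y : R => dIpart 1 y + y ^+ 3 * (1 / 2)) - @atanhR R.
have fE y : f y = y + y ^+ 3 / 2 - atanhR y.
  have d1 : dIpart 1 y = y by rewrite /dIpart big_nat1 divr1.
  by rewrite (_ : f y = dIpart 1 y + y ^+ 3 * (1 / 2) - atanhR y) // d1 mul1r.
rewrite -fE; have {1}-> : 0 = f 0.
  by rewrite fE /atanhR !expr0n /= !(addr0, subr0, mul0r, subrr).
apply: (@deriv_nondecr R f (fun y => ddIpart 1 y + (3%:R * y ^+ 2) * (1 / 2) - (1 - y ^+ 2)^-1)) => //.
  move=> y hy; apply: is_deriveB; last by apply: is_derive_atanh; lra.
  by apply: is_deriveD; [exact: is_derive_dIpart | apply: is_derive_scale; exact: is_derive_pow].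
move=> y /andP[y0 y1].
have y2 : y ^+ 2 <= 1 / 4 by nra.
have yy : 0 <= y ^+ 2 by rewrite exprn_ge0.
have -> : ddIpart 1 y = 1 by rewrite /ddIpart big_nat1.
have h2 : 0 < 1 - y ^+ 2 by lra.
rewrite subr_ge0 -div1r ler_pdivrMr //; move: (y ^+ 2) y2 yy => z z1 z0; nra.
Qed.

Lemma ratio_le x y : 0 < x -> x <= y -> x / y <= expR (- (2 * ((y - x) / (y + x)))).
Proof.
move=> x0 xy; have y0 : 0 < y by apply: lt_le_trans xy.
rewrite -[leLHS]lnK ?posrE ?divr_gt0 // ler_expR atanh_ratio // lerN2 ler_pM2l //.
have s0 : 0 <= (y - x) / (y + x) by rewrite divr_ge0 ?subr_ge0 // addr_ge0 ?ltW.
have s1 : (y - x) / (y + x) < 1 by rewrite ltr_pdivrMr; lra.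
by have := dIpart_le 1 s0 s1; rewrite /dIpart big_nat1 divr1.
Qed.

Lemma ratio_ge x y : 0 < x -> x <= y -> y <= 3 * x ->
  expR (- (2 * ((y - x) / (y + x)) + ((y - x) / (y + x)) ^+ 3)) <= x / y.
Proof.
move=> x0 xy y3; have y0 : 0 < y by apply: lt_le_trans xy.
rewrite -[leRHS]lnK ?posrE ?divr_gt0 // ler_expR atanh_ratio // lerN2.
have s0 : 0 <= (y - x) / (y + x) by rewrite divr_ge0 ?subr_ge0 // addr_ge0 ?ltW.
have s1 : (y - x) / (y + x) <= 1 / 2 by rewrite ler_pdivrMr; lra.
by have := @atanh_le ((y - x) / (y + x)) ltac:(by rewrite s0 s1); lra.
Qed.

Lemma expR_1B_ge x : 0 <= x <= 1 / 2 -> expR (- (2 * x)) <= 1 - x.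
Proof.
move=> /andP[x0 x1].
have h : 0 < 1 + 2 * x by lra.
apply: (@le_trans _ _ (1 + 2 * x)^-1).
  by rewrite expRN lef_pV2 ?posrE ?expR_gt0 // expR_ge1Dx.
by rewrite -div1r ler_pdivrMr //; nra.
Qed.

(** The terms 16 j / n with j < t add up to 8 t (t - 1) / n; the 8 added to [C] accounts for the
    difference from 8 t ^ 2 / n. *)
Lemma gauss_chain_le (f : nat -> R) (n C : R) (t : nat) : 0 < n ->
  (forall j, (j < t)%N -> f j.+1 <= f j * expR (- (16 * j%:R / n) + C / n)) ->
  f t <= f 0%N * expR (- (8 * t%:R ^+ 2 / n) + (C + 8) * t%:R / n).
Proof.
move=> n0; elim: t => [|t IH] h; first by rewrite expr0n /= !(mulr0, mul0r, oppr0, addr0) expR0 mulr1.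
apply: (le_trans (h t _)) => //.
have := IH (fun j jt => h j (ltnW jt)).
move=> /(ler_wpM2r (expR_ge0 (- (16 * t%:R / n) + C / n))) /le_trans; apply.
rewrite -[leLHS]mulrA -expRD le_eqVlt; apply/orP; left; apply/eqP; congr (_ * expR _).
by rewrite -natr1; field; rewrite gt_eqF.
Qed.

Lemma gauss_chain_ge (f : nat -> R) (n C : R) (t : nat) : 0 < n -> 0 <= f 0%N ->
  (forall j, (j < t)%N -> f j * expR (- (16 * j%:R / n) - C / n) <= f j.+1) ->
  f 0%N * expR (- (8 * t%:R ^+ 2 / n) - (C + 8) * t%:R / n) <= f t.
Proof.
move=> n0 f0; elim: t => [|t IH] h; first by rewrite expr0n /= !(mulr0, mul0r, oppr0, addr0) expR0 mulr1.
apply: (le_trans _ (h t _)) => //.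
have := IH (fun j jt => h j (ltnW jt)).
move=> /(ler_wpM2r (expR_ge0 (- (16 * t%:R / n) - C / n))); apply: le_trans.
rewrite -[leRHS]mulrA -expRD ler_wpM2l // ler_expR -subr_ge0.
rewrite (_ : _ - _ = 16 / n) ?divr_ge0 ?ltW //.
by rewrite -natr1; field; rewrite gt_eqF.
Qed.

End RatioBounds.

Section Hypergeometric.
Variable R : realType.
Implicit Types (a b i t : nat) (M T : R).

(** The number of colourings with the same class sizes a, b in which i vertices have left the first
    class; over 'C(a + b, a), a hypergeometric law. *)
Definition hyp a b i : R := 'C(a, i)%:R * 'C(b, i)%:R.

Lemma hyp_ge0 a b i : 0 <= hyp a b i. Proof. by rewrite mulr_ge0. Qed.

Lemma hypS a b i : (i <= a)%N -> (i <= b)%N ->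
  hyp a b i.+1 * (i%:R + 1) ^+ 2 = hyp a b i * ((a%:R - i%:R) * (b%:R - i%:R)).
Proof.
move=> ia ib; rewrite /hyp natr1 -!natrB // expr2 -!natrM; congr (_%:R).
have h1 := mul_bin_left a i; have h2 := mul_bin_left b i; nia.
Qed.

Lemma hyp0 a b i : ((a < i) || (b < i))%N -> hyp a b i = 0.
Proof. by case/orP => h; rewrite /hyp (bin_small h) ?mul0r ?mulr0. Qed.

Lemma quarter n : 4 * (n %/ 4)%:R <= n%:R :> R /\ n%:R <= 4 * (n %/ 4)%:R + 3 :> R.
Proof.
have -> : 4 * (n %/ 4)%:R = (4 * (n %/ 4))%:R :> R by rewrite natrM.
rewrite -natrD !ler_nat; lia.
Qed.

(** Reduces the ratio of consecutive weights to the balanced case: the imbalance enters only through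
    (a - b) ^ 2 / 4 = O(n), a relative error O(1 / n). *)
Lemma prod_le_sq (a b i : R) : (a - i) * (b - i) = ((a + b) / 2 - i) ^+ 2 - (a - b) ^+ 2 / 4.
Proof. by field. Qed.

(* a and b are the sizes of the colour classes; i0 = n %/ 4 is the mode of [hyp a b]. *)
Record nearly_half (a b i0 : nat) (n : R) : Prop := NearlyHalf {
  nh_sum : n = a%:R + b%:R;
  nh_lo : 4 * i0%:R <= n;
  nh_hi : n <= 4 * i0%:R + 3;
  nh_ge1 : 1 <= n }.

Lemma hyp_up_step a b i0 (n : R) j : nearly_half a b i0 n ->
  hyp a b (i0 + j).+1 <= hyp a b (i0 + j) * expR (- (16 * j%:R / (n + 2)) + 4 / n).
Proof.
case=> nE iL iU n1; have n2 : 0 < n + 2 by lra.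
case: (leqP (i0 + j) a) => [ia|ia]; last by rewrite hyp0 ?mulr_ge0 ?hyp_ge0 ?expR_ge0 // leqW.
case: (leqP (i0 + j) b) => [ib|ib]; last by rewrite hyp0 ?mulr_ge0 ?hyp_ge0 ?expR_ge0 // orbC leqW.
have y0 : 0 < (i0 + j)%:R + 1 :> R by rewrite natr1.
rewrite -(ler_pM2r (exprn_gt0 2 y0)) hypS // -[leRHS]mulrA ler_wpM2l ?hyp_ge0 //.
have {}ia : (i0 + j)%:R <= a%:R :> R by rewrite ler_nat.
have {}ib : (i0 + j)%:R <= b%:R :> R by rewrite ler_nat.
rewrite prod_le_sq -nE; set x := n / 2 - _; set y := _ + 1 in y0 *.
have x0 : 0 <= x by rewrite /x nE; lra.
apply: (@le_trans _ _ (x ^+ 2)); first by rewrite gerBl divr_ge0 // sqr_ge0.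
have E : expR (- (16 * j%:R / (n + 2)) + 4 / n) = (expR (- (8 * j%:R / (n + 2)) + 2 / n)) ^+ 2.
  by rewrite -expRM_natr; congr expR; field; rewrite !gt_eqF //; lra.
rewrite E -exprMn; apply: lerXn2r; rewrite ?nnegrE ?mulr_ge0 ?expR_ge0 ?(ltW y0) //.
rewrite -ler_pdivrMr //.
have jE : (i0 + j)%:R = i0%:R + j%:R :> R by rewrite natrD.
have [xy|yx] := leP x y.
  move: x0; rewrite le_eqVlt => /orP[/eqP <-|x0]; first by rewrite mul0r expR_ge0.
  apply: (le_trans (ratio_le x0 xy)); rewrite ler_expR.
  have -> : y + x = (n + 2) / 2 by rewrite /x /y; field.
  have h : 2 * j%:R - 1 / 2 <= y - x by rewrite /x /y jE; lra.
  have -> : 2 * ((y - x) / ((n + 2) / 2)) = 4 * (y - x) / (n + 2) by field; rewrite gt_eqF.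
  rewrite -lerN2 opprD !opprK.
  have h1 : (8 * j%:R - 2) / (n + 2) <= 4 * (y - x) / (n + 2).
    by rewrite ler_pM2r ?invr_gt0 //; lra.
  apply: le_trans h1; rewrite mulrBl lerD2l lerN2 ler_pM2l // lef_pV2 ?posrE; lra.
(* Rounding in i0 = n %/ 4 lets the ratio exceed 1 only at the first step, and there by at most exp
   (2 / n) before squaring. *)
have j0 : j = 0%N.
  apply/eqP; rewrite -leqn0 -ltnS -(ltr_nat R); move: yx; rewrite /x /y jE; lra.
rewrite j0 mulr0 mul0r oppr0 add0r; apply: le_trans (expR_ge1Dx _).
rewrite ler_pdivrMr //.
have : 2 / n * n = 2 by rewrite divfK // gt_eqF //; lra.
have : n / 4 <= y by rewrite /y jE j0; lra.
have h : 0 < 2 / n by rewrite divr_gt0; clear -n1; lra.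
by move=> h1 h2; have := ler_wpM2l (ltW h) h1; rewrite /x /y jE j0 in h2 *; lra.
Qed.

Lemma half_diff_le a b (M n z : R) : 1 <= n -> 0 <= M -> (a%:R - b%:R) ^+ 2 <= M * n ->
  n / 4 <= z -> (a%:R - b%:R) ^+ 2 / 4 <= z ^+ 2 * (4 * M / n).
Proof.
move=> n1 M0 hv hz; have h : (n / 4) ^+ 2 <= z ^+ 2 by apply: lerXn2r; rewrite ?nnegrE; lra.
have M1 : 0 <= 4 * M / n by rewrite divr_ge0 ?mulr_ge0; lra.
have := ler_wpM2r M1 h; apply: le_trans.
have -> : (n / 4) ^+ 2 * (4 * M / n) = M * n / 4 by field; rewrite gt_eqF //; lra.
by rewrite ler_pM2r ?invr_gt0.
Qed.

Lemma quarter_le a b i0 (M n : R) i : nearly_half a b i0 n ->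
  (a%:R - b%:R) ^+ 2 <= M * n -> 64 * M <= n -> (i <= i0)%N -> (i <= a)%N /\ (i <= b)%N.
Proof.
case=> nE iL iU n1 hv nM; rewrite -!(ler_nat R) => ii; have iN : i%:R <= n / 4 by lra.
have h : (a%:R - b%:R) ^+ 2 <= (n / 8) ^+ 2 by nra.
have n0 : 0 <= n / 8 by lra.
have : `|a%:R - b%:R| <= n / 8 by rewrite -ler_sqr ?nnegrE // -normrX ger0_norm ?sqr_ge0.
by rewrite ler_norml => /andP[]; lra.
Qed.

Lemma hyp_down_step a b i0 (M n : R) j : nearly_half a b i0 n -> 0 <= M ->
  (a%:R - b%:R) ^+ 2 <= M * n -> 64 * M <= n -> (j < i0)%N ->
  hyp a b (i0 - j.+1) <= hyp a b (i0 - j) * expR (- (16 * j%:R / (n + 2)) + 8 * M / n).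
Proof.
move=> nh M0 hv nM ji.
have [ia ib] := quarter_le nh hv nM (leq_subr j.+1 i0 : (i0 - j.+1 <= i0)%N).
rewrite -(subnSK ji); move: ia ib; set i := (i0 - j.+1)%N.
have iE : i%:R = i0%:R - j%:R - 1 :> R by rewrite /i natrB // -natr1; ring.
move=> ia ib; have H := hypS ia ib.
case: nh => nE iL iU n1; have n2 : 0 < n + 2 by lra.
have j0 : 0 <= j%:R :> R by [].
pose x : R := i%:R + 1; pose y := n / 2 - i%:R.
have i00 : 0 <= i%:R :> R by [].
have x0 : 0 < x by rewrite /x; lra.
have y4 : n / 4 <= y by rewrite /y iE; lra.
have y0 : 0 < y by lra.
have hz := half_diff_le n1 M0 hv y4.
have yz : y ^+ 2 * (1 - 4 * M / n) <= (a%:R - i%:R) * (b%:R - i%:R).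
  by rewrite prod_le_sq -nE -/y; clear -hz; lra.
have Mn : 0 <= 4 * M / n <= 1 / 2 by rewrite divr_ge0 ?mulr_ge0 ?ler_pdivrMr //; clear -nM n1; lra.
have he := expR_1B_ge Mn.
have d0 : 0 < (a%:R - i%:R) * (b%:R - i%:R) :> R.
  by apply: lt_le_trans yz; rewrite mulr_gt0 ?exprn_gt0 //; lra.
have xy : x <= y by rewrite /x /y iE; clear -iL j0; lra.
have hr := ratio_le x0 xy.
have h1 : x <= y * expR (- (8 * j%:R / (n + 2))).
  rewrite mulrC -ler_pdivrMr //; apply: (le_trans hr); rewrite ler_expR lerN2.
  have -> : y + x = (n + 2) / 2 by rewrite /x /y; field.
  have -> : 2 * ((y - x) / ((n + 2) / 2)) = 4 * (y - x) / (n + 2) by field; rewrite gt_eqF.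
  by rewrite ler_pM2r ?invr_gt0 // /x /y iE; clear -iL; lra.
rewrite -(ler_pM2r d0) -H -/x -[leRHS]mulrA ler_wpM2l ?hyp_ge0 //.
have h2 : x ^+ 2 <= y ^+ 2 * expR (- (16 * j%:R / (n + 2))).
  have -> : expR (- (16 * j%:R / (n + 2))) = expR (- (8 * j%:R / (n + 2))) ^+ 2.
    by rewrite -expRM_natr; congr expR; field; rewrite gt_eqF.
  by rewrite -exprMn; apply: lerXn2r => //; rewrite nnegrE ?mulr_ge0 ?expR_ge0 // ltW.
have h3 : y ^+ 2 * expR (- (2 * (4 * M / n))) <= (a%:R - i%:R) * (b%:R - i%:R).
  by apply: le_trans yz; rewrite ler_wpM2l // exprn_ge0 // ltW.
have h4 : y ^+ 2 <= expR (8 * M / n) * ((a%:R - i%:R) * (b%:R - i%:R)).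
  rewrite -(ler_pM2l (expR_gt0 (8 * M / n))) in h3; apply: le_trans h3.
  by rewrite mulrCA -expRD (_ : 8 * M / n + _ = 0) ?expR0 ?mulr1 //; field; rewrite gt_eqF //; clear -n1; lra.
apply: (le_trans h2); rewrite expRD -[leRHS]mulrA mulrC ler_wpM2l ?expR_ge0 //.
Qed.

Lemma hyp_upper a b i0 (M n : R) t : nearly_half a b i0 n -> 0 <= M ->
  (a%:R - b%:R) ^+ 2 <= M * n -> 64 * M <= n ->
  let B := hyp a b i0 * expR (- (8 * t%:R ^+ 2 / n) + (8 * M + 44) * t%:R / n) in
  hyp a b (i0 + t) <= B /\ ((t <= i0)%N -> hyp a b (i0 - t) <= B).
Proof.
move=> nh M0 hv nM; have [nE iL iU n1] := nh.
have n0 : 0 < n by lra.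
(* Changing the denominator n + 2 into n costs 32 j / (n (n + 2)) <= 32 / n, whence 36 = 32 + 4. *)
have shift (j : nat) c : j%:R <= n -> 0 <= c -> c <= 8 * M + 4 ->
    expR (- (16 * j%:R / (n + 2)) + c / n) <= expR (- (16 * j%:R / n) + (8 * M + 36) / n).
  move=> jn c0 cM; rewrite ler_expR -subr_ge0.
  rewrite (_ : _ - _ = 32 / n * ((n + 2 - j%:R) / (n + 2)) + (8 * M + 4 - c) / n); last first.
    by field; rewrite !gt_eqF //; lra.
  have h1 : 0 <= (8 * M + 4 - c) / n by rewrite divr_ge0 //; clear -n0 cM; lra.
  have h2 : 0 <= (n + 2 - j%:R) / (n + 2) by rewrite divr_ge0 //; clear -n0 jn; lra.
  by rewrite addr_ge0 // mulr_ge0 // divr_ge0 // ltW.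
have tE : 8 * M + 44 = 8 * M + 36 + 8 by lra.
rewrite tE; split => [|ti].
  have [tn|tn] := leP (i0 + t)%:R n; last first.
    rewrite hyp0 ?mulr_ge0 ?hyp_ge0 ?expR_ge0 // -(ltr_nat R a).
    have b0 : 0 <= b%:R :> R by []. rewrite nE in tn.
    by apply/orP; left; lra.
  have := @gauss_chain_le R (fun j => hyp a b (i0 + j)) n (8 * M + 36) t n0.
  rewrite addn0; apply=> j jt; rewrite addnS; apply: (le_trans (hyp_up_step j nh)).
  rewrite ler_wpM2l ?hyp_ge0 //; apply: shift; [|lra|lra].
  by apply: le_trans tn; rewrite ler_nat; lia.
have := @gauss_chain_le R (fun j => hyp a b (i0 - j)) n (8 * M + 36) t n0.
rewrite subn0; apply=> j jt; have ji : (j < i0)%N by apply: leq_trans ti.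
apply: (le_trans (hyp_down_step nh M0 hv nM ji)).
rewrite ler_wpM2l ?hyp_ge0 //; apply: shift; [|lra|lra].
have : j%:R <= i0%:R :> R by rewrite ler_nat ltnW.
have : 0 <= i0%:R :> R by []. clear -iL; lra.
Qed.

(** Here s is about 4 j / n, so while j ^ 2 <= T n the cubic term is at most s ^ 2 = O(T / n) per
    step and can be absorbed in the constant of the chain. *)
Lemma gauss_cubic_step (n T : R) j (s c : R) : 0 < n -> 16 <= n -> 0 <= T ->
  j%:R + 1 <= n / 16 -> j%:R ^+ 2 <= T * n -> 0 <= s ->
  s <= (4 * j%:R + c) / n -> 2 <= c -> c <= 5 ->
  expR (- (16 * j%:R / n) - (64 * T + 120) / n) <= expR (- (2 * s + s ^+ 3)) ^+ 2.
Proof.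
move=> n0 n16 T0 jn jT s0 sj c2 c5; have j0 : 0 <= j%:R :> R by [].
rewrite -expRM_natr ler_expR.
have s1 : s <= 1 by apply: (le_trans sj); rewrite ler_pdivrMr //; lra.
have s3 : s ^+ 3 <= s ^+ 2 by rewrite exprS ler_piMl // exprn_ge0.
have s2 : s ^+ 2 <= (32 * T + 50) / n.
  have h : s ^+ 2 <= ((4 * j%:R + c) / n) ^+ 2 by apply: lerXn2r; rewrite ?nnegrE ?divr_ge0 //; lra.
  apply: (le_trans h); rewrite expr_div_n ler_pdivrMr ?exprn_gt0 //.
  have -> : (32 * T + 50) / n * n ^+ 2 = (32 * T + 50) * n by field; rewrite gt_eqF.
  by nra.
have s4 : (4 * j%:R + c) / n <= (4 * j%:R + 5) / n by rewrite ler_pM2r ?invr_gt0 //; lra.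
have -> : - (16 * j%:R / n) - (64 * T + 120) / n = - (4 * ((4 * j%:R + 5) / n) + 2 * ((32 * T + 50) / n)).
  by field; rewrite gt_eqF.
lra.
Qed.

Lemma hyp_up_step_ge a b i0 (M T n : R) j : nearly_half a b i0 n -> 0 <= M -> 0 <= T ->
  (a%:R - b%:R) ^+ 2 <= M * n -> 64 * M <= n -> 16 <= n ->
  j%:R + 1 <= n / 16 -> j%:R ^+ 2 <= T * n ->
  hyp a b (i0 + j) * expR (- (16 * j%:R / n) - (64 * T + 32 * M + 200) / n) <= hyp a b (i0 + j).+1.
Proof.
move=> nh M0 T0 hv nM n16 jn jT; have [nE iL iU n1] := nh.
have n0 : 0 < n by lra.
have j0 : 0 <= j%:R :> R by [].
have jE : (i0 + j)%:R = i0%:R + j%:R :> R by rewrite natrD.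
pose x : R := n / 2 - (i0 + j)%:R; pose y : R := (i0 + j)%:R + 1.
have x8 : n / 8 <= x by rewrite /x jE; lra.
have x0 : 0 < x by lra.
have y0 : 0 < y by rewrite /y natr1.
have z1 : 0 <= 16 * M / n <= 1 / 2 by rewrite divr_ge0 ?mulr_ge0 ?ler_pdivrMr //; clear -M0 nM; lra.
have yz : x ^+ 2 * (1 - 16 * M / n) <= (a%:R - (i0 + j)%:R) * (b%:R - (i0 + j)%:R).
  rewrite prod_le_sq -nE -/x mulrBr mulr1 lerD2l lerN2.
  have h : (n / 8) ^+ 2 <= x ^+ 2 by apply: lerXn2r; rewrite ?nnegrE; clear -n0 x8; lra.
  have := ler_wpM2r (proj1 (andP z1)) h; apply: le_trans.
  have -> : (n / 8) ^+ 2 * (16 * M / n) = M * n / 4 by field; rewrite gt_eqF.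
  by rewrite ler_pM2r ?invr_gt0.
have ia : (i0 + j <= a)%N /\ (i0 + j <= b)%N.
  rewrite -!(ler_nat R) jE.
  have h : (a%:R - b%:R) ^+ 2 <= (n / 8) ^+ 2 by clear -M0 hv nM; nra.
  have n8 : 0 <= n / 8 by clear -n0; lra.
  have : `|a%:R - b%:R| <= n / 8 by rewrite -ler_sqr ?nnegrE // -normrX ger0_norm ?sqr_ge0.
  by rewrite ler_norml => /andP[]; clear -jn nE iL; lra.
rewrite -(ler_pM2r (exprn_gt0 2 y0)) [leRHS]hypS; [|by case: ia..].
rewrite -[leLHS]mulrA ler_wpM2l ?hyp_ge0 //; apply: le_trans yz.
have h1 : expR (- (16 * j%:R / n) - (64 * T + 120) / n) <= (x / y) ^+ 2.
  have [xy|yx] := leP x y; last first.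
    have h : 1 <= x / y by rewrite ler_pdivlMr // mul1r ltW.
    apply: (@le_trans _ _ 1); last by rewrite exprn_ege1.
    have q1 : 0 <= (64 * T + 120) / n by rewrite divr_ge0 //; lra.
    have q2 : 0 <= 16 * j%:R / n by rewrite divr_ge0 ?mulr_ge0 // ltW.
    by rewrite -[leRHS]expR0 ler_expR; clear -q1 q2; lra.
  have y3 : y <= 3 * x by rewrite /x /y jE; clear -n16 jn iL; lra.
  have s0 : 0 <= (y - x) / (y + x) by rewrite divr_ge0 ?subr_ge0 // addr_ge0 ?ltW.
  have h : expR (- (2 * ((y - x) / (y + x)) + ((y - x) / (y + x)) ^+ 3)) ^+ 2 <= (x / y) ^+ 2.
    by apply: lerXn2r; rewrite ?nnegrE ?expR_ge0 ?divr_ge0 ?(ltW x0) ?(ltW y0) // ratio_ge.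
  apply: le_trans h; apply: (gauss_cubic_step n0 n16 T0 jn jT s0 (c := 2)) => //; last by lra.
  have -> : y + x = (n + 2) / 2 by rewrite /x /y; field.
  rewrite ler_pdivrMr; last by clear -n0; lra.
  have -> : (4 * j%:R + 2) / n * ((n + 2) / 2) = (2 * j%:R + 1) * ((n + 2) / n) by field; rewrite gt_eqF.
  apply: (@le_trans _ _ (2 * j%:R + 1)); first by rewrite /x /y jE; clear -iL; lra.
  have h7 : 1 <= (n + 2) / n by rewrite ler_pdivlMr //; clear; lra.
  by rewrite ler_peMr //; lra.
have he := expR_1B_ge z1.
have -> : - (16 * j%:R / n) - (64 * T + 32 * M + 200) / n =
   - (16 * j%:R / n) - (64 * T + 120) / n + - (2 * (16 * M / n)) - 80 / n.
  by field; rewrite gt_eqF.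
have -> : x ^+ 2 = (x / y) ^+ 2 * y ^+ 2 by rewrite -exprMn divfK // gt_eqF.
have h2 : expR (- (80 / n)) <= 1 by rewrite -[leRHS]expR0 ler_expR oppr_le0 divr_ge0 // ltW.
have h3 : expR (- (16 * j%:R / n) - (64 * T + 120) / n) * expR (- (2 * (16 * M / n))) <=
    (x / y) ^+ 2 * (1 - 16 * M / n) by apply: ler_pM; rewrite ?expR_ge0.
rewrite !expRD -expRD mulrAC; apply: (le_trans (ler_wpM2l _ h2)).
  by rewrite !mulr_ge0 ?expR_ge0 ?exprn_ge0 // ltW.
by rewrite mulr1 [leRHS]mulrAC ler_wpM2r // exprn_ge0 // ltW.
Qed.

Lemma hyp_down_step_ge a b i0 (M T n : R) j : nearly_half a b i0 n -> 0 <= M -> 0 <= T ->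
  (a%:R - b%:R) ^+ 2 <= M * n -> 64 * M <= n -> 16 <= n ->
  j%:R + 1 <= n / 16 -> j%:R ^+ 2 <= T * n ->
  hyp a b (i0 - j) * expR (- (16 * j%:R / n) - (64 * T + 32 * M + 200) / n) <= hyp a b (i0 - j.+1).
Proof.
move=> nh M0 T0 hv nM n16 jn jT; have [nE iL iU n1] := nh.
have n0 : 0 < n by lra.
have ji : (j < i0)%N by rewrite -(ltr_nat R); lra.
have [ia ib] := quarter_le nh hv nM (leq_subr j.+1 i0 : (i0 - j.+1 <= i0)%N).
rewrite -(subnSK ji); move: ia ib; set i := (i0 - j.+1)%N.
have iE : i%:R = i0%:R - j%:R - 1 :> R by rewrite /i natrB // -natr1; ring.
move=> ia ib; have H := hypS ia ib.
have j0 : 0 <= j%:R :> R by [].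
pose x : R := i%:R + 1; pose y := n / 2 - i%:R.
have x0 : 0 < x by rewrite /x natr1.
have xy : x <= y by rewrite /x /y iE; clear -iL j0; lra.
have y0 : 0 < y by lra.
have y3 : y <= 3 * x by rewrite /x /y iE; clear -n16 jn iU; lra.
have [ia' ib'] : i%:R < a%:R :> R /\ i%:R < b%:R :> R.
  rewrite iE; have h : (a%:R - b%:R) ^+ 2 <= (n / 8) ^+ 2 by clear -hv nM n16; nra.
  have n8 : 0 <= n / 8 by clear -n0; lra.
  have : `|a%:R - b%:R| <= n / 8 by rewrite -ler_sqr ?nnegrE // -normrX ger0_norm ?sqr_ge0.
  by rewrite ler_norml => /andP[]; clear -nE iL j0; lra.
have d0 : 0 < (a%:R - i%:R) * (b%:R - i%:R) :> R by rewrite mulr_gt0 ?subr_gt0.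
have dy : (a%:R - i%:R) * (b%:R - i%:R) <= y ^+ 2.
  by rewrite prod_le_sq -nE -/y gerBl divr_ge0 // sqr_ge0.
rewrite -(ler_pM2r d0) -H -/x -[leLHS]mulrA ler_wpM2l ?hyp_ge0 //.
apply: (le_trans (ler_wpM2l (expR_ge0 _) dy)).
rewrite -ler_pdivlMr ?exprn_gt0 // -expr_div_n.
have s0 : 0 <= (y - x) / (y + x) by rewrite divr_ge0 ?subr_ge0 // addr_ge0 ?ltW.
have h : expR (- (2 * ((y - x) / (y + x)) + ((y - x) / (y + x)) ^+ 3)) ^+ 2 <= (x / y) ^+ 2.
  by apply: lerXn2r; rewrite ?nnegrE ?expR_ge0 ?divr_ge0 ?(ltW x0) ?(ltW y0) // ratio_ge.
apply: le_trans h; apply: (@le_trans _ _ (expR (- (16 * j%:R / n) - (64 * T + 120) / n))).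
  rewrite ler_expR lerD2l lerN2 ler_pM2r ?invr_gt0 //; clear -M0; lra.
apply: (gauss_cubic_step n0 n16 T0 jn jT s0 (c := 5)) => //; last by clear; lra.
have -> : y + x = (n + 2) / 2 by rewrite /x /y; field.
rewrite ler_pdivrMr; last by clear -n0; lra.
have -> : (4 * j%:R + 5) / n * ((n + 2) / 2) = (2 * j%:R + 5 / 2) * ((n + 2) / n) by field; rewrite gt_eqF.
apply: (@le_trans _ _ (2 * j%:R + 5 / 2)); first by rewrite /x /y iE; clear -iU; lra.
have h7 : 1 <= (n + 2) / n by rewrite ler_pdivlMr //; clear; lra.
    by rewrite ler_peMr //; lra.
Qed.

Lemma hyp_lower a b i0 (M T n : R) t : nearly_half a b i0 n -> 0 <= M -> 0 <= T ->
  (a%:R - b%:R) ^+ 2 <= M * n -> 64 * M <= n -> 256 * T <= n -> 16 <= n -> t%:R ^+ 2 <= T * n ->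
  let B := hyp a b i0 * expR (- (8 * t%:R ^+ 2 / n) - (64 * T + 32 * M + 208) * t%:R / n) in
  [/\ (t <= i0)%N, B <= hyp a b (i0 + t) & B <= hyp a b (i0 - t)].
Proof.
move=> nh M0 T0 hv nM nT n16 tT; have [nE iL iU n1] := nh.
have n0 : 0 < n by lra.
have tn : t%:R <= n / 16.
  have h : t%:R ^+ 2 <= (n / 16) ^+ 2 by nra.
  have h2 : 0 <= n / 16 by lra.
  by have := h; rewrite ler_sqr ?nnegrE.
have ti : (t <= i0)%N by rewrite -(ler_nat R); lra.
have jb (j : nat) : (j < t)%N -> j%:R + 1 <= n / 16 /\ j%:R ^+ 2 <= T * n.
  move=> jt; have h : j%:R + 1 <= t%:R :> R by rewrite natr1 ler_nat.
  by split; [lra | apply: le_trans tT; apply: lerXn2r; rewrite ?nnegrE //; lra].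
have CE : 64 * T + 32 * M + 208 = 64 * T + 32 * M + 200 + 8 by clear; lra.
rewrite CE; split => //.
  have := @gauss_chain_ge R (fun j => hyp a b (i0 + j)) n (64 * T + 32 * M + 200) t n0.
  rewrite addn0; apply; first exact: hyp_ge0.
  move=> j jt; have [jn jT] := jb j jt; rewrite addnS; exact: hyp_up_step_ge.
have := @gauss_chain_ge R (fun j => hyp a b (i0 - j)) n (64 * T + 32 * M + 200) t n0.
rewrite subn0; apply; first exact: hyp_ge0.
by move=> j jt; have [jn jT] := jb j jt; exact: hyp_down_step_ge.
Qed.

End Hypergeometric.

(** * Riemann sums of the Gaussian *)

Section GaussSums.
Variable R : realType.
Implicit Types (p q h y : R) (N : nat).

Let mu := @lebesgue_measure R.

(** The integral of exp (- t ^ 2) from 0; [Ginf] is its limit at infinity. Right and left endpoint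
    sums bound it from the two sides. *)
Definition Phi : R -> R := @gauss_integral_proof.integral0_gauss R.

Definition Ginf : R := Num.sqrt pi / 2.

Let gauss_integrable p q : mu.-integrable `[p, q] (EFin \o @gauss_fun R).
Proof.
apply: continuous_compact_integrable; first exact: segment_compact.
by apply: continuous_subspaceT; exact: continuous_gauss_fun.
Qed.

Let cst_integrable p q (c : R) : mu.-integrable `[p, q] (EFin \o (fun=> c)).
Proof.
apply: continuous_compact_integrable; first exact: segment_compact.
by apply: continuous_subspaceT => z; exact: cvg_cst.
Qed.

Lemma Phi0 : Phi 0 = 0.
Proof. by rewrite /Phi /gauss_integral_proof.integral0_gauss set_itv1 Rintegral_set1. Qed.

Lemma Phi_step p q : 0 <= p -> p <= q ->
  expR (- q ^+ 2) * (q - p) <= Phi q - Phi p <= expR (- p ^+ 2) * (q - p).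
Proof.
move=> p0 pq; rewrite /Phi /gauss_integral_proof.integral0_gauss.
rewrite (Rintegral_itvB (gauss_integrable 0 q)) ?bnd_simp //.
rewrite Rintegral_itv_obnd_cbnd; last first.
  by apply: (integrableS _ _ _ (gauss_integrable p q)) => //; exact: subset_itv_oc_cc.
have len : fine (mu `[p, q]%classic) = q - p.
  rewrite /mu lebesgue_measure_itv /= lte_fin; move: pq; rewrite le_eqVlt => /predU1P[->|pq].
    by rewrite ltxx subrr.
  by rewrite pq -EFinB.
have cst (c : R) : c * (q - p) = (\int[mu]_(x in `[p, q]) c)%R by rewrite Rintegral_cst // len.
apply/andP; split; rewrite cst; apply: le_Rintegral => //= x; rewrite in_itv /= => /andP[px xq];
  rewrite ler_expR lerN2; apply: lerXn2r; rewrite ?nnegrE //; lra.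
Qed.

Lemma Phi_nondecr p q : 0 <= p -> p <= q -> Phi p <= Phi q.
Proof.
move=> p0 pq; have /andP[h _] := Phi_step p0 pq.
by rewrite -subr_ge0; apply: le_trans h; rewrite mulr_ge0 ?expR_ge0 ?subr_ge0.
Qed.

Lemma Phi_ge0 y : 0 <= Phi y.
Proof. exact: gauss_integral_proof.integral0_gauss_ge0. Qed.

Lemma Ginf_gt0 : 0 < Ginf.
Proof. by rewrite divr_gt0 // sqrtr_gt0 pi_gt0. Qed.

Lemma Phi_cvg : Phi y @[y --> +oo] --> (Ginf : R).
Proof.
have : Num.sqrt (Phi y ^+ 2) @[y --> +oo] --> Num.sqrt (pi / 4 : R).
  apply: continuous_cvg => //; [exact: sqrt_continuous|exact: gauss_integral_proof.cvg_integral0_gauss_sqr].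
rewrite sqrtrM ?pi_ge0 // sqrtrV // (_ : 4 = 2 ^+ 2 :> R); last by rewrite expr2 -natrM.
rewrite [Num.sqrt (2 ^+ 2)]sqrtr_sqr ger0_norm // (_ : (fun y => Num.sqrt (Phi y ^+ 2)) = Phi) //.
by apply/funext => y; rewrite sqrtr_sqr ger0_norm // Phi_ge0.
Qed.

Lemma Phi_le y : 0 <= y -> Phi y <= Ginf.
Proof.
move=> y0; rewrite leNgt; apply/negP => h.
have [A [_ hA]] := @cvgr_lt _ _ _ _ _ _ Phi_cvg _ h.
have := hA (Num.max (A + 1) (y + 1)); rewrite lt_max ltrDl ltr01 => /(_ isT).
by rewrite ltNge Phi_nondecr // le_max lerDl ler01 orbT.
Qed.

Lemma Phi_near e : 0 < e -> exists2 y : R, 0 < y & Ginf - e < Phi y.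
Proof.
move=> e0; have h : Ginf - e < Ginf by rewrite ltrBlDr ltrDl.
have [A [_ hA]] := @cvgr_gt _ _ _ _ _ _ Phi_cvg _ h.
exists (Num.max (A + 1) 1); first by rewrite lt_max ltr01 orbT.
by apply: hA; rewrite lt_max ltrDl ltr01.
Qed.

Lemma gauss_sum_le h N : 0 < h -> \sum_(t < N) expR (- (h * t.+1%:R) ^+ 2) <= Phi (h * N%:R) / h.
Proof.
move=> h0; rewrite ler_pdivlMr // mulr_suml; elim: N => [|N IH]; first by rewrite big_ord0 mulr0 Phi0.
rewrite big_ord_recr /=.
have hN : 0 <= h * N%:R by rewrite mulr_ge0 // ltW.
have hS : h * N%:R <= h * N.+1%:R by rewrite ler_pM2l // ler_nat.
have /andP[+ _] := Phi_step hN hS; rewrite -mulrBr -natr1 addrAC subrr add0r mulr1; lra.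
Qed.

Lemma gauss_sum_ge h N : 0 < h -> Phi (h * N%:R) / h <= \sum_(t < N) expR (- (h * t%:R) ^+ 2).
Proof.
move=> h0; rewrite ler_pdivrMr // mulr_suml; elim: N => [|N IH]; first by rewrite big_ord0 mulr0 Phi0.
rewrite big_ord_recr /=.
have hN : 0 <= h * N%:R by rewrite mulr_ge0 // ltW.
have hS : h * N%:R <= h * N.+1%:R by rewrite ler_pM2l // ler_nat.
have /andP[_ +] := Phi_step hN hS; rewrite -mulrBr -natr1 addrAC subrr add0r mulr1; lra.
Qed.

End GaussSums.

Section HypergeometricMass.
Variable R : realType.

Lemma sum_hyp a b N : (a <= N)%N -> \sum_(i < N.+1) hyp R a b i = 'C(a + b, a)%:R.
Proof.
move=> aN; rewrite -binomial.Vandermonde natr_sum.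
rewrite -(big_mkord xpredT (fun i => hyp R a b i)) (big_cat_nat _ (n := a.+1)) //=.
have -> : \sum_(a.+1 <= i < N.+1) hyp R a b i = 0.
  by rewrite big_nat big1 // => i /andP[ai _]; rewrite hyp0 // ai.
rewrite addr0.
rewrite big_mkord (reindex_inj rev_ord_inj); apply: eq_bigr => i _ /=.
have ia : (i <= a)%N by rewrite -ltnS.
by rewrite /hyp subSS bin_sub // -natrM.
Qed.

Lemma split_sum (f : nat -> R) i0 N : (i0 <= N)%N ->
  \sum_(i < N.+1) f i = f i0 + \sum_(t < i0) f (i0 - t.+1)%N + \sum_(t < N - i0) f (i0 + t.+1)%N.
Proof.
move=> iN; rewrite -(big_mkord xpredT f) (big_cat_nat _ (n := i0)) //=; last by lia.
rewrite [X in _ + X]big_ltn ?ltnS // [X in X + _]big_mkord (reindex_inj rev_ord_inj) /=.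
rewrite -[i0.+1]add0n big_addn big_mkord subSS addrCA addrA.
by congr (_ + _); apply: eq_bigr => i _; congr f; lia.
Qed.

(* Both half-lines around the mode carry a Gaussian profile. *)
Lemma hyp_mass_ge a b i0 (M T n : R) N : nearly_half a b i0 n -> 0 <= M -> 0 <= T ->
  (a%:R - b%:R) ^+ 2 <= M * n -> 64 * M <= n -> 256 * T <= n -> 16 <= n ->
  N%:R ^+ 2 <= T * n ->
  forall h, h = Num.sqrt (8 / n) ->
  hyp R a b i0 * expR (- ((64 * T + 32 * M + 208) * N%:R / n)) * (2 * Phi (h * N%:R) / h - 1)
    <= 'C(a + b, a)%:R.
Proof.
move=> nh M0 T0 hv nM nT n16 NT h hdef; have [nE iL iU n1] := nh.
have n0 : 0 < n by lra.
have h0 : 0 < h by rewrite hdef sqrtr_gt0 divr_gt0.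
have hE (t : nat) : - (h * t%:R) ^+ 2 = - (8 * t%:R ^+ 2 / n).
  by rewrite hdef exprMn sqr_sqrtr ?divr_ge0 ?(ltW n0) // mulrAC.
set K := hyp R a b i0 * _; have K0 : 0 <= K by rewrite mulr_ge0 ?hyp_ge0 ?expR_ge0.
have low (t : nat) : (t <= N)%N -> [/\ (t <= i0)%N, K * expR (- (h * t%:R) ^+ 2) <= hyp R a b (i0 + t) &
    K * expR (- (h * t%:R) ^+ 2) <= hyp R a b (i0 - t)].
  move=> tN; have tT : t%:R ^+ 2 <= T * n.
    by apply: le_trans NT; apply: lerXn2r; rewrite ?nnegrE // ler_nat.
  have [ti h1 h2] := hyp_lower nh M0 T0 hv nM nT n16 tT.
  have h3 : K * expR (- (h * t%:R) ^+ 2) <=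
      hyp R a b i0 * expR (- (8 * t%:R ^+ 2 / n) - (64 * T + 32 * M + 208) * t%:R / n).
    rewrite /K hE -mulrA -expRD ler_wpM2l ?hyp_ge0 // ler_expR addrC lerD2l lerN2.
    rewrite ler_pM2r ?invr_gt0; last exact: n0.
    by apply: ler_wpM2l; [clear -M0 T0; lra|rewrite ler_nat].
  by split => //; apply: le_trans h3 _.
have [Ni _ _] := low N (leqnn N).
have iab : (i0 <= a + b)%N.
  by rewrite -(ler_nat R) natrD -nE; have : 0 <= i0%:R :> R by []; clear -iL; lra.
rewrite -(@sum_hyp a b (a + b)) ?leq_addr // (split_sum (fun i => hyp R a b i) iab).
have Nr : (N <= a + b - i0)%N.
  have h1 : (N%:R : R) <= i0%:R by rewrite ler_nat.
  by rewrite -(ler_nat R) natrB // natrD -nE; clear -iL n0 h1; lra.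
have S := gauss_sum_ge N h0.
have sub (F : nat -> R) P : (N <= P)%N -> (forall t, (t <= N)%N -> K * expR (- (h * t%:R) ^+ 2) <= F t) ->
   (forall t, 0 <= F t) ->
   K * (Phi (h * N%:R) / h - 1) <= \sum_(t < P) F t.+1.
  move=> NP hF F0; apply: (@le_trans _ _ (\sum_(t < N) F t.+1)); last first.
    by rewrite -!(big_mkord xpredT (fun t => F t.+1)) (big_cat_nat _ (n := N) (p := P)) //= lerDl sumr_ge0.
  have h1 : K * (\sum_(t < N.+1) expR (- (h * t%:R) ^+ 2) - 1) <= \sum_(t < N) F t.+1.
    rewrite big_ord_recl mulr0 expr0n /= oppr0 expR0 addrAC subrr add0r mulr_sumr.
    by apply: ler_sum => t _; exact: hF.
  apply: le_trans h1; rewrite ler_wpM2l // lerD2r big_ord_recr /=.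
  by apply: (le_trans S); rewrite lerDl expR_ge0.
have u1 := sub (fun t => hyp R a b (i0 - t)) i0 Ni (fun t tN => let: And3 _ _ p := low t tN in p) (fun t => hyp_ge0 R a b _).
have u2 := sub (fun t => hyp R a b (i0 + t)) _ Nr (fun t tN => let: And3 _ p _ := low t tN in p) (fun t => hyp_ge0 R a b _).
have u3 : K <= hyp R a b i0.
  by have [_ + _] := low 0%N (leq0n N); rewrite mulr0 expr0n /= oppr0 expR0 mulr1 addn0.
rewrite (_ : K * (2 * Phi (h * N%:R) / h - 1) = K + K * (Phi (h * N%:R) / h - 1) + K * (Phi (h * N%:R) / h - 1)).
  by apply: lerD; [apply: lerD|].
ring.
Qed.

(** The weight [r] flattens the Gaussian exponent from 8 / n to 8 c / n; as a Riemann sum of step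
    sqrt c * sqrt (8 / n), each side of the mode contributes at most [Ginf] over the step. *)
Lemma hyp_near_le a b i0 (n K c : R) (r : nat -> R) N : nearly_half a b i0 n -> 0 < c -> 0 <= K ->
  (i0 <= N)%N -> (forall i, (0 <= r i)) ->
  (forall t, hyp R a b (i0 + t) * r (i0 + t)%N <= K * expR (- (8 * c * t%:R ^+ 2 / n))) ->
  (forall t, (t <= i0)%N -> hyp R a b (i0 - t) * r (i0 - t)%N <= K * expR (- (8 * c * t%:R ^+ 2 / n))) ->
  \sum_(i < N.+1) hyp R a b i * r i <= K * (1 + 2 * (Ginf R / (Num.sqrt c * Num.sqrt (8 / n)))).
Proof.
move=> nh c0 K0 iN r0 hu hd; have [nE iL iU n1] := nh.
have n0 : 0 < n by lra.
pose h := Num.sqrt c * Num.sqrt (8 / n).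
have h0 : 0 < h by rewrite mulr_gt0 ?sqrtr_gt0 ?divr_gt0.
have hE (t : nat) : - (8 * c * t%:R ^+ 2 / n) = - (h * t%:R) ^+ 2.
  by rewrite /h !exprMn !sqr_sqrtr ?divr_ge0 ?(ltW n0) ?(ltW c0) //; congr (- _); field; rewrite gt_eqF.
rewrite -/h (split_sum (fun i => hyp R a b i * r i) iN).
have S P : K * \sum_(t < P) expR (- (h * t.+1%:R) ^+ 2) <= K * (Ginf R / h).
  rewrite ler_wpM2l // (le_trans (gauss_sum_le P h0)) // ler_pM2r ?invr_gt0 // Phi_le //.
  by rewrite mulr_ge0 // ltW.
have -> : K * (1 + 2 * (Ginf R / h)) = K + K * (Ginf R / h) + K * (Ginf R / h) by ring.
apply: lerD; [apply: lerD|].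
- by have := hu 0%N; rewrite addn0 expr0n /= mulr0 mul0r oppr0 expR0 mulr1.
- apply: le_trans (S i0); rewrite mulr_sumr; apply: ler_sum => t _.
  by rewrite -hE; apply: hd; exact: ltn_ord.
- apply: le_trans (S (N - i0)%N); rewrite mulr_sumr; apply: ler_sum => t _.
  by rewrite -hE; exact: hu.
Qed.

End HypergeometricMass.

(** * The second moment over one class of colourings *)

Section FallingFactorial.
Variable R : realType.
Implicit Types (b k : nat).

(** The number of pairs of vertices in an edge, and minus the second coefficient of the falling
    factorial b ^_ k. It is the source of the factor exp (- x / 2). *)
Definition cc k : R := k%:R * (k%:R - 1) / 2.

Lemma ccS k : cc k.+1 = cc k + k%:R.
Proof. by rewrite /cc -natr1; field. Qed.

Lemma cc_ge0 k : 0 <= cc k.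
Proof. by case: k => [|k]; rewrite /cc ?mul0r // -natr1 addrK divr_ge0 // mulr_ge0. Qed.

Lemma ffact_ge b k : b%:R ^+ k.+1 - cc k.+1 * b%:R ^+ k <= (b ^_ k.+1)%:R :> R.
Proof.
elim: k => [|k IH]; first by rewrite ffactn1 expr1 /cc subrr mulr0 !mul0r subr0.
have b0 : 0 <= b%:R :> R by [].
have bk : 0 <= b%:R ^+ k :> R by rewrite exprn_ge0.
have c0 := cc_ge0 k.+1; have k0 : 0 <= k%:R :> R by [].
rewrite [b ^_ _]ffactnSr natrM ccS.
have [kb|bk'] := leqP k.+1 b.
  rewrite natrB //; have kb' : 0 <= b%:R - k.+1%:R :> R by rewrite subr_ge0 ler_nat.
  apply: le_trans (ler_wpM2r kb' IH); rewrite !exprS -subr_ge0.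
  rewrite (_ : _ - _ = k.+1%:R * cc k.+1 * b%:R ^+ k); last by ring.
  by rewrite mulr_ge0 ?mulr_ge0.
rewrite ffact_small // mul0r exprS -mulrBl.
rewrite -oppr_ge0 -mulNr mulr_ge0 ?exprn_ge0 // opprB subr_ge0.
have : b%:R <= k.+1%:R :> R by rewrite ler_nat ltnW.
lra.
Qed.

Lemma ffact_le b k :
  (b ^_ k.+2)%:R <= b%:R ^+ k.+2 - cc k.+2 * b%:R ^+ k.+1 + cc k.+2 ^+ 2 * b%:R ^+ k :> R.
Proof.
have pos c : 0 <= b%:R ^+ 2 - c * b%:R + c ^+ 2 :> R by nra.
elim: k => [|k IH].
  case: b {pos} => [|b]; first by rewrite ffact_small // expr0 expr1 /cc mulr0n; lra.
  by rewrite ffactnS ffactn1 natrM /= /cc expr0 expr1 -natr1; nra.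
have b0 : 0 <= b%:R :> R by [].
have bk : 0 <= b%:R ^+ k :> R by rewrite exprn_ge0.
have c0 := cc_ge0 k.+2; have k0 : 0 <= k.+2%:R :> R by [].
rewrite [b ^_ _]ffactnSr natrM (ccS k.+2).
have [kb|bk'] := leqP k.+2 b.
  rewrite natrB //; have kb' : 0 <= b%:R - k.+2%:R :> R by rewrite subr_ge0 ler_nat.
  apply: (le_trans (ler_wpM2r kb' IH)); rewrite ![_ ^+ k.+3]exprS ![b%:R ^+ k.+2]exprS ![b%:R ^+ k.+1]exprS -subr_ge0.
  set x := cc k.+2 in c0 *; set y := k.+2%:R in k0 *; set p := b%:R ^+ k in bk *.
  rewrite (_ : _ - _ = (x * y + y ^+ 2) * (b%:R * p) + y * x ^+ 2 * p); last by ring.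
  have d1 : 0 <= x * y + y ^+ 2 by rewrite addr_ge0 ?mulr_ge0 ?sqr_ge0.
  by rewrite addr_ge0 //; apply: mulr_ge0 => //; rewrite mulr_ge0 ?sqr_ge0.
rewrite ffact_small // mul0r ![_ ^+ k.+3]exprS ![b%:R ^+ k.+2]exprS ![b%:R ^+ k.+1]exprS.
set x := cc k.+2 + _; rewrite [leRHS](_ : _ = (b%:R ^+ 2 - x * b%:R + x ^+ 2) * (b%:R * b%:R ^+ k)); last by ring.
by rewrite mulr_ge0 ?mulr_ge0.
Qed.

Lemma ffact_norm k b (n x : R) : 0 < n -> b%:R = n * x -> 0 <= x ->
  x ^+ k.+2 - cc k.+2 * n^-1 * x ^+ k.+1 <= (b ^_ k.+2)%:R / n ^+ k.+2 <=
  x ^+ k.+2 - cc k.+2 * n^-1 * x ^+ k.+1 + (cc k.+2 * n^-1) ^+ 2 * x ^+ k.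
Proof.
move=> n0 bE x0; have nk : 0 < n ^+ k.+2 by rewrite exprn_gt0.
have nn : 0 < n ^+ k by rewrite exprn_gt0.
rewrite ler_pdivlMr // ler_pdivrMr //.
have := ffact_ge b k.+1; have := ffact_le b k; rewrite bE !exprMn.
move=> h1 h2; apply/andP; split.
  apply: le_trans h2; rewrite le_eqVlt; apply/orP; left; apply/eqP.
  by rewrite !exprS; field; rewrite gt_eqF.
apply: (le_trans h1); rewrite le_eqVlt; apply/orP; left; apply/eqP.
by rewrite !exprS; field; rewrite gt_eqF.
Qed.

(** The even and odd parts of (s + h) ^ k mix when k grows, E becoming s E + h O and O becoming s O
    + h E. Hence three estimates of different precision are proved together; the first is the sharp
    one, the others feed it. *)
Lemma even_expand k : exists2 C : R, 0 <= C & forall s h : R, `|s - 1| <= 1 -> `|h| <= 2 ->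
  [/\ (s + h) ^+ k + (s - h) ^+ k <= 2 * s ^+ k + 2 * cc k * h ^+ 2 + C * (h ^+ 2 * (`|s - 1| + h ^+ 2)),
     `|(s + h) ^+ k - (s - h) ^+ k - 2 * k%:R * h| <= C * (`|h| * (`|s - 1| + h ^+ 2)) &
     `|(s + h) ^+ k + (s - h) ^+ k - 2| <= C * (`|s - 1| + h ^+ 2)].
Proof.
elim: k => [|k [C C0 IH]].
  exists 0 => // s h _ _; rewrite !expr0 /cc !mul0r !mulr0 !mul0r subrr subr0 normr0; split=> //.
  - by lra.
  - by rewrite (_ : 1 + 1 - 2 = 0) ?normr0 //; lra.
have k0 := cc_ge0 k; have kk : 0 <= k%:R :> R by [].
exists (10 * C + 2 * cc k + 4 * k%:R + 2) => [|s h hs hh]; first by lra.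
have [h1 h2 h3] := IH s h hs hh.
have w0 : 0 <= `|s - 1| by []. have H0 : 0 <= `|h| by [].
have hE : h ^+ 2 = `|h| ^+ 2 by rewrite -normrX ger0_norm ?sqr_ge0.
have s2 : 0 <= s <= 2 by move: hs; rewrite ler_norml => /andP[]; lra.
have sw : `|s| <= 2 by rewrite ger0_norm; clear -s2; lra.
set E := _ ^+ k + _ ^+ k in h1 h3; set O := _ ^+ k - _ ^+ k in h2.
have -> : (s + h) ^+ k.+1 + (s - h) ^+ k.+1 = s * E + h * O by rewrite /E /O !exprS; ring.
have -> : (s + h) ^+ k.+1 - (s - h) ^+ k.+1 = s * O + h * E by rewrite /E /O !exprS; ring.
set W := `|s - 1| in hs h1 h2 h3 w0 *.
have e0 : 0 <= W + h ^+ 2 by rewrite addr_ge0 ?sqr_ge0.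
have hO : `|h * (O - 2 * k%:R * h)| <= C * (h ^+ 2 * (W + h ^+ 2)).
  by rewrite normrM; apply: (le_trans (ler_wpM2l H0 h2)); rewrite hE; clear; lra.
have hO2 := hO; rewrite ler_norml in hO2; case/andP: hO2 => _ hO2.
have hw : `|(s - 1) * (2 * k%:R * h)| <= 2 * k%:R * (`|h| * (W + h ^+ 2)).
  rewrite !normrM -/W [`|2|]ger0_norm // [`|k%:R|]ger0_norm //.
  have : 0 <= `|h| * h ^+ 2 by rewrite mulr_ge0 ?sqr_ge0.
  move=> /(mulr_ge0 kk); clear; lra.
have g0 : 0 <= h ^+ 2 * (W + h ^+ 2) by rewrite mulr_ge0 ?sqr_ge0.
have g1 : 0 <= `|h| * (W + h ^+ 2) by rewrite mulr_ge0.
split.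
- have h4 := ler_wpM2l (proj1 (andP s2)) h1.
  have h5 : s * (C * (h ^+ 2 * (W + h ^+ 2))) <= 2 * (C * (h ^+ 2 * (W + h ^+ 2))).
    by rewrite ler_wpM2r ?(mulr_ge0 C0 g0) //; case/andP: s2.
  have h6 : s * (2 * cc k * h ^+ 2) <= 2 * cc k * h ^+ 2 + 2 * cc k * (h ^+ 2 * (W + h ^+ 2)).
    have : (s - 1) * (2 * cc k * h ^+ 2) <= W * (2 * cc k * h ^+ 2).
      by rewrite ler_wpM2r ?ler_norm // mulr_ge0 ?sqr_ge0 // mulr_ge0.
    have : 0 <= cc k * (h ^+ 2 * h ^+ 2) by rewrite mulr_ge0 // mulr_ge0 ?sqr_ge0.
    clear; lra.
  have h7 : 0 <= C * (h ^+ 2 * (W + h ^+ 2)) by rewrite mulr_ge0.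
  have h8 : 0 <= k%:R * (h ^+ 2 * (W + h ^+ 2)) by rewrite mulr_ge0.
  rewrite ccS exprS; lra.
- have -> : s * O + h * E - 2 * k.+1%:R * h = s * (O - 2 * k%:R * h) + (s - 1) * (2 * k%:R * h) + h * (E - 2).
    by rewrite -natr1; ring.
  apply: (le_trans (ler_normD _ _)); apply: (le_trans (lerD (ler_normD _ _) (lexx _))).
  have h4 : `|s * (O - 2 * k%:R * h)| <= 2 * (C * (`|h| * (W + h ^+ 2))).
    by rewrite normrM; apply: ler_pM.
  have h5 : `|h * (E - 2)| <= C * (`|h| * (W + h ^+ 2)).
    by rewrite normrM; apply: (le_trans (ler_wpM2l H0 h3)); clear; lra.
  have h6 : 0 <= C * (`|h| * (W + h ^+ 2)) by rewrite mulr_ge0.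
  have h7 : 0 <= cc k * (`|h| * (W + h ^+ 2)) by rewrite mulr_ge0.
  have h8 : 0 <= k%:R * (`|h| * (W + h ^+ 2)) by rewrite mulr_ge0.
  clear -hw g1 h4 h5 h6 h7 h8; lra.
- have -> : s * E + h * O - 2 = s * (E - 2) + 2 * (s - 1) + h * (O - 2 * k%:R * h) + 2 * k%:R * h ^+ 2 by ring.
  apply: (le_trans (ler_normD _ _)); apply: (le_trans (lerD (ler_normD _ _) (lexx _))).
  apply: (le_trans (lerD (lerD (ler_normD _ _) (lexx _)) (lexx _))).
  have h4 : `|s * (E - 2)| <= 2 * (C * (W + h ^+ 2)) by rewrite normrM; apply: ler_pM.
  have h5 : `|2 * (s - 1)| = 2 * W by rewrite normrM ger0_norm.
  have h6 : `|2 * k%:R * h ^+ 2| = 2 * k%:R * h ^+ 2 by rewrite ger0_norm // mulr_ge0 ?sqr_ge0 // mulr_ge0.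
  have h7 : C * (h ^+ 2 * (W + h ^+ 2)) <= 4 * (C * (W + h ^+ 2)).
    rewrite mulrCA ler_wpM2r ?mulr_ge0 // hE.
    have : `|h| ^+ 2 <= 2 ^+ 2 by apply: lerXn2r; rewrite ?nnegrE.
    clear; lra.
  have h8 : 0 <= C * (W + h ^+ 2) by rewrite mulr_ge0.
  have h9 : 0 <= cc k * (W + h ^+ 2) by rewrite mulr_ge0.
  have h10 : 0 <= k%:R * W by rewrite mulr_ge0.
  have h11 : 0 <= h ^+ 2 by rewrite sqr_ge0.
  have h12 : 0 <= k%:R * h ^+ 2 by rewrite mulr_ge0.
  lra.
Qed.

(** The binomial 'C(b, k) without the common factor n ^ k / k!, so that edge counts become nearly
    polynomials in the proportions b / n. *)
Definition nff k (n : R) b : R := (b ^_ k)%:R / n ^+ k.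

Lemma sev_quad k : exists2 C : R, 0 <= C & forall u : R, `|u| <= 1 -> Sev k u <= 1 + C * u ^+ 2.
Proof.
have [C C0 H] := even_expand k; exists C => // u u1.
have [_ _] := H 1 u ltac:(by rewrite subrr normr0) ltac:(by apply: le_trans u1 _; rewrite ler1n).
rewrite subrr normr0 add0r ler_norml => /andP[_ h]; rewrite /Sev.
have : 0 <= C * u ^+ 2 by rewrite mulr_ge0 ?sqr_ge0.
lra.
Qed.

Lemma Sev_ge k (u : R) : 1 + cc k * u ^+ 2 <= Sev k u.
Proof.
have [u0|u0] := leP 0 u; first exact: (Sev_ge_sq k u0).1.
by rewrite -SevN -sqrrN; apply: (Sev_ge_sq k _).1; lra.
Qed.

Lemma nffN_bound k n : (0 < n)%N -> forall z : R, z = n%:R^-1 ->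
  1 - cc k.+2 * z <= nff k.+2 n%:R n <= 1 - cc k.+2 * z + (cc k.+2 * z) ^+ 2.
Proof.
move=> n0 z ->; have n0' : 0 < n%:R :> R by rewrite ltr0n.
have := @ffact_norm k n n%:R 1 n0' ltac:(by rewrite mulr1) ltac:(by []).
by rewrite !expr1n !mulr1.
Qed.

Lemma nffA_bound k : exists2 C : R, 0 <= C & forall (a b : nat) (n z u : R),
  1 <= n -> n = a%:R + b%:R -> u = (a%:R - b%:R) / n -> z = n^-1 ->
  2 / 2 ^+ k.+2 * (1 + cc k.+2 * u ^+ 2 - 2 * cc k.+2 * z) - C * (u ^+ 2 * z)
    <= nff k.+2 n a + nff k.+2 n b <= 2 / 2 ^+ k.+2 + C * (u ^+ 2 + z ^+ 2).
Proof.
have [C1 C10 H1] := sev_quad k.+1; have [C2 C20 H2] := sev_quad k.+2.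
have c0 := cc_ge0 k.+2.
have p0 : 0 < 2 ^+ k.+2 :> R by rewrite exprn_gt0.
have p1 : 2 / 2 ^+ k.+2 <= 1 :> R.
  by rewrite ler_pdivrMr // mul1r exprS ler_peMr // exprn_ege1 // ler1n.
have q0 : 0 <= 2 / 2 ^+ k.+2 :> R by rewrite divr_ge0 // ltW.
exists (2 * cc k.+2 * C1 + C2 + 2 * cc k.+2 ^+ 2).
  by rewrite !addr_ge0 ?mulr_ge0 ?sqr_ge0.
move=> a b n z u n1 nE uE zE; have n0 : 0 < n by lra.
have z0 : 0 < z by rewrite zE invr_gt0.
have aE : a%:R = n * ((1 + u) / 2).
  apply: (@eq_trans _ _ ((n + (a%:R - b%:R)) / 2)); first by rewrite nE; field.
  by rewrite uE; field; rewrite gt_eqF.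
have bE : b%:R = n * ((1 - u) / 2).
  apply: (@eq_trans _ _ ((n - (a%:R - b%:R)) / 2)); first by rewrite nE; field.
  by rewrite uE; field; rewrite gt_eqF.
have a0 : 0 <= (1 + u) / 2 by rewrite -(pmulr_rge0 _ n0) -aE.
have b0 : 0 <= (1 - u) / 2 by rewrite -(pmulr_rge0 _ n0) -bE.
have u1 : `|u| <= 1 by rewrite ler_norml; apply/andP; split; clear -a0 b0; lra.
have /andP[ha1 ha2] := ffact_norm k n0 aE a0.
have /andP[hb1 hb2] := ffact_norm k n0 bE b0.
rewrite -zE -/(nff k.+2 n a) -/(nff k.+2 n b) in ha1 ha2 hb1 hb2.
have S1 : ((1 + u) / 2) ^+ k.+1 + ((1 - u) / 2) ^+ k.+1 = 2 * (2 / 2 ^+ k.+2) * Sev k.+1 u.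
  by rewrite !expr_div_n /Sev [2 ^+ k.+2]exprS; field; rewrite gt_eqF // exprn_gt0.
have S2 : ((1 + u) / 2) ^+ k.+2 + ((1 - u) / 2) ^+ k.+2 = 2 / 2 ^+ k.+2 * Sev k.+2 u.
  by rewrite !expr_div_n /Sev; field; rewrite gt_eqF.
have S0 : ((1 + u) / 2) ^+ k + ((1 - u) / 2) ^+ k <= 2.
  have e1 : ((1 + u) / 2) ^+ k <= 1 by rewrite exprn_ile1 //; clear -b0; lra.
  have e2 : ((1 - u) / 2) ^+ k <= 1 by rewrite exprn_ile1 //; clear -a0; lra.
  clear -e1 e2; lra.
have G2 := ler_wpM2l q0 (Sev_ge k.+2 u).
have G2' := ler_wpM2l q0 (H2 u u1).
have cz : 0 <= cc k.+2 * z by rewrite mulr_ge0 // ltW.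
have G1 := ler_wpM2l (mulr_ge0 cz (mulr_ge0 (ltW (ltr0Sn R 1)) q0)) (H1 u u1).
have uz : 0 <= u ^+ 2 * z by rewrite mulr_ge0 ?sqr_ge0 // ltW.
have uu : 0 <= u ^+ 2 by rewrite sqr_ge0.
have zz : 0 <= z ^+ 2 by rewrite sqr_ge0.
have f1 : 0 <= cc k.+2 * C1 * (u ^+ 2 * z) by rewrite mulr_ge0 // mulr_ge0.
have f2 : 0 <= C2 * (u ^+ 2 * z) by rewrite mulr_ge0.
have f3 : 0 <= cc k.+2 ^+ 2 * (u ^+ 2 * z) by rewrite mulr_ge0 ?sqr_ge0.
have f4 : 2 / 2 ^+ k.+2 * (cc k.+2 * C1 * (u ^+ 2 * z)) <= cc k.+2 * C1 * (u ^+ 2 * z).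
  by rewrite ler_piMl.
have T1 : cc k.+2 * z * (((1 + u) / 2) ^+ k.+1 + ((1 - u) / 2) ^+ k.+1) <=
    2 / 2 ^+ k.+2 * (2 * cc k.+2 * z) + 2 * (cc k.+2 * C1 * (u ^+ 2 * z)).
  rewrite S1; clear -G1 f4; lra.
have T3 : 0 <= cc k.+2 * z * (((1 + u) / 2) ^+ k.+1 + ((1 - u) / 2) ^+ k.+1).
  by rewrite mulr_ge0 // addr_ge0 // exprn_ge0.
have T4 := ler_wpM2l (sqr_ge0 (cc k.+2 * z)) S0.
have f5 : 2 / 2 ^+ k.+2 * (C2 * u ^+ 2) <= C2 * u ^+ 2 by rewrite ler_piMl // mulr_ge0.
have f6 : 0 <= C2 * z ^+ 2 by rewrite mulr_ge0.
have f7 : 0 <= cc k.+2 ^+ 2 * u ^+ 2 by rewrite mulr_ge0 // sqr_ge0.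
have f8 : 0 <= cc k.+2 * C1 * (u ^+ 2 + z ^+ 2) by rewrite mulr_ge0 ?addr_ge0 // mulr_ge0.
apply/andP; split.
  clear -ha1 hb1 S2 G2 T1 f2 f3; lra.
clear -ha2 hb2 S2 G2' T3 T4 f5 f6 f7 f8; lra.
Qed.

(** Jensen's inequality for the four cells, by tangents at 1/4. *)
Lemma pow_sum_ge j (x y t : R) : 0 <= x -> 0 <= y -> 0 <= t -> x + y + 2 * t = 1 ->
  4 * (1 / 4) ^+ j.+1 <= x ^+ j.+1 + y ^+ j.+1 + 2 * t ^+ j.+1.
Proof.
move=> x0 y0 t0 s; have q : 0 <= 1 / 4 :> R by lra.
have := tangent_pow j x0 q; have := tangent_pow j y0 q; have := tangent_pow j t0 q.
have -> : x = 1 - y - 2 * t by lra.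
set e := j.+1%:R * _; move: (_ ^+ j.+1) (_ ^+ j.+1) => A B; lra.
Qed.

(** The four cells of two colourings have proportions (1 + w + 2 u) / 4, (1 + w - 2 u) / 4 and twice
    (1 - w) / 4. [even_expand] at s = 1 + w, h = 2 u treats the first two, and [pow_sum_ge] bounds
    the correction for distinct vertices. *)
Lemma nffD_bound k : exists2 C : R, 0 <= C & forall (a b i : nat) (n z u w : R),
  1 <= n -> n = a%:R + b%:R -> u = (a%:R - b%:R) / n -> z = n^-1 -> w = 1 - 4 * i%:R / n ->
  (i <= a)%N -> (i <= b)%N ->
  nff k.+2 n (a - i) + 2 * nff k.+2 n i + nff k.+2 n (b - i) <=
  (2 / 2 ^+ k.+2) ^+ 2 * (Sev k.+2 w + 2 * cc k.+2 * u ^+ 2 - 4 * cc k.+2 * z)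
   + C * (u ^+ 2 * `|w| + u ^+ 4 + z ^+ 2).
Proof.
have [C1 C10 H1] := even_expand k.+2.
have c0 := cc_ge0 k.+2.
exists (16 * C1 + 4 * cc k.+2 ^+ 2); first by rewrite addr_ge0 ?mulr_ge0 ?sqr_ge0.
move=> a b i n z u w n1 nE uE zE wE ia ib; have n0 : 0 < n by lra.
have z0 : 0 < z by rewrite zE invr_gt0.
have xE : (a - i)%:R = n * ((1 + w + 2 * u) / 4).
  apply: (@eq_trans _ _ ((2 * n - 4 * i%:R + 2 * (a%:R - b%:R)) / 4)); first by rewrite natrB // nE; field.
  by rewrite uE wE; field; rewrite gt_eqF.
have yE : (b - i)%:R = n * ((1 + w - 2 * u) / 4).
  apply: (@eq_trans _ _ ((2 * n - 4 * i%:R - 2 * (a%:R - b%:R)) / 4)); first by rewrite natrB // nE; field.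
  by rewrite uE wE; field; rewrite gt_eqF.
have tE : i%:R = n * ((1 - w) / 4) by rewrite wE; field; rewrite gt_eqF.
set x := (1 + w + 2 * u) / 4 in xE; set y := (1 + w - 2 * u) / 4 in yE; set t := (1 - w) / 4 in tE.
have x0 : 0 <= x by rewrite -(pmulr_rge0 _ n0) -xE.
have y0 : 0 <= y by rewrite -(pmulr_rge0 _ n0) -yE.
have t0 : 0 <= t by rewrite -(pmulr_rge0 _ n0) -tE.
have s1 : x + y + 2 * t = 1 by rewrite /x /y /t; field.
have /andP[_ hx] := ffact_norm k n0 xE x0.
have /andP[_ hy] := ffact_norm k n0 yE y0.
have /andP[_ ht] := ffact_norm k n0 tE t0.
rewrite -zE -/(nff k.+2 n _) in hx; rewrite -zE -/(nff k.+2 n _) in hy; rewrite -zE -/(nff k.+2 n _) in ht.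
have w1 : `|w| <= 1 by rewrite ler_norml; apply/andP; rewrite /x /y /t in x0 y0 t0; split; clear -x0 y0 t0; lra.
have u1 : `|2 * u| <= 2 by rewrite ler_norml; apply/andP; rewrite /x /y /t in x0 y0 t0; split; clear -x0 y0 t0; lra.
have [+ _ _] := H1 (1 + w) (2 * u) ltac:(by rewrite addrC addKr) u1.
rewrite (_ : 1 + w - 1 = w); last by ring.
rewrite (_ : 1 + w + 2 * u = 4 * x); last by rewrite /x; field.
rewrite (_ : 1 + w - 2 * u = 4 * y); last by rewrite /y; field.
rewrite [(4 * x) ^+ _]exprMn [(4 * y) ^+ _]exprMn [(2 * u) ^+ 2]exprMn => hE.
have P0 : 0 < 4 ^+ k.+2 :> R by rewrite exprn_gt0.
have P1 : 1 <= 4 ^+ k.+2 :> R by rewrite exprn_ege1 // ler1n.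
have T2 := pow_sum_ge k x0 y0 t0 s1.
have q2 : (2 / 2 ^+ k.+2) ^+ 2 = 4 / 4 ^+ k.+2 :> R.
  by rewrite expr_div_n -exprM mulnC exprM; congr (_ / _ ^+ _); ring.
have T2' : 4 * (1 / 4) ^+ k.+1 = 16 / 4 ^+ k.+2 :> R.
  by rewrite expr_div_n expr1n [4 ^+ k.+2]exprS; field; rewrite gt_eqF // exprn_gt0.
have le1 (v : R) : 0 <= v -> v <= 1 -> v ^+ k <= 1 by move=> *; rewrite exprn_ile1.
have T0 : x ^+ k + y ^+ k + 2 * t ^+ k <= 4.
  have := le1 x x0 ltac:(clear -y0 t0 s1; lra); have := le1 y y0 ltac:(clear -x0 t0 s1; lra).
  have := le1 t t0 ltac:(clear -y0 x0 t0 s1; lra); clear; lra.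
have tk : t ^+ k.+2 = (1 - w) ^+ k.+2 / 4 ^+ k.+2 by rewrite /t expr_div_n.
have SE : Sev k.+2 w = ((1 + w) ^+ k.+2 + (1 - w) ^+ k.+2) / 2 by [].
have u2 : 0 <= u ^+ 2 by rewrite sqr_ge0.
have u4 : 0 <= u ^+ 4 by rewrite (_ : u ^+ 4 = (u ^+ 2) ^+ 2) ?sqr_ge0 // -exprM.
have e0 : 0 <= C1 * (u ^+ 2 * `|w| + u ^+ 4).
  by rewrite mulr_ge0 // addr_ge0 // mulr_ge0.
have T3 : x ^+ k.+2 + y ^+ k.+2 + 2 * t ^+ k.+2 <=
    4 / 4 ^+ k.+2 * (Sev k.+2 w + 2 * cc k.+2 * u ^+ 2) + 16 * (C1 * (u ^+ 2 * `|w| + u ^+ 4)).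
  have h1 : x ^+ k.+2 + y ^+ k.+2 <= (2 * (1 + w) ^+ k.+2 + 8 * cc k.+2 * u ^+ 2 +
      16 * (C1 * (u ^+ 2 * `|w| + u ^+ 4))) / 4 ^+ k.+2.
    rewrite ler_pdivlMr // mulrDl ![_ * 4 ^+ k.+2]mulrC; apply: (le_trans hE).
    have : 0 <= C1 * (u ^+ 2 * `|w|) by rewrite mulr_ge0 // mulr_ge0.
    clear; lra.
  have h2 : 16 * (C1 * (u ^+ 2 * `|w| + u ^+ 4)) / 4 ^+ k.+2 <= 16 * (C1 * (u ^+ 2 * `|w| + u ^+ 4)).
    by rewrite ler_pdivrMr // ler_peMr // mulr_ge0.
  rewrite tk SE; clear -h1 h2; lra.
have cz : 0 <= cc k.+2 * z by rewrite mulr_ge0 // ltW.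
have T4 := ler_wpM2l cz T2; have T5 := ler_wpM2l (sqr_ge0 (cc k.+2 * z)) T0.
rewrite T2' in T4; rewrite q2.
have f1 : 0 <= C1 * z ^+ 2 by rewrite mulr_ge0 // sqr_ge0.
have f2 : 0 <= cc k.+2 ^+ 2 * (u ^+ 2 * `|w| + u ^+ 4).
  by rewrite mulr_ge0 ?sqr_ge0 // addr_ge0 // mulr_ge0.
clear -hx hy ht T3 T4 T5 f1 f2; lra.
Qed.

(* The second-order terms in u cancel between D N and A ^ 2. *)
Lemma overlap_excess (D N A S u w z q c C M : R) :
  0 <= C -> 0 <= M -> 0 <= c -> 0 <= q <= 1 -> 0 <= z <= 1 -> u ^+ 2 <= M * z ->
  1 <= S -> 0 <= D -> 0 <= N -> 0 <= w ->
  D <= q ^+ 2 * (S + 2 * c * u ^+ 2 - 4 * c * z) + C * (u ^+ 2 * w + u ^+ 4 + z ^+ 2) ->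
  N <= 1 - c * z + (c * z) ^+ 2 ->
  q * (1 + c * u ^+ 2 - 2 * c * z) - C * (u ^+ 2 * z) <= A ->
  D * N - A ^+ 2 <= q ^+ 2 * (S - 1 - c * z) +
     (C * (M + M ^+ 2 + 1) * (1 + c ^+ 2) + (4 + S + 2 * c * M) * c ^+ 2 + 2 * C * M) * (z * (w + z)).
Proof.
move=> C0 M0 c0 /andP[q0 q1] /andP[z0 z1] uM S1 D0 N0 w0 hD hN hA.
have u0 : 0 <= u ^+ 2 by rewrite sqr_ge0.
have u4 : u ^+ 4 = u ^+ 2 * u ^+ 2 by rewrite -exprD.
rewrite u4 in hD; move: (u ^+ 2) u0 uM hD hA {u4} => v v0 vM hD hA.
have A2 : q ^+ 2 * (1 + 2 * (c * v - 2 * c * z)) - 2 * q * (C * (v * z)) <= A ^+ 2.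
  have : 0 <= (A - q) ^+ 2 by rewrite sqr_ge0.
  have := ler_wpM2l q0 hA; nra.
have z2 : 0 <= z ^+ 2 by rewrite sqr_ge0.
have zz : z ^+ 2 <= z by rewrite expr2 ler_piMl.
have q2 : q ^+ 2 <= 1 by rewrite exprn_ile1.
have q20 : 0 <= q ^+ 2 by rewrite sqr_ge0.
set e := v * w + v * v + z ^+ 2 in hD.
have e0 : 0 <= e by rewrite !addr_ge0 ?mulr_ge0.
have eM : e <= (M + M ^+ 2 + 1) * (z * (w + z)).
  have h1 : v * w <= M * z * w by rewrite ler_wpM2r.
  have h2 : v * v <= M * z * (M * z) by rewrite ler_pM.
  have h3 : 0 <= z * w by rewrite mulr_ge0.
  have h4 : 0 <= M ^+ 2 * (z * w) by rewrite mulr_ge0 ?sqr_ge0.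
  have h5 : 0 <= M * z ^+ 2 by rewrite mulr_ge0.
  rewrite /e; clear -h1 h2 h3 h4 h5; lra.
have DN : D * N <= (q ^+ 2 * (S + 2 * c * v - 4 * c * z) + C * e) * (1 - c * z + (c * z) ^+ 2).
  by apply: ler_pM.
have cz2 : (c * z) ^+ 2 <= c ^+ 2 by rewrite exprMn ler_piMr ?sqr_ge0 // (le_trans zz).
have cz0 : 0 <= c * z by rewrite mulr_ge0.
have g0 : 0 <= z * (w + z) by rewrite mulr_ge0 ?addr_ge0.
have Ce : C * e * (1 - c * z + (c * z) ^+ 2) <= C * (M + M ^+ 2 + 1) * (1 + c ^+ 2) * (z * (w + z)).
  have h1 : C * e * (1 - c * z + (c * z) ^+ 2) <= C * e * (1 + c ^+ 2).
    by rewrite ler_wpM2l ?mulr_ge0 //; clear -cz2 cz0; lra.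
  apply: (le_trans h1).
  have h2 : C * e <= C * ((M + M ^+ 2 + 1) * (z * (w + z))) by rewrite ler_wpM2l.
  have h3 : 0 <= 1 + c ^+ 2 by rewrite addr_ge0 ?sqr_ge0.
  have := ler_wpM2r h3 h2; clear; lra.
have Qb : q ^+ 2 * (S + 2 * c * v - 4 * c * z) * (1 - c * z + (c * z) ^+ 2) <=
   q ^+ 2 * (S - 1 - c * z) + q ^+ 2 * (1 + 2 * (c * v - 2 * c * z)) + (4 + S + 2 * c * M) * c ^+ 2 * z ^+ 2.
  have h1 : (S + 2 * c * v - 4 * c * z) * (1 - c * z + (c * z) ^+ 2) <=
     (S - 1 - c * z) + (1 + 2 * (c * v - 2 * c * z)) + (4 + S + 2 * c * M) * c ^+ 2 * z ^+ 2.
    have k1 : 0 <= (S - 1) * (c * z) by rewrite mulr_ge0 // subr_ge0.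
    have k2 : 0 <= c * v * (c * z) by rewrite !mulr_ge0.
    have k3 : c * v * (c * z) ^+ 2 <= c * M * (c * z) ^+ 2.
      rewrite ler_wpM2r ?sqr_ge0 // ler_wpM2l //; apply: (le_trans vM).
      by rewrite ler_piMr.
    have k4 : 0 <= c * z * (c * z) ^+ 2 by rewrite !mulr_ge0 ?sqr_ge0.
    have k5 : (c * z) ^+ 2 = c ^+ 2 * z ^+ 2 by rewrite exprMn.
    clear -k1 k2 k3 k4 k5; nra.
  have h2 := ler_wpM2l q20 h1.
  have h3 : q ^+ 2 * ((4 + S + 2 * c * M) * c ^+ 2 * z ^+ 2) <= (4 + S + 2 * c * M) * c ^+ 2 * z ^+ 2.
    rewrite ler_piMl // !mulr_ge0 ?sqr_ge0 //.
    have : 0 <= c * M by rewrite mulr_ge0.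
    clear -S1; lra.
  clear -h2 h3; lra.
have R1 : 2 * q * (C * (v * z)) <= 2 * C * M * (z * (w + z)).
  have h1 : q * (C * (v * z)) <= C * (v * z) by rewrite ler_piMl // !mulr_ge0.
  have h2 : C * (v * z) <= C * (M * z * z) by rewrite ler_wpM2l // ler_wpM2r.
  have h3 : 0 <= C * (M * (z * w)) by rewrite !mulr_ge0.
  clear -h1 h2 h3; lra.
have R2 : (4 + S + 2 * c * M) * c ^+ 2 * z ^+ 2 <= (4 + S + 2 * c * M) * c ^+ 2 * (z * (w + z)).
  rewrite ler_wpM2l ?mulr_ge0 ?sqr_ge0 //.
    have : 0 <= c * M by rewrite mulr_ge0.
    clear -S1; lra.
  by rewrite expr2 mulrDr lerDr mulr_ge0.
clear -DN Ce Qb R1 R2 A2; lra.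
Qed.

End FallingFactorial.

(** * Probability of two colourings at a given overlap *)

Section OverlapRatio.
Variable R : realType.

(** Compare the falling factorials factor by factor. With X = D N - A ^ 2, the j-th pair of factors
    satisfies (Nb - j) (N - j) = (Ns - j) ^ 2 + X - j D, so the whole excess is governed by X. *)
Lemma bin_ratio_le (N Ns Nb A D m : nat) : (Ns + A = N)%N -> (Nb + 2 * A = N + D)%N ->
  (D <= N)%N -> (2 * m <= Ns)%N -> (0 < Ns)%N ->
  'C(Nb, m)%:R * 'C(N, m)%:R <= 'C(Ns, m)%:R ^+ 2 *
    expR (m%:R * ((D%:R * N%:R - A%:R ^+ 2) / Ns%:R ^+ 2) + 6 * m%:R ^+ 2 * N%:R ^+ 2 / Ns%:R ^+ 3) :> R.
Proof.
move=> NsE NbE DN mNs Ns0.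
have Y0 : 0 < Ns%:R :> R by rewrite ltr0n.
pose X : R := D%:R * N%:R - A%:R ^+ 2.
pose tau : R := X / Ns%:R ^+ 2 + 6 * m%:R * N%:R ^+ 2 / Ns%:R ^+ 3.
have NE : N%:R = Ns%:R + A%:R :> R by rewrite -NsE natrD.
have BE : Nb%:R = N%:R + D%:R - 2 * A%:R :> R.
  have : (Nb + 2 * A)%:R = (N + D)%:R :> R by rewrite NbE.
  by rewrite natrD natrM natrD; lra.
have mY : 2 * m%:R <= Ns%:R :> R by rewrite -natrM ler_nat.
have DN' : D%:R <= N%:R :> R by rewrite ler_nat.
have D0 : 0 <= D%:R :> R by []. have N0 : 0 <= N%:R :> R by []. have m0 : 0 <= m%:R :> R by [].
have XN : X <= N%:R ^+ 2.
  have : D%:R * N%:R <= N%:R * N%:R :> R by rewrite ler_wpM2r.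
  by have := sqr_ge0 (A%:R : R); rewrite /X expr2; lra.
have step (j : nat) : (j < m)%N ->
    (Nb - j)%:R * (N - j)%:R <= (Ns - j)%:R ^+ 2 * expR tau :> R.
  move=> jm; have jN : (j <= N)%N by lia.
  have jNs : (j <= Ns)%N by lia.
  have [jb|jb] := leqP j Nb; last first.
    by rewrite (_ : (Nb - j = 0)%N) ?mul0r ?mulr_ge0 ?expR_ge0 ?exprn_ge0 //; lia.
  have jm' : j%:R <= m%:R :> R by rewrite ler_nat ltnW.
  rewrite !natrB //; have j0 : 0 <= j%:R :> R by [].
  have h : (Nb%:R - j%:R) * (N%:R - j%:R) = (Ns%:R - j%:R) ^+ 2 + (X - j%:R * D%:R) :> R.
    by rewrite BE NE /X NE; ring.
  rewrite h; have jX : X - j%:R * D%:R <= X by rewrite gerBl mulr_ge0.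
  have s0 : 0 <= (Ns%:R - j%:R) ^+ 2 :> R by rewrite sqr_ge0.
  apply: (@le_trans _ _ ((Ns%:R - j%:R) ^+ 2 * (1 + tau))); last by rewrite ler_wpM2l // expR_ge1Dx.
  rewrite mulrDr mulr1 lerD2l; apply: (le_trans jX).
  have [X0|X0] := leP X 0.
    have t1 : X / Ns%:R ^+ 2 <= tau by rewrite lerDl !mulr_ge0 ?invr_ge0 ?exprn_ge0.
    apply: le_trans (ler_wpM2l s0 t1); rewrite mulrCA ler_niMr //.
    rewrite ler_pdivrMr ?exprn_gt0 // mul1r; apply: lerXn2r; rewrite ?nnegrE //; clear -mY jm' j0; lra.
  (* For positive X the denominator Ns - j is smaller than Ns. The 6 compensates for this: (1 - t) ^
     2 (1 + 6 t) >= 1 for 0 <= t <= 1/2, with t = m / Ns. *)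
  have t1 : X / Ns%:R ^+ 2 * (1 + 6 * (m%:R / Ns%:R)) <= tau.
    rewrite mulrDr mulr1 lerD2l.
    rewrite (_ : X / _ * _ = 6 * m%:R * X / Ns%:R ^+ 3); last by field; rewrite gt_eqF.
    by rewrite ler_wpM2r ?invr_ge0 ?exprn_ge0 // ler_wpM2l // mulr_ge0.
  apply: le_trans (ler_wpM2l s0 t1).
  set t := m%:R / Ns%:R; have tE : m%:R = t * Ns%:R by rewrite /t divfK // gt_eqF.
  have t0 : 0 <= t by rewrite divr_ge0 // ltW.
  have t2 : t <= 1 / 2 by rewrite /t ler_pdivrMr //; clear -mY; lra.
  have s1 : Ns%:R ^+ 2 * (1 - t) ^+ 2 <= (Ns%:R - j%:R) ^+ 2 :> R.
    rewrite -exprMn; apply: lerXn2r; rewrite ?nnegrE ?mulr_ge0 //; [lra|lra|].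
    by rewrite mulrBr mulr1 [_ * t]mulrC -tE; clear -jm'; lra.
  have c1 : 0 <= X / Ns%:R ^+ 2 * (1 + 6 * t).
    by rewrite mulr_ge0 ?divr_ge0 ?exprn_ge0 ?(ltW X0) //; clear -t0; lra.
  apply: le_trans (ler_wpM2r c1 s1).
  rewrite [leRHS](_ : _ = X * ((1 - t) ^+ 2 * (1 + 6 * t))); last first.
    by clearbody X t; field; rewrite gt_eqF.
  rewrite ler_peMr ?(ltW X0) // [leRHS](_ : _ = 1 + t * ((1 - 2 * t) * (4 - 3 * t))); last by clearbody t; ring.
  by rewrite lerDl mulr_ge0 // mulr_ge0 //; clear -t0 t2; lra.
have prod j : (j <= m)%N -> (Nb ^_ j)%:R * (N ^_ j)%:R <= (Ns ^_ j)%:R ^+ 2 * expR (j%:R * tau) :> R.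
  elim: j => [|j IH] jm; first by rewrite !ffactn0 mul0r expR0 expr1n !mulr1.
  rewrite !ffactnSr !natrM -natr1 mulrDl mul1r expRD mulrACA.
  have -> : ((Ns ^_ j)%:R * (Ns - j)%:R) ^+ 2 * (expR (j%:R * tau) * expR tau) =
     ((Ns ^_ j)%:R ^+ 2 * expR (j%:R * tau)) * ((Ns - j)%:R ^+ 2 * expR tau) :> R by ring.
  by apply: ler_pM; rewrite ?mulr_ge0 // ?IH ?step // ltnW.
have := prod m (leqnn m).
rewrite -!bin_ffact !natrM => h.
have f0 : 0 < (m`!%:R : R) ^+ 2 by rewrite exprn_gt0 // ltr0n fact_gt0.
rewrite -(ler_pM2r f0); move: h.
have -> : m%:R * tau = m%:R * (X / Ns%:R ^+ 2) + 6 * m%:R ^+ 2 * N%:R ^+ 2 / Ns%:R ^+ 3.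
  by rewrite /tau; field; rewrite gt_eqF.
rewrite -/X => h; rewrite [leLHS](_ : _ = 'C(Nb, m)%:R * m`!%:R * ('C(N, m)%:R * m`!%:R)); last by ring.
by apply: (le_trans h); rewrite exprMn mulrAC.
Qed.

(** As m z = r + O(z) and Y = 1 - q + O(z), the factor m z / Y ^ 2 is r / (1 - q) ^ 2 up to O(z);
    the remaining factor n X stays explicit because n (S - 1) need not be bounded. *)
Lemma exponent_bound (r q c z n m w S X Y C C3 C4 : R) :
  0 <= r -> 0 <= q <= 1 / 4 -> 0 <= c -> 0 < z <= 1 -> n = z^-1 -> 0 <= C3 -> C3 * z <= 1 / 4 ->
  `|Y - (1 - q)| <= C3 * z -> r * n <= m <= r * n + 1 -> 0 <= w -> 0 <= C -> 0 <= C4 ->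
  0 <= S - 1 <= C4 * w -> X <= q ^+ 2 * (S - 1 - c * z) + C * (z * (w + z)) ->
  m * (X / Y ^+ 2) <= r * (q / (1 - q)) ^+ 2 * (n * (S - 1) - c) +
    (4 * (r + 1) * C + (4 + 22 * r * C3) * (C4 + c)) * (w + z).
Proof.
move=> r0 /andP[q0 q1] c0 /andP[z0 z1] nE C30 C3z; rewrite ler_norml => /andP[Y1 Y2] /andP[m1 m2] w0 C0 C40 /andP[S0 S1] hX.
have n0 : 0 < n by rewrite nE invr_gt0.
have nz : n * z = 1 by rewrite nE mulVf // gt_eqF.
have Yh : 1 / 2 <= Y by clear -q1 C3z Y1; lra.
have Y0 : 0 < Y by clear -Yh; lra.
have Yt : Y <= 5 / 4 by clear -q0 C3z Y2; lra.
pose p := 1 - q; have p1 : 3 / 4 <= p by rewrite /p; clear -q1; lra.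
pose rho := m * z / Y ^+ 2.
have mz1 : r <= m * z by rewrite -[leLHS]mulr1 -nz mulrA ler_pM2r.
have mz2 : m * z <= r + z by have := ler_wpM2r (ltW z0) m2; rewrite mulrDl -mulrA nz mulr1 mul1r.
have iY : 0 < Y ^- 2 by rewrite invr_gt0 exprn_gt0.
have iY4 : Y ^- 2 <= 4.
  rewrite -[leRHS]invrK lef_pV2 ?posrE ?invr_gt0 ?exprn_gt0 // (_ : 4^-1 = (1 / 2) ^+ 2); last by field.
  by apply: lerXn2r; rewrite ?nnegrE; clear -Yh; lra.
have rho0 : 0 <= rho by rewrite mulr_ge0 ?(ltW iY) //; clear -r0 mz1; lra.
have rho4 : rho <= 4 * (r + 1).
  by rewrite mulrC; apply: ler_pM; rewrite ?(ltW iY) //; clear -r0 z1 mz1 mz2; lra.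
have nX : n * X <= q ^+ 2 * (n * (S - 1) - c) + C * (w + z).
  have := ler_wpM2l (ltW n0) hX.
  have -> : n * (q ^+ 2 * (S - 1 - c * z) + C * (z * (w + z))) =
     q ^+ 2 * (n * (S - 1) - c * (n * z)) + C * ((n * z) * (w + z)) by ring.
  by rewrite nz !mulr1 mul1r.
have E : m * (X / Y ^+ 2) = rho * (n * X).
  have -> : rho * (n * X) = m * (X / Y ^+ 2) * (n * z) by rewrite /rho; ring.
  by rewrite nz mulr1.
have dr : `|rho - r / p ^+ 2| <= (4 + 22 * r * C3) * z.
  have -> : rho - r / p ^+ 2 = (m * z - r) * Y ^- 2 + r * ((p - Y) * ((p + Y) * (Y ^- 2 * p ^- 2))).
    by rewrite /rho; field; rewrite !gt_eqF //; clear -p1; lra.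
  have b1 : `|(m * z - r) * Y ^- 2| <= z * 4.
    rewrite normrM; apply: ler_pM => //; rewrite ger0_norm; clear -mz1 mz2 iY iY4; lra.
  have ip : p ^- 2 <= 16 / 9.
    rewrite -[leRHS]invrK lef_pV2 ?posrE ?invr_gt0 ?exprn_gt0 //; last by clear -p1; lra.
    rewrite (_ : (16 / 9)^-1 = (3 / 4) ^+ 2); last by field.
    by apply: lerXn2r; rewrite ?nnegrE; clear -p1; lra.
  have ip0 : 0 < p ^- 2 by rewrite invr_gt0 exprn_gt0 //; clear -p1; lra.
  have b2 : Y ^- 2 * p ^- 2 <= 4 * (16 / 9) by apply: ler_pM; rewrite ?(ltW iY) ?(ltW ip0).
  have b3 : (p + Y) * (Y ^- 2 * p ^- 2) <= 22.
    apply: (@le_trans _ _ (9 / 4 * (4 * (16 / 9)))); last by clear; lra.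
    by apply: ler_pM; rewrite ?mulr_ge0 ?(ltW iY) ?(ltW ip0) //; rewrite /p; clear -q0 q1 C3z Y1 Y2; lra.
  have b4 : `|r * ((p - Y) * ((p + Y) * (Y ^- 2 * p ^- 2)))| <= r * (C3 * z * 22).
    rewrite normrM (ger0_norm r0) ler_wpM2l // normrM; apply: ler_pM => //.
      by rewrite ler_norml /p; apply/andP; split; clear -Y1 Y2; lra.
    by rewrite ger0_norm // !mulr_ge0 ?(ltW iY) ?(ltW ip0) // /p; clear -q1 Y0; lra.
  by apply: (le_trans (ler_normD _ _)); clear -b1 b4; lra.
have g0 : 0 <= w + z by clear -z0 w0; lra.
rewrite E; apply: (le_trans (ler_wpM2l rho0 nX)); rewrite mulrDr.
have e1 : rho * (C * (w + z)) <= 4 * (r + 1) * C * (w + z).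
  by rewrite mulrA ler_wpM2r // ler_wpM2r.
have q2 : q ^+ 2 <= 1 by rewrite exprn_ile1; clear -q0 q1; lra.
have Sn : `|q ^+ 2 * (n * (S - 1) - c)| <= n * (S - 1) + c.
  rewrite normrM ger0_norm ?sqr_ge0 // -[leRHS]mul1r; apply: ler_pM; rewrite ?sqr_ge0 //.
  have : 0 <= n * (S - 1) by rewrite mulr_ge0 // ltW.
  by move=> h; rewrite ler_norml; lra.
have zS : z * (n * (S - 1) + c) <= (C4 + c) * (w + z).
  have -> : z * (n * (S - 1) + c) = (n * z) * (S - 1) + c * z by ring.
  rewrite nz mul1r.
  have : 0 <= C4 * z by rewrite mulr_ge0 // ltW.
  have : 0 <= c * w by rewrite mulr_ge0.
  lra.
have K0 : 0 <= 4 + 22 * r * C3.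
  have h : 0 <= r * C3 by rewrite mulr_ge0.
  by clear -h; lra.
have e2 : (rho - r / p ^+ 2) * (q ^+ 2 * (n * (S - 1) - c)) <= (4 + 22 * r * C3) * ((C4 + c) * (w + z)).
  apply: (le_trans (ler_norm _)); rewrite normrM.
  apply: (le_trans (ler_pM _ _ dr Sn)) => //.
  by rewrite -[leLHS]mulrA ler_wpM2l.
have e3 : r / p ^+ 2 * (q ^+ 2 * (n * (S - 1) - c)) = r * (q / (1 - q)) ^+ 2 * (n * (S - 1) - c).
  by rewrite expr_div_n -/p; ring.
clear -e1 e2 e3; lra.
Qed.

Lemma theta_q k : (2 <= k)%N -> theta R k = (2 / 2 ^+ k) / (1 - 2 / 2 ^+ k).
Proof.
case: k => [|k] // k1; rewrite /theta subn1 /= exprS.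
have : 1 < 2 ^+ k :> R by rewrite exprn_egt1 ?ltr1n //; lia.
move: (2 ^+ k) => x x1; field; rewrite !gt_eqF //; lra.
Qed.

Lemma bin_nff k (n : R) b : 0 < n -> 'C(b, k)%:R = nff k n b * (n ^+ k / k`!%:R).
Proof.
move=> n0; rewrite /nff -bin_ffact natrM; field.
by rewrite pnatr_eq0 -lt0n fact_gt0 expf_neq0 // gt_eqF.
Qed.

(** Limiting logarithm of the ratio between the probability of a pair of colourings and the product
    of the single probabilities. It equals minus r theta ^ 2 cc at w = 0, not 0. *)
Definition overlap_exponent k (r w n : R) := r * theta R k ^+ 2 * (n * (Sev k w - 1) - cc R k).

Lemma separation_close (N A q c z v C M : R) : 0 <= C -> 0 <= M -> 0 <= c -> 0 <= q <= 1 -> 0 <= z <= 1 ->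
  0 <= v <= M * z -> 1 - c * z <= N <= 1 - c * z + (c * z) ^+ 2 ->
  q * (1 + c * v - 2 * c * z) - C * (v * z) <= A <= q + C * (v + z ^+ 2) ->
  `|N - A - (1 - q)| <= (c ^+ 2 + 3 * c + C * (M + 1)) * z.
Proof.
move=> C0 M0 c0 /andP[q0 q1] /andP[z0 z1] /andP[v0 vM] /andP[N1 N2] /andP[A1 A2].
have zz : z ^+ 2 <= z by rewrite expr2 ler_piMl.
have cz : (c * z) ^+ 2 <= c ^+ 2 * z by rewrite exprMn ler_wpM2l ?sqr_ge0.
have vz : C * (v * z) <= C * (M * z) by rewrite ler_wpM2l // (le_trans _ vM) // ler_piMr.
have Cv : C * (v + z ^+ 2) <= C * ((M + 1) * z) by rewrite ler_wpM2l //; lra.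
have h1 : 0 <= q * (c * v) by rewrite !mulr_ge0.
have h2 : q * (c * z) <= c * z by rewrite ler_piMl // mulr_ge0.
have h3 : 0 <= c ^+ 2 * z by rewrite mulr_ge0 ?sqr_ge0.
have h4 : 0 <= c * z by rewrite mulr_ge0.
have h5 : 0 <= C * z by rewrite mulr_ge0.
by rewrite ler_norml; apply/andP; split; clear -N1 N2 A1 A2 cz vz Cv h1 h2 h4 h5; lra.
Qed.

Lemma overlap_normalised k (M : R) : (3 <= k)%N -> 0 <= M ->
  exists C C3 C4 : R, [/\ 0 <= C, 0 <= C3, 0 <= C4 &
   forall (a b i : nat) (n z w : R),
   1 <= n -> n = a%:R + b%:R -> z = n^-1 -> w = 1 - 4 * i%:R / n ->
   (a%:R - b%:R) ^+ 2 <= M * n -> (i <= a)%N -> (i <= b)%N ->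
   let N := nff k n (a + b) in let A := nff k n a + nff k n b in
   let D := nff k n (a - i) + 2 * nff k n i + nff k n (b - i) in
   [/\ `|w| <= 1, 0 <= Sev k w - 1 <= C4 * `|w|, `|N - A - (1 - 2 / 2 ^+ k)| <= C3 * z &
     D * N - A ^+ 2 <= (2 / 2 ^+ k) ^+ 2 * (Sev k w - 1 - cc R k * z) + C * (z * (`|w| + z))]].
Proof.
case: k => [|[|[|k]]] // _ M0.
have [CA CA0 HA] := nffA_bound R k.+1.
have [CD CD0 HD] := nffD_bound R k.+1.
have [C4 C40 H4] := sev_quad R k.+3.
set K := k.+3 in HA HD H4 *; pose c := cc R K; have c0 : 0 <= c := cc_ge0 R K.
pose q : R := 2 / 2 ^+ K.
have q0 : 0 <= q by rewrite divr_ge0 // exprn_ge0.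
have q1 : q <= 1.
  by rewrite ler_pdivrMr ?exprn_gt0 // mul1r /K exprS ler_peMr // exprn_ege1 // ler1n.
pose C1 := CA + CD; have C10 : 0 <= C1 by rewrite addr_ge0.
have cM : 0 <= c * M by rewrite mulr_ge0.
have c2 : 0 <= c ^+ 2 by rewrite sqr_ge0.
have M2 : 0 <= M ^+ 2 by rewrite sqr_ge0.
have CM1 : 0 <= C1 * (M + 1) by rewrite mulr_ge0 // addr_ge0.
exists (C1 * (M + M ^+ 2 + 1) * (1 + c ^+ 2) + (5 + C4 + 2 * c * M) * c ^+ 2 + 2 * C1 * M),
  (c ^+ 2 + 3 * c + C1 * (M + 1)), C4; split => //.
- have h1 : 0 <= C1 * (M + M ^+ 2 + 1) * (1 + c ^+ 2) by rewrite !mulr_ge0 ?addr_ge0.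
  have h2 : 0 <= (5 + C4 + 2 * c * M) * c ^+ 2 by rewrite mulr_ge0 //; clear -C40 cM; lra.
  have h3 : 0 <= 2 * C1 * M by rewrite !mulr_ge0.
  by rewrite !addr_ge0.
- by clear -c2 c0 CM1; lra.
move=> a b i n z w n1 nE zE wE hM ia ib N A D.
pose u : R := (a%:R - b%:R) / n.
have n0 : 0 < n by clear -n1; lra.
have z0 : 0 < z by rewrite zE invr_gt0.
have z1 : z <= 1 by rewrite zE invf_le1.
have nz : n * z = 1 by rewrite zE mulfV // gt_eqF.
have uM : u ^+ 2 <= M * z.
  rewrite /u expr_div_n ler_pdivrMr ?exprn_gt0 //.
  have -> : M * z * n ^+ 2 = M * n * (n * z) by ring.
  by rewrite nz mulr1.
have u20 : 0 <= u ^+ 2 by rewrite sqr_ge0.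
have w1 : `|w| <= 1.
  have ia' : i%:R <= a%:R :> R by rewrite ler_nat.
  have ib' : i%:R <= b%:R :> R by rewrite ler_nat.
  have h2 : 4 * i%:R / n <= 2 by rewrite ler_pdivrMr // nE; clear -ia' ib'; lra.
  have h3 : 0 <= 4 * i%:R / n by rewrite divr_ge0 ?mulr_ge0 // ltW.
  by rewrite ler_norml wE; apply/andP; clear -h2 h3; split; lra.
have A12 := HA a b n z u n1 nE erefl zE.
have D1 := HD a b i n z u w n1 nE erefl zE wE ia ib.
have nab : (0 < a + b)%N by rewrite -(ltr_nat R) natrD -nE.
have nE' : n = (a + b)%:R by rewrite natrD.
have N12 := @nffN_bound R k.+1 (a + b) nab z ltac:(by rewrite -nE').
rewrite -nE' -/K -/c -/q -/N -/A -/D in A12 D1 N12.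
have S1 : 1 <= Sev K w.
  have := Sev_ge K w; have : 0 <= cc R K * w ^+ 2 by rewrite mulr_ge0 ?sqr_ge0.
  by clear; lra.
have ww : w ^+ 2 <= `|w| by rewrite -[w ^+ 2]ger0_norm ?sqr_ge0 // normrX expr2 ler_piMl.
have S2 : Sev K w - 1 <= C4 * `|w|.
  by have := ler_wpM2l C40 ww; have := H4 w w1; clear; lra.
have S4 : Sev K w <= 1 + C4.
  have S3 : C4 * `|w| <= C4 by rewrite ler_piMr.
  by clear -S2 S3; lra.
have nff0 b' : 0 <= nff K n b' by rewrite divr_ge0 // exprn_ge0 // ltW.
have D0 : 0 <= D by rewrite /D addr_ge0 // addr_ge0 // mulr_ge0.
have w0 : 0 <= `|w| by [].
have uz : 0 <= u ^+ 2 * z by rewrite mulr_ge0 // ltW.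
have z20 : 0 <= z ^+ 2 by rewrite sqr_ge0.
have Ca : CA * (u ^+ 2 * z) <= C1 * (u ^+ 2 * z) by rewrite ler_wpM2r // lerDl.
have Ca2 : CA * (u ^+ 2 + z ^+ 2) <= C1 * (u ^+ 2 + z ^+ 2) by rewrite ler_wpM2r ?addr_ge0 // lerDl.
have u4 : 0 <= u ^+ 4 by rewrite (_ : u ^+ 4 = (u ^+ 2) ^+ 2) ?sqr_ge0 // -exprM.
have Cd : CD * (u ^+ 2 * `|w| + u ^+ 4 + z ^+ 2) <= C1 * (u ^+ 2 * `|w| + u ^+ 4 + z ^+ 2).
  by rewrite ler_wpM2r ?lerDr // !addr_ge0 // mulr_ge0.
have A12' : q * (1 + c * u ^+ 2 - 2 * c * z) - C1 * (u ^+ 2 * z) <= A <= q + C1 * (u ^+ 2 + z ^+ 2).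
  by case/andP: A12 => A1 A2; apply/andP; clear -A1 A2 Ca Ca2; split; lra.
have D1' := le_trans D1 (lerD (lexx _) Cd).
have qq : 0 <= q <= 1 by rewrite q0 q1.
have zz : 0 <= z <= 1 by rewrite (ltW z0) z1.
split=> //; first by rewrite subr_ge0 S1 S2.
  by apply: (separation_close C10 M0 c0 qq zz _ N12 A12'); rewrite u20 uM.
have /andP[_ N2] := N12; have /andP[A1 _] := A12'.
apply: (le_trans (overlap_excess C10 M0 c0 qq zz uM S1 D0 (nff0 _) w0 D1' N2 A1)).
rewrite lerD2l ler_wpM2r ?mulr_ge0 ?addr_ge0 ?(ltW z0) // lerD2r lerD2l ler_wpM2r //.
by clear -S4; lra.
Qed.

Lemma leq_ffact_expn n k : (n ^_ k <= n ^ k)%N.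
Proof. by elim: k => [|k IH] //; rewrite ffactnSr expnSr leq_mul ?leq_subr. Qed.

Lemma bin_add_le x y k : (0 < k)%N -> ('C(x, k) + 'C(y, k) <= 'C(x + y, k))%N.
Proof.
case: k => // k _; elim: y => [|y IH]; first by rewrite bin0n addn0 addn0.
rewrite addnS !binS addnA leq_add // leq_bin2l //; exact: leq_addl.
Qed.

Lemma bin_cells_le a b i k : (0 < k)%N -> (i <= a)%N -> (i <= b)%N ->
  ('C(a - i, k) + 2 * 'C(i, k) + 'C(b - i, k) <= 'C(a + b, k))%N.
Proof.
move=> k1 ia ib; rewrite -{2}(subnK ia) -{2}(subnK ib) addnACA.
have h1 := bin_add_le (a - i) (b - i) k1; have h2 := bin_add_le i i k1.
by have := bin_add_le (a - i + (b - i)) (i + i) k1; lia.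
Qed.

Lemma overlap_bound k (r M : R) : (3 <= k)%N -> 0 <= r -> 0 <= M ->
  exists C : R, exists n0 : nat, 0 <= C /\ forall (n a b i m Ns Nb : nat),
   (n0 <= n)%N -> (a + b = n)%N -> (a%:R - b%:R) ^+ 2 <= M * n%:R :> R -> (i <= a)%N -> (i <= b)%N ->
   r * n%:R <= m%:R <= r * n%:R + 1 ->
   (Ns + ('C(a, k) + 'C(b, k)) = 'C(n, k))%N ->
   (Nb + 2 * ('C(a, k) + 'C(b, k)) = 'C(n, k) + ('C(a - i, k) + 2 * 'C(i, k) + 'C(b - i, k)))%N ->
   'C(Nb, m)%:R * 'C('C(n, k), m)%:R <= 'C(Ns, m)%:R ^+ 2 *
     expR (overlap_exponent k r (1 - 4 * i%:R / n%:R) n%:R + C * (`|1 - 4 * i%:R / n%:R| + n%:R^-1)).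
Proof.
move=> k3 r0 M0; have [C [C3 [C4 [C0 C30 C40 H]]]] := overlap_normalised k3 M0.
pose q : R := 2 / 2 ^+ k.
have k2 : (2 <= k)%N by exact: ltnW.
have q0 : 0 <= q by rewrite divr_ge0 // exprn_ge0.
have q1 : q <= 1 / 4.
  rewrite ler_pdivrMr ?exprn_gt0 //.
  have : 2 ^+ 3 <= 2 ^+ k :> R by rewrite ler_eXn2l ?ltr1n.
  by rewrite !exprS expr0; clear; lra.
have c0 := cc_ge0 R k.
have f0 : 0 < k`!%:R :> R by rewrite ltr0n fact_gt0.
pose K1 := 4 * (r + 1) * C + (4 + 22 * r * C3) * (C4 + cc R k).
pose K2 := 48 * (r + 1) ^+ 2 * k`!%:R : R.
have r1 : 0 <= r + 1 by clear -r0; lra.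
have K10 : 0 <= K1.
  have h : 0 <= r * C3 by rewrite mulr_ge0.
  have h1 : 0 <= (r + 1) * C by rewrite mulr_ge0.
  have h2 : 0 <= (4 + 22 * r * C3) * (C4 + cc R k) by rewrite mulr_ge0 //; clear -h C40 c0; lra.
  by rewrite /K1; clear -h1 h2; lra.
have K20 : 0 <= K2 by rewrite mulr_ge0 ?(ltW f0) // mulr_ge0 // sqr_ge0.
have rk0 : 0 <= (r + 1) * k`!%:R by rewrite mulr_ge0 // ltW.
(* The threshold secures [C3 * z <= 1 / 4] and [2 * m <= Ns]. *)
exists (K1 + K2), (Num.truncn (4 * C3 + 4 * (r + 1) * k`!%:R)).+1; split; first by rewrite addr_ge0.
move=> n a b i m Ns Nb nn abn hM ia ib hm NsE NbE.
have nbig : 4 * C3 + 4 * (r + 1) * k`!%:R <= n%:R.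
  apply: ltW; apply: lt_le_trans (archimedean.Num.Theory.truncnS_gt _) _.
  by rewrite ler_nat.
have n1 : 1 <= n%:R :> R by rewrite ler1n (leq_trans _ nn).
have n0 : 0 < n%:R :> R by clear -n1; lra.
pose z : R := n%:R^-1.
have z0 : 0 < z by rewrite invr_gt0.
have z1 : z <= 1 by rewrite invf_le1.
have nE : n%:R = a%:R + b%:R :> R by rewrite -abn natrD.
have := H a b i n%:R z _ n1 nE erefl erefl hM ia ib.
rewrite abn -/z; set w := 1 - _; set N' := nff _ _ n; set A' := nff _ _ a + _; set D' := _ + nff _ _ (b - i).
move=> [w1 S12 Y1 X2].
have C3z : C3 * z <= 1 / 4.
  by rewrite /z ler_pdivrMr //; clear -nbig rk0; lra.
have Y2 : 1 / 2 <= N' - A' by move: Y1; rewrite ler_norml => /andP[+ _]; rewrite -/q; clear -C3z q1; lra.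
have zK : n%:R = z^-1 by rewrite invrK.
have qq : 0 <= q <= 1 / 4 by rewrite q0 q1.
have zz : 0 < z <= 1 by rewrite z0 z1.
have E1 := exponent_bound r0 qq c0 zz zK C30 C3z Y1 hm (normr_ge0 w) C0 C40 S12 X2.
pose F : R := n%:R ^+ k / k`!%:R.
have F0 : 0 < F by rewrite divr_gt0 // exprn_gt0.
have NR : 'C(n, k)%:R = N' * F by rewrite (bin_nff _ _ n0).
have AR : ('C(a, k) + 'C(b, k))%:R = A' * F by rewrite natrD !(bin_nff k _ n0) -mulrDl.
have DR : ('C(a - i, k) + 2 * 'C(i, k) + 'C(b - i, k))%:R = D' * F.
  by rewrite natrD natrD natrM !(bin_nff k _ n0) -/F /D'; ring.
have NsR : Ns%:R = (N' - A') * F :> R.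
  have : (Ns + ('C(a, k) + 'C(b, k)))%:R = 'C(n, k)%:R :> R by rewrite NsE.
  by rewrite natrD AR NR mulrBl; clear; lra.
have Fn : n%:R ^+ 3 / k`!%:R <= F by rewrite ler_pM2r ?invr_gt0 //; apply: ler_weXn2l.
have N'1 : N' <= 1.
  by rewrite /N' /nff ler_pdivrMr ?exprn_gt0 // mul1r -natrX ler_nat leq_ffact_expn.
have mn : m%:R <= (r + 1) * n%:R.
  by case/andP: hm => _ h; apply: (le_trans h); clear -n1; lra.
have m0 : 0 <= m%:R :> R by [].
have Ns2 : (2 * m <= Ns)%N.
  rewrite -(ler_nat R) natrM NsR.
  apply: (@le_trans _ _ (1 / 2 * (n%:R ^+ 3 / k`!%:R))); last by apply: ler_pM; rewrite ?divr_ge0 ?exprn_ge0 ?(ltW f0).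
  rewrite mulrA ler_pdivlMr // exprS.
  have h1 : 4 * (r + 1) * k`!%:R <= n%:R by clear -nbig C30; lra.
  have h2 := ler_wpM2l (ltW n0) h1.
  have h3 : n%:R * n%:R <= n%:R * n%:R ^+ 2 :> R by rewrite ler_pM2l // expr2 ler_peMl // ltW.
  have h4 := ler_wpM2r (ltW f0) mn.
  by clear -h2 h3 h4; lra.
have Ns0 : (0 < Ns)%N.
  by rewrite -(ltr_nat R) NsR mulr_gt0 //; clear -Y2; lra.
have DN : ('C(a - i, k) + 2 * 'C(i, k) + 'C(b - i, k) <= 'C(n, k))%N.
  by rewrite -abn; apply: bin_cells_le => //; exact: ltnW.
apply: (le_trans (bin_ratio_le NsE NbE DN Ns2 Ns0)).
rewrite ler_wpM2l ?exprn_ge0 // ler_expR NR AR DR NsR -/w -/z.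
have Yp : 0 < N' - A' by clear -Y2; lra.
have -> : (D' * F * (N' * F) - (A' * F) ^+ 2) / ((N' - A') * F) ^+ 2 = (D' * N' - A' ^+ 2) / (N' - A') ^+ 2.
  by clearbody D' N' A' F; field; rewrite !gt_eqF.
(* The m edges being distinct costs only m ^ 2 / Ns up to a constant; with Ns at least of order n ^
   3, as k >= 3, this is O(1 / n). *)
have E2 : 6 * m%:R ^+ 2 * (N' * F) ^+ 2 / ((N' - A') * F) ^+ 3 <= K2 * z.
  have -> : 6 * m%:R ^+ 2 * (N' * F) ^+ 2 / ((N' - A') * F) ^+ 3 = 6 * m%:R ^+ 2 * N' ^+ 2 * ((N' - A') ^- 3 * F^-1).
    by clearbody N' A' F; field; rewrite !gt_eqF.
  have N'0 : 0 <= N' by rewrite /N' divr_ge0 // exprn_ge0 // ltW.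
  have g1 : N' ^+ 2 <= 1 by rewrite exprn_ile1.
  have g2 : (N' - A') ^- 3 <= 8.
    rewrite -[leRHS]invrK lef_pV2 ?posrE ?invr_gt0 ?exprn_gt0 // (_ : 8^-1 = (1 / 2) ^+ 3); last by field.
    by apply: lerXn2r; rewrite ?nnegrE ?(ltW Yp) // divr_ge0.
  have g3 : F^-1 <= k`!%:R / n%:R ^+ 3.
    by rewrite -[leRHS]invrK lef_pV2 ?posrE ?invr_gt0 ?divr_gt0 ?exprn_gt0 // invf_div.
  have g4 : m%:R ^+ 2 <= ((r + 1) * n%:R) ^+ 2 by apply: lerXn2r; rewrite ?nnegrE // mulr_ge0 // ltW.
  have iF : 0 <= F^-1 by rewrite invr_ge0 ltW.
  have iY : 0 <= (N' - A') ^- 3 by rewrite invr_ge0 exprn_ge0 // ltW.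
  have g5 : (N' - A') ^- 3 * F^-1 <= 8 * (k`!%:R / n%:R ^+ 3) by apply: ler_pM.
  have g6 : 6 * m%:R ^+ 2 * N' ^+ 2 <= 6 * ((r + 1) * n%:R) ^+ 2 * 1.
    by apply: ler_pM; rewrite ?mulr_ge0 ?exprn_ge0 // ler_pM2l.
  have g7 := ler_pM (_ : 0 <= 6 * m%:R ^+ 2 * N' ^+ 2) (_ : 0 <= (N' - A') ^- 3 * F^-1) g6 g5.
  apply: (le_trans (g7 _ _)); rewrite ?mulr_ge0 ?exprn_ge0 //.
  rewrite le_eqVlt; apply/orP; left; apply/eqP; rewrite /K2 /z.
  by clear -n0; field; rewrite gt_eqF.
rewrite /overlap_exponent theta_q // -/q.
have h : 0 <= K2 * `|w| by rewrite mulr_ge0.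
rewrite -/K1 in E1; clear -E1 E2 h; lra.
Qed.

End OverlapRatio.

(** * Entropy bounds on binomial coefficients *)

Section BinomialEntropy.
Variable R : realType.

Lemma expr_expR (x : R) j : 0 <= x -> (x = 0 -> j = 0%N) -> x ^+ j = expR (j%:R * ln x).
Proof.
rewrite le_eqVlt => /predU1P[<- /(_ erefl) -> |x0 _]; first by rewrite mul0r expR0 expr0.
by rewrite mulrC expRM_natr lnK // posrE.
Qed.

Lemma entropy_term (n j : nat) (w : R) : (0 < n)%N -> (j <= n)%N -> w = 1 - 2 * j%:R / n%:R ->
  (1 - w) ^+ j * (1 + w) ^+ (n - j) = expR (n%:R * Ient w).
Proof.
move=> n0 jn wE; have n0' : 0 < n%:R :> R by rewrite ltr0n.
have jn' : j%:R <= n%:R :> R by rewrite ler_nat.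
have E1 : 1 - w = 2 * j%:R / n%:R by rewrite wE; ring.
have E2 : 1 + w = 2 * (n - j)%:R / n%:R by rewrite wE natrB //; field; rewrite gt_eqF.
have p1 : 0 <= 1 - w by rewrite E1 divr_ge0 ?mulr_ge0.
have p2 : 0 <= 1 + w by rewrite E2 divr_ge0 ?mulr_ge0.
have z (i : nat) : 2 * i%:R / n%:R = 0 :> R -> i = 0%N.
  by move/eqP; rewrite !mulf_eq0 invr_eq0 !pnatr_eq0 (gtn_eqF n0) orbF /= => /eqP.
rewrite (expr_expR p1) ?E1 //; last exact: z.
rewrite (expr_expR p2) ?E2 //; last exact: z.
rewrite -E1 -E2 -expRD /Ient; congr expR.
have -> : n%:R * (((1 + w) * ln (1 + w) + (1 - w) * ln (1 - w)) / 2) =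
  (n%:R * (1 + w) / 2) * ln (1 + w) + (n%:R * (1 - w) / 2) * ln (1 - w) by field.
have -> : n%:R * (1 + w) / 2 = (n - j)%:R by rewrite E2; field; rewrite gt_eqF.
have -> : n%:R * (1 - w) / 2 = j%:R by rewrite E1; field; rewrite gt_eqF.
by rewrite addrC.
Qed.

Lemma sum_tilted_bin (n : nat) (w : R) :
  \sum_(j < n.+1) 'C(n, j)%:R * ((1 - w) ^+ j * (1 + w) ^+ (n - j)) = 2 ^+ n.
Proof.
have -> : 2 = (1 + w) + (1 - w) by ring.
by rewrite exprDn; apply: eq_bigr => j _; rewrite mulr_natl [_ ^+ j * _]mulrC.
Qed.

(** Keep one term of the expansion of ((1 + w) + (1 - w)) ^ n; the tilt w is the one for which that
    term is exp (n * Ient w) times the coefficient. *)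
Lemma bin_entropy_le (n j : nat) (w : R) : (0 < n)%N -> (j <= n)%N -> w = 1 - 2 * j%:R / n%:R ->
  'C(n, j)%:R <= 2 ^+ n * expR (- (n%:R * Ient w)).
Proof.
move=> n0 jn wE; rewrite expRN ler_pdivlMr ?expR_gt0 // -(entropy_term n0 jn wE) -(sum_tilted_bin n w).
have n0' : 0 < n%:R :> R by rewrite ltr0n.
have jn' : j%:R <= n%:R :> R by rewrite ler_nat.
have w1 : 0 <= 1 - w by rewrite wE opprB addrC subrK divr_ge0 ?mulr_ge0.
have w2 : 0 <= 1 + w.
  have : 2 * j%:R / n%:R <= 2 :> R by rewrite ler_pdivrMr //; lra.
  by rewrite wE; lra.
have jn1 : (j < n.+1)%N by [].
rewrite (bigD1 (Ordinal jn1)) //= lerDl sumr_ge0 // => i _.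
by rewrite mulr_ge0 // mulr_ge0 // exprn_ge0.
Qed.

(** Mode of a binomial law with success probability a / (a + b), in integers: the ratio of the
    values at i + 1 and i is (n - i) a / ((i + 1) b), which passes 1 at i = a. The mode is thus at
    least the average of the n + 1 terms, whence [bin_entropy_ge]. *)
Lemma bin_mode (a b j : nat) : (j <= a + b)%N ->
  ('C(a + b, j) * (a ^ j * b ^ (a + b - j)) <= 'C(a + b, a) * (a ^ a * b ^ b))%N.
Proof.
move=> jn; set n := (a + b)%N in jn *.
pose f j := ('C(n, j) * (a ^ j * b ^ (n - j)))%N.
rewrite -[leqLHS]/(f j) (_ : ('C(n, a) * _)%N = f a); last by rewrite /f /n addKn.
have rec i : (i < n)%N -> (f i.+1 * (i.+1 * b) = f i * ((n - i) * a))%N.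
  move=> iN; rewrite /f; have -> : (n - i = (n - i.+1).+1)%N by lia.
  rewrite [(b ^ _.+1)%N]expnS [(a ^ _.+1)%N]expnS; have := mul_bin_left n i; have -> : (n - i = (n - i.+1).+1)%N by lia.
  move: (n - i.+1)%N => p; move: 'C(n, i.+1) 'C(n, i) (a ^ i)%N (b ^ p)%N => x y s t E.
  by have /= := congr1 (muln^~ (a * s * t * b)%N) E; lia.
have up c : (j <= c)%N -> (c <= a)%N -> (f j <= f c)%N.
  elim: c => [|c IH]; first by rewrite leqn0 => /eqP ->.
  rewrite leq_eqVlt => /predU1P[-> //|]; rewrite ltnS => jc ca.
  apply: leq_trans (IH jc (ltnW ca)) _.
  have [b0|b0] := posnP b.
    rewrite [leqLHS](_ : _ = 0)%N // /f b0 exp0n ?muln0 //; rewrite /n b0; lia.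
  have cn : (c < n)%N by rewrite /n; lia.
  rewrite -(@leq_pmul2r (c.+1 * b)) ?muln_gt0 // rec // leq_mul2l; apply/orP; right.
  by rewrite mulnC leq_mul // /n; lia.
have dn c : (a <= c)%N -> (c <= n)%N -> (f c <= f a)%N.
  elim: c => [|c IH]; first by rewrite leqn0 => /eqP ->.
  rewrite leq_eqVlt => /predU1P[<- //|]; rewrite ltnS => ac cn.
  apply: leq_trans (IH ac (ltnW cn)).
  have [b0|b0] := posnP b; first by move: cn; rewrite /n b0; lia.
  rewrite -(@leq_pmul2r (c.+1 * b)) ?muln_gt0 // rec // leq_mul2l; apply/orP; right.
  by rewrite [leqRHS]mulnC leq_mul // /n; lia.
by have [ja|/ltnW ja] := leqP j a; [exact: up|exact: dn].
Qed.

Lemma bin_entropy_ge (a b : nat) (u : R) : (0 < a + b)%N -> u = (b%:R - a%:R) / (a + b)%:R ->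
  2 ^+ (a + b) <= (a + b).+1%:R * ('C(a + b, a)%:R * expR ((a + b)%:R * Ient u)).
Proof.
move=> n0 uE; set n := (a + b)%N in n0 uE *.
have n0' : 0 < n%:R :> R by rewrite ltr0n.
have nE : n%:R = a%:R + b%:R :> R by rewrite /n natrD.
have uE' : u = 1 - 2 * a%:R / n%:R.
  by rewrite uE (_ : b%:R - a%:R = n%:R - 2 * a%:R) ?nE; [|ring]; field; rewrite -nE gt_eqF.
have an : (a <= n)%N by rewrite leq_addr.
have E1 : 1 - u = 2 * a%:R / n%:R by rewrite uE'; ring.
have E2 : 1 + u = 2 * b%:R / n%:R by rewrite uE' (_ : b%:R = n%:R - a%:R) ?nE; [|ring]; field; rewrite -nE gt_eqF.
rewrite -(entropy_term n0 an uE') -(sum_tilted_bin n u).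
have -> : n.+1%:R * ('C(n, a)%:R * ((1 - u) ^+ a * (1 + u) ^+ (n - a))) =
   \sum_(j < n.+1) 'C(n, a)%:R * ((1 - u) ^+ a * (1 + u) ^+ (n - a)) :> R.
  by rewrite sumr_const card_ord mulr_natl.
apply: ler_sum => j _; have jn : (j <= n)%N by rewrite -ltnS.
have tE (i : nat) : (i <= n)%N -> (1 - u) ^+ i * (1 + u) ^+ (n - i) = (2 / n%:R) ^+ n * (a ^ i * b ^ (n - i))%:R.
  move=> iN; rewrite E1 E2 ![2 * _ / _]mulrAC; set c := 2 / _.
  have -> : c ^+ n = c ^+ i * c ^+ (n - i) by rewrite -exprD subnKC.
  by rewrite natrM !natrX !exprMn mulrACA.
rewrite !tE // mulrCA [leRHS]mulrCA ler_wpM2l ?exprn_ge0 ?divr_ge0 // -!natrM ler_nat.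
by have := bin_mode jn; rewrite -/n {6}/n addKn.
Qed.

Lemma hyp_bin_le a b i : hyp R a b i <= 'C(a + b, 2 * i)%:R.
Proof.
rewrite /hyp -natrM ler_nat -binomial.Vandermonde.
have h : (i < (2 * i).+1)%N by lia.
rewrite (bigD1 (Ordinal h)) //= (_ : (2 * i - i = i)%N); last by lia.
exact: leq_addr.
Qed.

(** By Vandermonde the weight is at most 'C(n, 2 * i), and the correlation w is exactly the bias of
    2 i among n. Near balance, 'C(n, a) is at least 2 ^ n exp (- M) / (n + 1). *)
Lemma hyp_far a b i (M w : R) : (0 < a + b)%N -> (i <= a)%N -> (i <= b)%N ->
  (a%:R - b%:R) ^+ 2 <= M * (a + b)%:R -> 4 * M <= (a + b)%:R -> w = 1 - 4 * i%:R / (a + b)%:R ->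
  hyp R a b i <= (a + b).+1%:R * expR M * expR (- ((a + b)%:R * Ient w)) * 'C(a + b, a)%:R.
Proof.
move=> n0 ia ib hM nM wE; have n0' : 0 < (a + b)%:R :> R by rewrite ltr0n.
have wE' : w = 1 - 2 * (2 * i)%:R / (a + b)%:R by rewrite wE (_ : 4 * i%:R = 2 * (2 * i)%:R) // natrM; ring.
apply: (le_trans (hyp_bin_le a b i)).
have i2 : (2 * i <= a + b)%N by lia.
apply: (le_trans (bin_entropy_le n0 i2 wE')).
have := bin_entropy_ge n0 erefl; set u := _ / _ => h.
have M0 : 0 <= M.
  by have := le_trans (sqr_ge0 _) hM; rewrite pmulr_lge0.
have Iu : (a + b)%:R * Ient u <= M.
  have uu : u ^+ 2 <= M / (a + b)%:R.
    rewrite /u expr_div_n -sqrrN opprB ler_pdivrMr ?exprn_gt0 //.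
    by rewrite expr2 mulrA divfK // gt_eqF.
  have key (v : R) : 0 <= v -> v ^+ 2 = u ^+ 2 -> (a + b)%:R * Ient v <= M.
    move=> v0 vE; have v4 : v ^+ 2 <= (1 / 2) ^+ 2.
      by rewrite vE; apply: (le_trans uu); rewrite ler_pdivrMr //; lra.
    have v1 : v <= 1 / 2 by move: v4; rewrite ler_sqr ?nnegrE //; lra.
    have I1 := @Ient_le R v v0 ltac:(lra).
    rewrite -ler_pdivlMl // [_^-1 * _]mulrC; apply: (le_trans I1); apply: le_trans uu; rewrite -vE.
    by rewrite ler_pdivrMr; [|lra]; rewrite ler_peMr ?sqr_ge0 //; clear -v1; lra.
  have [u0|u0] := leP 0 u; first exact: key.
  by rewrite -IentN; apply: key; rewrite ?sqrrN //; lra.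
have h2 : expR ((a + b)%:R * Ient u) <= expR M by rewrite ler_expR.
have h3 : 2 ^+ (a + b) <= (a + b).+1%:R * expR M * 'C(a + b, a)%:R :> R.
  apply: (le_trans h); rewrite -mulrA ler_wpM2l // mulrC ler_wpM2r //.
have := ler_wpM2r (expR_ge0 (- ((a + b)%:R * Ient w))) h3.
by move=> h4; apply: (le_trans h4); rewrite mulrAC.
Qed.

End BinomialEntropy.

(** * The Laplace sum over the overlap *)

Section SecondMomentSum.
Variables (R : realType) (k : nat).
Implicit Types (r C M x w n e : R).

(* The correlation of two balanced colourings whose classes of colour true differ in i places *)
Definition wt (n : R) (i : nat) : R := 1 - 4 * i%:R / n.

Definition overlap_weight r C n i :=
  expR (overlap_exponent k r (wt n i) n + C * (`|wt n i| + n^-1)).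

(** Near w = 0 the overlap exponent is (xpar / 2) (n w ^ 2 - 1), while the hypergeometric weight
    behaves as exp (- n w ^ 2 / 2). The sum is therefore Gaussian with inverse variance scaled by 1
    - xpar, and xpar must be less than 1. *)
Definition xpar r := 2 * (r * theta R k ^+ 2 * cc R k).

Lemma near_term r C M : (2 <= k)%N -> 0 <= r -> 0 <= C -> 0 <= M -> exists2 K : R, 0 <= K &
  forall (n e : R) (a b i0 t i : nat), nearly_half a b i0 n ->
  (a%:R - b%:R) ^+ 2 <= M * n -> 64 * M <= n -> 0 < e <= 1 ->
  i = (i0 + t)%N \/ (t <= i0)%N /\ i = (i0 - t)%N -> `|wt n i| <= e ->
  hyp R a b i * overlap_weight r C n i <=
  hyp R a b i0 * expR (- (xpar r / 2) + K * (e + n^-1)) *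
   expR (- (8 * (1 - xpar r - K * e) * t%:R ^+ 2 / n)).
Proof.
move=> k2 r0 C0 M0; have [C5 C50 H5] := even_expand R k.
have c0 := cc_ge0 R k; have t0 := theta_gt0 R k2.
pose s := r * theta R k ^+ 2; have s0 : 0 <= s by rewrite mulr_ge0 // exprn_ge0 // ltW.
pose B1 := s * (cc R k + C5); have B10 : 0 <= B1 by rewrite mulr_ge0 // addr_ge0.
have sC : 0 <= s * C5 by rewrite mulr_ge0.
exists (33 * B1 + 8 * M + 44 + C + 2 * (s * C5)); first by clear -B10 M0 C0 sC; lra.
move=> n e a b i0 t i nh hv nM /andP[e0 e1] it we.
have [nE iL iU n1] := nh.
have n0 : 0 < n by clear -n1; lra.
have z0 : 0 < n^-1 by rewrite invr_gt0.
have hH : hyp R a b i <= hyp R a b i0 * expR (- (8 * t%:R ^+ 2 / n) + (8 * M + 44) * t%:R / n).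
  have [h1 h2] := hyp_upper t nh M0 hv nM.
  by case: it => [->//|[ti ->]]; exact: h2.
have t00 : 0 <= t%:R :> R by [].
have wn : n * `|wt n i| <= 4 * t%:R + 3 /\ 4 * t%:R <= n * `|wt n i| + 3.
  rewrite -[n in n * _]ger0_norm ?(ltW n0) // -normrM.
  have -> : n * wt n i = n - 4 * i%:R by rewrite /wt; field; rewrite gt_eqF.
  case: it => [->|[ti ->]]; rewrite ?natrD ?natrB //.
    by case: ger0P => h; split; clear -h iL iU t00; lra.
  by case: ger0P => h; split; clear -h iL iU t00; lra.
set w := wt n i in we wn *; have w0 : 0 <= `|w| by [].
have w1 : `|w| <= 1 by apply: le_trans e1.
have S : Sev k w - 1 <= cc R k * w ^+ 2 + C5 * e * w ^+ 2.
  have [+ _ _] := H5 1 w ltac:(by rewrite subrr normr0) ltac:(by clear -w1; lra).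
  rewrite subrr normr0 add0r expr1n mulr1 /Sev.
  have ww : w ^+ 2 <= e.
    rewrite -[w ^+ 2]ger0_norm ?sqr_ge0 // normrX expr2.
    by apply: le_trans we; rewrite ler_piMl.
  have : C5 * (w ^+ 2 * w ^+ 2) <= C5 * (e * w ^+ 2) by rewrite ler_wpM2l // ler_wpM2r ?sqr_ge0.
  have : 0 <= C5 * (w ^+ 2 * w ^+ 2) by rewrite mulr_ge0 // mulr_ge0 ?sqr_ge0.
  by clear; lra.
pose B := s * (cc R k + C5 * e).
have B0 : 0 <= B by rewrite mulr_ge0 // addr_ge0 // mulr_ge0 // ltW.
have BB : B <= B1 by rewrite ler_wpM2l // lerD2l ler_piMr.
have nw : n * w ^+ 2 <= (16 * t%:R ^+ 2 + 24 * t%:R + 9) / n.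
  rewrite ler_pdivlMr //.
  have -> : n * w ^+ 2 * n = (n * `|w|) ^+ 2.
    by rewrite exprMn -normrX ger0_norm ?sqr_ge0 //; ring.
  have : (n * `|w|) ^+ 2 <= (4 * t%:R + 3) ^+ 2.
    apply: lerXn2r; rewrite ?nnegrE; [by rewrite mulr_ge0 // ltW|by clear -t00; lra|by case: wn].
  by clear; lra.
have tn : t%:R / n <= e + n^-1.
  rewrite ler_pdivrMr // mulrDl mulVf ?gt_eqF //.
  have := ler_wpM2l (ltW n0) we; case: wn => _; clear -e0 n0.
  have : 0 <= e * n by rewrite mulr_ge0 // ltW.
  lra.
have ex : overlap_exponent k r w n + C * (`|w| + n^-1) <=
   B * ((16 * t%:R ^+ 2 + 24 * t%:R + 9) / n) - xpar r / 2 + C * (e + n^-1).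
  have h1 : C * (`|w| + n^-1) <= C * (e + n^-1) by rewrite ler_wpM2l // lerD2r.
  have h2 : s * (n * (Sev k w - 1)) <= B * (n * w ^+ 2).
    have := ler_wpM2l s0 (ler_wpM2l (ltW n0) S); rewrite /B; clear; lra.
  have h3 := ler_wpM2l B0 nw.
  by rewrite /overlap_exponent /xpar -/s; clear -h1 h2 h3; lra.
apply: (@le_trans _ _ (hyp R a b i0 * expR (- (8 * t%:R ^+ 2 / n) + (8 * M + 44) * t%:R / n) *
   expR (B * ((16 * t%:R ^+ 2 + 24 * t%:R + 9) / n) - xpar r / 2 + C * (e + n^-1)))).
  by apply: ler_pM; rewrite ?hyp_ge0 ?expR_ge0 // ler_expR.
rewrite -[leLHS]mulrA -[leRHS]mulrA -!expRD ler_wpM2l ?hyp_ge0 // ler_expR.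
have xB : xpar r = 2 * B - 2 * (s * C5) * e by rewrite /xpar /B -/s; ring.
set K := _ + 2 * (s * C5).
have g1 : (24 * B + 8 * M + 44) * (t%:R / n) <= (24 * B1 + 8 * M + 44) * (e + n^-1).
  apply: ler_pM => //; [by clear -B0 M0; lra|by rewrite divr_ge0 // ltW|by clear -BB; lra].
have g2 : 9 * B * n^-1 <= 9 * B1 * (e + n^-1).
  apply: ler_pM; [by rewrite mulr_ge0|exact: ltW|by rewrite ler_pM2l|by clear -e0; lra].
have tt : 0 <= t%:R ^+ 2 / n by rewrite divr_ge0 ?exprn_ge0 // ltW.
have g3 : (2 * (s * C5) - K) * e * (t%:R ^+ 2 / n) <= 0.
  have K0 : 2 * (s * C5) - K <= 0 by rewrite /K; clear -B10 M0 C0; lra.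
  have et : 0 <= e * (t%:R ^+ 2 / n) by apply: mulr_ge0 => //; exact: ltW.
  rewrite -[leLHS]mulrA; exact: mulr_le0_ge0.
have g4 : 0 <= 2 * (s * C5) * (e + n^-1) by apply: mulr_ge0; [apply: mulr_ge0|apply: addr_ge0; exact: ltW].
have -> : - (8 * (1 - xpar r - K * e) * t%:R ^+ 2 / n) = 
   - (8 * (1 - 2 * B) * (t%:R ^+ 2 / n)) - 8 * ((2 * (s * C5) - K) * e * (t%:R ^+ 2 / n)).
  by rewrite xB; ring.
have -> : (8 * M + 44) * t%:R / n = (8 * M + 44) * (t%:R / n) by ring.
have -> : B * ((16 * t%:R ^+ 2 + 24 * t%:R + 9) / n) =
   16 * B * (t%:R ^+ 2 / n) + 24 * B * (t%:R / n) + 9 * B * n^-1 by ring.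
have -> : 8 * t%:R ^+ 2 / n = 8 * (t%:R ^+ 2 / n) by ring.
have KE : K * (e + n^-1) = 24 * B1 * (e + n^-1) + 9 * B1 * (e + n^-1) + (8 * M + 44) * (e + n^-1) + C * (e + n^-1) + 2 * (s * C5) * (e + n^-1).
  by rewrite /K; ring.
clear -g1 g2 g3 g4 KE; lra.
Qed.

(** The correlation w costs exp (- n * Ient w) in the number of colourings and gains at most exp ((1
    - kp) * n * Ient w) in probability, up to constants; the entropy gap leaves exponential
    decay. *)
Lemma far_term r C M kp : (2 <= k)%N -> 0 <= r -> 0 <= C ->
  (forall w, -1 <= w <= 1 -> r * theta R k ^+ 2 * (Sev k w - 1) <= (1 - kp) * Ient w) -> 0 <= kp ->
  forall (a b i : nat) (n e : R), n = (a + b)%:R -> 1 <= n -> 4 * M <= n ->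
  (a%:R - b%:R) ^+ 2 <= M * n -> 0 <= e -> e <= `|wt n i| -> 
  hyp R a b i * overlap_weight r C n i <=
  (n + 1) * expR (M + 2 * C) * expR (- (kp * e ^+ 2 / 2 * n)) * 'C(a + b, a)%:R.
Proof.
move=> k2 r0 C0 hI kp0 a b i n e nE n1 nM hv e0 we.
have n0 : 0 < n by clear -n1; lra.
have B0 : 0 <= (n + 1) * expR (M + 2 * C) * expR (- (kp * e ^+ 2 / 2 * n)) * 'C(a + b, a)%:R.
  by rewrite !mulr_ge0 ?expR_ge0 // addr_ge0 // ltW.
have [ia|ia] := leqP i a; last by rewrite hyp0 ?mul0r // ia.
have [ib|ib] := leqP i b; last by rewrite hyp0 ?mul0r // ib orbT.
have ab0 : (0 < a + b)%N by rewrite -(ltr_nat R) -nE.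
have w1 : -1 <= wt n i <= 1.
  have ia' : i%:R <= a%:R :> R by rewrite ler_nat.
  have ib' : i%:R <= b%:R :> R by rewrite ler_nat.
  have h2 : 4 * i%:R / n <= 2 by rewrite ler_pdivrMr // nE natrD; clear -ia' ib'; lra.
  have h3 : 0 <= 4 * i%:R / n by rewrite divr_ge0 ?mulr_ge0 // ltW.
  by rewrite /wt; clear -h2 h3; apply/andP; split; lra.
have wn1 : `|wt n i| <= 1 by rewrite ler_norml.
have hF : hyp R a b i <= (n + 1) * expR M * expR (- (n * Ient (wt n i))) * 'C(a + b, a)%:R.
  have := @hyp_far R a b i M (wt n i) ab0 ia ib.
  by rewrite -[(a + b).+1%:R]natr1 -nE; apply.
have I2 : e ^+ 2 / 2 <= Ient (wt n i).
  apply: le_trans (Ient_ge_sq w1); rewrite ler_pM2r ?invr_gt0 //.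
  by rewrite -[wt n i ^+ 2]ger0_norm ?sqr_ge0 // normrX; apply: lerXn2r.
have z1 : n^-1 <= 1 by rewrite invf_le1.
have hW : overlap_weight r C n i <= expR ((1 - kp) * (n * Ient (wt n i)) + 2 * C).
  rewrite ler_expR; apply: lerD; last first.
    have := ler_wpM2l C0 (lerD wn1 z1); clear; lra.
  have := ler_wpM2l (ltW n0) (hI _ w1); rewrite /overlap_exponent.
  have : 0 <= r * theta R k ^+ 2 * cc R k.
    by rewrite mulr_ge0 ?cc_ge0 // mulr_ge0 // exprn_ge0 // ltW // theta_gt0.
  by clear; lra.
apply: (le_trans (ler_pM (hyp_ge0 _ _ _ _) (expR_ge0 _) hF hW)).
rewrite mulrAC ler_wpM2r // -!mulrA ler_wpM2l ?addr_ge0 ?(ltW n0) // -!expRD ler_expR.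
have h1 := ler_wpM2l kp0 (ler_wpM2r (ltW n0) I2).
by clear -h1; lra.
Qed.

Lemma near_sum r C M : (2 <= k)%N -> 0 <= r -> 0 <= C -> 0 <= M -> exists2 K : R, 0 <= K &
  forall (n e : R) (a b i0 N : nat), nearly_half a b i0 n ->
  (a%:R - b%:R) ^+ 2 <= M * n -> 64 * M <= n -> 0 < e <= 1 -> (i0 <= N)%N ->
  0 < 1 - xpar r - K * e ->
  \sum_(i < N.+1 | `|wt n i| <= e) hyp R a b i * overlap_weight r C n i <=
  hyp R a b i0 * expR (- (xpar r / 2) + K * (e + n^-1)) *
  (1 + 2 * (Ginf R / (Num.sqrt (1 - xpar r - K * e) * Num.sqrt (8 / n)))).
Proof.
move=> k2 r0 C0 M0; have [K K0 H] := near_term k2 r0 C0 M0; exists K => //.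
move=> n e a b i0 N nh hv nM he iN c0.
pose g i := if `|wt n i| <= e then overlap_weight r C n i else 0.
rewrite big_mkcond (eq_bigr (fun i : 'I_N.+1 => hyp R a b i * g i)); last first.
  by move=> i _; rewrite /g; case: ifP; rewrite ?mulr0.
have K'0 : 0 <= hyp R a b i0 * expR (- (xpar r / 2) + K * (e + n^-1)).
  by rewrite mulr_ge0 ?hyp_ge0 ?expR_ge0.
have key (t i : nat) : i = (i0 + t)%N \/ (t <= i0)%N /\ i = (i0 - t)%N ->
   hyp R a b i * g i <= hyp R a b i0 * expR (- (xpar r / 2) + K * (e + n^-1)) *
     expR (- (8 * (1 - xpar r - K * e) * t%:R ^+ 2 / n)).
  by move=> it; rewrite /g; case: ifP => h; [exact: (H n e a b i0)|rewrite mulr0 mulr_ge0 ?expR_ge0].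
apply: (hyp_near_le nh c0 K'0 iN).
- by move=> i; rewrite /g; case: ifP; rewrite ?expR_ge0.
- by move=> t; apply: key; left.
- by move=> t ti; apply: key; right.
Qed.

Lemma far_sum r C M kp : (2 <= k)%N -> 0 <= r -> 0 <= C ->
  (forall w, -1 <= w <= 1 -> r * theta R k ^+ 2 * (Sev k w - 1) <= (1 - kp) * Ient w) -> 0 <= kp ->
  forall (a b : nat) (n e : R), n = (a + b)%:R -> 1 <= n -> 4 * M <= n ->
  (a%:R - b%:R) ^+ 2 <= M * n -> 0 <= e ->
  \sum_(i < (a + b).+1 | ~~ (`|wt n i| <= e)) hyp R a b i * overlap_weight r C n i <=
  (n + 1) ^+ 2 * expR (M + 2 * C) * expR (- (kp * e ^+ 2 / 2 * n)) * 'C(a + b, a)%:R.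
Proof.
move=> k2 r0 C0 hI kp0 a b n e nE n1 nM hv e0.
have B0 : 0 <= (n + 1) * expR (M + 2 * C) * expR (- (kp * e ^+ 2 / 2 * n)) * 'C(a + b, a)%:R.
  by rewrite !mulr_ge0 ?expR_ge0 // addr_ge0 //; clear -n1; lra.
rewrite big_mkcond; apply: (@le_trans _ _ (\sum_(i < (a + b).+1)
   ((n + 1) * expR (M + 2 * C) * expR (- (kp * e ^+ 2 / 2 * n)) * 'C(a + b, a)%:R))).
  apply: ler_sum => i _; case: ifP => // h.
  by apply: far_term => //; rewrite ltW // ltNge.
have E : (a + b).+1%:R = n + 1 by rewrite -natr1 -nE.
rewrite sumr_const card_ord -[leLHS]mulr_natl E; clear E.
by rewrite le_eqVlt; apply/orP; left; apply/eqP; ring.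
Qed.

(** Converts the value at the mode into a multiple of the total 'C(a + b, a), by summing the
    Gaussian lower bound up to y in the scaled variable h t. This replaces an asymptotic formula for
    the mode. *)
Lemma class_mass (M y n : R) (a b i0 : nat) : nearly_half a b i0 n -> 0 <= M -> 0 < y ->
  (a%:R - b%:R) ^+ 2 <= M * n -> 64 * M <= n -> 256 * (y ^+ 2 / 4 + 2) <= n -> 16 <= n ->
  forall h, h = Num.sqrt (8 / n) -> h < 2 * Phi y ->
  hyp R a b i0 <= 'C(a + b, a)%:R * (expR ((64 * (y ^+ 2 / 4 + 2) + 32 * M + 208) * (y * h / 8 + n^-1)) *
     (h / (2 * Phi y - h))).
Proof.
move=> nh M0 y0 hv nM nT n16 h hE hP; have [nE iL iU n1] := nh.
have n0 : 0 < n by clear -n16; lra.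
have h0 : 0 < h by rewrite hE sqrtr_gt0 divr_gt0.
have h2 : h ^+ 2 = 8 / n by rewrite hE sqr_sqrtr // divr_ge0 // ltW.
pose N := (Num.truncn (y / h)).+1.
have yh : 0 <= y / h by rewrite divr_ge0 // ltW.
have N1 : y / h <= N%:R by apply: ltW; exact: archimedean.Num.Theory.truncnS_gt.
have N2 : N%:R <= y / h + 1.
  by rewrite -natr1 lerD2r; apply: (proj1 (andP (archimedean.Num.Theory.truncn_itv yh))).
(* From (y / h + 1) ^ 2 <= 2 (y / h) ^ 2 + 2 and h ^ 2 = 8 / n, one gets N ^ 2 <= y ^ 2 n / 4 + 2 <=
   T n. *)
pose T := y ^+ 2 / 4 + 2.
have T0 : 0 <= T by rewrite addr_ge0 // divr_ge0 // exprn_ge0 // ltW.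
have NT : N%:R ^+ 2 <= T * n.
  apply: (@le_trans _ _ ((y / h + 1) ^+ 2)).
    by apply: lerXn2r; rewrite ?nnegrE // addr_ge0.
  have e1 : (y / h) ^+ 2 = y ^+ 2 * n / 8 by rewrite expr_div_n h2; field; rewrite gt_eqF.
  have := sqr_ge0 (y / h - 1); rewrite /T; clear -e1 n1; nra.
have := hyp_mass_ge nh M0 T0 hv nM nT n16 NT hE.
have hN : Phi y <= Phi (h * N%:R).
  by apply: Phi_nondecr; [exact: ltW|rewrite mulrC -ler_pdivrMr].
have P0 : 0 < 2 * Phi y / h - 1 by rewrite subr_gt0 ltr_pdivlMr // mul1r.
have hN2 : 2 * Phi y / h - 1 <= 2 * Phi (h * N%:R) / h - 1.
  by rewrite lerD2r ler_pM2r ?invr_gt0 // ler_pM2l.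
have Nn : N%:R / n <= y * h / 8 + n^-1.
  rewrite ler_pdivrMr // mulrDl mulVf ?gt_eqF //; apply: (le_trans N2).
  rewrite lerD2r le_eqVlt; apply/orP; left; apply/eqP.
  have -> : n = 8 / h ^+ 2 by rewrite h2; field; rewrite gt_eqF.
  by field; rewrite gt_eqF.
set cT := 64 * T + 32 * M + 208 => H.
have cT0 : 0 <= cT by rewrite /cT; clear -T0 M0; lra.
have {}H : hyp R a b i0 * expR (- (cT * (y * h / 8 + n^-1))) * (2 * Phi y / h - 1) <= 'C(a + b, a)%:R.
  apply: le_trans H; apply: ler_pM => //; rewrite ?mulr_ge0 ?hyp_ge0 ?expR_ge0 ?(ltW P0) //.
  by rewrite ler_wpM2l ?hyp_ge0 // ler_expR lerN2 -mulrA ler_wpM2l.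
have E : h / (2 * Phi y - h) = (2 * Phi y / h - 1)^-1.
  have -> : 2 * Phi y / h - 1 = (2 * Phi y - h) / h by field; rewrite gt_eqF.
  by rewrite invf_div.
rewrite E mulrA ler_pdivlMr // -ler_pdivrMr ?expR_gt0 // -expRN mulrAC.
exact: H.
Qed.

(** Near terms are bounded by [near_sum] as a multiple of the value at the mode, which [class_mass]
    then eliminates; the step h cancels between the two Gaussian sums. *)
Lemma class_sum r C M kp : (2 <= k)%N -> 0 <= r -> 0 <= C -> 0 <= M ->
  (forall w, -1 <= w <= 1 -> r * theta R k ^+ 2 * (Sev k w - 1) <= (1 - kp) * Ient w) -> 0 <= kp ->
  exists2 K : R, 0 <= K & forall (e y n h : R) (a b : nat), n = (a + b)%:R ->
  (a%:R - b%:R) ^+ 2 <= M * n -> 64 * M <= n -> 0 < e <= 1 -> 0 < 1 - xpar r - K * e ->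
  0 < y -> 256 * (y ^+ 2 / 4 + 2) <= n -> 16 <= n -> h = Num.sqrt (8 / n) -> h < 2 * Phi y ->
  \sum_(i < (a + b).+1) hyp R a b i * overlap_weight r C n i <=
  (expR ((64 * (y ^+ 2 / 4 + 2) + 32 * M + 208) * (y * h / 8 + n^-1)) *
    expR (- (xpar r / 2) + K * (e + n^-1)) *
     ((h + 2 * (Ginf R / Num.sqrt (1 - xpar r - K * e))) / (2 * Phi y - h)) +
   (n + 1) ^+ 2 * expR (M + 2 * C) * expR (- (kp * e ^+ 2 / 2 * n))) * 'C(a + b, a)%:R.
Proof.
move=> k2 r0 C0 M0 hI kp0; have [K K0 H] := near_sum k2 r0 C0 M0; exists K => //.
move=> e y n h a b nE hv nM he c0 y0 nT n16 hE hP.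
have n1 : 1 <= n by clear -n16; lra.
have n0 : 0 < n by clear -n16; lra.
have h0 : 0 < h by rewrite hE sqrtr_gt0 divr_gt0.
pose i0 := ((a + b) %/ 4)%N.
have [iL iU] := quarter R (a + b).
have nh : nearly_half a b i0 n.
  by split; [rewrite nE natrD|rewrite nE|rewrite nE|exact: n1].
have iN : (i0 <= a + b)%N by rewrite leq_div.
rewrite (bigID (fun i : 'I_(a + b).+1 => `|wt n i| <= e)) /= mulrDl; apply: lerD; last first.
  apply: (far_sum k2 r0 C0 hI kp0 nE n1 _ hv); last by case/andP: he => /ltW.
  by clear -nM M0; lra.
apply: (le_trans (H n e a b i0 (a + b)%N nh hv nM he iN c0)).
have Hm := class_mass nh M0 y0 hv nM nT n16 hE hP.
rewrite -hE; set E := expR (- (xpar r / 2) + _); set E' := expR (_ * _) in Hm *.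
set G := Ginf R / Num.sqrt _.
have sc : 0 < Num.sqrt (1 - xpar r - K * e) by rewrite sqrtr_gt0.
have -> : Ginf R / (Num.sqrt (1 - xpar r - K * e) * h) = G / h.
  by rewrite /G invfM mulrA.
have G0 : 0 <= G by rewrite divr_ge0 ?(ltW sc) // ltW // Ginf_gt0.
have g1 : 0 <= E * (1 + 2 * (G / h)).
  rewrite mulr_ge0 ?expR_ge0 // addr_ge0 // mulr_ge0 // divr_ge0 // ltW //.
have := ler_wpM2r g1 Hm; rewrite -[leRHS]mulrA [leLHS]mulrA => h1; apply: (le_trans h1).
rewrite le_eqVlt; apply/orP; left; apply/eqP.
clear h1 Hm g1.
by clearbody G E E'; field; rewrite !gt_eqF // subr_gt0.
Qed.

End SecondMomentSum.

Section SecondMomentLimit.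
Variable R : realType.

(* exp (\sum_(l >= 2) x ^ l / (2 l)) *)
Definition Cinf (x : R) := expR (- (x / 2)) / Num.sqrt (1 - x).

Lemma poly_exp_cvg0 (a : R) : 0 < a ->
  ((n%:R + 1) ^+ 2 * expR (- (a * n%:R)) : R) @[n --> \oo] --> 0.
Proof.
move=> a0.
have up n : (0 < n)%N -> (n%:R + 1) ^+ 2 * expR (- (a * n%:R)) <= 108 / a ^+ 3 * n%:R^-1.
    move=> n0; have n1 : 1 <= n%:R :> R by rewrite ler1n.
    have an : 0 < a * n%:R by rewrite mulr_gt0 // ltr0n.
    (* A cubic lower bound on the exponential beats the square and leaves 1 / n; 108 is 4 * 27. *)
    have h1 : (a * n%:R / 3) ^+ 3 <= expR (a * n%:R).
      have -> : expR (a * n%:R) = expR (a * n%:R / 3) ^+ 3.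
        by rewrite -expRM_natr; congr expR; field.
      apply: lerXn2r; rewrite ?nnegrE ?expR_ge0 //; first by rewrite divr_ge0 // ltW.
      by apply: le_trans (expR_ge1Dx _); rewrite lerDr.
    have h2 : (n%:R + 1) ^+ 2 <= 4 * n%:R ^+ 2 :> R by clear -n1; nra.
    rewrite expRN ler_pdivrMr ?expR_gt0 //; apply: (le_trans h2).
    have c0 : 0 <= 108 / a ^+ 3 * n%:R^-1.
      by rewrite mulr_ge0 ?invr_ge0 // divr_ge0 // exprn_ge0 // ltW.
    apply: le_trans (ler_wpM2l c0 h1).
    rewrite le_eqVlt; apply/orP; left; apply/eqP.
    by field; rewrite !gt_eqF // ltr0n.
apply: (cvgn_le0 (v := fun n => 108 / a ^+ 3 * n%:R^-1)).
  exists 1%N => // n n0; rewrite /= ger0_norm ?up //.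
by rewrite -[X in _ --> X](mulr0 (108 / a ^+ 3)); apply: cvgMr; exact: cvgn_inv_nat.
Qed.

Lemma sqrt_inv_cvg0 : (Num.sqrt (8 / n%:R) : R) @[n --> \oo] --> 0.
Proof.
rewrite -(sqrtr0 R); apply: (continuous_cvg _ (@sqrt_continuous R 0)).
by rewrite -(mulr0 (8 : R)); apply: cvgMr; exact: cvgn_inv_nat.
Qed.

Lemma Cinf_approx (x K eps : R) : x < 1 -> 0 <= K -> 0 < eps -> exists e : R,
  [/\ 0 < e <= 1, 0 < 1 - x - K * e & 
    expR (- (x / 2) + K * e) / Num.sqrt (1 - x - K * e) < Cinf x + eps].
Proof.
move=> x1 K0 eps0.
pose u (n : nat) : R := n%:R^-1.
have u0 : u n @[n --> \oo] --> 0 by exact: cvgn_inv_nat.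
have c1 : (1 - x - K * u n : R) @[n --> \oo] --> 1 - x.
  rewrite [X in _ --> X](_ : _ = 1 - x - K * 0); last by rewrite mulr0 subr0.
  by apply: cvgB; [exact: cvg_cst|apply: cvgMr].
have c2 : (expR (- (x / 2) + K * u n) / Num.sqrt (1 - x - K * u n) : R) @[n --> \oo] --> Cinf x.
  apply: cvgM.
    apply: (continuous_cvg _ (@continuous_expR R _)).
    rewrite [X in _ --> X](_ : _ = - (x / 2) + K * 0); last by rewrite mulr0 addr0.
    by apply: cvgD; [exact: cvg_cst|apply: cvgMr].
  apply: cvgV; first by rewrite gt_eqF // sqrtr_gt0 subr_gt0.
  exact: (continuous_cvg _ (@sqrt_continuous R (1 - x))).
have h1 := @cvgr_gt _ _ _ _ _ _ c1 _ (_ : 0 < 1 - x).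
have h2 := @cvgr_lt _ _ _ _ _ _ c2 _ (_ : Cinf x < Cinf x + eps).
suff [n [n1 [g1 g2]]] : exists n, (0 < n)%N /\ (0 < 1 - x - K * u n) /\
   expR (- (x / 2) + K * u n) / Num.sqrt (1 - x - K * u n) < Cinf x + eps.
  exists (u n); split => //; rewrite /u invr_gt0 ltr0n n1 /= invf_le1 ?ltr0n //.
  by rewrite ler1n.
apply: (@filter_ex _ \oo).
near=> n; split; [|split]; near: n.
- exact: nbhs_infty_gt.
- by apply: h1; rewrite subr_gt0.
- by apply: h2; rewrite ltrDl.
Unshelve. all: by end_near. Qed.

(** The parameters are chosen in order: the window e, so that the inflated Gaussian constant is
    close to [Cinf]; the cut y, so that [Phi y] is close to [Ginf]; then n. *)
Lemma class_sum_lim (k : nat) (r C M kp : R) : (2 <= k)%N -> 0 <= r -> 0 <= C -> 0 <= M ->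
  (forall w, -1 <= w <= 1 -> r * theta R k ^+ 2 * (Sev k w - 1) <= (1 - kp) * Ient w) -> 0 < kp ->
  xpar k r < 1 -> forall eps, 0 < eps -> exists n0 : nat, forall a b : nat,
  (n0 <= a + b)%N -> (a%:R - b%:R) ^+ 2 <= M * (a + b)%:R ->
  \sum_(i < (a + b).+1) hyp R a b i * overlap_weight k r C (a + b)%:R i <=
  (Cinf (xpar k r) + eps) * 'C(a + b, a)%:R.
Proof.
move=> k2 r0 C0 M0 hI kp0 x1 eps eps0.
have [K K0 H] := class_sum k2 r0 C0 M0 hI (ltW kp0).
set x := xpar k r in x1 H *.
have eps2 : 0 < eps / 2 by rewrite divr_gt0.
have [e [he c0 fe]] := Cinf_approx x1 K0 eps2.
have e0 : 0 < e by case/andP: he.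
set s := Num.sqrt _ in fe; have s0 : 0 < s by rewrite sqrtr_gt0.
set f := expR _ / s in fe.
have f0 : 0 < f by rewrite divr_gt0 ?expR_gt0.
have D0 : 0 < Cinf x + eps / 2 by apply: lt_trans fe.
have G0 := Ginf_gt0 R.
(* The distance to [Ginf] is tuned so that f * Ginf / Phi y, the limit of the bound, stays below
   [Cinf x + eps / 2]. *)
have [y y0 Py] : exists2 y, 0 < y & Ginf R - (Ginf R - Ginf R * (f / (Cinf x + eps / 2))) < Phi y.
  by apply: Phi_near; rewrite subr_gt0 gtr_pMr // ltr_pdivrMr // mul1r.
have P0 : 0 < Phi y by apply: lt_trans Py; rewrite subKr mulr_gt0 // divr_gt0.
have lim0 : f * (Ginf R / Phi y) < Cinf x + eps / 2.
  rewrite subKr in Py; rewrite mulrA ltr_pdivrMr // mulrC.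
  by move: Py; rewrite mulrA ltr_pdivrMr // [Phi y * _]mulrC.
pose h (n : nat) : R := Num.sqrt (8 / n%:R).
pose cT : R := 64 * (y ^+ 2 / 4 + 2) + 32 * M + 208.
pose bd (n : nat) : R := expR (cT * (y * h n / 8 + n%:R^-1)) *
    expR (- (x / 2) + K * (e + n%:R^-1)) *
     ((h n + 2 * (Ginf R / s)) / (2 * Phi y - h n)) +
   (n%:R + 1) ^+ 2 * expR (M + 2 * C) * expR (- (kp * e ^+ 2 / 2 * n%:R)).
have h0 : h n @[n --> \oo] --> 0 by exact: sqrt_inv_cvg0.
have z0 : (n%:R^-1 : R) @[n --> \oo] --> 0 by exact: cvgn_inv_nat.
have bdl : bd n @[n --> \oo] --> f * (Ginf R / Phi y).
  have -> : f * (Ginf R / Phi y) = expR (cT * (y * 0 / 8 + 0)) *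
    expR (- (x / 2) + K * (e + 0)) * ((0 + 2 * (Ginf R / s)) / (2 * Phi y - 0)) + expR (M + 2 * C) * 0.
    rewrite mulr0 mul0r !addr0 mulr0 expR0 mul1r add0r subr0 mulr0 addr0 /f.
    move: (expR _) => E; field; rewrite !gt_eqF //.
  have ey : (expR (cT * (y * h n / 8 + n%:R^-1)) : R) @[n --> \oo] --> expR (cT * (y * 0 / 8 + 0)).
    apply: (continuous_cvg _ (@continuous_expR R _)).
    by apply: cvgMr; apply: cvgD => //; apply: cvgMl; apply: cvgMr.
  have ez : (expR (- (x / 2) + K * (e + n%:R^-1)) : R) @[n --> \oo] --> expR (- (x / 2) + K * (e + 0)).
    apply: (continuous_cvg _ (@continuous_expR R _)).
    by apply: cvgD; [exact: cvg_cst|apply: cvgMr; apply: cvgD => //; exact: cvg_cst].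
  have el : ((n%:R + 1) ^+ 2 * expR (M + 2 * C) * expR (- (kp * e ^+ 2 / 2 * n%:R)) : R) @[n --> \oo] --> expR (M + 2 * C) * 0.
    apply: (@cvgn_ext _ (fun n => expR (M + 2 * C) * ((n%:R + 1) ^+ 2 * expR (- (kp * e ^+ 2 / 2 * n%:R))))).
      by move=> n; rewrite mulrA [expR _ * _]mulrC.
    by apply: cvgMr; apply: poly_exp_cvg0; rewrite divr_gt0 // mulr_gt0 // exprn_gt0.
  apply: cvgD el; apply: cvgM; first exact: cvgM.
  apply: cvgM; first by apply: cvgD => //; exact: cvg_cst.
  apply: cvgV; first by rewrite subr0 gt_eqF // mulr_gt0.
  by apply: cvgB => //; exact: cvg_cst.
have l1 := @cvgr_lt _ _ _ _ _ _ bdl _ lim0.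
have l2 := @cvgr_lt _ _ _ _ _ _ h0 (2 * Phi y) ltac:(by rewrite mulr_gt0).
have ev : \forall n \near \oo, [/\ bd n < Cinf x + eps / 2, h n < 2 * Phi y, 16 <= n%:R :> R,
    64 * M <= n%:R & 256 * (y ^+ 2 / 4 + 2) <= n%:R].
  by near=> n; split; near: n; [exact: l1|exact: l2|exact: nbhs_infty_ger|exact: nbhs_infty_ger|exact: nbhs_infty_ger].
case: ev => n0 _ ev; exists n0 => a b nab hv.
have [b1 b2 b3 b4 b5] := ev (a + b)%N nab.
apply: (le_trans (H e y (a + b)%:R _ a b erefl hv b4 he c0 y0 b5 b3 erefl b2)).
apply: ler_wpM2r => //; apply: (le_trans (ltW b1)).
by rewrite lerD2l ler_pdivrMr // ler_peMr ?ler1n // ltW.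
Unshelve. all: by end_near. Qed.

End SecondMomentLimit.

(** * Moments of the number of nearly balanced colourings *)

Section Moments.
Variable R : realType.

Lemma bin_shift_le (x D m y : nat) : (m + y <= x)%N -> (0 < y)%N ->
  'C(x + D, m)%:R <= 'C(x, m)%:R * expR (m%:R * (D%:R / y%:R)) :> R.
Proof.
move=> mx y0; have yR : 0 < y%:R :> R by rewrite ltr0n.
have f0 : 0 < m`!%:R :> R by rewrite ltr0n fact_gt0.
rewrite -(ler_pM2r f0) mulrAC -!natrM !bin_ffact.
elim: m mx {f0} => [|m IH] mx; first by rewrite !ffactn0 mul0r expR0 mulr1.
have mx' : (m + y <= x)%N by lia.
have h : ((x + D - m)%N)%:R <= (x - m)%N%:R * expR (D%:R / y%:R) :> R.
  have yx : y%:R <= (x - m)%N%:R :> R by rewrite ler_nat; lia.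
  apply: (@le_trans _ _ ((x - m)%N%:R * (1 + D%:R / y%:R))); last by rewrite ler_wpM2l ?expR_ge1Dx.
  rewrite -addnBAC; last by lia.
  rewrite natrD mulrDr mulr1 lerD2l mulrCA ler_peMr // ler_pdivlMr // mul1r.
  exact: yx.
rewrite !ffactnSr !natrM -[m.+1%:R]natr1 mulrDl mul1r expRD mulrACA.
by apply: ler_pM => //; exact: IH.
Qed.

(** Convexity: no colouring, whatever its imbalance, has fewer monochromatic edges than one in
    [balanced 4] by more than a proportion O(1 / n) of all edges. Over m = O(n) edges this changes
    the count of hypergraphs by a constant factor only. *)
Lemma planted_count_le k (r : R) : (3 <= k)%N -> 0 <= r -> exists C : R, exists n0 : nat, 0 <= C /\
  forall n a b a' b' m Ns Nt : nat, (n0 <= n)%N -> (a + b = n)%N -> (a' + b' = n)%N ->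
  (a'%:R - b'%:R) ^+ 2 <= 4 * n%:R :> R -> r * n%:R <= m%:R <= r * n%:R + 1 ->
  (Ns + ('C(a, k) + 'C(b, k)) = 'C(n, k))%N -> (Nt + ('C(a', k) + 'C(b', k)) = 'C(n, k))%N ->
  'C(Ns, m)%:R <= C * 'C(Nt, m)%:R /\ (m <= Nt)%N.
Proof.
move=> k3 r0; have [CX [C3 [C4 [_ C30 _ HN]]]] := @overlap_normalised R k 4 k3 ltac:(by []).
have [CA CA0 HA] : exists2 C : R, 0 <= C & forall (a b : nat) (n z u : R),
  1 <= n -> n = a%:R + b%:R -> u = (a%:R - b%:R) / n -> z = n^-1 ->
  2 / 2 ^+ k * (1 + cc R k * u ^+ 2 - 2 * cc R k * z) - C * (u ^+ 2 * z)
    <= nff k n a + nff k n b <= 2 / 2 ^+ k + C * (u ^+ 2 + z ^+ 2).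
  by move: k3; clear HN; case: k => [|[|k]] // _; exact: nffA_bound.
pose q : R := 2 / 2 ^+ k.
have q0 : 0 <= q by rewrite divr_ge0 // exprn_ge0.
have q1 : q <= 1 / 4.
  rewrite ler_pdivrMr ?exprn_gt0 //.
  have : 2 ^+ 3 <= 2 ^+ k :> R by rewrite ler_eXn2l ?ltr1n.
  by rewrite !exprS expr0; clear; lra.
have c0 := cc_ge0 R k.
have f0 : 0 < k`!%:R :> R by rewrite ltr0n fact_gt0.
pose K : R := 2 * cc R k + 6 * CA.
have K0 : 0 <= K by rewrite /K; clear -c0 CA0; lra.
have r1 : 0 <= r + 1 by clear -r0; lra.
have rk0 : 0 <= (r + 1) * k`!%:R by rewrite mulr_ge0 // ltW.
have e1 : 1 <= expR (4 * K * (r + 1)).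
  by rewrite -[leLHS]expR0 ler_expR mulr_ge0 // mulr_ge0.
exists (expR (4 * K * (r + 1))), (Num.truncn (4 * C3 + 4 * (r + 1) * k`!%:R)).+1; split; first exact: expR_ge0.
move=> n a b a' b' m Ns Nt nn abn abn' hv hm NsE NtE.
have nbig : 4 * C3 + 4 * (r + 1) * k`!%:R <= n%:R.
  apply: ltW; apply: lt_le_trans (archimedean.Num.Theory.truncnS_gt _) _.
  by rewrite ler_nat.
have n1 : 1 <= n%:R :> R by rewrite ler1n (leq_trans _ nn).
have n0 : 0 < n%:R :> R by clear -n1; lra.
pose z : R := n%:R^-1.
have z0 : 0 < z by rewrite invr_gt0.
have z1 : z <= 1 by rewrite invf_le1.
have nE : n%:R = a%:R + b%:R :> R by rewrite -abn natrD.
have nE' : n%:R = a'%:R + b'%:R :> R by rewrite -abn' natrD.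
have := HN a' b' 0%N n%:R z _ n1 nE' erefl erefl hv isT isT.
rewrite abn' -/q => -[_ _ Y1 _].
have := HA a' b' n%:R z _ n1 nE' erefl erefl; have := HA a b n%:R z _ n1 nE erefl erefl.
rewrite -/q; rewrite -/z; set u := (a%:R - b%:R) / _; set u' := (a'%:R - _) / n%:R.
set N' := nff _ _ n in Y1 *; set A := nff _ _ a + _; set A' := nff _ _ a' + _ in Y1 * => /andP[hA _] /andP[_ hA'].
have C3z : C3 * z <= 1 / 4.
  by rewrite /z ler_pdivrMr //; clear -nbig rk0; lra.
have Y2 : 1 / 2 <= N' - A' by move: Y1; rewrite ler_norml => /andP[+ _]; rewrite -/q; clear -C3z q1; lra.
have u2 : u ^+ 2 <= 1.
  rewrite /u expr_div_n ler_pdivrMr ?exprn_gt0 // mul1r nE.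
  have : 0 <= a%:R * b%:R :> R by rewrite mulr_ge0.
  clear; lra.
have u2' : u' ^+ 2 <= 4 * z.
  by rewrite /u' /z expr_div_n ler_pdivrMr ?exprn_gt0 // (_ : 4 / n%:R * n%:R ^+ 2 = 4 * n%:R) //; field; rewrite gt_eqF.
have dA : A' - A <= K * z.
  have h1 : 0 <= q * (cc R k * u ^+ 2) by rewrite mulr_ge0 // mulr_ge0 ?sqr_ge0.
  have h2 : CA * (u ^+ 2 * z) <= CA * z by rewrite ler_wpM2l // ler_piMl // ltW.
  have h3 : q * (cc R k * z) <= cc R k * z.
    have cz : 0 <= cc R k * z by apply: mulr_ge0 => //; exact: ltW.
    by apply: ler_piMl => //; clear -q1; lra.
  have h4 : CA * (u' ^+ 2 + z ^+ 2) <= CA * (5 * z).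
    rewrite ler_wpM2l //; have : z ^+ 2 <= z by rewrite expr2 ler_piMl // ltW.
    clear -u2'; lra.
  clear -h1 h2 h3 h4 hA hA'; rewrite /K; lra.
pose F : R := n%:R ^+ k / k`!%:R.
have F0 : 0 < F by rewrite divr_gt0 // exprn_gt0.
have NR : 'C(n, k)%:R = N' * F by rewrite (bin_nff _ _ n0).
have AR : ('C(a, k) + 'C(b, k))%:R = A * F by rewrite natrD !(bin_nff k _ n0) -mulrDl.
have AR' : ('C(a', k) + 'C(b', k))%:R = A' * F by rewrite natrD !(bin_nff k _ n0) -mulrDl.
have NsR : Ns%:R = (N' - A) * F :> R.
  have : (Ns + ('C(a, k) + 'C(b, k)))%:R = 'C(n, k)%:R :> R by rewrite NsE.
  by rewrite natrD AR NR mulrBl; clear; lra.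
have NtR : Nt%:R = (N' - A') * F :> R.
  have : (Nt + ('C(a', k) + 'C(b', k)))%:R = 'C(n, k)%:R :> R by rewrite NtE.
  by rewrite natrD AR' NR mulrBl; clear; lra.
have Fn : n%:R ^+ 3 / k`!%:R <= F by rewrite ler_pM2r ?invr_gt0 //; apply: ler_weXn2l.
have mn : m%:R <= (r + 1) * n%:R.
  by case/andP: hm => _ h; apply: (le_trans h); clear -n1; lra.
have m0 : 0 <= m%:R :> R by [].
have mF : 4 * m%:R <= F.
  apply: le_trans Fn; rewrite ler_pdivlMr // exprS.
  have h1 : 4 * (r + 1) * k`!%:R <= n%:R by clear -nbig C30; lra.
  have h2 := ler_wpM2l (ltW n0) h1.
  have h3 : n%:R * n%:R <= n%:R * n%:R ^+ 2 :> R by rewrite ler_pM2l // expr2 ler_peMl // ltW.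
  have h4 := ler_wpM2r (ltW f0) mn.
  by clear -h2 h3 h4; lra.
have NtF : 1 / 2 * F <= Nt%:R by rewrite NtR ler_wpM2r // ltW.
have mNt : (m < Nt)%N by rewrite -(ltr_nat R); clear -mF NtF F0 m0; lra.
split; last exact: ltnW.
have [le|lt] := leqP Ns Nt.
  apply: (@le_trans _ _ 'C(Nt, m)%:R); first by rewrite ler_nat leq_bin2l.
  by rewrite ler_peMl.
have DE : (Nt + (Ns - Nt) = Ns)%N by rewrite subnKC // ltnW.
have yx : (m + (Nt - m) <= Nt)%N by rewrite subnKC // ltnW.
have y0 : (0 < Nt - m)%N by rewrite subn_gt0.
have := bin_shift_le (Ns - Nt) yx y0; rewrite DE => h; apply: (le_trans h).
rewrite mulrC ler_wpM2r // ler_expR natrB ?(ltnW lt) // natrB ?(ltnW mNt) //.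
have D1 : Ns%:R - Nt%:R <= K * z * F.
  have := ler_wpM2r (ltW F0) dA; rewrite NsR NtR; clear; lra.
have y1 : 1 / 4 * F <= Nt%:R - m%:R by clear -NtF mF; lra.
have y2 : 0 < Nt%:R - m%:R :> R by rewrite subr_gt0 ltr_nat.
rewrite mulrA ler_pdivrMr //.
have KzF : 0 <= K * z * F by rewrite mulr_ge0 ?(ltW F0) // mulr_ge0 // ltW.
apply: (@le_trans _ _ ((r + 1) * n%:R * (K * z * F))).
  by apply: ler_pM => //; rewrite subr_ge0 ler_nat ltnW.
apply: (@le_trans _ _ (4 * K * (r + 1) * (1 / 4 * F))).
  rewrite le_eqVlt; apply/orP; left; apply/eqP; rewrite /z.
  by clear -n0; field; rewrite gt_eqF.
by rewrite ler_wpM2l // mulr_ge0 // mulr_ge0.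
Qed.


Section Typical.
Variables (k : nat) (d : R).
Hypothesis k3 : (3 <= k)%N.
Hypothesis d0 : 0 < d.
Hypothesis dk : d / k%:R <= 2 ^+ (k - 1) * ln 2 - 2.
Local Notation m n := (medges k d n).

Definition planted n (s : {ffun 'I_n -> bool}) : R := 'C(#|bichromatic k s|, m n)%:R.

Lemma planted_ge0 n (s : {ffun 'I_n -> bool}) : 0 <= planted s.
Proof. by []. Qed.

Let r0 : 0 <= d / k%:R. Proof. by rewrite divr_ge0 // ltW. Qed.

Lemma medges_le n : d / k%:R * n%:R <= (m n)%:R <= d / k%:R * n%:R + 1.
Proof. by have /andP[h1 h2] := medges_bounds k d0 n; rewrite h1 ltW. Qed.

Lemma unbalanced_planted : exists C : R, exists n0 : nat, [/\ 0 <= C,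
  forall n (M : R), (n0 <= n)%N -> 0 < M ->
  \sum_(s in (~: balanced n M)%SET) planted s <= C / M * \sum_(s : {ffun 'I_n -> bool}) planted s &
  forall n (s : {ffun 'I_n -> bool}), (n0 <= n)%N -> s \in balanced n (4 : R) -> (m n <= #|bichromatic k s|)%N].
Proof.
have [C [n0 [C0 H]]] := planted_count_le k3 r0.
exists (2 * C), n0.+1; split; first by rewrite mulr_ge0.
  move=> n M nn M0; have n1 : (0 < n)%N by apply: leq_trans nn.
  apply: unbalanced_sum_le => // s t.
  rewrite finset.inE => ht.
  by have [] := H n _ _ _ _ (m n) _ _ (ltnW nn) (card_colour_classes s) (card_colour_classes t) ht (medges_le n)
     (card_bichromatic k3 s) (card_bichromatic k3 t).
move=> n s nn; rewrite finset.inE => hs.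
by have [] := H n _ _ _ _ (m n) _ _ (ltnW nn) (card_colour_classes s) (card_colour_classes s) hs (medges_le n)
     (card_bichromatic k3 s) (card_bichromatic k3 s).
Qed.

(* lambda_l * delta_l ^ 2 = xval ^ l / (2 l) *)
Definition xval : R := d * (k%:R - 1) * theta R k ^+ 2.

Lemma xparE : xpar k (d / k%:R) = xval.
Proof.
rewrite /xpar /xval /cc; field; by rewrite pnatr_eq0; case: k k3.
Qed.

(** For fixed s the pair count depends on t only through the overlap i, and [hyp R a b i] colourings
    t of the class have it. So the double sum is the number of s times one overlap sum. *)
Lemma class_second_moment (M eps : R) : 0 <= M -> 0 < eps -> exists n0 : nat, forall n (a : nat),
  (n0 <= n)%N -> (a <= n)%N -> (a%:R - (n - a)%N%:R) ^+ 2 <= M * n%:R ->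
  \sum_(s in class_col n a) \sum_(t in class_col n a)
     'C(#|bichromatic k s :&: bichromatic k t|%SET, m n)%:R * 'C('C(n, k), m n)%:R <=
  (Cinf xval + eps) * (\sum_(s in class_col n a) planted s) ^+ 2.
Proof.
move=> M0 eps0; have [kp /andP[kp0 _] [hI x1]] := entropy_gap k3 d0 dk.
have [C [n1 [C0 HO]]] := overlap_bound k3 r0 M0.
have x1' : xpar k (d / k%:R) < 1 by rewrite xparE.
have [n2 HL] := class_sum_lim (ltnW k3) r0 C0 M0 hI kp0 x1' eps0.
rewrite xparE in HL.
exists (maxn n1 n2) => n a; rewrite geq_max => /andP[nn1 nn2] an hM.
set b := (n - a)%N in hM; have abn : (a + b)%N = n by rewrite subnKC.
pose Ns := ('C(n, k) - ('C(a, k) + 'C(b, k)))%N.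
have NsC (s : {ffun 'I_n -> bool}) : s \in class_col n a -> 
    #|colour_class s true| = a /\ #|colour_class s false| = b /\ #|bichromatic k s| = Ns.
  rewrite finset.inE => /eqP sa; have sb : #|colour_class s false| = b.
    by have := card_colour_classes s; rewrite sa /b; clear; lia.
  split => //; split => //; rewrite /Ns -(card_bichromatic k3 s) sa sb addnK //.
have -> : \sum_(s in class_col n a) planted s = 'C(n, a)%:R * 'C(Ns, m n)%:R.
  rewrite -(card_class_col n a) mulr_natl -sumr_const; apply: eq_bigr => s /NsC [_ [_ e]].
  by rewrite /planted e.
have E : (Cinf xval + eps) * ('C(n, a)%:R * 'C(Ns, m n)%:R) ^+ 2 =
   \sum_(s in class_col n a) ('C(Ns, m n)%:R ^+ 2 * ((Cinf xval + eps) * 'C(n, a)%:R)).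
  by rewrite sumr_const card_class_col -[RHS]mulr_natl; ring.
rewrite E; apply: ler_sum => s sa; have [ca [cb Nse]] := NsC s sa.
pose g i : R := 'C(('C(n, k) + ('C(a - i, k) + 2 * 'C(i, k) + 'C(b - i, k)) -
      2 * ('C(a, k) + 'C(b, k)))%N, m n)%:R * 'C('C(n, k), m n)%:R.
have gE t : t \in class_col n a ->
   'C(#|bichromatic k s :&: bichromatic k t|%SET, m n)%:R * 'C('C(n, k), m n)%:R =
   g #|colour_class s true :\: colour_class t true|%SET.
  move=> ta; have [ca' _] := NsC t ta; rewrite /g; congr ('C(_, _)%:R * _).
  by rewrite -ca -cb -(card_bichromatic_overlap k3) ?addnK // ca.
rewrite (eq_bigr _ gE) -[in X in X <= _]ca (sum_class_col g s) ca -/b.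
apply: (@le_trans _ _ (\sum_(i < n.+1) 'C(Ns, m n)%:R ^+ 2 * (hyp R a b i * overlap_weight k (d / k%:R) C n%:R i))).
  apply: ler_sum => i _; rewrite natrM -/(hyp R a b i).
  have [ia|ia] := leqP i a; last by rewrite hyp0 ?ia // !mul0r mulr0.
  have [ib|ib] := leqP i b; last by rewrite hyp0 ?ib ?orbT // !mul0r mulr0.
  rewrite [leRHS]mulrCA ler_wpM2l ?hyp_ge0 //.
  apply: (HO n a b i (m n) Ns) => //; first exact: medges_le.
    by rewrite -Nse -ca -cb; exact: card_bichromatic.
  have [t ta ti] : exists2 t : {ffun 'I_n -> bool}, #|colour_class t true| = #|colour_class s true| &
      #|colour_class s true :\: colour_class t true|%SET = i.
    by apply: overlap_exists; rewrite ?ca ?cb.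
  have := card_bichromatic_overlap k3 ta; rewrite ca cb ti => <-.
  by rewrite subnK // leq_addl.
rewrite -mulr_sumr ler_wpM2l ?exprn_ge0 //.
by have := HL a b; rewrite abn; apply.
Qed.


Definition count_in n (A : {set {ffun 'I_n -> bool}}) (H : {set {set 'I_n}}) : R :=
  \sum_(s in A) (H \subset bichromatic k s)%:R.

Lemma sum_count_in n (A : {set {ffun 'I_n -> bool}}) :
  \sum_(H in msub (ksets n k) (m n)) count_in A H = \sum_(s in A) planted s.
Proof.
rewrite exchange_big /=; apply: eq_bigr => s _.
rewrite /planted -(card_colourings k) -sum1_card natr_sum [RHS]big_mkcond [LHS]big_mkcond /=.
apply: eq_bigr => H _; case: (boolP (H \in msub (ksets n k) (m n))) => hH; rewrite finset.inE ?hH ?(negbTE hH) //=.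
by case: (H \subset bichromatic k s).
Qed.

Lemma sum_count_in_sqr n (A : {set {ffun 'I_n -> bool}}) :
  \sum_(H in msub (ksets n k) (m n)) count_in A H ^+ 2 =
  \sum_(s in A) \sum_(t in A) 'C(#|bichromatic k s :&: bichromatic k t|%SET, m n)%:R.
Proof.
under eq_bigr do rewrite expr2 mulr_suml; rewrite exchange_big /=; apply: eq_bigr => s _.
under eq_bigr do rewrite mulr_sumr; rewrite exchange_big /=; apply: eq_bigr => t _.
rewrite -(card_colourings2 k) -sum1_card natr_sum [RHS]big_mkcond [LHS]big_mkcond /=.
apply: eq_bigr => H _; case: (boolP (H \in msub (ksets n k) (m n))) => hH; rewrite finset.inE ?hH ?(negbTE hH) //=.
by case: (H \subset bichromatic k s); case: (H \subset bichromatic k t); rewrite ?mul0r ?mulr0 ?mul1r.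
Qed.

Lemma sum_balanced n (M : R) (f : {ffun 'I_n -> bool} -> R) :
  \sum_(s in balanced n M) f s =
  \sum_(a < n.+1) if (a%:R - (n - a)%N%:R) ^+ 2 <= M * n%:R then \sum_(s in class_col n a) f s else 0.
Proof.
have h (s : {ffun 'I_n -> bool}) : (#|colour_class s true| < n.+1)%N.
  by rewrite ltnS -[leqRHS](card_ord n) max_card.
rewrite (partition_big (fun s : {ffun 'I_n -> bool} => (inord #|colour_class s true| : 'I_n.+1)) predT) //=.
apply: eq_bigr => a _.
have E (s : {ffun 'I_n -> bool}) : (s \in balanced n M) && (inord #|colour_class s true| == a) =
   ((a%:R - (n - a)%N%:R) ^+ 2 <= M * n%:R) && (s \in class_col n a).
  rewrite !finset.inE -val_eqE /= inordK // andbC; case: eqP => [e|]; rewrite ?andbF //= andbT.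
  have b : (n - a)%N = #|colour_class s false|.
    by have := card_colour_classes s; rewrite e; clear; lia.
  by rewrite /imbalance e b.
rewrite (eq_bigl _ _ E); case: ifP => _; first by apply: eq_bigl => s.
by rewrite big_pred0.
Qed.

(** Split the count by class size a and apply [minkowski_sqr]; sizes outside the balanced range
    contribute 0 to both families [f] and [mm]. *)
Lemma balanced_second_moment (M eps : R) : 0 <= M -> 0 < eps -> exists n0 : nat, forall n,
  (n0 <= n)%N ->
  #|msub (ksets n k) (m n)|%:R * \sum_(H in msub (ksets n k) (m n)) count_in (balanced n M) H ^+ 2 <=
  (Cinf xval + eps) * (\sum_(s in balanced n M) planted s) ^+ 2.
Proof.
move=> M0 eps0; have [n0 H0] := class_second_moment M0 eps0; exists n0 => n nn.
have C0 : 0 <= Cinf xval + eps by rewrite addr_ge0 ?(ltW eps0) // divr_ge0 ?expR_ge0 // sqrtr_ge0.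
rewrite card_msub card_ksets; have [B0|B0] := posnP 'C('C(n, k), m n).
  by rewrite B0 mul0r mulr_ge0 // sqr_ge0.
have BR : 0 < 'C('C(n, k), m n)%:R :> R by rewrite ltr0n.
rewrite mulrC -ler_pdivlMr // mulrAC.
pose typ a := (a%:R - (n - a)%N%:R) ^+ 2 <= M * n%:R.
pose f (a : 'I_n.+1) H : R := if typ a then count_in (class_col n a) H else 0.
pose mm (a : 'I_n.+1) : R := if typ a then \sum_(s in class_col n a) planted s else 0.
rewrite (_ : \sum_(s in balanced n M) planted s = \sum_(a < n.+1) mm a); last exact: sum_balanced.
rewrite (eq_bigr (fun H => (\sum_(a < n.+1) f a H) ^+ 2)); last first.
  by move=> H _; congr (_ ^+ 2); exact: sum_balanced.
apply: minkowski_sqr.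
- by rewrite divr_ge0.
- by move=> a H _; rewrite /f; case: ifP => // _; apply: sumr_ge0.
- by move=> a; rewrite /mm; case: ifP => // _; apply: sumr_ge0.
move=> a; rewrite /f /mm; case: ifP => ta; last by rewrite big1 ?expr0n ?mulr0 // => H _; rewrite expr0n.
rewrite sum_count_in_sqr mulrAC ler_pdivlMr // mulr_suml.
apply: le_trans (H0 n a nn (leq_ord a) ta); rewrite le_eqVlt; apply/orP; left; apply/eqP.
by apply: eq_bigr => s _; rewrite mulr_suml.
Qed.

End Typical.

End Moments.

(** * Concentration given the cycle counts *)

Section Joint.
Variables (R : realType) (k : nat) (d : R).
Hypothesis k3 : (3 <= k)%N.
Hypothesis d0 : 0 < d.
Local Notation m n := (medges k d n).
Local Notation cyc_fam L n F := (fun j : 'I_L => @cycles 'I_n k j F).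

Definition null_lim L (a : {ffun 'I_L -> nat}) : R :=
  poisw (fun i => lambda k d i.+2) a * expR (- \sum_(i < L) lambda k d i.+2).

Definition planted_lim L (a : {ffun 'I_L -> nat}) : R :=
  poisw (fun i => lambda k d i.+2 * (1 + delta R k i.+2)) a *
  expR (- \sum_(i < L) lambda k d i.+2 * (1 + delta R k i.+2)).

Definition gfun L (a : {ffun 'I_L -> nat}) : R :=
  \prod_(i < L) ((1 + delta R k i.+2) ^+ a i * expR (- (lambda k d i.+2 * delta R k i.+2))).

Lemma planted_limE L (a : {ffun 'I_L -> nat}) : planted_lim a = gfun a * null_lim a.
Proof.
rewrite /planted_lim /null_lim /gfun /poisw !big_split /= -!sumrN.
rewrite !expR_sum -!big_split /=; apply: eq_bigr => i _.
rewrite exprMn mulrDr mulr1 opprD expRD; ring.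
Qed.

Lemma balanced_half (M : R) (sigma : forall n, {ffun 'I_n -> bool}) : 0 <= M ->
  (\forall n \near \oo, sigma n \in balanced n M) ->
  ((nclass (sigma n) true)%:R / n%:R : R) @[n --> \oo] --> (2^-1 : R).
Proof.
move=> M0 hb.
apply: (@cvgn_sub0 _ _ (fun=> 2^-1)); last exact: cvg_cst.
apply: (cvgn_le0 (v := fun n => Num.sqrt (M / 32) * Num.sqrt (8 / n%:R))); last first.
  by rewrite -[X in _ --> X](mulr0 (Num.sqrt (M / 32))); apply: cvgMr; exact: sqrt_inv_cvg0.
near=> n.
have n0 : 0 < n%:R :> R by rewrite ltr0n; near: n; exists 1%N.
have : sigma n \in balanced n M by near: n.
rewrite finset.inE imbalanceE => h.
rewrite -sqrtrM; last by rewrite divr_ge0.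
rewrite -sqrtr_sqr ler_sqrt; last by rewrite mulr_ge0 // divr_ge0.
rewrite /nclass -/(colour_class (sigma n) true).
have -> : M / 32 * (8 / n%:R) = (M * n%:R) / (2 * n%:R) ^+ 2 by field; rewrite gt_eqF.
rewrite ler_pdivlMr ?exprn_gt0 ?mulr_gt0 // -exprMn.
apply: le_trans h; rewrite le_eqVlt; apply/orP; left; apply/eqP.
move: (_%:R) (n%:R) n0 => x y y0; field; by rewrite gt_eqF.
Unshelve. all: by end_near. Qed.

Lemma balanced_neq0 (M : R) n : 4 <= M -> (0 < n)%N -> exists s, s \in balanced n M.
Proof.
move=> M4 n0; have M0 : 0 < M by apply: lt_le_trans M4.
apply/existsP; rewrite -[[exists _, _]]negbK negb_exists; apply/negP => /forallP h.
have cM := card_unbalanced M0 n0.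
have E : ~: balanced n M = [set: {ffun 'I_n -> bool}]%SET.
  by apply/setP => s; have := h s; rewrite !finset.inE => ->.
move: cM; rewrite E cardsT card_ffun card_bool card_ord natrX ler_pdivlMr // ger_pMr ?exprn_gt0 //.
by move=> h4; have := le_trans M4 h4; rewrite (ler_nat R 4 1).
Qed.

Lemma null_cvg L (a : {ffun 'I_L -> nat}) :
  pcnt R (ksets n k) (m n) (cyc_fam L n (ksets n k)) a @[n --> \oo] --> null_lim a.
Proof.
(* The counting argument shared with the planted model carries a reference colouring; any balanced
   one is picked, with a default at n = 0. *)
pose sigma n : {ffun 'I_n -> bool} := odflt [ffun => false] [pick s in balanced n (4 : R)].
have sb n : (0 < n)%N -> sigma n \in balanced n (4 : R).
  move=> n0; rewrite /sigma; case: pickP => [//|/= h].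
  by have [//|s] := @balanced_neq0 4 n _ n0; have /= -> := h s.
have hl := balanced_half (ler0n R 4) (ex_intro2 _ _ 1%N I sb).
exact: (null_poisson k3 d0 hl (a := a)).
Qed.

(** Uniformity for free: the convergence holds along every sequence of balanced colourings, in
    particular along one that picks, whenever possible, a colouring violating the bound. *)
Lemma planted_uniform L (a : {ffun 'I_L -> nat}) (M eps : R) : 4 <= M -> 0 < eps ->
  exists n0 : nat, forall n (s : {ffun 'I_n -> bool}), (n0 <= n)%N -> s \in balanced n M ->
  `|pcnt R (bichromatic k s) (m n) (cyc_fam L n (bichromatic k s)) a - planted_lim a| <= eps.
Proof.
move=> M4 eps0.
pose dist n (s : {ffun 'I_n -> bool}) : R :=
  `|pcnt R (bichromatic k s) (m n) (cyc_fam L n (bichromatic k s)) a - planted_lim a|.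
pose sigma n : {ffun 'I_n -> bool} :=
  if [pick s in balanced n M | eps < dist n s] is Some s then s
  else odflt [ffun => false] [pick s in balanced n M].
have M0 : 0 < M by apply: lt_le_trans M4.
have sb n : (0 < n)%N -> sigma n \in balanced n M.
  move=> n0; rewrite /sigma; case: pickP => [s /andP[]//|_].
  case: pickP => [//|/= h].
  by have [s] := balanced_neq0 M4 n0; have /= -> := h s.
have hl := balanced_half (ltW M0) (ex_intro2 _ _ 1%N I sb).
have := planted_poisson k3 d0 hl (a := a); rewrite -/(planted_lim a) => /cvgrPdist_le /(_ eps eps0)[n0 _ H].
exists (maxn n0 1) => n s; rewrite geq_max => /andP[nn n1] hs; rewrite leNgt; apply/negP => bad.
have := H n nn; rewrite distrC leNgt => /negP; apply.
rewrite /sigma; case: pickP => [s' /andP[_ //]|/(_ s)].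
by rewrite hs /dist bad.
Qed.

(** Given that s colours it properly, the random hypergraph is uniform on the m-subsets of the
    bichromatic edges, and by [subcounts_cycles] its cycle counts do not depend on the host. *)
Lemma joint_count L n (s : {ffun 'I_n -> bool}) (a : {ffun 'I_L -> nat}) :
  \sum_(H in msub (ksets n k) (m n) | subcounts (cyc_fam L n (ksets n k)) H == a)
     ((H \subset bichromatic k s)%:R : R) =
  planted k d s * pcnt R (bichromatic k s) (m n) (cyc_fam L n (bichromatic k s)) a.
Proof.
set bs := bichromatic k s.
have bF : (bs \subset ksets n k) by apply/fintype.subsetP => f; rewrite finset.inE => /andP[].
have -> : planted k d s * pcnt R bs (m n) (cyc_fam L n bs) a =
   #|[set H in msub bs (m n) | subcounts (cyc_fam L n bs) H == a]%SET|%:R.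
  rewrite /pcnt /unif_prob /planted card_msub mulrC.
  have [B0|B0] := eqVneq ('C(#|bs|, m n)%:R : R) 0; last by rewrite divfK.
  rewrite -/bs B0 mulr0; move/eqP: B0; rewrite pnatr_eq0 -card_msub cards_eq0 => /eqP->.
  by rewrite (_ : [set _ in _ | _]%SET = finset.set0) ?cards0 //; apply/setP => H; rewrite !finset.inE.
rewrite -sum1_card natr_sum big_mkcond [RHS]big_mkcond /=; apply: eq_bigr => H _.
have -> : (H \in [set H0 in msub bs (m n) | subcounts (cyc_fam L n bs) H0 == a]%SET) =
  (H \in msub bs (m n)) && (subcounts (cyc_fam L n bs) H == a) by rewrite finset.inE.
have [Hb|Hb] := boolP (H \subset bs); last first.
  have -> : (H \in msub bs (m n)) = false by rewrite finset.inE (negbTE Hb).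
  by case: ifP.
rewrite (subcounts_cycles _ _ Hb) (subcounts_cycles _ _ (fintype.subset_trans Hb bF)).
by rewrite !finset.inE Hb (fintype.subset_trans Hb bF); case: ifP.
Qed.


Lemma planted_lim_cvg L (a : {ffun 'I_L -> nat}) (M eps : R) : 4 <= M -> 0 < eps ->
  exists n0 : nat, forall n, (n0 <= n)%N ->
  `|\sum_(H in msub (ksets n k) (m n) | subcounts (cyc_fam L n (ksets n k)) H == a)
     count_in R k (balanced n M) H - planted_lim a * \sum_(s in balanced n M) planted k d s| <=
  eps * \sum_(s in balanced n M) planted k d s.
Proof.
move=> M4 eps0; have [n0 H0] := planted_uniform a M4 eps0; exists n0 => n nn.
rewrite /count_in exchange_big /=; under eq_bigr do rewrite joint_count.
rewrite !mulr_sumr -sumrB; apply: le_trans (ler_norm_sum _ _ _) _; apply: ler_sum => s hs.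
rewrite mulrC -mulrBl normrM [`|planted k d s|]ger0_norm ?planted_ge0 //.
by rewrite ler_wpM2r ?planted_ge0 // H0.
Qed.

End Joint.

Section BoxSums.
Variables (R : realType) (T : finType) (S : {set T}) (L K : nat) (X : T -> {ffun 'I_L -> nat}).

Lemma box_inj : injective (@box L K).
Proof.
move=> c c' h; apply/ffunP => i; apply/val_inj; have := congr1 (fun f : {ffun _} => f i) h.
by rewrite !ffunE.
Qed.

Lemma box_sum_le (F : T -> R) : (forall H, H \in S -> 0 <= F H) ->
  \sum_(c : {ffun 'I_L -> 'I_K}) \sum_(H in S | X H == box c) F H <= \sum_(H in S) F H.
Proof.
move=> F0; rewrite (exchange_big_dep (mem S)) /=; last by move=> c H _ /andP[].
apply: ler_sum => H HS; rewrite sumr_const -[leRHS]mulr1n -[leLHS]mulr_natr -[leRHS]mulr_natr.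
rewrite ler_wpM2l ?F0 // ler_nat; apply/card_le1_eqP => c c'.
by move=> /andP[_ /eqP e1] /andP[_ /eqP e2]; apply: box_inj; rewrite -e1 -e2.
Qed.

Lemma box_l2 (Y : T -> R) (g : {ffun 'I_L -> 'I_K} -> R) :
  \sum_(c : {ffun 'I_L -> 'I_K}) \sum_(H in S | X H == box c) (Y H - g c) ^+ 2 <=
  \sum_(H in S) Y H ^+ 2 - \sum_(c : {ffun 'I_L -> 'I_K})
     (2 * g c * \sum_(H in S | X H == box c) Y H - g c ^+ 2 * #|[set H in S | X H == box c]%SET|%:R).
Proof.
apply: (@le_trans _ _ (\sum_(c : {ffun 'I_L -> 'I_K}) \sum_(H in S | X H == box c) Y H ^+ 2 -
   \sum_(c : {ffun 'I_L -> 'I_K})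
     (2 * g c * \sum_(H in S | X H == box c) Y H - g c ^+ 2 * #|[set H in S | X H == box c]%SET|%:R))).
  rewrite -sumrB le_eqVlt; apply/orP; left; apply/eqP; apply: eq_bigr => c _.
  have -> : #|[set H in S | X H == box c]%SET|%:R = \sum_(H in S | X H == box c) (1 : R).
    by rewrite -sum1_card natr_sum; apply: eq_bigl => H; rewrite finset.inE.
  by rewrite !mulr_sumr -!sumrB; apply: eq_bigr => H _; ring.
by rewrite lerD2r; apply: box_sum_le => H _; exact: sqr_ge0.
Qed.

(** Cauchy-Schwarz in the form [|y| <= t / 2 + y ^ 2 / (2 * t)]. *)
Lemma box_l1 (Y : T -> R) (g : {ffun 'I_L -> 'I_K} -> R) (t B : R) : 0 < t ->
  B = #|S|%:R ->
  \sum_(c : {ffun 'I_L -> 'I_K}) \sum_(H in S | X H == box c) (Y H - g c) ^+ 2 <= t ^+ 2 * B ->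
  \sum_(c : {ffun 'I_L -> 'I_K}) \sum_(H in S | X H == box c) `|Y H - g c| <= t * B.
Proof.
move=> t0 BE H2.
have c1 : \sum_(c : {ffun 'I_L -> 'I_K}) \sum_(H in S | X H == box c) (1 : R) <= B.
  by rewrite BE -sum1_card natr_sum; exact: box_sum_le.
apply: (@le_trans _ _ (t / 2 * (\sum_(c : {ffun 'I_L -> 'I_K}) \sum_(H in S | X H == box c) 1) +
   t^-1 / 2 * (\sum_(c : {ffun 'I_L -> 'I_K}) \sum_(H in S | X H == box c) (Y H - g c) ^+ 2))).
  rewrite !mulr_sumr -big_split /=; apply: ler_sum => c _; rewrite !mulr_sumr -big_split /=.
  apply: ler_sum => H _; rewrite -[(_ - _) ^+ 2]ger0_norm ?sqr_ge0 // normrX -subr_ge0.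
  have -> : t / 2 * 1 + t^-1 / 2 * `|Y H - g c| ^+ 2 - `|Y H - g c| = t^-1 / 2 * (t - `|Y H - g c|) ^+ 2.
    by field; rewrite gt_eqF.
  by rewrite mulr_ge0 ?sqr_ge0 // divr_ge0 // invr_ge0 ltW.
have h1 : t / 2 * (\sum_(c : {ffun 'I_L -> 'I_K}) \sum_(H in S | X H == box c) 1) <= t / 2 * B.
  by rewrite ler_wpM2l // divr_ge0 // ltW.
have h2 := ler_wpM2l (_ : 0 <= t^-1 / 2) H2.
apply: le_trans (lerD h1 (h2 _)) _; first by rewrite divr_ge0 // invr_ge0 ltW.
by rewrite le_eqVlt; apply/orP; left; apply/eqP; field; rewrite gt_eqF.
Qed.

End BoxSums.

(** * The second-moment constant as a series *)

Section LogSeries.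
Variable R : realType.

Definition logpart L (x : R) := \sum_(0 <= i < L) x ^+ i.+2 / i.+2%:R.

Lemma geometric_part L (t : R) : (1 - t) * (1 + \sum_(0 <= i < L) t ^+ i.+1) = 1 - t ^+ L.+1.
Proof.
elim: L => [|L IH]; first by rewrite big_geq // expr1; ring.
by rewrite big_nat_recr //= addrA mulrDr IH [t ^+ L.+2]exprS; ring.
Qed.

(** Compare derivatives on [0, x]: the truncated geometric sum (1 - t ^ (L + 1)) / (1 - t) is at
    least (1 - x ^ (L + 1)) / (1 - t). *)
Lemma logpart_ge L (x : R) : 0 <= x < 1 -> (1 - x ^+ L.+1) * (- ln (1 - x)) <= x + logpart L x.
Proof.
move=> /andP[x0 x1]; set p := x ^+ L.+1.
pose f := (id + logpart L) - (fun t : R => ln (1 - t) * (p - 1)).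
have fE t : f t = t + logpart L t - ln (1 - t) * (p - 1) by [].
suff : f 0 <= f x.
  rewrite !fE subr0 ln1 mul0r subr0 add0r.
  have -> : logpart L 0 = 0 by rewrite /logpart big1 // => i _; rewrite exprS !mul0r.
  by rewrite subr_ge0 => h; apply: le_trans h; rewrite le_eqVlt; apply/orP; left; apply/eqP; ring.
pose df (t : R) := 1 + \sum_(0 <= i < L) t ^+ i.+1 - (- (1 - t)^-1) * (p - 1).
have := @deriv_nondecr R f df x x0; apply=> t /andP[t0 tx].
  have t1 : t < 1 by apply: le_lt_trans x1.
  apply: is_deriveB; last by apply: is_derive_scale; exact: is_derive_ln1B.
  apply: is_deriveD.
  apply: (is_derive_bigsum _ (F := fun i y => y ^+ i.+2 / i.+2%:R) (dF := fun i y => y ^+ i.+1)) => i.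
  have := is_derive_scale i.+2%:R^-1 (is_derive_pow t i.+1).
  by rewrite mulrAC mulfV ?mul1r // pnatr_eq0.
have t1 : 0 < 1 - t by rewrite subr_gt0; apply: le_lt_trans x1.
have tp : t ^+ L.+1 <= p by apply: lerXn2r.
have g := geometric_part L t.
rewrite /df subr_ge0 -(ler_pM2l t1) g mulrA mulrN mulfV ?gt_eqF // mulN1r opprB.
by rewrite lerD2l lerN2.
Qed.

Lemma Cinf_expR (x : R) : x < 1 -> Cinf x = expR ((- ln (1 - x) - x) / 2).
Proof.
move=> x1; have y0 : 0 < 1 - x by rewrite subr_gt0.
rewrite /Cinf (_ : Num.sqrt (1 - x) = expR (ln (1 - x) / 2)).
  by rewrite -expRN -expRD; congr expR; field.
apply: (@pexpIrn _ 2) => //; rewrite ?nnegrE ?sqrtr_ge0 ?expR_ge0 //.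
rewrite sqr_sqrtr ?(ltW y0) // -expRM_natr (_ : ln (1 - x) / 2 * 2 = ln (1 - x)); last by field.
by rewrite lnK.
Qed.

Lemma Cinf_le_logpart (x eta : R) : 0 <= x < 1 -> 0 < eta -> exists L0 : nat, forall L, (L0 <= L)%N ->
  Cinf x - eta <= expR (logpart L x / 2).
Proof.
move=> hx eta0; have /andP[x0 x1] := hx; rewrite Cinf_expR //.
set C := expR _; have C0 : 0 < C by exact: expR_gt0.
have l0 : 0 <= - ln (1 - x) by rewrite oppr_ge0 ln_le0 // gerBl.
have hl : (x ^+ n.+1 : R) @[n --> \oo] --> 0.
  have h : (x ^+ n : R) @[n --> \oo] --> 0 by apply: cvg_expr; rewrite ger0_norm.
  by rewrite -(mulr0 x); under eq_fun do rewrite exprS; apply: cvgMr.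
have e0 : 0 < eta / (C * (- ln (1 - x) / 2) + 1).
  by rewrite divr_gt0 // ltr_wpDl // mulr_ge0 ?(ltW C0) // divr_ge0.
have [L0 _ H] := @cvgr_le _ _ _ _ _ _ hl _ e0.
exists L0 => L LL; have /= h := H L LL.
apply: (@le_trans _ _ (C * (1 - x ^+ L.+1 * (- ln (1 - x) / 2)))).
  rewrite mulrBr mulr1 lerD2l lerN2 mulrCA.
  apply: (@le_trans _ _ (eta / (C * (- ln (1 - x) / 2) + 1) * (C * (- ln (1 - x) / 2)))).
    by rewrite ler_wpM2r // mulr_ge0 ?(ltW C0) // divr_ge0.
  have D0 : 0 < C * (- ln (1 - x) / 2) + 1 by rewrite ltr_wpDl // mulr_ge0 ?(ltW C0) // divr_ge0.
  by rewrite mulrAC ler_pdivrMr // ler_pM2l // lerDl.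
apply: (@le_trans _ _ (C * expR (- (x ^+ L.+1 * (- ln (1 - x) / 2))))).
  by rewrite ler_wpM2l ?(ltW C0) //; apply: expR_ge1Dx.
rewrite /C -expRD ler_expR.
by have := logpart_ge L hx; lra.
Qed.

End LogSeries.

(** * L1 approximation by the cycle functional *)

Section Capture.
Variables (R : realType) (k : nat) (d : R).
Hypothesis k3 : (3 <= k)%N.
Hypothesis d0 : 0 < d.
Hypothesis dk : d / k%:R <= 2 ^+ (k - 1) * ln 2 - 2.

Lemma lambda_delta_sqr l : lambda k d l * delta R k l ^+ 2 = xval k d ^+ l / l%:R / 2.
Proof.
rewrite /lambda /delta /xval /theta expr_div_n sqrr_sign div1r.
rewrite exprVn [in RHS]exprMn exprVn -[in RHS]exprM mulnC exprM invfM; ring.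
Qed.

Lemma xval_bounds : 0 <= xval k d < 1.
Proof.
have [kp _ [_ x1]] := entropy_gap k3 d0 dk; rewrite x1 andbT /xval.
rewrite mulr_ge0 ?sqr_ge0 // mulr_ge0 ?(ltW d0) // subr_ge0 ler1n; exact: ltn_trans k3.
Qed.

(** Squaring g tilts the Poisson rates from lambda to lambda (1 + delta) ^ 2, so the total over all
    counts is exp (sum lambda delta ^ 2), the same series as in [Cinf]. *)
Lemma gfun_sqr_null L (a : {ffun 'I_L -> nat}) : gfun k d a ^+ 2 * null_lim k d a =
  poisw (fun i => lambda k d i.+2 * (1 + delta R k i.+2) ^+ 2) a *
  expR (- \sum_(i < L) (lambda k d i.+2 + 2 * (lambda k d i.+2 * delta R k i.+2))).
Proof.
rewrite /null_lim /gfun /poisw -prodrXl -!sumrN !expR_sum -!big_split /=; apply: eq_bigr => i _.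
move: (lambda k d i.+2) (delta R k i.+2) (a i) => la de j.
rewrite [in LHS]exprMn [in RHS]exprMn -[in RHS]exprM [(2 * j)%N]mulnC exprM opprD expRD.
rewrite (_ : - (2 * (la * de)) = - (la * de) * 2%:R); last by ring.
by rewrite expRM_natr; ring.
Qed.

(** First L is taken large for the series, then K for the box. The free lower bound [L0] on L is
    needed later, to make the tail of W small for the same L. *)
Lemma box_capture (eta : R) (L0 : nat) : 0 < eta -> exists L K : nat, [/\ (L0 <= L)%N,
  Cinf (xval k d) - eta <= \sum_(c : {ffun 'I_L -> 'I_K}) gfun k d (box c) ^+ 2 * null_lim k d (box c) &
  1 - eta <= \sum_(c : {ffun 'I_L -> 'I_K}) null_lim k d (box c)].
Proof.
move=> eta0; have e2 : 0 < eta / 2 by rewrite divr_gt0.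
have [L1 H1] := Cinf_le_logpart xval_bounds e2.
pose L := maxn L0 L1; exists L.
have h1 : (\sum_(c : {ffun 'I_L -> 'I_K}) null_lim k d (box c)) @[K --> \oo] --> (1 : R).
  under eq_fun do rewrite /null_lim -mulr_suml.
  have E : expR (\sum_(i < L) lambda k d i.+2) * expR (- \sum_(i < L) lambda k d i.+2) = 1.
    by rewrite -expRD subrr expR0.
  have h : (\sum_(c : {ffun 'I_L -> 'I_K}) poisw (fun i => lambda k d i.+2) (box c)) *
      expR (- \sum_(i < L) lambda k d i.+2) @[K --> \oo] -->
      expR (\sum_(i < L) lambda k d i.+2) * expR (- \sum_(i < L) lambda k d i.+2).
    by apply: cvgMl; exact: sum_poisw_cvg.
  by rewrite E in h.
have h2 : (\sum_(c : {ffun 'I_L -> 'I_K}) gfun k d (box c) ^+ 2 * null_lim k d (box c)) @[K --> \oo] -->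
   expR (logpart L (xval k d) / 2).
  under eq_fun => K do under eq_bigr do rewrite gfun_sqr_null.
  under eq_fun do rewrite -mulr_suml.
  rewrite (_ : logpart L (xval k d) / 2 = \sum_(i < L) lambda k d i.+2 * (1 + delta R k i.+2) ^+ 2 -
     \sum_(i < L) (lambda k d i.+2 + 2 * (lambda k d i.+2 * delta R k i.+2))); last first.
    rewrite /logpart big_mkord mulr_suml -sumrB; apply: eq_bigr => i _.
    by rewrite -lambda_delta_sqr; ring.
  rewrite expRD; apply: cvgMl; exact: sum_poisw_cvg.
have g1 := @cvgr_ge _ _ _ _ _ _ h1 (1 - eta) ltac:(by rewrite gtrBl).
have g2 := @cvgr_ge _ _ _ _ _ _ h2 (expR (logpart L (xval k d) / 2) - eta / 2) ltac:(by rewrite gtrBl).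
have [K [k1 k2]] := filter_ex (filterI (g1 _) (g2 _)).
exists K; split; [exact: leq_maxl| |exact: k1].
apply: le_trans k2; have := H1 L (leq_maxr _ _); clear -e2; lra.
Qed.


Local Notation m n := (medges k d n).
Local Notation Hs n := (msub (ksets n k) (m n)).
Local Notation XX L n := (subcounts (fun j : 'I_L => @cycles 'I_n k j (ksets n k))).

Lemma gfun_ge0 L (a : {ffun 'I_L -> nat}) : 0 <= gfun k d a.
Proof.
by apply: prodr_ge0 => i _; rewrite mulr_ge0 ?expR_ge0 // exprn_ge0 //; exact: (delta_ge k3 d0).
Qed.

Lemma planted_sum_gt0 : exists n0 : nat, forall n (M : R), (n0 <= n)%N -> 4 <= M ->
  0 < #|Hs n|%:R :> R /\ 0 < \sum_(s in balanced n M) planted k d s.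
Proof.
have [C [n0 [_ _ H]]] := unbalanced_planted k3 d0; exists n0.+1 => n M nn M4.
have n1 : (0 < n)%N by apply: leq_ltn_trans nn.
have [s sb] := @balanced_neq0 R 4 n (lexx _) n1.
have ms := H n s (ltnW nn) sb.
have sM : s \in balanced n M.
  move: sb; rewrite !finset.inE => h; apply: (le_trans h).
  by rewrite ler_wpM2r.
split.
  rewrite card_msub ltr0n bin_gt0 (leq_trans ms) // subset_leq_card //.
  by apply/fintype.subsetP => f; rewrite finset.inE => /andP[].
apply: lt_le_trans (_ : planted k d s <= _); first by rewrite /planted ltr0n bin_gt0.
rewrite (bigD1 s) //= lerDl; apply: sumr_ge0 => t _; exact: planted_ge0.
Qed.

Lemma box_near (L K : nat) (Q : {ffun 'I_L -> 'I_K} -> nat -> Prop) :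
  (forall c, exists n0 : nat, forall n, (n0 <= n)%N -> Q c n) ->
  exists n0 : nat, forall n, (n0 <= n)%N -> forall c, Q c n.
Proof.
move=> /choice[f hf]; exists (\max_c f c) => n nn c; apply: hf; apply: leq_trans nn.
exact: leq_bigmax.
Qed.

(** Pythagoras: with Y the count normalised to mean 1, E (Y - g) ^ 2 on the box is at most E Y ^ 2 -
    2 E (g Y) + E g ^ 2, where the last two are restricted to the box. The cross term tends to twice
    the box sum of g ^ 2 and E g ^ 2 to that sum, so only the part of [Cinf] missed by the box
    remains. *)
Lemma typical_l2 (M eta : R) (L K : nat) : 4 <= M -> 0 < eta ->
  exists n0 : nat, forall n (B E : R), (n0 <= n)%N -> B = #|Hs n|%:R ->
  E = \sum_(s in balanced n M) planted k d s ->
  \sum_(c : {ffun 'I_L -> 'I_K}) \sum_(H in Hs n | XX L n H == box c)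
     (count_in R k (balanced n M) H * (B / E) - gfun k d (box c)) ^+ 2 <=
  (Cinf (xval k d) - \sum_(c : {ffun 'I_L -> 'I_K}) gfun k d (box c) ^+ 2 * null_lim k d (box c) + eta) * B.
Proof.
move=> M4 eta0; have M0 : 0 <= M by apply: le_trans M4.
have e2 : 0 < eta / 2 by rewrite divr_gt0.
pose SC := \sum_(c : {ffun 'I_L -> 'I_K}) (2 * gfun k d (box c) + gfun k d (box c) ^+ 2).
have SC0 : 0 <= SC.
  by apply: sumr_ge0 => c _; rewrite addr_ge0 ?sqr_ge0 // mulr_ge0 // gfun_ge0.
(* [SC] bounds the total effect of an error eps in every cell, so all cells together cost at most
   eta / 2. *)
pose eps := eta / 2 / (SC + 1).
have eps0 : 0 < eps by rewrite divr_gt0 // ltr_wpDl.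
have [n1 H1] := balanced_second_moment k3 d0 dk M0 e2.
have [n2 H2] := @box_near L K _ (fun c => planted_lim_cvg k3 d0 (box c) M4 eps0).
have [n3 H3] : exists n0 : nat, forall n, (n0 <= n)%N -> forall c : {ffun 'I_L -> 'I_K},
   pcnt R (ksets n k) (m n) (fun j : 'I_L => cycles k j (ksets n k)) (box c) <= null_lim k d (box c) + eps.
  apply: box_near => c; have := null_cvg k3 d0 (a := box c) => /cvgr_le /(_ (null_lim k d (box c) + eps)).
  by rewrite ltrDl => /(_ eps0)[n0 _ h]; exists n0 => n nn; exact: h.
have [n4 H4] := planted_sum_gt0.
exists (maxn (maxn n1 n2) (maxn n3 n4)) => n B E.
rewrite !geq_max => /andP[/andP[nn1 nn2] /andP[nn3 nn4]] BE EE.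
have [B0 E0] := H4 n M nn4 M4; rewrite -BE in B0; rewrite -EE in E0.
have BE0 : 0 < B / E by rewrite divr_gt0.
apply: (le_trans (box_l2 _ _ _ _)).
have s1 : \sum_(H in Hs n) (count_in R k (balanced n M) H * (B / E)) ^+ 2 <= (Cinf (xval k d) + eta / 2) * B.
  have := H1 n nn1; rewrite -EE -BE => h.
  under eq_bigr do rewrite exprMn; rewrite -mulr_suml -ler_pdivlMr ?exprn_gt0 //.
  rewrite -(ler_pM2l B0); apply: (le_trans h); rewrite le_eqVlt; apply/orP; left; apply/eqP.
  by clear -B0 E0; field; rewrite !gt_eqF.
have s2 (c : {ffun 'I_L -> 'I_K}) : (2 * (gfun k d (box c) ^+ 2 * null_lim k d (box c)) - gfun k d (box c) ^+ 2 * null_lim k d (box c)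
      - eps * (2 * gfun k d (box c) + gfun k d (box c) ^+ 2)) * B <=
   2 * gfun k d (box c) * \sum_(H in Hs n | XX L n H == box c) (count_in R k (balanced n M) H * (B / E)) -
   gfun k d (box c) ^+ 2 * #|[set H in Hs n | XX L n H == box c]%SET|%:R.
  have g0 : 0 <= gfun k d (box c) := gfun_ge0 (box c).
  have := H2 n nn2 c; rewrite -EE planted_limE ler_norml lerBrDr => /andP[h1 _].
  have := H3 n nn3 c; rewrite /pcnt /unif_prob -BE ler_pdivrMr // => h2.
  move: g0 h1 h2; rewrite -mulr_suml.
  set g := gfun k d _; set nl := null_lim _ _ _; set S := \sum_(_ in _ | _) _; set N := #|_|%:R => g0 h1 h2.
  have h3 : (g * nl - eps) * B <= S * (B / E).
    have := ler_wpM2r (ltW BE0) h1; apply: le_trans; rewrite le_eqVlt; apply/orP; left; apply/eqP.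
    by clear -E0; field; rewrite gt_eqF.
  have h4 := ler_wpM2l g0 h3.
  have h5 := ler_wpM2l (sqr_ge0 g) h2.
  clear -h4 h5; lra.
have s3 : (\sum_(c : {ffun 'I_L -> 'I_K}) gfun k d (box c) ^+ 2 * null_lim k d (box c) - eta / 2) * B <=
   \sum_(c : {ffun 'I_L -> 'I_K}) (2 * gfun k d (box c) * \sum_(H in Hs n | XX L n H == box c) (count_in R k (balanced n M) H * (B / E)) -
   gfun k d (box c) ^+ 2 * #|[set H in Hs n | XX L n H == box c]%SET|%:R).
  apply: le_trans (ler_sum _ (fun c _ => s2 c)); rewrite -mulr_suml ler_wpM2r ?(ltW B0) //.
  rewrite !sumrB -!mulr_sumr -/SC.
  have : eps * SC <= eta / 2.
    by rewrite /eps mulrAC ler_pdivrMr ?ltr_wpDl // ler_pM2l // lerDl.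
  clear; lra.
clear -s1 s3; lra.
Qed.


Definition colourings n (H : {set {set 'I_n}}) : R := count_in R k [set: {ffun 'I_n -> bool}]%SET H.

Definition planted_total n : R := \sum_(s : {ffun 'I_n -> bool}) planted k d s.

(** Dropping the unbalanced colourings removes mass t, and renormalising the others to mean 1 adds
    back the same amount. *)
Lemma truncation_error (M t : R) n (B : R) : 0 < M -> 0 <= t <= 1 ->
  B = #|Hs n|%:R ->
  0 < \sum_(s in balanced n M) planted k d s ->
  \sum_(s in (~: balanced n M)%SET) planted k d s <= t * planted_total n ->
  \sum_(H in Hs n) `|colourings H * (B / planted_total n) -
     count_in R k (balanced n M) H * (B / \sum_(s in balanced n M) planted k d s)| <= 2 * t * B.
Proof.
move=> M0 /andP[t0 t1] BE; set E := \sum_(s in balanced n M) _; set D := \sum_(s in ~: _) _ => E0 hD.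
have B0 : 0 <= B by rewrite BE.
have D0 : 0 <= D by apply: sumr_ge0 => s _; exact: planted_ge0.
have TE : planted_total n = E + D.
  rewrite /planted_total (bigID (mem (balanced n M))) /=; congr (_ + _).
  by apply: eq_bigl => s; rewrite finset.in_setC.
have T0 : 0 < planted_total n by rewrite TE ltr_pwDl.
pose Y H := count_in R k (balanced n M) H; pose Y' H := count_in R k (~: balanced n M)%SET H.
have YE H : colourings H = Y H + Y' H.
  rewrite /colourings /Y /Y' /count_in (bigID (mem (balanced n M))) /=; congr (_ + _).
    by apply: eq_bigl => s; rewrite finset.in_setT.
  by apply: eq_bigl => s; rewrite finset.in_setC finset.in_setT.
have Y0 H : 0 <= Y H by apply: sumr_ge0.
have Y'0 H : 0 <= Y' H by apply: sumr_ge0.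
have le1 : B / planted_total n <= B / E.
  by rewrite ler_wpM2l // lef_pV2 ?posrE // TE lerDl.
apply: (@le_trans _ _ (\sum_(H in Hs n) (Y' H * (B / planted_total n) + Y H * (B / E - B / planted_total n)))).
  apply: ler_sum => H _; rewrite YE mulrDl addrAC addrC.
  apply: (le_trans (ler_normD _ _)); apply: lerD.
    by rewrite ger0_norm // mulr_ge0 // divr_ge0 // ltW.
  rewrite -mulrBr normrM ger0_norm // distrC ger0_norm // subr_ge0 //.
rewrite big_split /= -!mulr_suml !(sum_count_in k d) -/E -/D.
have e1 : E * (B / E - B / planted_total n) = D * (B / planted_total n).
  by rewrite TE; field; rewrite -TE !gt_eqF.
rewrite e1.
have : D * (B / planted_total n) <= t * planted_total n * (B / planted_total n) by rewrite ler_wpM2r // divr_ge0 // ltW.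
rewrite (_ : t * planted_total n * (B / planted_total n) = t * B); last by field; rewrite gt_eqF.
clear; lra.
Qed.

Lemma concentration (eta : R) (L0 : nat) : 0 < eta -> exists L K n0 : nat, [/\ (L0 <= L)%N,
  1 - eta <= \sum_(c : {ffun 'I_L -> 'I_K}) null_lim k d (box c) &
  forall n (B : R), (n0 <= n)%N -> B = #|Hs n|%:R -> [/\ 0 < B, 0 < planted_total n &
  \sum_(c : {ffun 'I_L -> 'I_K}) \sum_(H in Hs n | XX L n H == box c)
    `|colourings H * (B / planted_total n) - gfun k d (box c)| <= eta * B]].
Proof.
move=> eta0; pose t := Num.min 1 (eta / 4).
have t0 : 0 < t by rewrite lt_min ltr01 divr_gt0.
have t1 : t <= 1 by rewrite ge_min lexx.
have t4 : t <= eta / 4 by rewrite ge_min lexx orbT.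
have [C [n1 [C0 HC _]]] := unbalanced_planted k3 d0.
(* Large enough that at most a proportion t of the first moment is unbalanced. The total error is 2
   t from truncation and t from the L2 bound. *)
pose M := 4 + C / t; have Ct : 0 <= C / t by rewrite divr_ge0 // ltW.
have M4 : 4 <= M by rewrite lerDl.
have M0 : 0 < M by apply: lt_le_trans M4.
have CM : C / M <= t by rewrite ler_pdivrMr // /M mulrDr mulrCA mulfV ?gt_eqF // mulr1 lerDr mulr_ge0 // ltW.
have tt : 0 < t ^+ 2 / 2 by rewrite divr_gt0 // exprn_gt0.
have ett : 0 < Num.min eta (t ^+ 2 / 2) by rewrite lt_min eta0 tt.
have [L [K [LL cap1 cap2]]] := box_capture L0 ett.
have [n2 H2] := typical_l2 L K M4 tt; have [n3 H3] := planted_sum_gt0.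
exists L, K, (maxn n1 (maxn n2 n3)); split => //.
  by apply: le_trans cap2; rewrite lerD2l lerN2 ge_min lexx.
move=> n B; rewrite !geq_max => /andP[nn1 /andP[nn2 nn3]] BE.
have [B0 E0] := H3 n M nn3 M4; rewrite -BE in B0.
have T0 : 0 < planted_total n.
  apply: (lt_le_trans E0); rewrite /planted_total [leRHS](bigID (mem (balanced n M))) /= lerDl.
  by apply: sumr_ge0 => s _; exact: planted_ge0.
split => //.
have hD : \sum_(s in (~: balanced n M)%SET) planted k d s <= t * planted_total n.
  by apply: (le_trans (HC n M nn1 M0)); rewrite ler_wpM2r // ltW.
have tr := truncation_error M0 (introT andP (conj (ltW t0) t1)) BE E0 hD.
set E := \sum_(s in balanced n M) _ in E0 tr.
have l2 := H2 n B E nn2 BE erefl.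
have {}l2 : \sum_(c : {ffun 'I_L -> 'I_K}) \sum_(H in Hs n | XX L n H == box c)
     (count_in R k (balanced n M) H * (B / E) - gfun k d (box c)) ^+ 2 <= t ^+ 2 * B.
  apply: (le_trans l2); rewrite ler_wpM2r ?(ltW B0) //.
  have : Num.min eta (t ^+ 2 / 2) <= t ^+ 2 / 2 by rewrite ge_min lexx orbT.
  clear -cap1; lra.
have l1 := box_l1 t0 BE l2.
apply: (@le_trans _ _ (\sum_(c : {ffun 'I_L -> 'I_K}) \sum_(H in Hs n | XX L n H == box c)
    (`|colourings H * (B / planted_total n) - count_in R k (balanced n M) H * (B / E)| +
     `|count_in R k (balanced n M) H * (B / E) - gfun k d (box c)|))).
  apply: ler_sum => c _; apply: ler_sum => H _.
  by apply: le_trans (ler_normD _ _); rewrite addrA subrK.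
under eq_bigr do rewrite big_split /=; rewrite big_split /=.
have tr' : \sum_(c : {ffun 'I_L -> 'I_K}) \sum_(H in Hs n | XX L n H == box c)
    `|colourings H * (B / planted_total n) - count_in R k (balanced n M) H * (B / E)| <= 2 * t * B.
  by apply: le_trans tr; apply: box_sum_le.
have h : 3 * t * B <= eta * B.
  rewrite ler_wpM2r ?(ltW B0) //; clear -t4 eta0; lra.
apply: le_trans (lerD tr' l1) _; clear -h; lra.
Qed.

End Capture.

(** * The limit variable *)

Section AbsSeries.
Variables (R : realType) (disp : measure_display) (T : measurableType disp) (P : probability T R).
Variables (u v : nat -> T -> R) (c rho : R).
Hypothesis mu : forall l, measurable_fun setT (u l).
Hypothesis mv : forall l, measurable_fun setT (v l).
Hypothesis uv : forall l w, `|u l w| <= v l w.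
Hypothesis c0 : 0 <= c.
Hypothesis rho01 : 0 <= rho < 1.
Hypothesis iv : forall l, (\int[P]_w (v l w)%:E <= (c * rho ^+ l)%:E)%E.

Let S N w : R := \sum_(0 <= l < N) u l w.

(** Tails of the dominating series, in the extended reals so that the bounds below make sense also
    where it diverges. *)
Definition vtail N w : \bar R := (\sum_(0 <= i <oo) (v (i + N)%N w)%:E)%E.

Definition usum w : R := limn (S^~ w).

Let v0 l w : 0 <= v l w. Proof. by apply: le_trans (uv l w). Qed.

Lemma vtail_ge0 N w : (0 <= vtail N w)%E.
Proof. by apply: nneseries_ge0 => i _ _; rewrite lee_fin. Qed.

Lemma measurable_vtail N : measurable_fun setT (vtail N).
Proof.
apply: (ge0_emeasurable_sum (P := xpredT) (h := fun i w => (v (i + N)%N w)%:E)) => [i w _ _|i _].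
  by rewrite lee_fin.
exact/measurable_EFinP.
Qed.

Lemma int_vtail N : (\int[P]_w vtail N w <= (c * rho ^+ N / (1 - rho))%:E)%E.
Proof.
have /andP[r0 r1] := rho01; have r1' : 0 < 1 - rho by rewrite subr_gt0.
rewrite integral_nneseries //; last first.
- by move=> i w _; rewrite lee_fin.
- by move=> i; exact/measurable_EFinP.
apply: lime_le; first by apply: is_cvg_nneseries => i _ _; apply: integral_ge0 => w _; rewrite lee_fin.
apply: nearW => n; apply: (@le_trans _ _ (\sum_(0 <= i < n) (c * rho ^+ (i + N))%:E)%E).
  by apply: lee_sum => i _; exact: iv.
rewrite sumEFin lee_fin ler_pdivlMr //.
have -> : (\sum_(0 <= i < n) c * rho ^+ (i + N)) * (1 - rho) = c * rho ^+ N * (1 - rho ^+ n).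
  elim: n => [|n IH]; first by rewrite big_geq // expr0; ring.
  by rewrite big_nat_recr //= mulrDl IH exprD exprS; ring.
by rewrite ler_piMr ?mulr_ge0 ?exprn_ge0 // gerBl exprn_ge0.
Qed.

Lemma partial_le_vtail N n w : (N <= n)%N -> (`|S n w - S N w|%:E <= vtail N w)%E.
Proof.
move=> Nn; have -> : S n w - S N w = \sum_(0 <= i < n - N) u (i + N)%N w.
  rewrite /S (big_cat_nat (n := N)) //= addrAC subrr add0r.
  by rewrite -{1}[N]add0n big_addn.
apply: (@le_trans _ _ (\sum_(0 <= i < n - N) (v (i + N)%N w)%:E)%E).
  rewrite sumEFin lee_fin; apply: (le_trans (ler_norm_sum _ _ _)).
  by apply: ler_sum => i _; exact: uv.
by apply: nneseries_lim_ge => i _ _; rewrite lee_fin.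
Qed.

Lemma cvg_usum w : (vtail 0 w < +oo)%E -> cvgn (S^~ w).
Proof.
move=> h; have fin : vtail 0 w \is a fin_num by rewrite ge0_fin_numE // vtail_ge0.
apply: normed_cvg; apply: nondecreasing_is_cvgn.
  by apply: nondecreasing_series => n _ _; exact: normr_ge0.
exists (fine (vtail 0 w)) => _ [n _ <-].
rewrite /series /= -lee_fin fineK // -sumEFin.
apply: (@le_trans _ _ (\sum_(0 <= i < n) (v (i + 0)%N w)%:E)%E).
  by apply: lee_sum => i _; rewrite lee_fin addn0.
by apply: nneseries_lim_ge => i _ _; rewrite lee_fin.
Qed.

Lemma vtail0E N w : vtail 0 w = ((\sum_(0 <= i < N) v i w)%:E + vtail N w)%E.
Proof.
rewrite /vtail (nneseries_addn (f := fun i => (v i w)%:E) N) => [|i]; last by rewrite lee_fin.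
rewrite (nneseries_addn (f := fun i => (v i w)%:E) 0) => [|i]; last by rewrite lee_fin.
rewrite [LHS](nneseries_split 0 N) => [|i _]; last by rewrite lee_fin.
by rewrite add0n sumEFin.
Qed.

Lemma vtail_le N w : (vtail N w <= vtail 0 w)%E.
Proof. by rewrite (vtail0E N) leeDr // lee_fin sumr_ge0. Qed.

Lemma usum_near N w : (vtail 0 w < +oo)%E -> (`|usum w - S N w|%:E <= vtail N w)%E.
Proof.
move=> h; have fin : vtail N w \is a fin_num.
  by rewrite ge0_fin_numE ?vtail_ge0 // (le_lt_trans (vtail_le N w)).
rewrite -(fineK fin) lee_fin.
have hc := cvg_usum h.
have hl : (`|S n w - S N w| : R) @[n --> \oo] --> `|usum w - S N w|.
  by apply: cvg_norm; apply: cvgB; [exact: hc|exact: cvg_cst].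
rewrite -(cvg_lim _ hl) //; apply: limr_le; first by apply/cvg_ex; exists `|usum w - S N w|.
near=> n; rewrite -lee_fin fineK //; apply: partial_le_vtail; near: n; exact: nbhs_infty_ge.
Unshelve. all: by end_near. Qed.

Lemma usum_le w : (`|usum w|%:E <= vtail 0 w)%E.
Proof.
have [h|] := ltP (vtail 0 w) +oo%E; last by rewrite leye_eq => /eqP->; rewrite leey.
by have := usum_near 0 h; rewrite /S big_geq // subr0.
Qed.

(** The limit takes a default value off the convergence set, so measurability of a pointwise limit
    does not apply directly. The convergence set is described by equal and finite upper and lower
    limits, which are measurable, and the cases are glued. *)
Lemma measurable_usum : measurable_fun setT usum.
Proof.
have mS N : measurable_fun setT (S N) by apply: measurable_sum.
pose es w := limn_esup (fun N => (S N w)%:E); pose ei w := limn_einf (fun N => (S N w)%:E).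
have mes : measurable_fun setT es by apply: measurable_fun_limn_esup => N; exact/measurable_EFinP.
have mei : measurable_fun setT ei.
  rewrite (_ : ei = fun w => (- limn_esup (fun N => (- S N w)%:E))%E).
    apply: measurableT_comp => //; apply: measurable_fun_limn_esup => N; apply/measurable_EFinP.
    exact: measurable_funN.
  by apply/funext => w.
pose b w := (ei w == es w) && (es w \is a fin_num).
have mb : measurable_fun setT b.
  apply: measurable_and; first exact: measurable_fun_eqe.
  apply: (measurable_fun_bool true); rewrite setTI.
  by have := emeasurable_fin_num measurableT mes; rewrite setTI.
(* [point] is the value of [limn] on a divergent sequence. *)
have E : usum = fun w => if b w then fine (es w) else point.
  apply/funext => w; rewrite /b; case: ifP => [/andP[/eqP e1 e2]|h].
    have hc : (S n w)%:E @[n --> \oo] --> es w.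
      apply: (@squeeze_cvge _ _ _ _ (einfs (fun N => (S N w)%:E)) _ (esups (fun N => (S N w)%:E))).
      - apply: nearW => n; apply/andP; split.
          by apply: ereal_inf_lbound; exists n => /=.
        by apply: ereal_sup_ubound; exists n => /=.
      - rewrite -e1 /ei limn_einf_lim; exact: is_cvg_einfs.
      - rewrite /es limn_esup_lim; exact: is_cvg_esups.
    rewrite -(fineK e2) in hc; have /fine_cvgP[_ hc'] := hc.
    exact: (cvg_lim _ hc').
  have [hc|nc] := pselect (cvgn (S^~ w)); last by rewrite /usum dvgP.
  exfalso; move/negP: h; apply.
  have hE : (S n w)%:E @[n --> \oo] --> (usum w)%:E by apply: cvg_EFin => //; exact: nearW.
  have [e1 e2] := cvg_limn_einf_sup hE.
  by rewrite /ei /es e1 e2 eqxx.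
rewrite E; apply: measurable_fun_ifT => //.
  exact: measurableT_comp.
Qed.

Lemma integrable_usum : P.-integrable setT (EFin \o usum).
Proof.
apply/integrableP; split; first exact/measurable_EFinP/measurable_usum.
apply: (@le_lt_trans _ _ (\int[P]_w vtail 0 w)%E).
  apply: ge0_le_integral => //.
  - by apply/measurableT_comp => //; exact/measurable_EFinP/measurable_usum.
  - exact: measurable_vtail.
  - by move=> w _; exact: usum_le.
by apply: le_lt_trans (int_vtail 0) _; exact: ltry.
Qed.

Lemma vtail0_fin_ae : {ae P, forall w, (vtail 0 w < +oo)%E}.
Proof.
have iV : P.-integrable setT (vtail 0).
  apply/integrableP; split; first exact: measurable_vtail.
  under eq_integral => w _ do rewrite gee0_abs ?vtail_ge0 //.
  by apply: le_lt_trans (int_vtail 0) _; exact: ltry.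
have := integrable_ae measurableT iV; apply: filterS => w /(_ I).
by rewrite ge0_fin_numE // vtail_ge0.
Qed.

Lemma ae_cvg_usum : {ae P, forall w, cvgn (S^~ w)}.
Proof. by apply: filterS vtail0_fin_ae => w; exact: cvg_usum. Qed.

Lemma usum_tail (N : nat) (tau : R) : 0 < tau ->
  (tau%:E * P [set w | tau <= `|usum w - S N w|]%R <= (c * rho ^+ N / (1 - rho))%:E)%E.
Proof.
move=> t0; set A := [set w | _].
have mS : measurable_fun setT (S N) by apply: measurable_sum.
have mA : measurable A.
  have mf : measurable_fun setT (fun w => `|usum w - S N w|).
    apply: measurableT_comp => //; apply: measurable_funB => //; exact: measurable_usum.
  by rewrite -[A]setTI; apply: (measurable_fun_le measurableT (measurable_cst tau) mf).
apply: le_trans (int_vtail N).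
rewrite -[P A](_ : \int[P]_w (\1_A w)%:E = P A)%E; last by rewrite integral_indic // setIT.
have mI : measurable_fun setT (fun w => (\1_A w)%:E : \bar R).
  by apply/measurable_EFinP; exact: measurable_indic.
rewrite -ge0_integralZl //; last by rewrite lee_fin ltW.
apply: ge0_le_integral => //.
- by move=> w _; rewrite mule_ge0 // lee_fin // ltW.
- exact: measurable_funeM.
- exact: measurable_vtail.
move=> w _; rewrite indicE; case: (boolP (w \in A)) => [|_]; last by rewrite mule0 vtail_ge0.
rewrite inE /A /= mule1 => h.
have [fin|] := ltP (vtail 0 w) +oo%E; first by apply: le_trans (usum_near N fin); rewrite lee_fin.
(* Where the whole dominating series is infinite, so is each of its tails, and the inequality is
   trivial. *)
rewrite leye_eq => /eqP e; have := vtail0E N w; rewrite e.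
by move: (vtail_ge0 N w); case: (vtail N w) => [r||] // _; rewrite leey.
Qed.

End AbsSeries.

(** * Variance of a Poisson variable *)

Section PoissonMoment.
Variable R : realType.

Lemma poisson_pmf_gt0E (la : R) j : 0 < la ->
  poisson_pmf la j = la ^+ j / j`!%:R * expR (- la).
Proof. by move=> l0; rewrite /poisson_pmf l0. Qed.

Lemma poisson_pmfS (la : R) j : 0 < la -> j.+1%:R * poisson_pmf la j.+1 = la * poisson_pmf la j.
Proof.
move=> l0; rewrite !poisson_pmf_gt0E // factS natrM exprS; field.
by rewrite addrC natr1 !pnatr_eq0 -lt0n fact_gt0.
Qed.

Lemma sum_poisson_pmf_le1 (la : R) N : 0 < la -> \sum_(0 <= j < N) poisson_pmf la j <= 1.
Proof.
move=> l0; under eq_bigr do rewrite poisson_pmf_gt0E //.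
rewrite -mulr_suml expRN ler_pdivrMr ?expR_gt0 // mul1r.
have h : (\sum_(0 <= j < K) la ^+ j / j`!%:R) @[K --> \oo] --> expR la by exact: exp_series_cvg.
rewrite -(cvg_lim _ h) //.
apply: (nondecreasing_cvgn_le (u_ := fun K => \sum_(0 <= j < K) la ^+ j / j`!%:R)); last by apply/cvg_ex; exists (expR la).
by apply: nondecreasing_series => n _ _; rewrite divr_ge0 // exprn_ge0 // ltW.
Qed.

(** An exact formula for the truncated variance: the relation between consecutive weights
    telescopes, leaving one boundary term, which has the favourable sign as soon as N >= la. *)
Lemma sum_poisson_var (la : R) N : 0 < la ->
  \sum_(0 <= j < N) (j%:R - la) ^+ 2 * poisson_pmf la j =
  la * (\sum_(0 <= j < N) poisson_pmf la j) - (N%:R - la) * (N%:R * poisson_pmf la N).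
Proof.
move=> l0; elim: N => [|N IH]; first by rewrite !big_geq // mul0r !mulr0 subr0.
rewrite !big_nat_recr //= IH poisson_pmfS // -[N.+1%:R]natr1; ring.
Qed.

Lemma sum_poisson_var_le (la : R) N : 0 < la ->
  \sum_(0 <= j < N) (j%:R - la) ^+ 2 * poisson_pmf la j <= la.
Proof.
move=> l0; pose N' := maxn N (Num.truncn la).+1.
have laN : la <= N'%:R.
  apply: ltW; apply: lt_le_trans (archimedean.Num.Theory.truncnS_gt la) _.
  by rewrite ler_nat leq_maxr.
apply: (@le_trans _ _ (\sum_(0 <= j < N') (j%:R - la) ^+ 2 * poisson_pmf la j)).
  rewrite [leRHS](big_cat_nat (n := N)) ?leq_maxl //= lerDl.
  by apply: sumr_ge0 => j _; rewrite mulr_ge0 ?sqr_ge0 ?poisson_pmf_ge0.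
rewrite sum_poisson_var // -[leRHS]subr0; apply: lerB.
  by rewrite ler_piMr ?(ltW l0) ?sum_poisson_pmf_le1.
by rewrite mulr_ge0 ?subr_ge0 // mulr_ge0 // poisson_pmf_ge0.
Qed.

Lemma poisson_RV_var (disp : measure_display) (T : measurableType disp) (P : probability T R)
    (la : R) (X : {RV P >-> nat}) : 0 < la -> poisson_RV la X ->
  (\int[P]_w (((X w)%:R - la) ^+ 2)%:E <= la%:E)%E.
Proof.
move=> l0 hX.
pose A j := X @^-1` [set j].
have mA j : measurable (A j) by apply: measurable_funPTI.
pose F j : R := (j%:R - la) ^+ 2; have F0 j : 0 <= F j by exact: sqr_ge0.
apply: (@le_trans _ _ (\int[P]_w \sum_(0 <= j <oo) ((F j)%:E * (\1_(A j) w)%:E))%E).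
  apply: ge0_le_integral => //.
  - by move=> w _; rewrite lee_fin sqr_ge0.
  - apply/measurable_EFinP.
    have mF : measurable_fun setT F by [].
    exact: (measurableT_comp mF).
  - apply: (ge0_emeasurable_sum (P := xpredT) (h := fun j w => ((F j)%:E * (\1_(A j) w)%:E)%E)) => [j w _ _|j _].
      by rewrite mule_ge0 // lee_fin.
    apply: measurable_funeM; apply/measurable_EFinP; exact: measurable_indic.
  move=> w _; apply: le_trans (nneseries_lim_ge (X w).+1 _) => [|j _ _]; last by rewrite mule_ge0 // lee_fin.
  rewrite big_nat_recr //= indicE (_ : w \in A (X w)) ?mule1 ?leeDr //; last by rewrite inE.
  by apply: sume_ge0 => j _; rewrite mule_ge0 // lee_fin.
rewrite integral_nneseries //; last 2 first.
- move=> j; apply: measurable_funeM; apply/measurable_EFinP; exact: measurable_indic.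
- by move=> j w _; rewrite mule_ge0 // lee_fin.
apply: lime_le.
  apply: is_cvg_nneseries => j _ _; apply: integral_ge0 => w _; by rewrite mule_ge0 // lee_fin.
apply: nearW => n; rewrite (eq_bigr (fun j => ((F j) * poisson_pmf la j)%:E)); last first.
  move=> j _; rewrite ge0_integralZl //.
  - have -> : (\int[P]_x (\1_(A j) x)%:E = (poisson_pmf la j)%:E)%E.
      by rewrite integral_indic // setIT; exact: hX.
    by rewrite EFinM.
  - by apply/measurable_EFinP; exact: measurable_indic.
  - by rewrite lee_fin.
by rewrite sumEFin lee_fin; exact: sum_poisson_var_le.
Qed.

End PoissonMoment.

Section LimitVariable.
Variables (R : realType) (k : nat) (d : R).
Hypothesis k3 : (3 <= k)%N.
Hypothesis d0 : 0 < d.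
Hypothesis dk : d / k%:R <= 2 ^+ (k - 1) * ln 2 - 2.
Variables (disp : measure_display) (T : measurableType disp) (P : probability T R).
Variable X : nat -> {RV P >-> nat}.
Hypothesis hpois : forall l : nat, (2 <= l)%N -> poisson_RV (lambda k d l) (X l).

Definition Wterm l w : R := (X l.+2 w)%:R * ln (1 + delta R k l.+2) - lambda k d l.+2 * delta R k l.+2.

Definition decay : R := Num.sqrt (xval k d).

(** A dominating function with integrable square instead of absolute values: X ln (1 + delta) -
    lambda delta splits into (X - lambda) ln (1 + delta) and lambda (ln (1 + delta) - delta), and
    the product of [|X - lambda|] and [|delta|] is split by the arithmetic-geometric inequality with
    weight [decay ^ l]. As lambda delta ^ 2 = xval ^ l / (2 l), the square root [decay] makes both
    halves geometric in expectation. *)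
Definition Wdom l w : R :=
  delta R k l.+2 ^+ 2 / decay ^+ l.+2 * ((X l.+2 w)%:R - lambda k d l.+2) ^+ 2 + 2 * decay ^+ l.+2.

Lemma lambda_gt0 l : 0 < lambda k d l.+1.
Proof.
rewrite /lambda divr_gt0 // ?mulr_gt0 // exprn_gt0 // mulr_gt0 // subr_gt0 ltr1n.
exact: ltn_trans k3.
Qed.

Lemma xval_gt0 : 0 < xval k d.
Proof.
rewrite /xval mulr_gt0 ?exprn_gt0 ?theta_gt0 //; last exact: ltnW.
by rewrite mulr_gt0 // subr_gt0 ltr1n; exact: ltn_trans k3.
Qed.

Lemma decay_bounds : 0 < decay < 1.
Proof.
rewrite /decay sqrtr_gt0 xval_gt0 -[X in _ < X]sqrtr1 ltr_sqrt //.
by have /andP[] := xval_bounds k3 d0 dk.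
Qed.

Lemma delta_le l : `|delta R k l.+1| <= 1 / 3.
Proof.
have Q1 : 3 <= 2 ^+ (k - 1) - 1 :> R.
  have : 2 ^+ 2 <= 2 ^+ (k - 1) :> R by rewrite ler_eXn2l ?ltr1n //; lia.
  rewrite expr2; lra.
have Q0 : 0 < 2 ^+ (k - 1) - 1 :> R by apply: lt_le_trans Q1.
rewrite /delta normrM normrX normrN1 expr1n mul1r normfV normrX ger0_norm ?(ltW Q0) // div1r.
rewrite lef_pV2 ?posrE ?exprn_gt0 //; apply: (le_trans Q1); rewrite exprS ler_peMr ?(ltW Q0) //.
by rewrite exprn_ege1 //; apply: le_trans Q1; rewrite (ler_nat R 1 3).
Qed.

Lemma ln_bounds (x : R) : `|x| <= 1 / 3 ->
  `|ln (1 + x)| <= 3 / 2 * `|x| /\ `|ln (1 + x) - x| <= 3 / 2 * x ^+ 2.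
Proof.
rewrite ler_norml => /andP[h1 h2].
have y0 : 0 < 1 + x by lra.
have u1 : ln (1 + x) <= x by apply: le_ln1Dx; lra.
have l1 : x - x ^+ 2 * (3 / 2) <= ln (1 + x).
  have : ln (1 + x)^-1 <= (1 + x)^-1 - 1.
    have e : 1 + ((1 + x)^-1 - 1) = (1 + x)^-1 by ring.
    rewrite -[X in ln X <= _]e; apply: le_ln1Dx.
    have i0 : 0 < (1 + x)^-1 by rewrite invr_gt0.
    lra.
  rewrite lnV ?posrE // => h.
  have e : (1 + x)^-1 - 1 = - x + x ^+ 2 * (1 + x)^-1 by field; rewrite gt_eqF.
  have i : (1 + x)^-1 <= 3 / 2.
    by rewrite -[leRHS]invrK lef_pV2 ?posrE ?invr_gt0 // ?invf_div; lra.
  have := ler_wpM2l (sqr_ge0 x) i; lra.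
have xx : x ^+ 2 <= 1 / 3 * `|x|.
  rewrite -[x ^+ 2]ger0_norm ?sqr_ge0 // normrX expr2 ler_wpM2r // ler_norml; lra.
split; last by rewrite ler_norml; apply/andP; split; have := sqr_ge0 x; lra.
by rewrite ler_norml; apply/andP; split; case: (ger0P x) xx => ? ?; lra.
Qed.

Lemma Wterm_le l w : `|Wterm l w| <= Wdom l w.
Proof.
have [h1 h2] := ln_bounds (delta_le l.+1).
have /andP[r0 r1] := decay_bounds.
have ld := lambda_delta_sqr k d l.+2.
rewrite /Wdom; set s := decay ^+ l.+2; have s0 : 0 < s by rewrite exprn_gt0.
have s1 : s <= 1 by rewrite exprn_ile1 // ltW.
have xs : xval k d ^+ l.+2 = s ^+ 2.
  by rewrite /s -exprM mulnC exprM /decay sqr_sqrtr // ltW // xval_gt0.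
have ls : lambda k d l.+2 * delta R k l.+2 ^+ 2 <= s / 4.
  rewrite ld xs; apply: (@le_trans _ _ (s ^+ 2 / 2 / 2)).
    rewrite ler_pM2r ?invr_gt0 // ler_wpM2l ?sqr_ge0 // lef_pV2 ?posrE ?ltr0n // ler_nat //.
  have : s ^+ 2 <= s by rewrite expr2 ler_piMl // ltW.
  by rewrite -mulrA -invfM -natrM => h; rewrite ler_pM2r // invr_gt0.
have la := lambda_gt0 l.+1; rewrite /Wterm.
move: (lambda k d l.+2) (delta R k l.+2) (ln _) ((X l.+2 w)%:R) h1 h2 ls la => la de L x h1 h2 ls la0.
have -> : x * L - la * de = (x - la) * L + la * (L - de) by ring.
set y := x - la.
have a1 : `|y * L| <= 3 / 2 * (`|y| * `|de|) by rewrite normrM mulrCA ler_wpM2l.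
have a2 : `|la * (L - de)| <= 3 / 2 * (la * de ^+ 2).
  by rewrite normrM (ger0_norm (ltW la0)) mulrCA ler_wpM2l // ltW.
have a3 : `|y| * `|de| <= (de ^+ 2 / s * y ^+ 2 + s) / 2.
  have e : (de ^+ 2 / s * y ^+ 2 + s) / 2 - `|y| * `|de| = (`|y| * `|de| - s) ^+ 2 / s / 2.
    rewrite -[de ^+ 2]ger0_norm ?sqr_ge0 // -[y ^+ 2]ger0_norm ?sqr_ge0 // !normrX; field.
    by rewrite gt_eqF.
  by rewrite -subr_ge0 e !divr_ge0 ?sqr_ge0 // ltW.
have a4 : 0 <= de ^+ 2 / s * y ^+ 2 by rewrite mulr_ge0 ?sqr_ge0 // divr_ge0 ?sqr_ge0 // ltW.
apply: (le_trans (ler_normD _ _)); lra.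
Qed.

Lemma measurable_X l : measurable_fun setT (fun w => (X l w)%:R : R).
Proof.
have mF : measurable_fun setT (fun j : nat => j%:R : R) by [].
exact: (measurableT_comp mF).
Qed.

Lemma measurable_Wterm l : measurable_fun setT (Wterm l).
Proof.
apply: measurable_funB => //; apply: measurable_funM => //; exact: measurable_X.
Qed.

Lemma measurable_Wdom l : measurable_fun setT (Wdom l).
Proof.
apply: measurable_funD => //; apply: measurable_funM => //.
by apply: measurable_funX; apply: measurable_funB => //; exact: measurable_X.
Qed.

Lemma int_Wdom l : (\int[P]_w (Wdom l w)%:E <= (3 * decay ^+ l)%:E)%E.
Proof.
have /andP[r0 r1] := decay_bounds.
have ld := lambda_delta_sqr k d l.+2.
have hv := poisson_RV_var (lambda_gt0 l.+1) (hpois (isT : (2 <= l.+2)%N)).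
rewrite /Wdom; set s := decay ^+ l.+2; have s0 : 0 < s by rewrite exprn_gt0.
have s1 : s <= decay ^+ l by rewrite /s -addn2 exprD ler_piMr ?exprn_ge0 ?exprn_ile1 // ltW.
have xs : xval k d ^+ l.+2 = s ^+ 2.
  by rewrite /s -exprM mulnC exprM /decay sqr_sqrtr // ltW // xval_gt0.
have c0 : 0 <= delta R k l.+2 ^+ 2 / s by rewrite divr_ge0 ?sqr_ge0 // ltW.
under eq_integral do rewrite EFinD EFinM.
rewrite ge0_integralD //; last 3 first.
- by move=> w _; rewrite mule_ge0 // lee_fin // sqr_ge0.
- apply: measurable_funeM; apply/measurable_EFinP.
  by apply: measurable_funX; apply: measurable_funB => //; exact: measurable_X.
- by move=> w _; rewrite lee_fin mulr_ge0 // ltW.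
rewrite ge0_integralZl //; last 2 first.
- apply/measurable_EFinP.
  by apply: measurable_funX; apply: measurable_funB => //; exact: measurable_X.
- by move=> w _; rewrite lee_fin sqr_ge0.
have -> : (\int[P]__ (2 * s)%:E = (2 * s)%:E)%E.
  transitivity ((2 * s)%:E * P setT)%E; first exact: integral_cst.
  by rewrite probability_setT mule1.
apply: (@le_trans _ _ ((delta R k l.+2 ^+ 2 / s)%:E * (lambda k d l.+2)%:E + (2 * s)%:E)%E).
  by apply: leeD => //; apply: lee_wpmul2l => //; rewrite lee_fin.
rewrite -EFinM -EFinD lee_fin.
have -> : delta R k l.+2 ^+ 2 / s * lambda k d l.+2 = xval k d ^+ l.+2 / l.+2%:R / 2 / s.
  by rewrite -ld; field; rewrite gt_eqF.
rewrite xs (_ : s ^+ 2 / l.+2%:R / 2 / s = s * (l.+2%:R^-1 / 2)); last first.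
  have p0 : l.+2%:R != 0 :> R by rewrite pnatr_eq0.
  by move: (l.+2%:R) p0 => p p0; field; rewrite p0 gt_eqF.
have : s * (l.+2%:R^-1 / 2) <= s.
  rewrite ler_piMr ?(ltW s0) // -invfM invf_le1 ?mulr_gt0 ?ltr0n // -natrM ler1n //.
move=> h; apply: (le_trans (lerD h (lexx _))).
have -> : 3 * decay ^+ l = decay ^+ l + 2 * decay ^+ l by ring.
by rewrite lerD // ler_pM2l.
Qed.


Lemma W_partialE N w : W_partial k d X N.+2 w = \sum_(0 <= l < N) Wterm l w.
Proof. by rewrite /W_partial 2!big_add1. Qed.

Lemma W_partial_cvg w (l : R) : (W_partial k d X N w @[N --> \oo] --> l) =
  ((\sum_(0 <= i < N) Wterm i w) @[N --> \oo] --> l).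
Proof.
have E : (fun N => W_partial k d X (N + 2)%N w) = (fun N => \sum_(0 <= i < N) Wterm i w).
  by apply/funext => N; rewrite addn2 W_partialE.
by rewrite -E (cvg_shiftn 2 (fun N => W_partial k d X N w)).
Qed.

(** Shifting the index does not change which limits the partial sums have, so the two functions
    agree even where both take the default value. *)
Lemma WE : W k d X = usum Wterm.
Proof.
apply/funext => w; rewrite /W /usum /lim /lim_in /=; congr (xget _ _).
by apply/funext => l; rewrite W_partial_cvg.
Qed.

Lemma W_ae_cvg : {ae P, forall w, cvgn (fun N => W_partial k d X N w)}.
Proof.
have /andP[r0 r1] := decay_bounds.
have := @ae_cvg_usum R disp T P Wterm Wdom 3 decay measurable_Wdom Wterm_le (ler0n R 3)
  (introT andP (conj (ltW r0) r1)) int_Wdom.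
by apply: filterS => w /cvg_ex[l h]; apply/cvg_ex; exists l; rewrite W_partial_cvg.
Qed.

Lemma W_integrable : P.-integrable setT (EFin \o W k d X).
Proof.
have /andP[r0 r1] := decay_bounds; rewrite WE.
exact: (integrable_usum measurable_Wterm measurable_Wdom Wterm_le (ler0n R 3)
  (introT andP (conj (ltW r0) r1)) int_Wdom).
Qed.

Lemma measurable_W : measurable_fun setT (W k d X).
Proof.
rewrite WE; apply: measurable_usum; exact: measurable_Wterm.
Qed.

Lemma W_tail (tau eta : R) : 0 < tau -> 0 < eta -> exists N0 : nat, forall N, (N0 <= N)%N ->
  (P [set w | tau <= `|W k d X w - \sum_(0 <= l < N) Wterm l w|]%R <= eta%:E)%E.
Proof.
move=> t0 e0; have /andP[r0 r1] := decay_bounds; have r1' : 0 < 1 - decay by rewrite subr_gt0.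
have hl : (decay ^+ n : R) @[n --> \oo] --> 0 by apply: cvg_expr; rewrite ger0_norm // ltW.
have c0 : 0 < eta * tau * (1 - decay) / 3 by rewrite divr_gt0 // mulr_gt0 // mulr_gt0.
have [N0 _ H] := @cvgr_le _ _ _ _ _ _ hl _ c0.
exists N0 => N NN; have /= h := H N NN; rewrite WE.
have := @usum_tail R disp T P Wterm Wdom 3 decay measurable_Wterm measurable_Wdom Wterm_le (ler0n R 3)
  (introT andP (conj (ltW r0) r1)) int_Wdom N tau t0.
set A := P _ => hA.
rewrite -(lee_pmul2l (x := tau%:E)) ?lte_fin //; apply: (le_trans hA).
rewrite -EFinM lee_fin ler_pdivrMr // mulrC -ler_pdivlMr //.
by apply: (le_trans h); rewrite le_eqVlt; apply/orP; left; apply/eqP; ring.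
Qed.

End LimitVariable.

(** * Convergence in distribution *)

Section CdfSandwich.
Variables (R : realType) (T : finType) (S : {set T}) (L K : nat) (X : T -> {ffun 'I_L -> nat}).
Variables (Y : T -> R) (g : {ffun 'I_L -> 'I_K} -> R) (t th eta B : R).
Hypothesis BE : B = #|S|%:R.
Hypothesis th0 : 0 < th.
Hypothesis dev : \sum_(c : {ffun 'I_L -> 'I_K}) \sum_(H in S | X H == box c) `|Y H - g c| <= eta * B.
Local Notation N c := (#|[set H in S | X H == box c]%SET|%:R : R).

Let NE (c : {ffun 'I_L -> 'I_K}) : N c = \sum_(H in S | X H == box c) 1.
Proof. by rewrite -sum1_card natr_sum; apply: eq_bigl => H; rewrite finset.inE. Qed.

Let cdfE : #|[set H in S | (Y H <= t)%R]%SET|%:R = \sum_(H in S) ((Y H <= t)%R%:R : R).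
Proof.
rewrite -sum1_card natr_sum big_mkcond [RHS]big_mkcond /=; apply: eq_bigr => H _.
rewrite finset.inE; case: (H \in S) => //=; by case: (_ <= _).
Qed.

Let dev' : \sum_(c : {ffun 'I_L -> 'I_K}) \sum_(H in S | X H == box c) th^-1 * `|Y H - g c| <= eta / th * B.
Proof.
under eq_bigr do rewrite -mulr_sumr; rewrite -mulr_sumr mulrC ler_pdivrMr // mulrAC divfK ?gt_eqF //.
Qed.

(** A hypergraph with Y <= t either lies outside the box, or in a cell with g <= t + th, or
    satisfies [|Y - g| > th]; Markov's inequality bounds the last case by the L1 deviation. *)
Lemma cdf_le : #|[set H in S | (Y H <= t)%R]%SET|%:R <=
  B - \sum_(c : {ffun 'I_L -> 'I_K}) N c + \sum_(c | g c <= t + th) N c + eta / th * B.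
Proof.
rewrite cdfE.
have e1 : \sum_(H in S) (Y H <= t)%R%:R = B - \sum_(H in S) (1 - (Y H <= t)%R%:R).
  have -> : B = \sum_(H in S) 1 by rewrite BE -sum1_card natr_sum.
  by rewrite sumrB subKr.
have h1 : \sum_(c : {ffun 'I_L -> 'I_K}) \sum_(H in S | X H == box c) (1 - (Y H <= t)%R%:R : R) <=
   \sum_(H in S) (1 - (Y H <= t)%R%:R : R).
  by apply: box_sum_le => H _; rewrite subr_ge0 (ler_nat R _ 1) leq_b1.
have e2 : \sum_(c : {ffun 'I_L -> 'I_K}) \sum_(H in S | X H == box c) (1 - (Y H <= t)%R%:R) =
   \sum_(c : {ffun 'I_L -> 'I_K}) N c - \sum_(c : {ffun 'I_L -> 'I_K}) \sum_(H in S | X H == box c) (Y H <= t)%R%:R.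
  by rewrite -sumrB; apply: eq_bigr => c _; rewrite sumrB NE.
have h3 : \sum_(c : {ffun 'I_L -> 'I_K}) \sum_(H in S | X H == box c) (Y H <= t)%R%:R <=
  \sum_(c | g c <= t + th) N c + 
  \sum_(c : {ffun 'I_L -> 'I_K}) \sum_(H in S | X H == box c) th^-1 * `|Y H - g c|.
  rewrite [X in _ <= X + _]big_mkcond -big_split /=; apply: ler_sum => c _.
  have -> : (if g c <= t + th then N c else 0) = \sum_(H in S | X H == box c) (g c <= t + th)%R%:R.
    rewrite NE; case: ifP => h; first by [].
    by rewrite big1.
  rewrite -big_split /=; apply: ler_sum => H _.
  have d0 : 0 <= th^-1 * `|Y H - g c| by rewrite mulr_ge0 // invr_ge0 ltW.
  case: (leP (Y H) t) => hY; last by rewrite addr_ge0.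
  case: (leP (g c) (t + th)) => hg; first by rewrite lerDl.
  rewrite add0r mulrC ler_pdivlMr // mul1r distrC.
  by apply: le_trans (ler_norm _); lra.
rewrite e1; have := dev'; move: h1 h3; rewrite e2; lra.
Qed.

Lemma cdf_ge : \sum_(c | g c <= t - th) N c - eta / th * B <= #|[set H in S | (Y H <= t)%R]%SET|%:R.
Proof.
rewrite cdfE; apply: (@le_trans _ _ (\sum_(c : {ffun 'I_L -> 'I_K}) \sum_(H in S | X H == box c) (Y H <= t)%R%:R)); last first.
  by apply: box_sum_le.
rewrite lerBlDr; apply: le_trans (lerD (lexx _) dev').
rewrite big_mkcond -big_split /=; apply: ler_sum => c _.
have -> : (if g c <= t - th then N c else 0) = \sum_(H in S | X H == box c) (g c <= t - th)%R%:R.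
  rewrite NE; case: ifP => h; first by [].
  by rewrite big1.
rewrite -big_split /=; apply: ler_sum => H _.
have d0 : 0 <= th^-1 * `|Y H - g c| by rewrite mulr_ge0 // invr_ge0 ltW.
case: (leP (g c) (t - th)) => hg; last by rewrite addr_ge0.
case: (leP (Y H) t) => hY; first by rewrite lerDl.
rewrite add0r mulrC ler_pdivlMr // mul1r.
by apply: le_trans (ler_norm _); lra.
Qed.

End CdfSandwich.

Section Deviation.
Variables (R : realType) (k : nat) (d : R).
Hypothesis k3 : (3 <= k)%N.
Local Notation m n := (medges k d n).
Local Notation Hs n := (msub (ksets n k) (m n)).

Lemma Z_colourings n (H : {set {set 'I_n}}) : H \in Hs n -> (Z H)%:R = colourings R k H.
Proof.
move=> hH; rewrite /Z /colourings /count_in -sum1_card natr_sum big_mkcond [RHS]big_mkcond /=.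
apply: eq_bigr => s _; rewrite !finset.inE (colouring_sub s hH).
by case: (_ \subset _).
Qed.

Lemma EZ_total n : EZ R k n (m n) = planted_total k d n / #|Hs n|%:R.
Proof.
rewrite /EZ /unif_mean hypergraphsE; congr (_ / _).
rewrite (eq_bigr (fun H => colourings R k H)); last by move=> H; exact: Z_colourings.
rewrite /colourings sum_count_in /planted_total; apply: eq_bigl => s; by rewrite finset.in_setT.
Qed.

Lemma lne_sub_le (z e x : R) : 0 <= z -> 0 < e ->
  (lne z%:E - lne e%:E <= x%:E)%E = (z <= expR x * e).
Proof.
move=> z0 e0; rewrite (lne_EFin e0).
(* At z = 0 the left side is -oo and both statements hold, so hypergraphs without colourings are
   counted correctly. *)
have [->|zn] := eqVneq z 0.
  by rewrite /= lexx addNye leNye mulr_ge0 ?expR_ge0 // ltW.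
have zp : 0 < z by rewrite lt0r zn.
rewrite (lne_EFin zp) -EFinB lee_fin lerBlDr -[in RHS](lnK (e0 : e \in Num.pos)) -expRD.
by rewrite -[in RHS](lnK (zp : z \in Num.pos)) ler_expR.
Qed.

Lemma lnZ_dev_cdfE n (B x : R) : B = #|Hs n|%:R -> 0 < B -> 0 < planted_total k d n ->
  lnZ_dev_cdf k n (m n) x = #|[set H in Hs n | (colourings R k H * (B / planted_total k d n) <= expR x)%R]%SET|%:R / B.
Proof.
move=> BE B0 T0; rewrite /lnZ_dev_cdf /unif_prob hypergraphsE -BE; congr (_%:R / _).
apply: eq_card => H; rewrite !finset.inE.
have [hH|] := boolP ((H \subset ksets n k) && (#|H| == m n)) => //=.
rewrite /lnZ_dev EZ_total -BE lne_sub_le ?divr_gt0 //.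
rewrite (Z_colourings (n := n)) ?finset.inE // mulrA ler_pdivlMr // mulrA ler_pdivrMr //.
Qed.

End Deviation.

(** * The law of the limit variable on a box of counts *)

Section BoxLaw.
Variables (R : realType) (k : nat) (d : R).
Hypothesis k3 : (3 <= k)%N.
Hypothesis d0 : 0 < d.
Hypothesis dk : d / k%:R <= 2 ^+ (k - 1) * ln 2 - 2.
Variables (disp : measure_display) (T : measurableType disp) (P : probability T R).
Variable X : nat -> {RV P >-> nat}.
Hypothesis hpois : forall l : nat, (2 <= l)%N -> poisson_RV (lambda k d l) (X l).
Hypothesis hindep : independent_RVs [set l : nat | (2 <= l)%N] X.

Definition at_counts L (a : {ffun 'I_L -> nat}) : set T := [set w | forall i : 'I_L, X i.+2 w = a i].

(** Rewrites the event in the form of [independent_RVs], whose events are indexed by the length l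
    itself. The implication in the index set avoids inverting i to i + 2. *)
Lemma at_counts_bigcap L (a : {ffun 'I_L -> nat}) : at_counts a =
  \bigcap_(l in [set` [seq i.+2 | i : 'I_L]]) X l @^-1` [set j | forall i : 'I_L, l = i.+2 -> j = a i].
Proof.
apply/seteqP; split => w /= h.
  by move=> l /= _ i ->; exact: h.
move=> i; apply: (h i.+2) => //=; apply/mapP; by exists i => //; rewrite mem_enum.
Qed.

Lemma measurable_at_counts L (a : {ffun 'I_L -> nat}) : measurable (at_counts a).
Proof.
rewrite at_counts_bigcap; apply: fin_bigcap_measurable; first exact: finite_seq.
by move=> l _; apply: measurable_funPTI.
Qed.

Lemma at_counts_prob L (a : {ffun 'I_L -> nat}) : P (at_counts a) = (null_lim k d a)%:E.
Proof.
rewrite at_counts_bigcap hindep; last 2 first.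
- by rewrite map_inj_uniq ?enum_uniq // => i j [] /val_inj.
- by move=> l /mapP[i _ ->].
rewrite big_map big_enum /= /null_lim /poisw -sumrN expR_sum -big_split /=.
rewrite (big_morph EFin EFinM erefl); apply: eq_bigr => i _.
rewrite (_ : [set j | _] = [set a i]); last first.
  by apply/seteqP; split => j /= h; [exact: h|move=> i' [] /val_inj <-].
by rewrite hpois // poisson_pmf_gt0E // lambda_gt0.
Qed.

Definition logg L (a : {ffun 'I_L -> nat}) : R :=
  \sum_(i < L) ((a i)%:R * ln (1 + delta R k i.+2) - lambda k d i.+2 * delta R k i.+2).

Lemma gfun_logg L (a : {ffun 'I_L -> nat}) : gfun k d a = expR (logg a).
Proof.
rewrite /gfun /logg expR_sum; apply: eq_bigr => i _.
rewrite expRD; congr (_ * _); rewrite mulrC expRM_natr lnK // posrE.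
have := delta_le k3 d0 dk i.+1; rewrite ler_norml => /andP[h _]; lra.
Qed.

Lemma logg_Wterm L (a : {ffun 'I_L -> nat}) w : at_counts a w ->
  \sum_(0 <= l < L) Wterm k d X l w = logg a.
Proof. by move=> h; rewrite big_mkord; apply: eq_bigr => i _; rewrite /Wterm h. Qed.

Lemma at_counts_seq L K (r : seq {ffun 'I_L -> 'I_K}) : uniq r ->
  measurable [set w | exists2 c, c \in r & at_counts (box c) w] /\
  P [set w | exists2 c, c \in r & at_counts (box c) w] = (\sum_(c <- r) null_lim k d (box c))%:E.
Proof.
elim: r => [_|c r IH /andP[cr ur]].
  have -> : [set w | exists2 c : {ffun 'I_L -> 'I_K}, c \in [::] & at_counts (box c) w] = set0.
    by apply/seteqP; split => w // [].
  by rewrite big_nil measure0.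
have [mI pI] := IH ur.
have E : [set w | exists2 c', c' \in c :: r & at_counts (box c') w] =
  at_counts (box c) `|` [set w | exists2 c, c \in r & at_counts (box c) w].
  apply/seteqP; split => w /=.
    move=> [c']; rewrite inE => /orP[/eqP->|c'r] h; [by left|by right; exists c'].
  move=> [h|[c' c'r h]]; [by exists c; rewrite ?mem_head|by exists c' => //; rewrite inE c'r orbT].
have mc := measurable_at_counts (box c).
rewrite E; split; first exact: measurableU.
rewrite big_cons EFinD -pI -at_counts_prob; apply: measureU => //.
apply/seteqP; split => w //= [h [c' c'r h']]; move: cr; rewrite (_ : c = c') ?c'r //.
by apply: box_inj; apply/ffunP => i; rewrite -h -h'.
Qed.

Lemma at_counts_pred L K (Q : pred {ffun 'I_L -> 'I_K}) :
  measurable [set w | exists2 c, Q c & at_counts (box c) w] /\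
  P [set w | exists2 c, Q c & at_counts (box c) w] = (\sum_(c | Q c) null_lim k d (box c))%:E.
Proof.
have := at_counts_seq (enum_uniq Q); rewrite big_enum /=.
rewrite (_ : [set w | exists2 c, c \in enum Q & at_counts (box c) w] = [set w | exists2 c, Q c & at_counts (box c) w]) //.
by apply/seteqP; split => w /= [c h1 h2]; exists c => //; move: h1; rewrite mem_enum.
Qed.

Definition Wcdf (y : R) : R := fine (P [set w | W k d X w <= y]).

Lemma measurable_Wle y : measurable [set w | W k d X w <= y].
Proof.
have mW := measurable_W k d X.
by rewrite -[X in measurable X]setTI; apply: (measurable_fun_le measurableT mW (measurable_cst y)).
Qed.

Lemma WcdfE y : P [set w | W k d X w <= y] = (Wcdf y)%:E.
Proof. by rewrite /Wcdf fineK // fin_num_measure //; exact: measurable_Wle. Qed.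

Lemma measurable_tail L tau :
  measurable [set w | tau <= `|W k d X w - \sum_(0 <= l < L) Wterm k d X l w|].
Proof.
have mW := measurable_W k d X.
have mS : measurable_fun setT (fun w => \sum_(0 <= l < L) Wterm k d X l w).
  by apply: measurable_sum => l; exact: measurable_Wterm.
rewrite -[X in measurable X]setTI; apply: (measurable_fun_le measurableT (measurable_cst tau)).
by apply: measurableT_comp => //; exact: measurable_funB.
Qed.

Lemma box_le_Wcdf L K (y tau eta : R) : 0 < tau ->
  (P [set w | tau <= `|W k d X w - \sum_(0 <= l < L) Wterm k d X l w|]%R <= eta%:E)%E ->
  \sum_(c : {ffun 'I_L -> 'I_K} | logg (box c) <= y) null_lim k d (box c) <= Wcdf (y + tau) + eta.
Proof.
move=> t0; set A := [set w | _ <= _] => hA; rewrite -lee_fin EFinD -WcdfE.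
have [mU <-] := at_counts_pred (fun c : {ffun 'I_L -> 'I_K} => logg (box c) <= y).
have mA : measurable A by exact: measurable_tail.
apply: le_trans (leeD (lexx _) hA); apply: le_trans (measureU2 _ _ _) => //; last exact: measurable_Wle.
apply: le_measure; rewrite ?inE //; first by apply: measurableU => //; exact: measurable_Wle.
move=> w [c hc hw]; have [h|h] := leP tau `|W k d X w - \sum_(0 <= l < L) Wterm k d X l w|; [by right|left].
move: h; rewrite (logg_Wterm hw) ltr_norml => /andP[_ h] /=; lra.
Qed.

(** Besides the tail of the series, the event that the Poisson counts leave the box must be paid
    for: that is the term 1 minus the mass of the box. *)
Lemma Wcdf_le_box L K (y tau eta : R) : 0 < tau ->
  (P [set w | tau <= `|W k d X w - \sum_(0 <= l < L) Wterm k d X l w|]%R <= eta%:E)%E ->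
  Wcdf (y - tau) <= \sum_(c : {ffun 'I_L -> 'I_K} | logg (box c) <= y) null_lim k d (box c) +
    (1 - \sum_(c : {ffun 'I_L -> 'I_K}) null_lim k d (box c)) + eta.
Proof.
move=> t0; set A := [set w | _ <= _] => hA; rewrite -lee_fin !EFinD -WcdfE.
have [mU <-] := at_counts_pred (fun c : {ffun 'I_L -> 'I_K} => logg (box c) <= y).
have [mV pV] := at_counts_pred (fun _ : {ffun 'I_L -> 'I_K} => true).
have mA : measurable A by exact: measurable_tail.
rewrite EFinN -pV -probability_setC //.
apply: le_trans (leeD (lexx _) hA).
set U := [set w | exists2 c, _ <= _ & _]; set V := [set w | exists2 c, true & _].
apply: (@le_trans _ _ (P (U `|` ~` V) + P A)%E); last by apply: leeD => //; apply: measureU2 => //; exact: measurableC.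
apply: le_trans (measureU2 _ _ _) => //; last by apply: measurableU => //; exact: measurableC.
apply: le_measure; rewrite ?inE //; first exact: measurable_Wle.
  by apply: measurableU => //; apply: measurableU => //; exact: measurableC.
move=> w /= hW; have [h|h] := leP tau `|W k d X w - \sum_(0 <= l < L) Wterm k d X l w|; [by right|left].
have [[c _ hw]|nV] := pselect (V w); [left|by right].
exists c => //; move: h; rewrite (logg_Wterm hw) ltr_norml => /andP[h _]; lra.
Qed.

End BoxLaw.

Section Convergence.
Variables (R : realType) (k : nat) (d : R).
Hypothesis k3 : (3 <= k)%N.
Hypothesis d0 : 0 < d.
Hypothesis dk : d / k%:R <= 2 ^+ (k - 1) * ln 2 - 2.
Variables (disp : measure_display) (T : measurableType disp) (P : probability T R).
Variable X : nat -> {RV P >-> nat}.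
Hypothesis hpois : forall l : nat, (2 <= l)%N -> poisson_RV (lambda k d l) (X l).
Hypothesis hindep : independent_RVs [set l : nat | (2 <= l)%N] X.
Local Notation m n := (medges k d n).
Local Notation Hs n := (msub (ksets n k) (m n)).
Local Notation G := (Wcdf k d X).

Lemma subset_sum_near L K (eta : R) : 0 < eta -> exists n0 : nat, forall n, (n0 <= n)%N ->
  forall Q : pred {ffun 'I_L -> 'I_K},
  `|\sum_(c | Q c) pcnt R (ksets n k) (m n) (fun j : 'I_L => @cycles 'I_n k j (ksets n k)) (box c) -
    \sum_(c | Q c) null_lim k d (box c)| <= eta.
Proof.
move=> e0; pose e := eta / (#|{: {ffun 'I_L -> 'I_K}}|%:R + 1).
have c0 : 0 < #|{: {ffun 'I_L -> 'I_K}}|%:R + 1 :> R by rewrite ltr_wpDl.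
have e1 : 0 < e by rewrite divr_gt0.
have [n0 H] : exists n0 : nat, forall n, (n0 <= n)%N -> forall c : {ffun 'I_L -> 'I_K},
   `|null_lim k d (box c) - pcnt R (ksets n k) (m n) (fun j : 'I_L => @cycles 'I_n k j (ksets n k)) (box c)| <= e.
  apply: box_near => c; have := null_cvg k3 d0 (a := box c) => /cvgrPdist_le /(_ e e1)[n0 _ h].
  by exists n0 => n nn; exact: h.
exists n0 => n nn Q; rewrite -sumrB.
apply: (le_trans (ler_norm_sum _ _ _)).
apply: (@le_trans _ _ (\sum_(c : {ffun 'I_L -> 'I_K}) e)).
  rewrite big_mkcond; apply: ler_sum => c _; case: ifP => _; last exact: ltW.
  by rewrite distrC; exact: H.
rewrite sumr_const -[leLHS]mulr_natr /e mulrAC ler_pdivrMr // ler_wpM2l ?(ltW e0) // lerDl.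
by [].
Qed.

(** One margin tau absorbs the distance between Z / E Z and g, the other the tail of the series W;
    hence 2 * tau. *)
Lemma cdf_near (x tau eps : R) : 0 < tau -> 0 < eps -> exists n0 : nat, forall n, (n0 <= n)%N ->
  G (x - 2 * tau) - eps <= lnZ_dev_cdf k n (m n) x <= G (x + 2 * tau) + eps.
Proof.
move=> t0 e0.
(* The L1 estimate lives on the scale of Z / E Z, so the margin tau on the logarithmic scale is
   translated into a margin th around exp x. *)
pose th := Num.min (expR (x + tau) - expR x) (expR x - expR (x - tau)).
have th0 : 0 < th by rewrite lt_min !subr_gt0 !ltr_expR ltrDl t0 gtrBl.
have th1 : expR x + th <= expR (x + tau).
  by rewrite -lerBrDl /th ge_min lexx.
have th2 : expR (x - tau) <= expR x - th.
  by rewrite lerBrDr -lerBrDl /th ge_min lexx orbT.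
(* eta appears both directly (box mass, cell probabilities, tail) and divided by th (Markov); a
   sixth of eps for each occurrence is enough. *)
pose eta := Num.min (eps / 6) (eps * th / 6).
have eta0 : 0 < eta by rewrite lt_min !divr_gt0 // mulr_gt0.
have eta1 : eta <= eps / 6 by rewrite /eta ge_min lexx.
have eta2 : eta / th <= eps / 6.
  by rewrite ler_pdivrMr // mulrAC /eta ge_min lexx orbT.
have [N0 HT] := W_tail k3 d0 dk hpois t0 eta0.
have [L [K [n1 [LN cap conc]]]] := concentration k3 d0 dk N0 eta0.
have [n2 near] := subset_sum_near L K eta0.
have tail := HT L LN.
exists (maxn n1 n2) => n; rewrite geq_max => /andP[nn1 nn2].
have [B0 T0 dev] := conc n _ nn1 erefl.
set B := #|_|%:R in B0 dev.
rewrite (lnZ_dev_cdfE (B := B)) //.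
pose p c : R := pcnt R (ksets n k) (m n) (fun j : 'I_L => @cycles 'I_n k j (ksets n k)) c.
have pE (c : {ffun 'I_L -> 'I_K}) :
    #|[set H in Hs n | subcounts (fun j : 'I_L => @cycles 'I_n k j (ksets n k)) H == box c]%SET|%:R = p (box c) * B.
  by rewrite /p /pcnt /unif_prob divfK // gt_eqF.
have p0 c : 0 <= p c by rewrite divr_ge0.
have near0 (Q : pred {ffun 'I_L -> 'I_K}) :
  `|\sum_(c | Q c) p (box c) - \sum_(c | Q c) null_lim k d (box c)| <= eta by exact: near n nn2 Q.
clearbody p.
have up := cdf_le (expR x) erefl th0 dev.
have lo := cdf_ge (expR x) th0 dev.
move: up lo; rewrite -/B (eq_bigr _ (fun c _ => pE c)) (eq_bigr _ (fun c _ => pE c)) [in X in _ -> X](eq_bigr _ (fun c _ => pE c)).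
rewrite -!mulr_suml; set A := #|_|%:R => up lo.
have sub1 : \sum_(c : {ffun 'I_L -> 'I_K} | gfun k d (box c) <= expR x + th) p (box c) <=
    \sum_(c : {ffun 'I_L -> 'I_K} | logg k d (box c) <= x + tau) p (box c).
  rewrite [leLHS]big_mkcond [leRHS]big_mkcond; apply: ler_sum => c _.
  case: ifP => [h|_]; last by case: ifP.
  by rewrite ifT // -ler_expR -(gfun_logg k3 d0 dk); apply: le_trans th1.
have sub2 : \sum_(c : {ffun 'I_L -> 'I_K} | logg k d (box c) <= x - tau) p (box c) <=
    \sum_(c : {ffun 'I_L -> 'I_K} | gfun k d (box c) <= expR x - th) p (box c).
  rewrite [leLHS]big_mkcond [leRHS]big_mkcond; apply: ler_sum => c _.
  case: ifP => [h|_]; last by case: ifP.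
  by rewrite ifT // (gfun_logg k3 d0 dk); apply: le_trans th2; rewrite ler_expR.
have w1 := box_le_Wcdf k3 d0 hpois hindep K (x + tau) t0 tail.
have w2 := Wcdf_le_box k3 d0 hpois hindep K (x - tau) t0 tail.
have := near0 predT; rewrite ler_norml => /andP[n_all _].
have := near0 (fun c : {ffun 'I_L -> 'I_K} => logg k d (box c) <= x + tau); rewrite ler_norml => /andP[_ n_up].
have := near0 (fun c : {ffun 'I_L -> 'I_K} => logg k d (box c) <= x - tau); rewrite ler_norml => /andP[n_lo _].
rewrite (_ : x + tau + tau = x + 2 * tau) in w1; last by ring.
rewrite (_ : x - tau - tau = x - 2 * tau) in w2; last by ring.
apply/andP; split.
  rewrite ler_pdivlMr //; apply: le_trans lo; rewrite -mulrBl ler_wpM2r ?(ltW B0) //.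
  move: sub2 w2 n_lo cap eta1 eta2; lra.
rewrite ler_pdivrMr //; apply: (le_trans up).
rewrite -[X in X - _]mul1r -mulrBl -!mulrDl ler_wpM2r ?(ltW B0) //.
move: sub1 w1 n_up n_all cap eta1 eta2; lra.
Qed.


Lemma cdf_cvg (x : R) : {for x, continuous (fun y : R => P [set w | W k d X w <= y])} ->
  (lnZ_dev_cdf k n (m n) x)%:E @[n --> \oo] --> P [set w | W k d X w <= x].
Proof.
have GE : (fun y : R => P [set w | W k d X w <= y]) = (fun y => (G y)%:E).
  by apply/funext => y; exact: WcdfE.
rewrite (WcdfE k d X x) GE => hc.
have {}hc : G y @[y --> x] --> G x by have /fine_cvgP[_] := hc.
apply: cvg_EFin; first exact: nearW.
apply/cvgrPdist_le => e e0; have e2 : 0 < e / 2 by rewrite divr_gt0.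
have /cvgrPdist_le /(_ (e / 2) e2) /nbhs_ballP[r /= r0 hr] := hc.
(* With tau = r / 3 the points x - 2 tau and x + 2 tau stay inside the ball of radius r where G is
   close to G x. *)
have r3 : 0 < r / 3 by rewrite divr_gt0.
have [n0 H] := cdf_near x r3 e2.
exists n0 => // n nn; have /andP[h1 h2] := H n nn.
have b1 : `|G x - G (x - 2 * (r / 3))| <= e / 2.
  by apply: hr; rewrite /ball /= opprB addrC subrK ger0_norm; lra.
have b2 : `|G x - G (x + 2 * (r / 3))| <= e / 2.
  by apply: hr; rewrite /ball /= opprD addNKr normrN ger0_norm; lra.
move: b1 b2; rewrite !ler_norml => /andP[b1 b1'] /andP[b2 b2'].
apply/andP; split; clear -h1 h2 b1' b2; lra.
Qed.

End Convergence.

Theorem theorem1p1 (R : realType) (k : nat) (d : R)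
    (hk : (3 <= k)%N) (hd : 0 < d)
    (hdk : d / k%:R <= 2 ^+ (k - 1) * ln 2 - 2)
    (disp : measure_display) (T : measurableType disp) (P : probability T R)
    (X : nat -> {RV P >-> nat})
    (hpois : forall l : nat, (2 <= l)%N -> poisson_RV (lambda k d l) (X l))
    (hindep : independent_RVs [set l : nat | (2 <= l)%N] X) :
  [/\ {ae P, forall w, cvgn (fun N => W_partial k d X N w)},
      P.-integrable [set: T] (EFin \o W k d X)
    & cvg_in_distribution
        (fun n => @lnZ_dev_cdf R k n `|Num.ceil (d * n%:R / k%:R)|%N)
        P (W k d X)].
Proof.
split.
- exact: W_ae_cvg.
- exact: W_integrable.
- by move=> G x; exact: (cdf_cvg hk hd hdk hpois hindep).
Qed.
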